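(* Assume that the 2-iquantum group $\mathfrak U^\imath=\mathfrak U^\imath(\varsigma,\zeta)$ is non-degenerate. For $\lambda\in X^\imath$ and words $\mathbf i,\mathbf j\in\langle I\rangle$ with $\mathrm{wt}^\imath(\mathbf i)=\mathrm{wt}^\imath(\mathbf j)$, we have that $$\langle b_{\mathbf i}1_\lambda,b_{\mathbf j}1_\lambda\rangle^\imath=\mathrm{rank}_{q^{-1}}\mathrm{Hom}_{\mathfrak U^\imath}(B_{\mathbf j}1_\lambda,B_{\mathbf i}1_\lambda),$$ where the graded rank is as a free graded right $\mathrm{End}_{\mathfrak U^\imath}(1_\lambda)$-module.
   Context: Conventions: graded 2-categories are enriched in graded $\Bbbk$-linear categories; juxtaposition is horizontal and $\circ$ vertical composition of 2-morphisms; $1_i$ denotes the identity of $B_i$; weights are suppressed when inferable. $[f(u)]_{u:n}$ is the $u^n$-coefficient, $[f(u)]_{u:\ge n}$, $[f(u)]_{u:<n}$ truncations; rational functions are expanded in $u^{-1}$. If a graded module is free with $m_d$ basis elements of degree $d$ (finitely many in each degree, degrees bounded below), $\mathrm{rank}_q=\sum_dm_dq^d$, and $\mathrm{rank}_{q^{-1}}$ is its image under $q\mapsto q^{-1}$. \textbf{Cartan and Satake data.} $A=(a_{i,j})_{i,j\in I}$ is a symmetrizable generalized Cartan matrix ($I$ may be infinite, each row and column having finitely many nonzero entries): $a_{i,i}=2$, $a_{i,j}\in-\mathbb N$ for $i\ne j$, $a_{i,j}=0\Leftrightarrow a_{j,i}=0$, with given positive integers $d_i$, $d_ia_{i,j}=d_ja_{j,i}$.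 $X,Y$ are free abelian groups with a perfect pairing $Y\times X\to\mathbb Z$, $(h,\lambda)\mapsto h(\lambda)$, simple roots $\alpha_i\in X$ and linearly independent simple coroots $h_i\in Y$, $h_i(\alpha_j)=a_{i,j}$. $\tau$ is an involution of $I$ (possibly the identity) with $a_{\tau i,\tau j}=a_{i,j}$, $d_{\tau i}=d_i$, and $\tau:X\to X$, $\tau^*:Y\to Y$ are involutions with $\tau^*(h)(\lambda)=h(\tau(\lambda))$, $\tau(\alpha_i)=\alpha_{\tau i}$, $\tau^*(h_i)=h_{\tau i}$. $\varsigma_i\in\mathbb Z$ satisfy $\varsigma_i+\varsigma_{\tau i}=-a_{i,\tau i}$, and $\varsigma_i\ge0$ if $i\ne\tau i$ (so $\varsigma_i=-1$ if $i=\tau i$). $X^\imath:=X/\mathrm{im}(\mathrm{id}+\tau)$, $Y^\imath:=\ker(\mathrm{id}+\tau^* )$; for $\lambda\in X^\imath$ with pre-image $\hat\lambda\in X$, $\lambda_i:=(h_i-h_{\tau i})(\hat\lambda)$ and $\lambda\pm\alpha_i$ is the image of $\hat\lambda\pm\alpha_i$. \textbf{Parameters.} $\Bbbk=\bigoplus_{n\ge0}\Bbbk_n$ is an $\mathbb N$-graded commutative ring, with $2$ invertible if $a_{i,\tau i}\ne0$ for some $i$; $\Bbbk^\times$ is the group of units of $\Bbbk_0$. $Q_{i,j}(x,y)=Q_{j,i}(y,x)\in\Bbbk[x,y]$, $Q_{i,i}=0$, $Q_{i,j}$ is homogeneous of degree $-2d_ia_{i,j}$ for $\deg x=2d_i,\deg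 y=2d_j$, and for $i\neq j$, $Q_{i,j}=t_{i,j}x^{-a_{i,j}}+\sum_{0\le r<-a_{i,j},0\le s<-a_{j,i}}t_{i,j;r,s}x^ry^s+t_{j,i}y^{-a_{j,i}}$ with $t_{i,j}\in\Bbbk^\times$ (read as $Q_{i,j}=t_{i,j}=t_{j,i}$ if $a_{i,j}=0$). $c_i:X\to\Bbbk^\times$ are homomorphisms with $c_i(\alpha_i)=1$; $r_{i,j}:=c_i(\alpha_j)/t_{i,j}$ for $i\ne j$, $r_{i,i}:=1$; $R_{i,j}:=r_{i,j}Q_{i,j}$ for $i\ne j$, $R_{i,i}:=1/(x-y)^2$. Assume: $c_{\tau i}(\tau\lambda)=(-1)^{h_i(\lambda)}c_i(\lambda)$ for $i\neq\tau i$; $Q_{\tau i,\tau j}(x,y)=r_{i,j}r_{j,i}r_{i,\tau j}r_{j,\tau i}Q_{i,j}(-x,-y)$ for all $i,j$; and for $i\ne\tau i$, $Q_{i,\tau i}(x,y)=c_i(\alpha_{\tau i})(x-y)^{e}\prod_{r=1}^{(-a_{i,\tau i}-e)/2}(x-\xi_{i,r}y)(x-\xi_{i,r}^{-1}y)$, $e\in\{0,1\}$ the parity of $a_{i,\tau i}$, with $\xi_{i,r}=\xi_{\tau i,r}\in\Bbbk^\times$ (or a unit in a field extension of $\Bbbk_0$) and $1+\xi_{i,r}$ invertible. $\zeta_i\in\Bbbk^\times$ satisfy $\zeta_i\zeta_{\tau i}=(-1)^{\varsigma_{\tau i}+1}R_{i,\tau i}(1,-1)$, and $\zeta_i=-\tfrac12$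 if $i=\tau i$. $\gamma_i(\lambda):=c_i(\hat\lambda-\tau(\hat\lambda))$ if $i\ne\tau i$, $(-1)^{h_i(\hat\lambda)}$ if $i=\tau i$. $Q^\imath_{i,j}:=(-1)^{\delta_{i,\tau j}}Q_{i,j}$ and $D_{i,j}(x,y,z):=\frac{Q^\imath_{i,j}(x,y)-Q^\imath_{i,j}(z,y)}{x-z}$. \textbf{2-iquantum group} $\mathfrak U^\imath=\mathfrak U^\imath(\varsigma,\zeta)$: objects $X^\imath$; generating 1-morphisms $B_i1_\lambda:\lambda\to\lambda-\alpha_i$; generating 2-morphisms $x_i:B_i1_\lambda\Rightarrow B_i1_\lambda$ (degree $2d_i$), $\cap_i:B_{\tau i}B_i1_\lambda\Rightarrow1_\lambda$ and $\cup_i:1_\lambda\Rightarrow B_{\tau i}B_i1_\lambda$ (degree $d_i(1+\varsigma_i-\lambda_i)$), $\psi_{i,j}:B_iB_j1_\lambda\Rightarrow B_jB_i1_\lambda$ (degree $-d_ia_{i,j}$), $\beta_{i,n}:1_\lambda\Rightarrow1_\lambda$ for $0\le n\le\varsigma_i-\lambda_i$ (degree $2d_in$). Put $\beta_i(u)=\beta_i^\lambda(u):=P_i(u)+\sum_{n\ge0}\cap_i\circ(1_{\tau i}x_i^n)\circ\cup_i\,u^{-n-1}$ with $P_i(u)=\sum_{n=0}^{\varsigma_i-\lambda_i}\beta_{i,n}u^{\varsigma_i-\lambda_i-n}$ if $i\ne\tau i$ and $P_i(u)=-\frac1{2u}$ if $i=\tau i$. Relations: (1) $[\beta_i^\lambda(u)]_{u:\ge\varsigma_i-\lambda_i}=\zeta_i\gamma_i(\lambda)u^{\varsigma_i-\lambda_i}$;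 (2) $[\beta_i(u)\beta_{\tau i}(-u)]_{u:<-a_{i,\tau i}}=0$; (3) $\beta_i^{\lambda-\alpha_j}(u)\,R_{i,j}(u,x_j)=R_{\tau i,j}(-u,x_j)\,\beta_i^\lambda(u)$ on $B_j1_\lambda$; (4) $(\cap_{\tau i}1_i)\circ(1_i\cup_i)=1_i=(1_i\cap_i)\circ(\cup_{\tau i}1_i)$; (5) $(x_{\tau i}1_i)\circ\cup_i=-(1_{\tau i}x_i)\circ\cup_i$, $\cap_i\circ(x_{\tau i}1_i)=-\cap_i\circ(1_{\tau i}x_i)$; (6) $(\psi_{j,i}1_{\tau i})\circ(1_j\cup_{\tau i})=r_{i,j}^{-1}(1_i\psi_{\tau i,j})\circ(\cup_{\tau i}1_j)$, $(\cap_i1_j)\circ(1_{\tau i}\psi_{j,i})=r_{i,j}^{-1}(1_j\cap_i)\circ(\psi_{\tau i,j}1_i)$; (7) $\psi_{i,j}\circ(x_i1_j)-(1_jx_i)\circ\psi_{i,j}=\delta_{i,j}1_i1_j-\delta_{i,\tau j}\cup_i\circ\cap_j=(x_j1_i)\circ\psi_{i,j}-\psi_{i,j}\circ(1_ix_j)$; (8) $(1_i\cap_{\tau i})\circ(\psi_{i,i}1_{\tau i})\circ(1_i\cup_{\tau i})=[\frac1{u-x_i}\beta_{\tau i}(-u)]_{u:-1}$; (9) $\psi_{j,i}\circ\psi_{i,j}=Q^\imath_{i,j}(x_i1_j,1_ix_j)+\delta_{i,\tau j}[(\frac1{u-x_i}1_j)\circ\cup_j\circ\beta_i(u)\circ\cap_j\circ(\frac1{u-x_i}1_j)]_{u:-1}$;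 (10) $(\psi_{j,k}1_i)\circ(1_j\psi_{i,k})\circ(\psi_{i,j}1_k)-(1_k\psi_{i,j})\circ(\psi_{i,k}1_j)\circ(1_i\psi_{j,k})$ equals $\delta_{i,k}D_{i,j}(x_i1_j1_k,1_ix_j1_k,1_i1_jx_k)$ $+\delta_{i,\tau j}\delta_{j,\tau k}\big[\big((\frac1{u-x_i}1_j)\circ\cup_j\circ\cap_j\circ(\frac1{u-x_i}1_j)\big)\beta_i(u)\frac1{u-x_k}-\frac1{u-x_i}\beta_{\tau i}(-u)\big((1_j\frac1{u-x_k})\circ\cup_k\circ\cap_k\circ(1_j\frac1{u-x_k})\big)\big]_{u:-1}$ $-\delta_{i,\tau j}r_{j,k}\sum p_{abc}\,(1_k[(x_j^c1_i)\circ\cup_i])\circ x_k^b\circ([\cap_j\circ(1_ix_j^a)]1_k)$ $-\delta_{j,\tau k}r_{k,i}^{-1}\sum p'_{abc}\,([(1_kx_j^a)\circ\cup_j]1_i)\circ x_i^b\circ(1_i[\cap_k\circ(x_j^c1_k)])$, where $D_{j,k}=\sum p_{abc}x^ay^bz^c$ and $D_{j,i}=\sum p'_{abc}x^ay^bz^c$. \textbf{Non-degeneracy.} For all $n\ge0$ let $\beta_{i,n}\in\mathrm{End}(1_\lambda)$ be the $u^{\varsigma_i-\lambda_i-n}$-coefficient of $\beta_i^\lambda(u)$. $I_0$ is the set of $\tau$-fixed points and $I_1$ a set of representatives of the $\tau$-orbits of size 2. $\langle I\rangle$ is the set of words $\mathbf i=i_1\cdots i_l$ in $I$; $l(\mathbf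 i)=l$, $B_{\mathbf i}=B_{i_1}\cdots B_{i_l}$, $b_{\mathbf i}=b_{i_1}\cdots b_{i_l}$, $\mathrm{wt}^\imath(\mathbf i)$ is the image of $\alpha_{i_1}+\cdots+\alpha_{i_l}$ in $X^\imath$. An $\mathbf i\times\mathbf j$ shape is a string diagram, without dots or closed components, built from cups, caps and crossings and representing 2-morphisms $B_{\mathbf j}1_\lambda\Rightarrow B_{\mathbf i}1_\lambda$ (endpoints labelled by $\mathbf j$ at the bottom, $\mathbf i$ at the top; a propagating string has the same label at both ends, a cup or cap has ends labelled $k,\tau k$). It is reduced if no string has more than one critical point, no two strings cross twice, and no string crosses itself. Two shapes are equivalent if they define the same matching of endpoints; $\mathrm{sh}(\mathbf i\times\mathbf j)$ is a fixed set of representatives of equivalence classes of reduced shapes. For each $D$ in it fix one point on each of its $l=(l(\mathbf i)+l(\mathbf j))/2$ strings, away from crossings and critical points, and let $D(x_1^{n_1}\cdots x_l^{n_l})$ be $D$ with $n_r$ dots at the $r$th point. $\mathfrak U^\imath$ is \emph{non-degenerate} if for each $\lambda\in X^\imath$: $\mathrm{End}_{\mathfrak U^\imath}(1_\lambda)$ is freely generated as a commutative $\Bbbk$-algebra by $\{\beta_{i,n}:i\in I_1,n\ge1\}\sqcup\{\beta_{i,n}:i\in I_0,n\ge1\text{ odd}\}$; and for all $\mathbf i,\mathbf j\in\langle I\rangle$ with $\mathrm{wt}^\imath(\mathbf i)=\mathrm{wt}^\imath(\mathbf j)$, $l(\mathbf i)\equiv l(\mathbf j)\pmod2$, $\mathrm{Hom}_{\mathfrak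 U^\imath}(B_{\mathbf j}1_\lambda,B_{\mathbf i}1_\lambda)$ is free as a right $\mathrm{End}_{\mathfrak U^\imath}(1_\lambda)$-module with basis $\{D(x_1^{n_1}\cdots x_l^{n_l}):D\in\mathrm{sh}(\mathbf i\times\mathbf j),n_1,\dots,n_l\ge0\}$. \textbf{The form.} $q_i=q^{d_i}$, $k_i=q^{d_ih_i}$; $\mathrm U=\langle q^h,e_i,f_i\rangle$ is the quantized enveloping algebra over $\mathbb Q(q)$ with the usual relations ($[e_i,f_j]=\delta_{i,j}(k_i-k_i^{-1})/(q_i-q_i^{-1})$, etc.); $\mathrm U^\imath\subset\mathrm U$ is generated by $q^h$ ($h\in Y^\imath$) and $b_i=f_i+q_i^{\varsigma_i}e_{\tau i}k_i^{-1}$; $\dot{\mathrm U}^\imath=\bigoplus_{\lambda,\mu\in X^\imath}1_\lambda\mathrm U^\imath1_\mu$ is its modified form inside the completion of Lusztig's $\dot{\mathrm U}$ by row- and column-finite matrices, with $1_\lambda=\sum_{\hat\lambda}1_{\hat\lambda}$ over pre-images of $\lambda\in X^\imath$; $b_i1_\lambda=1_{\lambda-\alpha_i}b_i$. For dominant $\hat\lambda$, $L(\hat\lambda)$ is the irreducible highest weight $\mathrm U$-module with highest weight vector $\eta_{\hat\lambda}$ and $(\cdot,\cdot)_{\hat\lambda}$ the unique symmetric bilinear form with $(\eta_{\hat\lambda},\eta_{\hat\lambda})_{\hat\lambda}=1$, $(uv,w)_{\hat\lambda}=(v,\rho(u)w)_{\hat\lambda}$, where $\rho$ is the linear anti-involution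 $\rho(e_i)=q_ik_if_i$, $\rho(f_i)=q_i^{-1}e_ik_i^{-1}$, $\rho(q^h)=q^h$. $(\cdot,\cdot)^\imath$ is the symmetric bilinear form on $\dot{\mathrm U}^\imath$ with $(x1_\lambda,y1_{\lambda'})^\imath=0$ for $\lambda\neq\lambda'$ and $(x1_\lambda,y1_\lambda)^\imath=\lim(x\eta_{\hat\lambda},y\eta_{\hat\lambda})_{\hat\lambda}$, limit in $\mathbb Q((q^{-1}))$ over pre-images with $h_i(\hat\lambda)\to\infty$ for all $i$. $\psi^\imath$ is the anti-linear ($q\mapsto q^{-1}$) involution of $\dot{\mathrm U}^\imath$ fixing all $b_i1_\lambda$, and $\langle x,y\rangle^\imath:=(\psi^\imath(x),y)^\imath$. *)

(* Defs.v *)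
From HB Require Import structures.
From mathcomp Require Import all_boot all_order all_algebra generic_quotient.
From mathcomp Require Import ring_quotient fraction polyXY finmap multiset.
From mathcomp Require Import boolp classical_sets fsbigop.
From Stdlib Require Import Relation_Operators.

Set Implicit Arguments.
Unset Strict Implicit.
Unset Printing Implicit Defensive.

Import Order.TTheory GRing.Theory Num.Theory.
Local Open Scope ring_scope.
Local Open Scope quotient_scope.

(* [act v c] is the scalar action of [c : R] on [v : V]; it covers integer
   multiples, left modules over a commutative ring, and right modules. *)
Section Bases.
Variables (R V : zmodType) (act : V -> R -> V) (K : choiceType) (b : K -> V).

Definition lin_indep : Prop :=
  forall (s : seq K) (c : K -> R), uniq s ->
    \sum_(k <- s) act (b k) (c k) = 0 -> forall k, k \in s -> c k = 0.

Definition spanning : Prop :=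
  forall v : V, exists (s : seq K) (c : K -> R),
    uniq s /\ v = \sum_(k <- s) act (b k) (c k).

Definition is_basis : Prop := lin_indep /\ spanning.
End Bases.

Inductive zspan (V : zmodType) (G : V -> Prop) : V -> Prop :=
| zspan0 : zspan G 0
| zspanB x y : zspan G x -> zspan G y -> zspan G (x - y)
| zspan_gen x : G x -> zspan G x.

Definition zspan_pred (V : zmodType) (G : V -> Prop) (x : V) : bool :=
  `[< zspan G x >].

Lemma zspan_closed (V : zmodType) (G : V -> Prop) : zmod_closed (zspan_pred G).
Proof.
split=> [|x y]; first exact/asboolP/zspan0.
by move=> /asboolP hx /asboolP hy; apply/asboolP/zspanB.
Qed.

HB.instance Definition _ (V : zmodType) (G : V -> Prop) :=
  GRing.isZmodClosed.Build V (zspan_pred G) (zspan_closed G).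

Definition zspan_zmod (V : zmodType) (G : V -> Prop) : zmodClosed V :=
  GRing.ZmodClosed.clone V (zspan_pred G) _.

(* The quotient of [V] by the subgroup generated by [G]. *)
Definition zquot (V : zmodType) (G : V -> Prop) : zmodType :=
  Quotient.quot (zspan_zmod G).

Definition zpi (V : zmodType) (G : V -> Prop) (x : V) : zquot G :=
  \pi_(Quotient.quot (zspan_zmod G)) x.
Definition zrepr (V : zmodType) (G : V -> Prop) (x : zquot G) : V :=
  repr (x : Quotient.quot (zspan_zmod G)).

Record satake_data := SatakeData {
  idx : choiceType;
  cartan : idx -> idx -> int;
  dd : idx -> nat;
  wlat : zmodType;                       (* X *)
  clat : zmodType;                       (* Y *)
  ev : clat -> wlat -> int;
  sroot : idx -> wlat;
  scoroot : idx -> clat;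
  tau : idx -> idx;
  tauX : wlat -> wlat;
  tauY : clat -> clat;
  vsig : idx -> int
}.

(* X and Y are free with a perfect pairing: they have bases dual to each other.
   In finite rank this is the same as both maps X -> Hom(Y,Z), Y -> Hom(X,Z)
   being bijective; the latter could not hold for free groups of infinite rank,
   which must be allowed because I may be infinite. *)
Definition dual_bases (D : satake_data) : Prop :=
  exists (K : choiceType) (bX : K -> wlat D) (bY : K -> clat D),
    [/\ is_basis (fun v n => v *~ n) bX, is_basis (fun v n => v *~ n) bY
      & forall k k', ev (bY k) (bX k') = (k == k')%:R].

Record satake_axioms (D : satake_data) : Prop := SatakeAxioms {
  sat_diag : forall i : idx D, cartan i i = 2;
  sat_offdiag : forall i j : idx D, i != j -> cartan i j <= 0;
  sat_zero : forall i j : idx D, cartan i j = 0 <-> cartan j i = 0;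
  sat_row : forall i : idx D, exists s : seq (idx D),
    forall j, cartan i j != 0 -> j \in s;
  sat_col : forall j : idx D, exists s : seq (idx D),
    forall i, cartan i j != 0 -> i \in s;
  sat_d : forall i : idx D, (0 < dd i)%N;
  sat_sym : forall i j : idx D,
    (dd i)%:Z * cartan i j = (dd j)%:Z * cartan j i;
  sat_evDl : forall (y y' : clat D) (x : wlat D),
    ev (y + y') x = ev y x + ev y' x;
  sat_evDr : forall (y : clat D) (x x' : wlat D),
    ev y (x + x') = ev y x + ev y x';
  sat_perfect : dual_bases D;
  sat_ev : forall i j : idx D, ev (scoroot i) (sroot j) = cartan i j;
  sat_indep : lin_indep (fun (v : clat D) (n : int) => v *~ n) (@scoroot D);
  sat_tauK : involutive (@tau D);
  sat_tau_cartan : forall i j : idx D, cartan (tau i) (tau j) = cartan i j;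
  sat_tau_d : forall i : idx D, dd (tau i) = dd i;
  sat_tauX_add : forall x x' : wlat D, tauX (x + x') = tauX x + tauX x';
  sat_tauXK : involutive (@tauX D);
  sat_tauY_add : forall y y' : clat D, tauY (y + y') = tauY y + tauY y';
  sat_tauYK : involutive (@tauY D);
  sat_tau_ev : forall (y : clat D) (x : wlat D), ev (tauY y) x = ev y (tauX x);
  sat_tau_root : forall i : idx D, tauX (sroot i) = sroot (tau i);
  sat_tau_coroot : forall i : idx D, tauY (scoroot i) = scoroot (tau i);
  sat_vsig : forall i : idx D, vsig i + vsig (tau i) = - cartan i (tau i);
  sat_vsig_ge0 : forall i : idx D, i != tau i -> 0 <= vsig i
}.

Section IWeights.
Variable D : satake_data.
Implicit Types (i j : idx D).

Definition iw_lattice : zmodType :=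
  zquot (fun x : wlat D => exists y, x = y + tauX y).

Definition iw (x : wlat D) : iw_lattice := zpi _ x.

(* a pre-image in X *)
Definition iw_lift (l : iw_lattice) : wlat D := zrepr l.

Definition iwc i (l : iw_lattice) : int :=
  ev (scoroot i - scoroot (tau i)) (iw_lift l).

Definition wti (w : seq (idx D)) : iw_lattice := iw (\sum_(i <- w) sroot i).

Definition dominant (x : wlat D) : Prop := forall i, 0 <= ev (scoroot i) x.
End IWeights.

(* In [{poly {poly k}}], as in polyXY, the outer variable ['X] is x and the
   inner variable ['Y] is y, so that [p`_r`_s] is the coefficient of x^r y^s. *)
Record structure_consts (D : satake_data) := StructureConsts {
  kk : comUnitRingType;
  kgr : nat -> kk -> Prop;                       (* [kgr n c]: c lies in k_n *)
  tt : idx D -> idx D -> kk;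
  QQ : idx D -> idx D -> {poly {poly kk}};
  cc : idx D -> wlat D -> kk;
  zeta : idx D -> kk
}.

Section Consts.
Variables (D : satake_data) (P : structure_consts D).
Notation k := (kk P).
Notation I := (idx D).
Implicit Types (i j : I).

Record graded_ground : Prop := GradedGround {
  kgr0 : forall n, kgr n (0 : k);
  kgrB : forall n (x y : k), kgr n x -> kgr n y -> kgr n (x - y);
  kgr1 : kgr 0 (1 : k);
  kgrM : forall m n (x y : k), kgr m x -> kgr n y -> kgr (m + n) (x * y);
  kgr_span : forall x : k, exists s : seq k,
    (forall n, kgr n s`_n) /\ x = \sum_(n < size s) s`_n;
  kgr_direct : forall s : seq k, (forall n, kgr n s`_n) ->
    \sum_(n < size s) s`_n = 0 -> forall n, s`_n = 0
}.

(* the units of k_0 *)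
Definition kunit (x : k) : Prop := [/\ kgr 0 x, x \is a GRing.unit & kgr 0 x^-1].

Definition rr i j : k := if i == j then 1 else cc P i (sroot j) / tt P i j.

(* R_{i,tau i}(1,-1), where R_{i,i}(x,y) = 1/(x-y)^2 *)
Definition R_at i : k :=
  if i == tau i then (4%:R)^-1 else rr i (tau i) * (QQ P i (tau i)).[1, -1].

(* The factorization of Q_{i,tau i}, read through a ring morphism k -> K. *)
Definition factors_with (K : comUnitRingType) (f : k -> K) (xi : seq K) i : Prop :=
  let a := `|cartan i (tau i)|%N in
  size xi = a./2 /\
  map_poly (map_poly f) (QQ P i (tau i)) =
    (f (cc P i (sroot (tau i))))%:P%:P * ('X - 'Y) ^+ (odd a)
      * \prod_(x <- xi) (('X - x%:P%:P * 'Y) * ('X - (x^-1)%:P%:P * 'Y)).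

(* For the second case, "a field extension K of k_0" presupposes that k_0 is a
   field; a ring morphism k_0 -> K is encoded as one on k killing k_n for n > 0. *)
Definition Q_factorized i : Prop :=
  (exists xi : seq k,
     [/\ forall x, x \in xi -> kunit x /\ kunit (1 + x),
         factors_with id xi i & factors_with id xi (tau i)])
  \/
  ((forall x : k, kgr 0 x -> x != 0 -> kunit x) /\
   exists (K : fieldType) (f : {rmorphism k -> K}) (xi : seq K),
     [/\ forall n (x : k), (0 < n)%N -> kgr n x -> f x = 0,
         forall x, x \in xi -> x != 0 /\ 1 + x != 0,
         forall r s, kgr 0 (QQ P i (tau i))`_r`_s /\
                     kgr 0 (QQ P (tau i) i)`_r`_s,
         factors_with f xi i
       & factors_with f xi (tau i)]).

Record const_axioms : Prop := ConstAxioms {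
  ca_ground : graded_ground;
  ca_two : (exists i, cartan i (tau i) != 0) -> (2%:R : k) \is a GRing.unit;
  ca_t : forall i j, i != j -> kunit (tt P i j);
  ca_Qsym : forall i j, QQ P i j = swapXY (QQ P j i);
  ca_Qdiag : forall i, QQ P i i = 0;
  ca_Qhomog : forall i j r s, (QQ P i j)`_r`_s != 0 ->
    exists n, kgr n (QQ P i j)`_r`_s /\
      n%:Z + (2 * dd i * r)%:Z + (2 * dd j * s)%:Z
        = - (2 * (dd i)%:Z * cartan i j);
  ca_Qlead : forall i j, i != j ->
    (QQ P i j)`_(`|cartan i j|%N)`_0 = tt P i j /\
    (QQ P i j)`_0`_(`|cartan j i|%N) = tt P j i;
  ca_Qsupp : forall i j r s, i != j -> (QQ P i j)`_r`_s != 0 ->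
    [\/ r = `|cartan i j|%N /\ s = 0%N, r = 0%N /\ s = `|cartan j i|%N
      | (r < `|cartan i j|)%N /\ (s < `|cartan j i|)%N];
  ca_c : forall i x, kunit (cc P i x);
  ca_cD : forall i x y, cc P i (x + y) = cc P i x * cc P i y;
  ca_c1 : forall i, cc P i (sroot i) = 1;
  ca_ctau : forall i x, i != tau i ->
    cc P (tau i) (tauX x) = (-1) ^+ `|ev (scoroot i) x|%N * cc P i x;
  ca_Qtau : forall i j r s,
    (QQ P (tau i) (tau j))`_r`_s =
      rr i j * rr j i * rr i (tau j) * rr j (tau i)
        * ((-1) ^+ (r + s) * (QQ P i j)`_r`_s);
  ca_Qfact : forall i, i != tau i -> Q_factorized i;
  ca_zeta : forall i, kunit (zeta P i);
  ca_zeta_tau : forall i,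
    zeta P i * zeta P (tau i) = (-1) ^+ `|(vsig (tau i) + 1)%R|%N * R_at i;
  ca_zeta_fix : forall i, i = tau i -> zeta P i = - (2%:R)^-1
}.

Definition gam i (l : iw_lattice D) : k :=
  let x := iw_lift l in
  if i == tau i then (-1) ^+ `|ev (scoroot i) x|%N else cc P i (x - tauX x).

(* Q^iota_{i,j} *)
Definition Qi i j : {poly {poly k}} :=
  if i == tau j then - QQ P i j else QQ P i j.

(* The coefficient of x^a y^b z^c in D_{i,j}: since
   (x^r - z^r)/(x - z) is the sum of x^a z^c over a + c + 1 = r. *)
Definition Dcoef i j (a b c : nat) : k := (Qi i j)`_(a + c).+1`_b.

(* The coefficient of u^b in R_{i,j}(u,y), as a polynomial in y; for i = j,
   1/(u-y)^2 is the sum of m y^(m-1) u^(-m-1) over m >= 1. *)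
Definition Rser i j (b : int) : {poly k} :=
  match b with
  | Posz n => if i == j then 0 else rr i j *: (QQ P i j)`_n
  | Negz m => if i == j then m%:R *: 'X^(m.-1) else 0
  end.

Definition sgk (n : int) : k := (-1) ^+ `|n|%N.
End Consts.

(* Formal 2-morphisms.  A 1-morphism B_{i_1} ... B_{i_l} 1_lambda is given by
   the word [:: i_1; ...; i_l] and the weight lambda at its right. *)
Inductive tm (I k : Type) : Type :=
| TId of seq I
| TDot of I
| TCap of I
| TCup of I
| TCross of I & I
| TBub of I & nat                          (* beta_{i,n} *)
| TComp of tm I k & tm I k                 (* vertical composition *)
| TTens of tm I k & tm I k                 (* horizontal composition *)
| TZero of seq I & seq I
| TAdd of tm I k & tm I k
| TScale of k & tm I k.

Arguments TId {I k}.
Arguments TDot {I k}.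
Arguments TCap {I k}.
Arguments TCup {I k}.
Arguments TCross {I k}.
Arguments TBub {I k}.
Arguments TZero {I k}.

Declare Scope tm_scope.
Delimit Scope tm_scope with tm.
Notation "a ∘ b" := (TComp a b) (at level 40, left associativity) : tm_scope.
Notation "a ⊗ b" := (TTens a b) (at level 38, left associativity) : tm_scope.
Notation "a ⊕ b" := (TAdd a b) (at level 50, left associativity) : tm_scope.
Notation "c ⊙ a" := (TScale c a) (at level 37, right associativity) : tm_scope.
Notation "a ⊖ b" := (TAdd a (TScale (-1)%R b))
  (at level 50, left associativity) : tm_scope.

Section TwoCategory.
Variables (D : satake_data) (P : structure_consts D).
Notation I := (idx D).
Notation word := (seq I).
Notation wt := (iw_lattice D).
Notation k := (kk P).
Notation tm := (tm I k).
Implicit Types (i j : I) (l : wt) (u v w : word) (a b f g : tm) (c d : k).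
Local Open Scope tm_scope.

(* [typed l v w a]: a is a 2-morphism B_v 1_l => B_w 1_l.  The zero 2-morphism
   is given every type; a term whose source and target are not parallel is
   equal to zero. *)
Inductive typed : wt -> word -> word -> tm -> Prop :=
| typed_id l w : typed l w w (TId w)
| typed_dot l i : typed l [:: i] [:: i] (TDot i)
| typed_cap l i : typed l [:: tau i; i] [::] (TCap i)
| typed_cup l i : typed l [::] [:: tau i; i] (TCup i)
| typed_cross l i j : typed l [:: i; j] [:: j; i] (TCross i j)
| typed_bub l i n : n%:Z <= vsig i - iwc i l -> typed l [::] [::] (TBub i n)
| typed_comp l u v w a b :
    typed l v w a -> typed l u v b -> typed l u w (a ∘ b)
| typed_tens l u u' v v' a b :
    typed (l - wti v) u u' a -> typed l v v' b ->
    typed l (u ++ v) (u' ++ v') (a ⊗ b)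
| typed_zero l v w : typed l v w (TZero v w)
| typed_add l v w a b : typed l v w a -> typed l v w b -> typed l v w (a ⊕ b)
| typed_scale l v w c a : typed l v w a -> typed l v w (c ⊙ a).

Inductive hdeg : wt -> word -> word -> int -> tm -> Prop :=
| hdeg_id l w : hdeg l w w 0 (TId w)
| hdeg_dot l i : hdeg l [:: i] [:: i] (2 * dd i)%:Z (TDot i)
| hdeg_cap l i : hdeg l [:: tau i; i] [::]
    ((dd i)%:Z * (1 + vsig i - iwc i l)) (TCap i)
| hdeg_cup l i : hdeg l [::] [:: tau i; i]
    ((dd i)%:Z * (1 + vsig i - iwc i l)) (TCup i)
| hdeg_cross l i j : hdeg l [:: i; j] [:: j; i]
    (- ((dd i)%:Z * cartan i j)) (TCross i j)
| hdeg_bub l i n : n%:Z <= vsig i - iwc i l ->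
    hdeg l [::] [::] (2 * dd i * n)%:Z (TBub i n)
| hdeg_comp l u v w m n a b :
    hdeg l v w m a -> hdeg l u v n b -> hdeg l u w (m + n) (a ∘ b)
| hdeg_tens l u u' v v' m n a b :
    hdeg (l - wti v) u u' m a -> hdeg l v v' n b ->
    hdeg l (u ++ v) (u' ++ v') (m + n) (a ⊗ b)
| hdeg_zero l v w n : hdeg l v w n (TZero v w)
| hdeg_add l v w n a b :
    hdeg l v w n a -> hdeg l v w n b -> hdeg l v w n (a ⊕ b)
| hdeg_scale l v w m n c a :
    kgr m c -> hdeg l v w n a -> hdeg l v w (m%:Z + n) (c ⊙ a).

Notation E := (TId [::]).
Notation "1_ i" := (TId [:: i]) (at level 8, i at level 2, format "1_ i") : tm_scope.

(* [dots i n] is x_i^n *)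
Definition dots i (n : nat) : tm := iter n (TComp (TDot i)) (1_ i).

(* the polynomial p evaluated at x_i *)
Definition poly_dots i (p : {poly k}) : tm :=
  \big[@TAdd I k/TZero [:: i] [:: i]]_(n < size p) (p`_n ⊙ dots i n).

(* Finite sums of 2-morphisms B_v => B_w *)
Definition tsum v w (n : nat) (F : nat -> tm) : tm :=
  \big[@TAdd I k/TZero v w]_(r < n) F r.

Definition tif (t : bool) v w a : tm := if t then a else TZero v w.

(* beta_coef i l m is the coefficient of u^m in beta_i^l(u). *)
Definition beta_coef i l (m : int) : tm :=
  match m with
  | Posz n =>
      if (i != tau i) && (m <= vsig i - iwc i l)
      then TBub i `|(vsig i - iwc i l - m)%R|%N else TZero [::] [::]
  | Negz n =>
      (TCap i ∘ (1_ (tau i) ⊗ dots i n) ∘ TCup i)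
      ⊕ (if (i == tau i) && (n == 0%N) then (- (2%:R)^-1) ⊙ E
         else TZero [::] [::])
  end.

(* All coefficients of beta_i^l(u) in degrees above beta_top vanish. *)
Definition beta_top i l : int := Num.max (vsig i - iwc i l) (-1).

(* The coefficient of u^m in a product of two Laurent series in u^{-1} whose
   degrees in u are at most A and B: the sum of F r s over r + s = m with
   r <= A and s <= B. *)
Definition conv v w (A B : int) (F : int -> int -> tm) (m : int) : tm :=
  tsum v w `|(Num.max 0 (A + B - m + 1))%R|%N (fun n => F (A - n%:Z) (m - A + n%:Z)).

(* the coefficient of u^m in beta_i(-u) *)
Definition beta_neg i l (m : int) : tm := sgk P m ⊙ beta_coef i l m.

Definition beta_len i l : nat := `|beta_top i l|%N.+1.

(* Q^iota_{i,j}(x_i 1_j, 1_i x_j) *)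
Definition Q_dots i j : tm :=
  tsum [:: i; j] [:: i; j] `|cartan i j|%N.+1 (fun r =>
  tsum [:: i; j] [:: i; j] `|cartan j i|%N.+1 (fun s =>
    (Qi P i j)`_r`_s ⊙ (dots i r ⊗ dots j s))).

(* The sum of d_{pqr} F p q r, where D_{i,j} is the sum of d_{pqr} x^p y^q z^r. *)
Definition D_sum v w i j (F : nat -> nat -> nat -> tm) : tm :=
  tsum v w `|cartan i j|%N (fun p => tsum v w `|cartan j i|%N.+1 (fun q =>
  tsum v w `|cartan i j|%N (fun r => Dcoef P i j p q r ⊙ F p q r))).

(* In the coefficient of u^{-1}, each factor 1/(u-x) contributes x^n u^(-n-1). *)
Definition curl_rhs l i : tm :=
  tsum [:: i] [:: i] (beta_len (tau i) l) (fun n =>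
    dots i n ⊗ beta_neg (tau i) l n%:Z).

Definition quadratic_rhs l i j : tm :=
  let N := beta_len i l in
  Q_dots i j ⊕ tif (i == tau j) [:: i; j] [:: i; j]
    (tsum [:: i; j] [:: i; j] N (fun n => tsum [:: i; j] [:: i; j] N (fun m =>
       (dots i n ⊗ 1_ j) ∘ TCup j ∘ beta_coef i l (n + m + 1)%N%:Z
         ∘ TCap j ∘ (dots i m ⊗ 1_ j)))).

Definition braid_rhs l i j h : tm :=
  let v := [:: i; j; h] in
  let w := [:: h; j; i] in
  let l1 := l - wti [:: h] in
  let N1 := beta_len i l1 in
  let l2 := l - wti [:: j; h] in
  let N2 := beta_len (tau i) l2 in
  tif (i == h) v w
    (D_sum v w i j (fun p q r => dots i p ⊗ dots j q ⊗ dots h r))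
  ⊕ tif ((i == tau j) && (j == tau h)) v w
    (tsum v w N1 (fun n => tsum v w N1 (fun m => tsum v w N1 (fun r =>
       ((dots i n ⊗ 1_ j) ∘ TCup j ∘ TCap j ∘ (dots i m ⊗ 1_ j))
         ⊗ beta_coef i l1 (n + m + r + 2)%N%:Z ⊗ dots h r)))
     ⊖ tsum v w N2 (fun n => tsum v w N2 (fun m => tsum v w N2 (fun r =>
       dots i r ⊗ beta_neg (tau i) l2 (n + m + r + 2)%N%:Z
         ⊗ ((1_ j ⊗ dots h n) ∘ TCup h ∘ TCap h ∘ (1_ j ⊗ dots h m))))))
  ⊖ tif (i == tau j) v w (rr P j h ⊙
      D_sum v w j h (fun p q r =>
        (1_ h ⊗ ((dots j r ⊗ 1_ i) ∘ TCup i)) ∘ dots h q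
          ∘ ((TCap j ∘ (1_ i ⊗ dots j p)) ⊗ 1_ h)))
  ⊖ tif (j == tau h) v w ((rr P h i)^-1 ⊙
      D_sum v w j i (fun p q r =>
        (((1_ h ⊗ dots j p) ∘ TCup j) ⊗ 1_ i) ∘ dots i q
          ∘ (1_ i ⊗ (TCap h ∘ (dots j r ⊗ 1_ h))))).

(* [rel2 l a b]: the relation a = b with l the weight at the right.  It is only
   imposed, in [eq2], when a and b are well typed at l. *)
Inductive rel2 : wt -> tm -> tm -> Prop :=
| rel_compA l a b f : rel2 l ((a ∘ b) ∘ f) (a ∘ (b ∘ f))
| rel_comp1l l w a : rel2 l (TId w ∘ a) a
| rel_comp1r l w a : rel2 l (a ∘ TId w) a
| rel_tensA l a b f : rel2 l ((a ⊗ b) ⊗ f) (a ⊗ (b ⊗ f))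
| rel_tens1l l a : rel2 l (E ⊗ a) a
| rel_tens1r l a : rel2 l (a ⊗ E) a
| rel_tens_id l v w : rel2 l (TId v ⊗ TId w) (TId (v ++ w))
| rel_interchange l a b f g : rel2 l ((a ∘ b) ⊗ (f ∘ g)) ((a ⊗ f) ∘ (b ⊗ g))
| rel_addA l a b f : rel2 l (a ⊕ (b ⊕ f)) (a ⊕ b ⊕ f)
| rel_addC l a b : rel2 l (a ⊕ b) (b ⊕ a)
| rel_add0 l v w a : rel2 l (TZero v w ⊕ a) a
| rel_scale0 l v w a : rel2 l (0 ⊙ a) (TZero v w)
| rel_scale1 l a : rel2 l (1 ⊙ a) a
| rel_scaleA l c d a : rel2 l (c ⊙ d ⊙ a) ((c * d)%R ⊙ a)
| rel_scaleDl l c d a : rel2 l ((c + d)%R ⊙ a) (c ⊙ a ⊕ d ⊙ a)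
| rel_scaleDr l c a b : rel2 l (c ⊙ (a ⊕ b)) (c ⊙ a ⊕ c ⊙ b)
| rel_compDl l a b f : rel2 l ((a ⊕ b) ∘ f) (a ∘ f ⊕ b ∘ f)
| rel_compDr l a b f : rel2 l (f ∘ (a ⊕ b)) (f ∘ a ⊕ f ∘ b)
| rel_compZl l c a f : rel2 l ((c ⊙ a) ∘ f) (c ⊙ (a ∘ f))
| rel_compZr l c a f : rel2 l (f ∘ (c ⊙ a)) (c ⊙ (f ∘ a))
| rel_tensDl l a b f : rel2 l ((a ⊕ b) ⊗ f) (a ⊗ f ⊕ b ⊗ f)
| rel_tensDr l a b f : rel2 l (f ⊗ (a ⊕ b)) (f ⊗ a ⊕ f ⊗ b)
| rel_tensZl l c a f : rel2 l ((c ⊙ a) ⊗ f) (c ⊙ (a ⊗ f))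
| rel_tensZr l c a f : rel2 l (f ⊗ (c ⊙ a)) (c ⊙ (f ⊗ a))
| rel_leading l i m : vsig i - iwc i l <= m ->
    rel2 l (beta_coef i l m)
      (if m == vsig i - iwc i l then (zeta P i * gam P i l)%R ⊙ E
       else TZero [::] [::])
| rel_grassmannian l i m : m < - cartan i (tau i) ->
    rel2 l
      (conv [::] [::] (beta_top i l) (beta_top (tau i) l)
         (fun r s => beta_coef i l r ∘ beta_neg (tau i) l s) m)
      (TZero [::] [::])
| rel_slide l i j m :
    rel2 l
      (conv [:: j] [:: j] (beta_top i (l - wti [:: j])) `|cartan i j|%N%:Z
         (fun r s => (beta_coef i (l - wti [:: j]) r ⊗ 1_ j)
                       ∘ poly_dots j (Rser P i j s)) m)
      (conv [:: j] [:: j] `|cartan (tau i) j|%N%:Z (beta_top i l)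
         (fun r s => poly_dots j (sgk P r *: Rser P (tau i) j r)
                       ∘ (1_ j ⊗ beta_coef i l s)) m)
| rel_zigzag_l l i : rel2 l ((TCap (tau i) ⊗ 1_ i) ∘ (1_ i ⊗ TCup i)) (1_ i)
| rel_zigzag_r l i : rel2 l ((1_ i ⊗ TCap i) ∘ (TCup (tau i) ⊗ 1_ i)) (1_ i)
| rel_dot_cup l i : rel2 l ((TDot (tau i) ⊗ 1_ i) ∘ TCup i)
                        ((-1) ⊙ ((1_ (tau i) ⊗ TDot i) ∘ TCup i))
| rel_dot_cap l i : rel2 l (TCap i ∘ (TDot (tau i) ⊗ 1_ i))
                        ((-1) ⊙ (TCap i ∘ (1_ (tau i) ⊗ TDot i)))
| rel_pitchfork_cup l i j :
    rel2 l ((TCross j i ⊗ 1_ (tau i)) ∘ (1_ j ⊗ TCup (tau i)))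
           ((rr P i j)^-1 ⊙ ((1_ i ⊗ TCross (tau i) j) ∘ (TCup (tau i) ⊗ 1_ j)))
| rel_pitchfork_cap l i j :
    rel2 l ((TCap i ⊗ 1_ j) ∘ (1_ (tau i) ⊗ TCross j i))
           ((rr P i j)^-1 ⊙ ((1_ j ⊗ TCap i) ∘ (TCross (tau i) j ⊗ 1_ i)))
| rel_dot_cross_l l i j :
    rel2 l (TCross i j ∘ (TDot i ⊗ 1_ j) ⊖ (1_ j ⊗ TDot i) ∘ TCross i j)
      (tif (i == j) [:: i; j] [:: j; i] (1_ i ⊗ 1_ j)
       ⊖ tif (i == tau j) [:: i; j] [:: j; i] (TCup i ∘ TCap j))
| rel_dot_cross_r l i j :
    rel2 l ((TDot j ⊗ 1_ i) ∘ TCross i j ⊖ TCross i j ∘ (1_ i ⊗ TDot j))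
      (tif (i == j) [:: i; j] [:: j; i] (1_ i ⊗ 1_ j)
       ⊖ tif (i == tau j) [:: i; j] [:: j; i] (TCup i ∘ TCap j))
| rel_curl l i :
    rel2 l ((1_ i ⊗ TCap (tau i)) ∘ (TCross i i ⊗ 1_ (tau i))
              ∘ (1_ i ⊗ TCup (tau i)))
           (curl_rhs l i)
| rel_quadratic l i j : rel2 l (TCross j i ∘ TCross i j) (quadratic_rhs l i j)
| rel_braid l i j h :
    rel2 l
      ((TCross j h ⊗ 1_ i) ∘ (1_ j ⊗ TCross i h) ∘ (TCross i j ⊗ 1_ h)
       ⊖ (1_ h ⊗ TCross i j) ∘ (TCross i h ⊗ 1_ j) ∘ (1_ i ⊗ TCross j h))
      (braid_rhs l i j h).

Inductive eq2 : wt -> word -> word -> tm -> tm -> Prop :=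
| eq2_rel l v w a b :
    typed l v w a -> typed l v w b -> rel2 l a b -> eq2 l v w a b
| eq2_refl l v w a : typed l v w a -> eq2 l v w a a
| eq2_sym l v w a b : eq2 l v w a b -> eq2 l v w b a
| eq2_trans l v w a b f : eq2 l v w a b -> eq2 l v w b f -> eq2 l v w a f
| eq2_comp l u v w a a' b b' :
    eq2 l v w a a' -> eq2 l u v b b' -> eq2 l u w (a ∘ b) (a' ∘ b')
| eq2_tens l u u' v v' a a' b b' :
    eq2 (l - wti v) u u' a a' -> eq2 l v v' b b' ->
    eq2 l (u ++ v) (u' ++ v') (a ⊗ b) (a' ⊗ b')
| eq2_add l v w a a' b b' :
    eq2 l v w a a' -> eq2 l v w b b' -> eq2 l v w (a ⊕ b) (a' ⊕ b')
| eq2_scale l v w c a a' : eq2 l v w a a' -> eq2 l v w (c ⊙ a) (c ⊙ a').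
End TwoCategory.

Section Hom.
Variables (D : satake_data) (P : structure_consts D).
Notation I := (idx D).
Notation word := (seq I).
Notation wt := (iw_lattice D).
Notation k := (kk P).

Section OneHom.
Variables (l : wt) (v w : word).

Definition prehom : Type := {a : tm I k | typed l v w a}.
HB.instance Definition _ := gen_eqMixin prehom.
HB.instance Definition _ := gen_choiceMixin prehom.

Definition heq (a b : prehom) : bool := `[< eq2 l v w (sval a) (sval b) >].

Lemma heq_equiv : equiv_class_of heq.
Proof.
split=> [a|a b|b a c].
- exact/asboolP/eq2_refl/(svalP a).
- by apply/asboolP/asboolP => /eq2_sym.
- by move=> /asboolP h1 /asboolP h2; apply/asboolP/(eq2_trans h1 h2).
Qed.
Canonical heq_equivRel := EquivRelPack heq_equiv.
Canonical heq_encModRel := defaultEncModRel heq.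

(* Hom(B_v 1_l, B_w 1_l) *)
Definition hom2 : Type := {eq_quot heq}.
HB.instance Definition _ := Choice.on hom2.
HB.instance Definition _ : EqQuotient prehom heq hom2 := EqQuotient.on hom2.

Definition hom2_of a (ta : typed l v w a) : hom2 := \pi_hom2 (exist _ a ta).

Lemma hom2_ofP (a b : tm I k) (ta : typed l v w a) (tb : typed l v w b) :
  eq2 l v w a b -> hom2_of ta = hom2_of tb.
Proof. by move=> h; apply/eqmodP/asboolP. Qed.

Lemma hom2_eq a b (ta : typed l v w a) (tb : typed l v w b) :
  hom2_of ta = hom2_of tb -> eq2 l v w a b.
Proof. by move=> /eqmodP/asboolP. Qed.

Lemma hom2_repr (x : hom2) : hom2_of (svalP (repr x)) = x.
Proof.
have e (y : prehom) : hom2_of (svalP y) = \pi_hom2 y by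
  apply/eqmodP/asboolP/eq2_refl/svalP.
by rewrite e reprK.
Qed.

Definition hzero : hom2 := hom2_of (typed_zero P l v w).
Definition hadd (x y : hom2) : hom2 :=
  hom2_of (typed_add (svalP (repr x)) (svalP (repr y))).
Definition hscale (c : k) (x : hom2) : hom2 :=
  hom2_of (typed_scale c (svalP (repr x))).
Definition hopp (x : hom2) : hom2 := hscale (-1) x.

Lemma hadd_of a b (ta : typed l v w a) (tb : typed l v w b) :
  hadd (hom2_of ta) (hom2_of tb) = hom2_of (typed_add ta tb).
Proof.
by apply: hom2_ofP; apply: eq2_add;
  apply: (@hom2_eq _ _ (svalP (repr _))); rewrite hom2_repr.
Qed.

Lemma hscale_of c a (ta : typed l v w a) :
  hscale c (hom2_of ta) = hom2_of (typed_scale c ta).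
Proof.
apply: hom2_ofP; apply: eq2_scale.
by apply: (@hom2_eq _ _ (svalP (repr _))); rewrite hom2_repr.
Qed.

Lemma hom2_ind (Q : hom2 -> Prop) :
  (forall a (ta : typed l v w a), Q (hom2_of ta)) -> forall x, Q x.
Proof. by move=> h x; rewrite -(hom2_repr x). Qed.

Lemma haddA : associative hadd.
Proof.
elim/hom2_ind=> a ta; elim/hom2_ind=> b tb; elim/hom2_ind=> c tc.
rewrite !hadd_of; apply/hom2_ofP/eq2_rel/rel_addA; by do ?[assumption | constructor].
Qed.

Lemma haddC : commutative hadd.
Proof.
elim/hom2_ind=> a ta; elim/hom2_ind=> b tb.
rewrite !hadd_of; apply/hom2_ofP/eq2_rel/rel_addC; by do ?[assumption | constructor].
Qed.

Lemma hadd0 : left_id hzero hadd.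
Proof.
elim/hom2_ind=> a ta.
rewrite hadd_of; apply/hom2_ofP/eq2_rel/rel_add0; by do ?[assumption | constructor].
Qed.

Lemma hscaleA c d x : hscale c (hscale d x) = hscale (c * d) x.
Proof.
elim/hom2_ind: x => a ta.
rewrite !hscale_of; apply/hom2_ofP/eq2_rel/rel_scaleA; by do ?[assumption | constructor].
Qed.

Lemma hscale1 : left_id 1 hscale.
Proof.
elim/hom2_ind=> a ta.
rewrite !hscale_of; apply/hom2_ofP/eq2_rel/rel_scale1; by do ?[assumption | constructor].
Qed.

Lemma hscaleDr : right_distributive hscale hadd.
Proof.
move=> c; elim/hom2_ind=> a ta; elim/hom2_ind=> b tb.
rewrite !(hadd_of, hscale_of).
apply/hom2_ofP/eq2_rel/rel_scaleDr; by do ?[assumption | constructor].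
Qed.

Lemma hscaleDl x : {morph hscale^~ x : c d / c + d >-> hadd c d}.
Proof.
move=> c d; elim/hom2_ind: x => a ta.
rewrite !(hadd_of, hscale_of).
apply/hom2_ofP/eq2_rel/rel_scaleDl; by do ?[assumption | constructor].
Qed.

Lemma hscale0 x : hscale 0 x = hzero.
Proof.
elim/hom2_ind: x => a ta.
rewrite hscale_of; apply/hom2_ofP/eq2_rel/rel_scale0; by do ?[assumption | constructor].
Qed.

Lemma haddN : left_inverse hzero hopp hadd.
Proof.
by move=> x; rewrite /hopp -[X in hadd _ X]hscale1 -hscaleDl addNr hscale0.
Qed.

HB.instance Definition _ := GRing.isZmodule.Build hom2 haddA haddC hadd0 haddN.
HB.instance Definition _ :=
  GRing.Zmodule_isLmodule.Build k hom2 hscaleA hscale1 hscaleDr hscaleDl.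

(* the class of a formal 2-morphism, with the junk value 0 if it is ill typed *)
Definition hom2_cls (a : tm I k) : hom2 :=
  if pselect (typed l v w a) is left ta then hom2_of ta else 0.

Definition homog (n : int) (x : hom2) : Prop :=
  exists a (ta : typed l v w a), hdeg l v w n a /\ x = hom2_of ta.
End OneHom.

Definition end1 (l : wt) : Type := hom2 l [::] [::].
HB.instance Definition _ l := GRing.Lmodule.on (end1 l).

Definition vcomp l u v w (x : hom2 l v w) (y : hom2 l u v) : hom2 l u w :=
  hom2_of (typed_comp (svalP (repr x)) (svalP (repr y))).

(* End(1_l) acts on the right by horizontal composition. *)
Definition ract l v w (x : hom2 l v w) (z : end1 l) : hom2 l v w :=
  hom2_cls l v w (TTens (sval (repr x)) (sval (repr (z : hom2 l [::] [::])))).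

Definition end_id l : end1 l := hom2_of (typed_id P l [::]).

(* beta_{i,n} in End(1_l), the coefficient of u^(vsig_i - l_i - n) in beta_i(u) *)
Definition beta_end l i (n : nat) : end1 l :=
  hom2_cls l [::] [::] (beta_coef P i l (vsig i - iwc i l - n%:Z)).
End Hom.

(* A shape is the list of its layers from bottom to top.  Each layer contains
   one cup, cap or crossing, with p strings to its left; the labels of caps and
   crossings are read off the word below the layer.  [PCup i] creates the ends
   labelled tau i, i. *)
Inductive piece (I : Type) : Type := PCup of I | PCap | PCross.
Arguments PCap {I}.
Arguments PCross {I}.
HB.instance Definition _ (I : Type) := gen_eqMixin (piece I).
HB.instance Definition _ (I : Type) := gen_choiceMixin (piece I).

Section Shapes.
Variable D : satake_data.
Notation I := (idx D).
Notation word := (seq I).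

Definition layer : Type := (nat * piece I)%type.
Definition shape : Type := seq layer.

Definition layer_run (x : layer) (w : word) : option word :=
  let u := take x.1 w in
  let v := drop x.1 w in
  match x.2 with
  | PCup i => if (x.1 <= size w)%N then Some (u ++ [:: tau i, i & v]) else None
  | PCap => if v is [:: j, i & v'] then
              if j == tau i then Some (u ++ v') else None
            else None
  | PCross => if v is [:: i, j & v'] then Some (u ++ [:: j, i & v']) else None
  end.

Definition run (w : word) (s : shape) : option word :=
  foldl (fun o x => obind (layer_run x) o) (Some w) s.

(* the word at height t, i.e. just above the first t layers *)
Definition level (w : word) (s : shape) (t : nat) : word :=
  odflt [::] (run w (take t s)).

(* A point (t, p) is the p-th string from the left at height t.  All strings
   pass through points, and a point is away from crossings and critical points. *)
Definition is_point (w : word) (s : shape) (x : nat * nat) : bool :=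
  (x.1 <= size s)%N && (x.2 < size (level w s x.1))%N.

(* Points joined by a segment of string crossing one layer. *)
Inductive joined (w : word) (s : shape) : nat * nat -> nat * nat -> Prop :=
| joined_cup t p i : onth s t = Some (p, PCup i) ->
    joined w s (t.+1, p) (t.+1, p.+1)
| joined_cup_left t p i r : onth s t = Some (p, PCup i) ->
    (r < p)%N -> joined w s (t, r) (t.+1, r)
| joined_cup_right t p i r : onth s t = Some (p, PCup i) ->
    (p <= r < size (level w s t))%N -> joined w s (t, r) (t.+1, r.+2)
| joined_cap t p : onth s t = Some (p, PCap) ->
    joined w s (t, p) (t, p.+1)
| joined_cap_left t p r : onth s t = Some (p, PCap) ->
    (r < p)%N -> joined w s (t, r) (t.+1, r)
| joined_cap_right t p r : onth s t = Some (p, PCap) ->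
    (p <= r)%N -> (r.+2 < size (level w s t))%N ->
    joined w s (t, r.+2) (t.+1, r)
| joined_cross_up t p : onth s t = Some (p, PCross) ->
    joined w s (t, p) (t.+1, p.+1)
| joined_cross_down t p : onth s t = Some (p, PCross) ->
    joined w s (t, p.+1) (t.+1, p)
| joined_cross_other t p r : onth s t = Some (p, PCross) ->
    r != p -> r != p.+1 -> (r < size (level w s t))%N ->
    joined w s (t, r) (t.+1, r).

Definition same_string (w : word) (s : shape) : nat * nat -> nat * nat -> Prop :=
  clos_refl_sym_trans (nat * nat) (joined w s).

(* [(b, p)] is the p-th endpoint at the top if b, at the bottom otherwise. *)
Definition endpoint (s : shape) (e : bool * nat) : nat * nat :=
  (if e.1 then size s else 0%N, e.2).

(* a point of the critical string of the layer t, if it is a cup or a cap *)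
Definition critical (s : shape) (t : nat) : option (nat * nat) :=
  match onth s t with
  | Some (p, PCup _) => Some (t.+1, p)
  | Some (p, PCap) => Some (t, p)
  | _ => None
  end.

(* s is an (i x j) shape: from the word j at the bottom to i at the top,
   without closed components *)
Definition is_shape (wi wj : word) (s : shape) : Prop :=
  run wj s = Some wi /\
  forall x, is_point wj s x ->
    exists e, is_point wj s (endpoint s e) /\ same_string wj s x (endpoint s e).

Record reduced (wj : word) (s : shape) : Prop := Reduced {
  red_critical : forall t t' x x', t != t' ->
    critical s t = Some x -> critical s t' = Some x' -> ~ same_string wj s x x';
  red_self : forall t p, onth s t = Some (p, PCross) ->
    ~ same_string wj s (t, p) (t, p.+1);
  red_twice : forall t t' p p', t != t' ->
    onth s t = Some (p, PCross) -> onth s t' = Some (p', PCross) ->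
    ~ (same_string wj s (t, p) (t', p') /\
       same_string wj s (t, p.+1) (t', p'.+1)) /\
    ~ (same_string wj s (t, p) (t', p'.+1) /\
       same_string wj s (t, p.+1) (t', p'))
}.

Definition reduced_shape (wi wj : word) (s : shape) : Prop :=
  is_shape wi wj s /\ reduced wj s.

Definition same_matching (wj : word) (s s' : shape) : Prop :=
  forall e e', is_point wj s (endpoint s e) -> is_point wj s (endpoint s e') ->
    (same_string wj s (endpoint s e) (endpoint s e') <->
     same_string wj s' (endpoint s' e) (endpoint s' e')).

(* The choices made in the definition of non-degeneracy: I_1, the sets
   sh(i x j), and one point on each string of each shape in them. *)
Record nd_choices := NdChoices {
  orbit_rep : pred I;
  sh : word -> word -> pred shape;
  marks : word -> word -> shape -> seq (nat * nat)
}.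

Record choices_axioms (C : nd_choices) : Prop := ChoicesAxioms {
  ch_rep_size2 : forall i, orbit_rep C i -> i != tau i;
  ch_rep : forall i, i != tau i -> orbit_rep C i (+) orbit_rep C (tau i);
  ch_sh_reduced : forall wi wj s, sh C wi wj s -> reduced_shape wi wj s;
  ch_sh_rep : forall wi wj s, reduced_shape wi wj s ->
    exists! s', sh C wi wj s' /\ same_matching wj s s';
  ch_marks_point : forall wi wj s x, sh C wi wj s ->
    x \in marks C wi wj s -> is_point wj s x;
  ch_marks_uniq : forall wi wj s, sh C wi wj s -> uniq (marks C wi wj s);
  ch_marks : forall wi wj s x, sh C wi wj s -> is_point wj s x ->
    exists! y, y \in marks C wi wj s /\ same_string wj s x y
}.
End Shapes.

Section NonDegeneracy.
Variables (D : satake_data) (P : structure_consts D) (C : nd_choices D).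
Notation I := (idx D).
Notation word := (seq I).
Notation wt := (iw_lattice D).
Notation k := (kk P).
Notation tm := (tm I k).
Local Open Scope tm_scope.

Definition layer_tm (x : layer D) (w : word) : tm :=
  let u := take x.1 w in
  let v := drop x.1 w in
  match x.2, v with
  | PCup i, _ => TId u ⊗ TCup i ⊗ TId v
  | PCap, [:: _, i & v'] => TId u ⊗ TCap i ⊗ TId v'
  | PCross, [:: i, j & v'] => TId u ⊗ TCross i j ⊗ TId v'
  | _, _ => TId w
  end.

(* nu p dots on the p-th string of w, for all p *)
Definition dotted_word (nu : nat -> nat) (w : word) : tm :=
  foldr (fun x a => dots P x.2 (nu x.1) ⊗ a) (TId [::]) (zip (iota 0 (size w)) w).

(* the shape s on the word w, with nu t p dots at each point (t, p) *)
Fixpoint dotted_shape (nu : nat -> nat -> nat) (w : word) (s : shape D) : tm :=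
  match s with
  | [::] => dotted_word (nu 0%N) w
  | x :: s' =>
      dotted_shape (fun t => nu t.+1) (odflt [::] (layer_run x w)) s'
        ∘ layer_tm x w ∘ dotted_word (nu 0%N) w
  end.

(* D(x_1^{n_1} ... x_l^{n_l}) *)
Definition marked_tm (wi wj : word) (s : shape D) (n : seq nat) : tm :=
  let m := marks C wi wj s in
  dotted_shape (fun t p => nth 0%N n (index (t, p) m)) wj s.

Definition basis_index (wi wj : word) : choiceType :=
  {x : shape D * seq nat | sh C wi wj x.1 && (size x.2 == size (marks C wi wj x.1))}.

Definition basis_elt (l : wt) (wi wj : word) (x : basis_index wi wj) :
    hom2 P l wj wi :=
  hom2_cls l wj wi (marked_tm wi wj (val x).1 (val x).2).

Definition bubble_index : choiceType :=
  {x : I * nat | (0 < x.2)%N &&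
     (orbit_rep C x.1 || ((x.1 == tau x.1) && odd x.2))}.

Definition bubble_monomial (l : wt) (m : {mset bubble_index}%mset) : end1 P l :=
  \big[@vcomp D P l [::] [::] [::]/end_id P l]_(x <- m)
     beta_end P l (val x).1 (val x).2.

Record non_degenerate : Prop := NonDegenerate {
  (* the monomials in the generators are a basis of End(1_l) *)
  nd_end : forall l : wt,
    is_basis (fun (x : end1 P l) (c : k) => c *: x) (bubble_monomial l);
  nd_hom : forall (l : wt) (wi wj : word), wti wi = wti wj ->
    odd (size wi) = odd (size wj) ->
    is_basis (@ract D P l wj wi) (@basis_elt l wi wj)
}.
End NonDegeneracy.

Section Rank.
Variables (D : satake_data) (P : structure_consts D).

(* There is a homogeneous basis with degrees bounded below and with m d elements
   of degree d, for each d; that is, rank_q is the sum of m d q^d. *)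
Definition graded_rank (l : iw_lattice D) (v w : seq (idx D)) (m : int -> nat) :
    Prop :=
  exists (K : choiceType) (b : K -> hom2 P l v w) (deg : K -> int),
    [/\ is_basis (@ract D P l v w) b,
        forall x, homog (deg x) (b x),
        exists N, forall x, N <= deg x
      & forall d, exists s : seq K,
          [/\ uniq s, size s = m d & forall x, (x \in s) = (deg x == d)]].
End Rank.

Definition Qq : fieldType := {fraction {poly rat}}.
Definition qq : Qq := FracField.tofrac 'X.

Section QuantumGroup.
Variable D : satake_data.
Notation I := (idx D).

Inductive uexp : Type :=
| UK of clat D                                              (* q^h *)
| UE of I
| UF of I
| UC of Qq
| UAdd of uexp & uexp
| UMul of uexp & uexp.

Definition usub (x y : uexp) : uexp := UAdd x (UMul (UC (-1)) y).
Definition upow (x : uexp) (n : nat) : uexp := iter n (UMul x) (UC 1).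

Definition qi (i : I) : Qq := qq ^+ dd i.
Definition qint (i : I) (n : nat) : Qq :=
  (qi i ^+ n - qi i ^- n) / (qi i - (qi i)^-1).
Definition qfact (i : I) (n : nat) : Qq := \prod_(m < n) qint i m.+1.
Definition qbin (i : I) (n r : nat) : Qq :=
  qfact i n / (qfact i r * qfact i (n - r)).

(* k_i and its inverse *)
Definition kel (i : I) : uexp := UK (scoroot i *+ dd i).
Definition kinv (i : I) : uexp := UK (- (scoroot i *+ dd i)).

Definition serre (x : I -> uexp) (i j : I) : uexp :=
  let n := `|cartan i j|%N.+1 in
  \big[UAdd/UC 0]_(r < n.+1)
    UMul (UC ((-1) ^+ r * qbin i n r))
      (UMul (upow (x i) (n - r)) (UMul (x j) (upow (x i) r))).

Inductive ueq : uexp -> uexp -> Prop :=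
| ueq_refl x : ueq x x
| ueq_sym x y : ueq x y -> ueq y x
| ueq_trans x y z : ueq x y -> ueq y z -> ueq x z
| ueq_add x x' y y' : ueq x x' -> ueq y y' -> ueq (UAdd x y) (UAdd x' y')
| ueq_mul x x' y y' : ueq x x' -> ueq y y' -> ueq (UMul x y) (UMul x' y')
| ueq_addA x y z : ueq (UAdd x (UAdd y z)) (UAdd (UAdd x y) z)
| ueq_addC x y : ueq (UAdd x y) (UAdd y x)
| ueq_add0 x : ueq (UAdd (UC 0) x) x
| ueq_mulA x y z : ueq (UMul x (UMul y z)) (UMul (UMul x y) z)
| ueq_mul1l x : ueq (UMul (UC 1) x) x
| ueq_mulDl x y z : ueq (UMul (UAdd x y) z) (UAdd (UMul x z) (UMul y z))
| ueq_mulDr x y z : ueq (UMul z (UAdd x y)) (UAdd (UMul z x) (UMul z y))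
| ueq_mul0 x : ueq (UMul (UC 0) x) (UC 0)
| ueq_CD c d : ueq (UC (c + d)) (UAdd (UC c) (UC d))
| ueq_CM c d : ueq (UC (c * d)) (UMul (UC c) (UC d))
| ueq_Ccomm c x : ueq (UMul (UC c) x) (UMul x (UC c))
| ueq_K0 : ueq (UK 0) (UC 1)
| ueq_KD h h' : ueq (UK (h + h')) (UMul (UK h) (UK h'))
| ueq_KE h i : ueq (UMul (UK h) (UE i))
    (UMul (UC (qq ^ ev h (sroot i))) (UMul (UE i) (UK h)))
| ueq_KF h i : ueq (UMul (UK h) (UF i))
    (UMul (UC (qq ^ (- ev h (sroot i)))) (UMul (UF i) (UK h)))
| ueq_EF i j : ueq (usub (UMul (UE i) (UF j)) (UMul (UF j) (UE i)))
    (if i == j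
     then UMul (UC (qi i - (qi i)^-1)^-1) (usub (kel i) (kinv i)) else UC 0)
| ueq_serreE i j : i != j -> ueq (serre UE i j) (UC 0)
| ueq_serreF i j : i != j -> ueq (serre UF i j) (UC 0).

HB.instance Definition _ := gen_eqMixin uexp.
HB.instance Definition _ := gen_choiceMixin uexp.

Definition ueqb (x y : uexp) : bool := `[< ueq x y >].

Lemma ueqb_equiv : equiv_class_of ueqb.
Proof.
split=> [x|x y|y x z].
- exact/asboolP/ueq_refl.
- by apply/asboolP/asboolP => /ueq_sym.
- by move=> /asboolP h1 /asboolP h2; apply/asboolP/(ueq_trans h1 h2).
Qed.
Canonical ueqb_equivRel := EquivRelPack ueqb_equiv.
Canonical ueqb_encModRel := defaultEncModRel ueqb.

Definition Uq : Type := {eq_quot ueqb}.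
HB.instance Definition _ := Choice.on Uq.
HB.instance Definition _ : EqQuotient uexp ueqb Uq := EqQuotient.on Uq.

Definition ucls (x : uexp) : Uq := \pi_Uq x.

Lemma uclsP x y : ueq x y -> ucls x = ucls y.
Proof. by move=> h; apply/eqmodP/asboolP. Qed.

Lemma ucls_eq x y : ucls x = ucls y -> ueq x y.
Proof. by move=> /eqmodP/asboolP. Qed.

Lemma ucls_ind (Q : Uq -> Prop) : (forall x, Q (ucls x)) -> forall x, Q x.
Proof. by move=> h x; rewrite -(reprK x). Qed.

Definition uadd (x y : Uq) : Uq := ucls (UAdd (repr x) (repr y)).
Definition umul (x y : Uq) : Uq := ucls (UMul (repr x) (repr y)).
Definition uscal (c : Qq) : Uq := ucls (UC c).
Definition uopp (x : Uq) : Uq := umul (uscal (-1)) x.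

Lemma ueq_repr x : ueq (repr (ucls x)) x.
Proof. by apply: ucls_eq; rewrite /ucls reprK. Qed.

Lemma uaddE x y : uadd (ucls x) (ucls y) = ucls (UAdd x y).
Proof. by apply/uclsP/ueq_add; apply: ueq_repr. Qed.

Lemma umulE x y : umul (ucls x) (ucls y) = ucls (UMul x y).
Proof. by apply/uclsP/ueq_mul; apply: ueq_repr. Qed.

Lemma uaddA : associative uadd.
Proof.
elim/ucls_ind=> x; elim/ucls_ind=> y; elim/ucls_ind=> z.
by rewrite !uaddE; apply/uclsP/ueq_addA.
Qed.

Lemma uaddC : commutative uadd.
Proof.
elim/ucls_ind=> x; elim/ucls_ind=> y.
by rewrite !uaddE; apply/uclsP/ueq_addC.
Qed.

Lemma uadd0 : left_id (uscal 0) uadd.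
Proof. by elim/ucls_ind=> x; rewrite uaddE; apply/uclsP/ueq_add0. Qed.

Lemma umulA : associative umul.
Proof.
elim/ucls_ind=> x; elim/ucls_ind=> y; elim/ucls_ind=> z.
by rewrite !umulE; apply/uclsP/ueq_mulA.
Qed.

Lemma umul1l : left_id (uscal 1) umul.
Proof. by elim/ucls_ind=> x; rewrite umulE; apply/uclsP/ueq_mul1l. Qed.

Lemma umulC1 c x : umul (uscal c) x = umul x (uscal c).
Proof. by elim/ucls_ind: x => x; rewrite !umulE; apply/uclsP/ueq_Ccomm. Qed.

Lemma umul1r : right_id (uscal 1) umul.
Proof. by move=> x; rewrite -umulC1 umul1l. Qed.

Lemma umulDl : left_distributive umul uadd.
Proof.
elim/ucls_ind=> x; elim/ucls_ind=> y; elim/ucls_ind=> z.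
by rewrite !(uaddE, umulE); apply/uclsP/ueq_mulDl.
Qed.

Lemma umulDr : right_distributive umul uadd.
Proof.
elim/ucls_ind=> z; elim/ucls_ind=> x; elim/ucls_ind=> y.
by rewrite !(uaddE, umulE); apply/uclsP/ueq_mulDr.
Qed.

Lemma uscalD c d : uscal (c + d) = uadd (uscal c) (uscal d).
Proof. by rewrite uaddE; apply/uclsP/ueq_CD. Qed.

Lemma uaddN : left_inverse (uscal 0) uopp uadd.
Proof.
move=> x; rewrite /uopp -{2}[x]umul1l -umulDl -uscalD addNr.
by elim/ucls_ind: x => x; rewrite umulE; apply/uclsP/ueq_mul0.
Qed.

HB.instance Definition _ := GRing.isZmodule.Build Uq uaddA uaddC uadd0 uaddN.
HB.instance Definition _ := GRing.Zmodule_isPzRing.Build Uq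
  umulA umul1l umul1r umulDl umulDr.
End QuantumGroup.

Arguments UC {D}.

Section IQuantumGroup.
Variable D : satake_data.
Notation I := (idx D).
Notation U := (Uq D).
Notation X := (wlat D).
Notation wt := (iw_lattice D).
Implicit Types (i j : I) (x y : X) (l : wt) (u : U).

(* b_i = f_i + q_i^(vsig_i) e_{tau i} k_i^{-1} *)
Definition bgen i : U :=
  ucls (UAdd (UF i) (UMul (UC (qi i ^ vsig i)) (UMul (UE (tau i)) (kinv i)))).

Definition bword (w : seq I) : U := \prod_(i <- w) bgen i.

(* the subalgebra U^iota of U *)
Inductive in_Ui : U -> Prop :=
| Ui_K (h : clat D) : h + tauY h = 0 -> in_Ui (ucls (UK h))
| Ui_b i : in_Ui (bgen i)
| Ui_C c : in_Ui (uscal D c)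
| Ui_add u u' : in_Ui u -> in_Ui u' -> in_Ui (u + u')
| Ui_mul u u' : in_Ui u -> in_Ui u' -> in_Ui (u * u').

(* 1_x Udot 1_y is the quotient of U by the sum of the (q^h - q^{h(x)}) U and
   the U (q^h - q^{h(y)}). *)
Definition block_gen x y (z : U) : Prop :=
  exists (h : clat D) (u : U),
    z = (ucls (UK h) - uscal D (qq ^ ev h x)) * u \/
    z = u * (ucls (UK h) - uscal D (qq ^ ev h y)).

Definition block x y : zmodType := zquot (block_gen x y).

(* The product of 1_x Udot 1_z and 1_z Udot 1_y is induced by that of U on
   representatives of weights x - z and z - y (for other representatives the
   product in U is not well defined modulo [block_gen x y]). *)
Definition has_weight x u : Prop :=
  forall h : clat D, ucls (UK h) * u = uscal D (qq ^ ev h x) * u * ucls (UK h).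

Definition block_lift x y (m : block x y) : U :=
  xget 0 [set u | has_weight (x - y) u /\ zpi (block_gen x y) u = m]%classic.

(* Families of elements of the 1_x Udot 1_y.  The modified form of U^iota lies
   among the row- and column-finite ones, for which [mmul] is the matrix
   product; the sum in it is over the finitely many nonzero terms. *)
Definition matrix_U : Type := forall x y : X, block x y.

Definition m0 : matrix_U := fun x y => 0.
Definition madd (M N : matrix_U) : matrix_U := fun x y => M x y + N x y.
Definition mscale (c : Qq) (M : matrix_U) : matrix_U :=
  fun x y => zpi _ (uscal D c * zrepr (M x y)).
Definition mmul (M N : matrix_U) : matrix_U :=
  fun x y => \sum_(z \in [set: X]%classic)
    (zpi _ (block_lift (M x z) * block_lift (N z y)) : block x y).

(* u 1_l *)
Definition m_right u l : matrix_U :=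
  fun x y => if iw y == l then zpi _ u else 0.
(* 1_l' u 1_l *)
Definition m_both l' u l : matrix_U :=
  fun x y => if (iw x == l') && (iw y == l) then zpi _ u else 0.

(* the modified form of U^iota *)
Inductive in_Uidot : matrix_U -> Prop :=
| Uidot_0 : in_Uidot m0
| Uidot_add M N : in_Uidot M -> in_Uidot N -> in_Uidot (madd M N)
| Uidot_gen l l' u : in_Ui u -> in_Uidot (m_both l u l').

(* the automorphism q |-> q^{-1} of Q(q) *)
Definition eval_inv (p : {poly rat}) : Qq :=
  (map_poly (fun c : rat => FracField.tofrac c%:P) p).[qq^-1].
Definition qbar (c : Qq) : Qq :=
  eval_inv \n_(repr c) / eval_inv \d_(repr c).

Record bar_involution (psi : matrix_U -> matrix_U) : Prop := BarInvolution {
  bar_in : forall M, in_Uidot M -> in_Uidot (psi M);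
  bar_add : forall M N, in_Uidot M -> in_Uidot N ->
    psi (madd M N) = madd (psi M) (psi N);
  bar_scale : forall c M, in_Uidot M -> psi (mscale c M) = mscale (qbar c) (psi M);
  bar_mul : forall M N, in_Uidot M -> in_Uidot N ->
    psi (mmul M N) = mmul (psi M) (psi N);
  bar_one : forall l, psi (m_right 1 l) = m_right 1 l;
  barK : forall M, in_Uidot M -> psi (psi M) = M;
  bar_b : forall i l, psi (m_right (bgen i) l) = m_right (bgen i) l
}.

(* the linear anti-involution rho *)
Fixpoint rho_exp (a : uexp D) : uexp D :=
  match a with
  | UK h => UK h
  | UE i => UMul (UC (qi i)) (UMul (kel i) (UF i))
  | UF i => UMul (UC (qi i)^-1) (UMul (UE i) (kinv i))
  | UC c => UC c
  | UAdd a b => UAdd (rho_exp a) (rho_exp b)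
  | UMul a b => UMul (rho_exp b) (rho_exp a)
  end.
Definition rho (u : U) : U := ucls (rho_exp (repr u)).

(* L(x), with its highest weight vector and its form *)
Record hw_data := HwData {
  hw_mod : lmodType U;
  hw_vec : hw_mod;
  hw_form : hw_mod -> hw_mod -> Qq
}.

Record is_hw_module (x : X) (L : hw_data) : Prop := IsHwModule {
  hw_nz : hw_vec L != 0;
  hw_E : forall i, ucls (UE i) *: hw_vec L = 0;
  hw_K : forall h : clat D,
    ucls (UK h) *: hw_vec L = uscal D (qq ^ ev h x) *: hw_vec L;
  hw_simple : forall v w : hw_mod L, v != 0 -> exists u : U, w = u *: v;
  hw_sym : forall v w, @hw_form L v w = @hw_form L w v;
  hw_lin : forall (c : Qq) v v' w,
    @hw_form L (uscal D c *: v + v') w = c * @hw_form L v w + @hw_form L v' w;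
  hw_one : @hw_form L (hw_vec L) (hw_vec L) = 1;
  hw_rho : forall (u : U) v w, @hw_form L (u *: v) w = @hw_form L v (rho u *: w)
}.
End IQuantumGroup.

(* An element of Q((q^{-1})) is given by its coefficients, that of q^n being
   [s n]; they vanish for n large. *)
Definition laurent : Type := int -> rat.

Definition is_laurent (s : laurent) : Prop :=
  exists N : int, forall n, N < n -> s n = 0.

Definition laurent_poly (p : {poly rat}) : laurent :=
  fun n => if n is Posz m then p`_m else 0.

Definition pmul (p : {poly rat}) (s : laurent) : laurent :=
  fun n => \sum_(m < size p) p`_m * s (n - m%:Z).

(* [s] is the expansion of [f : Q(q)] in Q((q^{-1})) *)
Definition expands (f : Qq) (s : laurent) : Prop :=
  is_laurent s /\
  forall a b : {poly rat}, b != 0 ->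
    f = FracField.tofrac a / FracField.tofrac b ->
    pmul b s = laurent_poly a.

Section Form.
Variable D : satake_data.
Notation I := (idx D).
Notation U := (Uq D).
Notation X := (wlat D).
Notation wt := (iw_lattice D).

(* x is a dominant pre-image of l with h_i(x) >= M for all i in F *)
Definition deep (l : wt) (F : seq I) (M : int) (x : X) : Prop :=
  [/\ iw x = l, dominant x & forall i, i \in F -> M <= ev (scoroot i) x].

(* The limit of f in Q((q^{-1})), as x runs over pre-images of l with
   h_i(x) -> oo for all i, is s. *)
Definition has_limit (l : wt) (f : X -> Qq) (s : laurent) : Prop :=
  [/\ is_laurent s,
      forall F M, exists x, deep l F M x
    & forall N : int, exists F M, forall x, deep l F M x ->
        exists t, expands (f x) t /\ forall n, N <= n -> t n = s n].

Record iform_axioms (L : X -> hw_data D)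
    (B : matrix_U D -> matrix_U D -> laurent) : Prop := IformAxioms {
  if_laurent : forall M N, in_Uidot M -> in_Uidot N -> is_laurent (B M N);
  if_sym : forall M N, in_Uidot M -> in_Uidot N -> B M N = B N M;
  if_add : forall M M' N, in_Uidot M -> in_Uidot M' -> in_Uidot N ->
    forall n, B (madd M M') N n = B M N n + B M' N n;
  (* homogeneity for the scalar a/b *)
  if_scale : forall (a b : {poly rat}) M N, b != 0 -> in_Uidot M -> in_Uidot N ->
    pmul b (B (mscale (FracField.tofrac a / FracField.tofrac b) M) N)
      = pmul a (B M N);
  if_orth : forall (u u' : U) (l l' : wt), in_Ui u -> in_Ui u' -> l != l' ->
    forall n, B (m_right u l) (m_right u' l') n = 0;
  if_lim : forall (u u' : U) (l : wt), in_Ui u -> in_Ui u' ->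
    has_limit l
      (fun x => @hw_form D (L x) (u *: hw_vec (L x)) (u' *: hw_vec (L x)))
      (B (m_right u l) (m_right u' l))
}.
End Form.

(* Main.v *)
Require Import Defs.
From HB Require Import structures.
From mathcomp Require Import all_boot all_order all_algebra.
From mathcomp Require Import generic_quotient ring_quotient fraction polyXY.
From mathcomp Require Import finmap multiset boolp classical_sets fsbigop zify ring.
From Stdlib Require Import Relation_Operators.


(** The form counts dotted matchings, and so does the graded rank.

    On the side of the quantum group, the adjoint of [b_i] for the form on a highest
    weight module is [b_{tau i}] times a power of q and a torus element, so that
    the pairing of two words is, up to a power of q, the coefficient of the highest
    weight vector in one longer word applied to it ([form_words]).  Expanding that
    word one letter at a time, each letter either creates an f or removes an earlier
    one, with a quantum integer as coefficient ([wexpsP]); this is Wick's formula, a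
    sum over matchings of the letters.  A quantum integer [n] is a sum of n powers of
    q with exponents in arithmetic progression, and n tends to infinity with the
    weight: in the limit it becomes a geometric series, which counts the dots on a
    string.  Hence the pairing is the sum over matchings of q to minus the degree of
    the matching times one geometric series per string ([wick_count], [form_count]).
    The words are fixed by the bar involution ([bar_bword]), so it plays no further
    part.

    On the categorical side, non-degeneracy gives a basis indexed by a reduced shape
    for each matching and a number of dots on each string.  The relations are
    homogeneous, so each basis element has a degree ([names_degree]), and that degree
    is seen to depend on the matching only: reading a reduced shape layer by layer,
    a cap, a crossing or a cup changes the degree attached to the matching of its
    endpoints ([match_deg]) by its own degree ([match_deg_cap], [match_deg_cross],
    [match_deg_cup]).  To handle shapes, the strings are given names, and a shape
    becomes a list of names at each height; two strings cross at most once, hence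
    they cross exactly when their ends alternate ([names_inv]).  Conversely each
    matching is realized by a reduced shape ([realizes_all]).  The two sides are then
    indexed by the same matchings, with the same degrees ([graded_rank_hom]).

    Finally the graded rank does not depend on the homogeneous basis
    ([graded_rank_uniq]): the ring of endomorphisms of the unit is nonnegatively graded
    with the ground ring in degree 0, so a change of basis is block triangular for
    the degree and its diagonal blocks are invertible. *)

Set Implicit Arguments.
Unset Strict Implicit.
Unset Printing Implicit Defensive.

Import Order.TTheory GRing.Theory Num.Theory.
Local Open Scope ring_scope.

(** * Quotients by a subgroup *)

Section ZQuot.
Variables (V : zmodType) (G : V -> Prop).

Lemma zpiD x y : zpi G (x + y) = zpi G x + zpi G y.
Proof. by rewrite /zpi /zquot raddfD. Qed.

Lemma zpiB x y : zpi G (x - y) = zpi G x - zpi G y.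
Proof. by rewrite /zpi /zquot raddfB. Qed.

Lemma zpi0 : zpi G 0 = 0.
Proof. by rewrite /zpi /zquot raddf0. Qed.

Lemma zreprK x : zpi G (zrepr x) = x.
Proof. by rewrite /zpi /zrepr reprK. Qed.

Lemma zpi_eqP x y : zpi G x = zpi G y <-> zspan G (x - y).
Proof.
have e : (x - y \in zspan_zmod G) = (zpi G x == zpi G y).
  exact: Quotient.idealrBE.
split=> [/eqP|] h; first by move: h; rewrite -e => /asboolP.
by apply/eqP; rewrite -e; apply/asboolP.
Qed.

Lemma zspanN x : zspan G x -> zspan G (- x).
Proof. by move=> h; rewrite -[- x]add0r; apply: zspanB => //; apply: zspan0. Qed.

Lemma zspanD x y : zspan G x -> zspan G y -> zspan G (x + y).
Proof. by move=> h1 h2; rewrite -[y]opprK; apply: zspanB => //; apply: zspanN. Qed.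

End ZQuot.

(** * Weights *)

Section Satake.
Variables (D : satake_data) (hD : satake_axioms D).
Notation I := (idx D).
Notation X := (wlat D).
Notation wt := (iw_lattice D).
Implicit Types (i j : I) (x y : X) (l : wt).

Lemma ev0r (h : clat D) : ev h 0 = 0.
Proof. by apply: (addrI (ev h 0)); rewrite -(sat_evDr hD) !addr0. Qed.

Lemma evNr (h : clat D) x : ev h (- x) = - ev h x.
Proof. by apply: (addrI (ev h x)); rewrite -(sat_evDr hD) !subrr ev0r. Qed.

Lemma evBr (h : clat D) x y : ev h (x - y) = ev h x - ev h y.
Proof. by rewrite (sat_evDr hD) evNr. Qed.

Lemma ev0l x : ev (0 : clat D) x = 0.
Proof. by apply: (addrI (ev 0 x)); rewrite -(sat_evDl hD) !addr0. Qed.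

Lemma evNl (h : clat D) x : ev (- h) x = - ev h x.
Proof. by apply: (addrI (ev h x)); rewrite -(sat_evDl hD) !subrr ev0l. Qed.

Lemma evBl (h h' : clat D) x : ev (h - h') x = ev h x - ev h' x.
Proof. by rewrite (sat_evDl hD) evNl. Qed.

Lemma evMl (h : clat D) n x : ev (h *+ n) x = ev h x *+ n.
Proof. by elim: n => [|n IH]; rewrite ?mulr0n ?ev0l // !mulrS (sat_evDl hD) IH. Qed.

Lemma tau_tau i : tau (tau i) = i. Proof. exact: (sat_tauK hD). Qed.

Lemma tauX0 : tauX (0 : X) = 0.
Proof. by apply: (addrI (tauX 0)); rewrite -(sat_tauX_add hD) !addr0. Qed.

Lemma iwD x y : iw (x + y) = iw x + iw y.
Proof. exact: zpiD. Qed.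

Lemma iwB x y : iw (x - y) = iw x - iw y.
Proof. exact: zpiB. Qed.

Lemma iw0 : iw (0 : X) = 0.
Proof. exact: zpi0. Qed.

Lemma iw_liftK l : iw (iw_lift l) = l.
Proof. exact: zreprK. Qed.

(** [lambda_i] does not depend on the pre-image because [h_i - h_{tau i}]
   vanishes on the image of [id + tau]. *)
Lemma iwc_iw i x : iwc i (iw x) = ev (scoroot i) x - ev (scoroot (tau i)) x.
Proof.
rewrite -evBl.
have /zpi_eqP h : iw (iw_lift (iw x)) = iw x by rewrite iw_liftK.
apply/eqP; rewrite /iwc -subr_eq0 -evBr; apply/eqP.
elim: h => [|a b _ ha _ hb|a [t ->]]; first exact: ev0r.
- by rewrite evBr ha hb subrr.
- rewrite (sat_evDr hD) !evBl -!(sat_tau_ev hD) !(sat_tau_coroot hD) tau_tau.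
  by rewrite addrC subrKA subrr.
Qed.

Lemma iwcD i l l' : iwc i (l + l') = iwc i l + iwc i l'.
Proof.
rewrite -(iw_liftK l) -(iw_liftK l') -iwD !iwc_iw !(sat_evDr hD).
by rewrite opprD addrACA.
Qed.

Lemma iwc0 i : iwc i 0 = 0.
Proof. by rewrite -iw0 iwc_iw !ev0r subrr. Qed.

Lemma iwcN i l : iwc i (- l) = - iwc i l.
Proof. by apply: (addrI (iwc i l)); rewrite -iwcD !subrr iwc0. Qed.

Lemma iwcB i l l' : iwc i (l - l') = iwc i l - iwc i l'.
Proof. by rewrite iwcD iwcN. Qed.

Lemma iwc_tau i l : iwc (tau i) l = - iwc i l.
Proof. by rewrite -(iw_liftK l) !iwc_iw tau_tau opprB. Qed.

Lemma iwc_fix i l : i = tau i -> iwc i l = 0.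
Proof. by move=> h; rewrite -(iw_liftK l) iwc_iw -h subrr. Qed.

Lemma iwc_root i j : iwc i (iw (sroot j)) = cartan i j - cartan (tau i) j.
Proof. by rewrite iwc_iw !(sat_ev hD). Qed.

Lemma wti_nil : wti ([::] : seq I) = 0.
Proof. by rewrite /wti big_nil iw0. Qed.

Lemma wti_cat u v : wti (u ++ v : seq I) = wti u + wti v.
Proof. by rewrite /wti big_cat iwD. Qed.

Lemma wti_cons i u : wti (i :: u : seq I) = iw (sroot i) + wti u.
Proof. by rewrite /wti big_cons iwD. Qed.

Lemma wti1 i : wti [:: i] = iw (sroot i).
Proof. by rewrite wti_cons wti_nil addr0. Qed.

Lemma iw_tau i : iw (sroot (tau i)) = - iw (sroot i).
Proof.
apply/eqP; rewrite -addr_eq0 -iwD; apply/eqP; rewrite -iw0; apply/zpi_eqP.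
by apply: zspan_gen; exists (sroot (tau i)); rewrite (sat_tau_root hD) tau_tau subr0.
Qed.

(** The symmetric form [(alpha_i, alpha_j)]. *)
Definition sip i j : int := (dd i)%:Z * cartan i j.

Lemma sipC i j : sip i j = sip j i.
Proof. exact: (sat_sym hD). Qed.

Lemma sip_tau i j : sip (tau i) (tau j) = sip i j.
Proof. by rewrite /sip (sat_tau_d hD) (sat_tau_cartan hD). Qed.

Lemma sip_taul i j : sip (tau i) j = sip i (tau j).
Proof. by rewrite -{1}(tau_tau j) sip_tau. Qed.

Lemma sipii i : sip i i = 2 * (dd i)%:Z.
Proof. by rewrite /sip (sat_diag hD) mulrC. Qed.

Lemma dd_iwc_root i j : (dd i)%:Z * iwc i (iw (sroot j)) = sip i j - sip (tau i) j.
Proof. by rewrite iwc_root mulrBr /sip (sat_tau_d hD). Qed.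

Lemma dd_vsig i : (dd i)%:Z * (vsig i + vsig (tau i)) = - sip i (tau i).
Proof. by rewrite (sat_vsig hD) mulrN. Qed.

End Satake.

(** * The algebra of 2-morphisms *)

Section HomAlgebra.
Variables (D : satake_data) (hD : satake_axioms D).
Variables (P : structure_consts D).
Notation I := (idx D).
Notation word := (seq I).
Notation wt := (iw_lattice D).
Notation k := (kk P).
Notation tm := (tm I k).
Implicit Types (i j : I) (l : wt) (u v w : word) (a b f g : tm) (c d : k).
Local Open Scope tm_scope.
Notation typed := (@typed D P).
Notation eq2 := (@eq2 D P).
Notation cls := (hom2_cls (P := P)).

Fixpoint src a : word := match a with
  | TId w => w | TDot i => [:: i] | TCap i => [:: tau i; i] | TCup i => [::]
  | TCross i j => [:: i; j] | TBub i n => [::] | TComp _ b => src b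
  | TTens a b => src a ++ src b | TZero v w => v | TAdd a _ => src a
  | TScale _ a => src a end.

Lemma typed_src l v w a : typed l v w a -> v = src a.
Proof. by elim=> //= {l v w a} l u u' v v' a b _ IHa _ IHb; congr cat. Qed.

Lemma eq2_typed l v w a b : eq2 l v w a b -> typed l v w a /\ typed l v w b.
Proof.
by elim=> {l v w a b} //= [l v w a b _ [? ?]|l v w a b f _ [? ?] _ [? ?]
  |l u v w a a' b b' _ [? ?] _ [? ?]|l u u' v v' a a' b b' _ [? ?] _ [? ?]
  |l v w a a' b b' _ [? ?] _ [? ?]|l v w c a a' _ [? ?]];
  split=> //; econstructor; eauto.
Qed.

Lemma clsE l v w a (ta : typed l v w a) : cls l v w a = hom2_of ta.
Proof.
rewrite /hom2_cls; case: pselect => [ta'|//]; exact/hom2_ofP/eq2_refl.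
Qed.

Lemma cls_eq l v w a b : eq2 l v w a b -> cls l v w a = cls l v w b.
Proof. by move=> h; have [ta tb] := eq2_typed h; rewrite (clsE ta) (clsE tb); apply: hom2_ofP. Qed.

Lemma cls_inj l v w a b : typed l v w a -> typed l v w b ->
  cls l v w a = cls l v w b -> eq2 l v w a b.
Proof. by move=> ta tb; rewrite (clsE ta) (clsE tb); apply: hom2_eq. Qed.

Lemma cls_rel l v w a b : typed l v w a -> typed l v w b -> rel2 l a b ->
  cls l v w a = cls l v w b.
Proof. by move=> ta tb r; apply/cls_eq/eq2_rel. Qed.

Lemma cls_repr l v w (x : hom2 P l v w) : cls l v w (sval (repr x)) = x.
Proof. by rewrite (clsE (svalP (repr x))) hom2_repr. Qed.

Lemma typed_repr l v w (x : hom2 P l v w) : typed l v w (sval (repr x)).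
Proof. exact: svalP. Qed.

Lemma cls_repr_eq2 l v w a : typed l v w a -> eq2 l v w (sval (repr (cls l v w a))) a.
Proof. by move=> ta; apply: cls_inj; rewrite ?cls_repr //; apply: svalP. Qed.

Lemma cls0 l v w v' w' : cls l v w (TZero v' w') = 0.
Proof.
rewrite /hom2_cls; case: pselect => // t.
inversion t; subst; exact/hom2_ofP/eq2_refl.
Qed.

Lemma clsD l v w a b : typed l v w a -> typed l v w b ->
  cls l v w (a ⊕ b) = cls l v w a + cls l v w b.
Proof.
move=> ta tb; rewrite (clsE ta) (clsE tb) (clsE (typed_add ta tb)).
exact/esym/hadd_of.
Qed.

Lemma clsZ l v w c a : cls l v w (c ⊙ a) = c *: cls l v w a.
Proof.
case: (pselect (typed l v w a)) => [ta|nta].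
  by rewrite (clsE ta) (clsE (typed_scale c ta)); apply/esym/hscale_of.
rewrite /hom2_cls; case: pselect => [t|_]; last by case: pselect => // _; rewrite scaler0.
by inversion t.
Qed.

Lemma vcomp_cls l u v w a b : typed l v w a -> typed l u v b ->
  vcomp (cls l v w a) (cls l u v b) = cls l u w (a ∘ b).
Proof.
move=> ta tb; rewrite (clsE (typed_comp ta tb)); apply: hom2_ofP.
by apply: eq2_comp; apply: cls_repr_eq2.
Qed.

Definition htens l u u' v v' (x : hom2 P (l - wti v) u u') (y : hom2 P l v v') :
  hom2 P l (u ++ v) (u' ++ v') :=
  hom2_of (typed_tens (svalP (repr x)) (svalP (repr y))).

Lemma htens_cls l u u' v v' a b : typed (l - wti v) u u' a -> typed l v v' b ->
  htens (cls (l - wti v) u u' a) (cls l v v' b) = cls l (u ++ v) (u' ++ v') (a ⊗ b).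
Proof.
move=> ta tb; rewrite (clsE (typed_tens ta tb)); apply: hom2_ofP.
by apply: eq2_tens; apply: cls_repr_eq2.
Qed.

Lemma cls_ind l v w (Q : hom2 P l v w -> Prop) :
  (forall a, typed l v w a -> Q (cls l v w a)) -> forall x, Q x.
Proof. by move=> h x; rewrite -(cls_repr x); apply/h/typed_repr. Qed.

Ltac ty := repeat first [eassumption | match goal with |- @Defs.typed _ _ _ _ _ _ => econstructor end].

Lemma vcompDl l u v w (x y : hom2 P l v w) (z : hom2 P l u v) :
  vcomp (x + y) z = vcomp x z + vcomp y z.
Proof.
elim/cls_ind: x => a ta; elim/cls_ind: y => b tb; elim/cls_ind: z => f tf.
rewrite -clsD // !vcomp_cls; ty.
rewrite -clsD; ty.
apply: cls_rel; ty; exact: rel_compDl.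
Qed.

Lemma vcompDr l u v w (x : hom2 P l v w) (y z : hom2 P l u v) :
  vcomp x (y + z) = vcomp x y + vcomp x z.
Proof.
elim/cls_ind: x => a ta; elim/cls_ind: y => b tb; elim/cls_ind: z => f tf.
rewrite -clsD // !vcomp_cls; ty.
rewrite -clsD; ty.
apply: cls_rel; ty; exact: rel_compDr.
Qed.

Lemma vcompZl l u v w c (x : hom2 P l v w) (y : hom2 P l u v) :
  vcomp (c *: x) y = c *: vcomp x y.
Proof.
elim/cls_ind: x => a ta; elim/cls_ind: y => b tb.
rewrite -clsZ !vcomp_cls -?clsZ; ty.
apply: cls_rel; ty; exact: rel_compZl.
Qed.

Lemma vcompZr l u v w c (x : hom2 P l v w) (y : hom2 P l u v) :
  vcomp x (c *: y) = c *: vcomp x y.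
Proof.
elim/cls_ind: x => a ta; elim/cls_ind: y => b tb.
rewrite -clsZ !vcomp_cls -?clsZ; ty.
apply: cls_rel; ty; exact: rel_compZr.
Qed.

Lemma htensDl l u u' v v' (x y : hom2 P (l - wti v) u u') (z : hom2 P l v v') :
  htens (x + y) z = htens x z + htens y z.
Proof.
elim/cls_ind: x => a ta; elim/cls_ind: y => b tb; elim/cls_ind: z => f tf.
rewrite -clsD // !htens_cls; ty.
rewrite -clsD; ty.
apply: cls_rel; ty; exact: rel_tensDl.
Qed.

Lemma htensDr l u u' v v' (x : hom2 P (l - wti v) u u') (y z : hom2 P l v v') :
  htens x (y + z) = htens x y + htens x z.
Proof.
elim/cls_ind: x => a ta; elim/cls_ind: y => b tb; elim/cls_ind: z => f tf.
rewrite -clsD // !htens_cls; ty.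
rewrite -clsD; ty.
apply: cls_rel; ty; exact: rel_tensDr.
Qed.

Lemma htensZl l u u' v v' c (x : hom2 P (l - wti v) u u') (y : hom2 P l v v') :
  htens (c *: x) y = c *: htens x y.
Proof.
elim/cls_ind: x => a ta; elim/cls_ind: y => b tb.
rewrite -clsZ !htens_cls -?clsZ; ty.
apply: cls_rel; ty; exact: rel_tensZl.
Qed.

Lemma htensZr l u u' v v' c (x : hom2 P (l - wti v) u u') (y : hom2 P l v v') :
  htens x (c *: y) = c *: htens x y.
Proof.
elim/cls_ind: x => a ta; elim/cls_ind: y => b tb.
rewrite -clsZ !htens_cls -?clsZ; ty.
apply: cls_rel; ty; exact: rel_tensZr.
Qed.

Lemma vcomp0l l u v w (z : hom2 P l u v) : vcomp (0 : hom2 P l v w) z = 0.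
Proof. by rewrite -(scale0r 0) vcompZl scale0r. Qed.

Lemma vcomp0r l u v w (z : hom2 P l v w) : vcomp z (0 : hom2 P l u v) = 0.
Proof. by rewrite -(scale0r 0) vcompZr scale0r. Qed.

Lemma htens0l l u u' v v' (z : hom2 P l v v') :
  htens (0 : hom2 P (l - wti v) u u') z = 0.
Proof. by rewrite -(scale0r 0) htensZl scale0r. Qed.

Lemma htens0r l u u' v v' (z : hom2 P (l - wti v) u u') :
  htens z (0 : hom2 P l v v') = 0.
Proof. by rewrite -(scale0r 0) htensZr scale0r. Qed.

(** Every generating 2-morphism preserves the weight and the parity of the
    length of a word, so only zero maps between words differing in either. *)
Lemma typed_mismatch l v w a : typed l v w a ->
  (wti v != wti w) || (odd (size v) != odd (size w)) -> cls l v w a = 0.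
Proof.
pose m v w := (wti v != wti w) || (odd (size v) != odd (size w)).
have mm v' w' u' : m v' w' -> m v' u' || m u' w'.
  rewrite /m; case: (eqVneq (wti v') (wti u')) => [->|//] /=.
  case: (eqVneq (wti u') (wti w')) => [_|] /=; last by rewrite orbT.
  by do 3! case: (odd _).
rewrite -/(m v w); elim=> {l v w a}.
- by move=> l w; rewrite /m !eqxx.
- by move=> l i; rewrite /m !eqxx.
- by move=> l i; rewrite /m wti_cons wti1 (iw_tau hD) addNr wti_nil !eqxx.
- by move=> l i; rewrite /m wti_cons wti1 (iw_tau hD) addNr wti_nil !eqxx.
- by move=> l i j; rewrite /m !wti_cons addrCA !eqxx.
- by move=> l i n; rewrite /m !eqxx.
- move=> l u v w a b ta IHa tb IHb /(mm _ _ v) /orP[h|h]; rewrite -(vcomp_cls ta tb).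
    by rewrite IHb // vcomp0r.
  by rewrite IHa // vcomp0l.
- move=> l u u' v v' a b ta IHa tb IHb h; rewrite -(htens_cls ta tb).
  have /orP[h'|h'] : m u u' || m v v'.
    move: h; rewrite /m !wti_cat !size_cat !oddD.
    case: (eqVneq (wti u) (wti u')) => [->|] //=.
    case: (eqVneq (wti v) (wti v')) => [->|] /=; last by rewrite !orbT.
    by rewrite eqxx; do 4! case: (odd _).
  by rewrite IHa // htens0l.
  by rewrite IHb // htens0r.
- by move=> l v w _; rewrite cls0.
- by move=> l v w a b ta IHa tb IHb h; rewrite clsD // IHa // IHb // addr0.
- by move=> l v w c a ta IHa h; rewrite clsZ IHa // scaler0.
Qed.

End HomAlgebra.

(** * Homogeneous components *)

Section Ground.
Variables (D : satake_data) (P : structure_consts D) (hk : graded_ground P).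
Notation k := (kk P).

Definition kdec (c : k) : seq k := sval (cid (kgr_span hk c)).

Lemma kdec_gr c n : kgr n (kdec c)`_n.
Proof. by rewrite /kdec; case: cid => s /= []. Qed.

Lemma kdec_sum c : c = \sum_(n < size (kdec c)) (kdec c)`_n.
Proof. by rewrite /kdec; case: cid => s /= []. Qed.

Lemma kgrN n (c : k) : kgr n c -> kgr n (- c).
Proof. by move=> h; rewrite -[- c]sub0r; apply: kgrB => //; apply: kgr0. Qed.

Lemma kgrD n (c d : k) : kgr n c -> kgr n d -> kgr n (c + d).
Proof. by move=> h1 h2; rewrite -[d]opprK; apply: kgrB => //; apply: kgrN. Qed.

Lemma kgr_nat n : kgr 0 (n%:R : k).
Proof.
elim: n => [|n IH]; first exact: kgr0.
by rewrite -addn1 natrD; apply: kgrD => //; apply: kgr1.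
Qed.

Lemma kgr_sign n : kgr 0 ((-1) ^+ n : k).
Proof.
elim: n => [|n IH]; first exact: kgr1.
by rewrite exprS mulN1r; apply: kgrN.
Qed.

Lemma kgr0M (c d : k) n : kgr 0 c -> kgr n d -> kgr n (c * d).
Proof. by move=> h1 h2; rewrite -[n]add0n; apply: kgrM. Qed.

Definition addv (V W : zmodType) (g : V -> W) := {morph g : x y / x + y}.

Lemma addv0 (V W : zmodType) (g : V -> W) : addv g -> g 0 = 0.
Proof. by move=> h; apply: (addrI (g 0)); rewrite -h !addr0. Qed.

Lemma addv_sum (V W : zmodType) (g : V -> W) (T : Type) (s : seq T) (Q : pred T) F :
  addv g -> g (\sum_(x <- s | Q x) F x) = \sum_(x <- s | Q x) g (F x).
Proof.
move=> h; elim: s => [|x s IH]; rewrite ?big_nil ?big_cons ?addv0 //.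
by case: (Q x) => //; rewrite h IH.
Qed.

(** A family of additive maps out of the graded pieces of the ground ring
    glues to a map out of the ground ring. *)
Definition kglue (V : zmodType) (g : nat -> k -> V) (c : k) : V :=
  \sum_(n < size (kdec c)) g n (kdec c)`_n.

Lemma kglue_seq (V : zmodType) (g : nat -> k -> V) (c : k) (s : seq k) :
  (forall n, addv (g n)) -> (forall n, kgr n s`_n) ->
  c = \sum_(n < size s) s`_n -> kglue g c = \sum_(n < size s) g n s`_n.
Proof.
move=> hg hs hc; set N := maxn (size s) (size (kdec c)).
have ext (W : zmodType) (f : nat -> k -> W) (t : seq k) : (size t <= N)%N ->
    (forall n, f n 0 = 0) -> \sum_(n < size t) f n t`_n = \sum_(n < N) f n t`_n.
  move=> le f0; rewrite (big_ord_widen N (fun n => f n t`_n) le) big_mkcond /=.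
  by apply: eq_bigr => n _; case: ltnP => // h; rewrite nth_default ?f0.
have g0 n : g n 0 = 0 by apply/addv0/hg.
rewrite /kglue !ext ?leq_max ?leqnn ?orbT //.
suff e n : s`_n = (kdec c)`_n by apply: eq_bigr => n _; rewrite e.
pose t := mkseq (fun n => s`_n - (kdec c)`_n) N.
have tE m : t`_m = s`_m - (kdec c)`_m.
  case: (ltnP m N) => h; first by rewrite nth_mkseq.
  rewrite !nth_default ?subr0 ?size_mkseq //; apply: leq_trans h;
    by rewrite leq_max leqnn ?orbT.
apply/eqP; rewrite -subr_eq0 -tE; apply/eqP; apply: (kgr_direct hk).
  by move=> m; rewrite tE; apply: kgrB => //; apply: kdec_gr.
rewrite size_mkseq (eq_bigr (fun m : 'I_N => s`_m - (kdec c)`_m)) => [|m _]; last exact: tE.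
rewrite sumrB -(ext _ (fun _ x => x) s) -?(ext _ (fun _ x => x) (kdec c)) //;
  by rewrite ?leq_max ?leqnn ?orbT // -kdec_sum -hc subrr.
Qed.

Lemma kglue_homog (V : zmodType) (g : nat -> k -> V) m c :
  (forall n, addv (g n)) -> kgr m c -> kglue g c = g m c.
Proof.
move=> hg hc; pose s := rcons (nseq m 0) c.
have sE n : s`_n = if n == m then c else 0.
  rewrite nth_rcons size_nseq nth_nseq; case: ltngtP => //.
rewrite (@kglue_seq _ _ _ s) => //.
- rewrite size_rcons size_nseq big_ord_recr /= sE eqxx big1 ?add0r // => n _.
  by rewrite sE ltn_eqF // addv0.
- by move=> n; rewrite sE; case: eqP => [->|_] //; apply: kgr0.
- rewrite size_rcons size_nseq big_ord_recr /= sE eqxx big1 ?add0r // => n _.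
  by rewrite sE ltn_eqF.
Qed.

Lemma kglue_ext (V : zmodType) (g g' : nat -> k -> V) c :
  (forall n x, g n x = g' n x) -> kglue g c = kglue g' c.
Proof. by move=> h; apply: eq_bigr. Qed.

Lemma kglueD (V : zmodType) (g : nat -> k -> V) c d :
  (forall n, addv (g n)) -> kglue g (c + d) = kglue g c + kglue g d.
Proof.
move=> hg; set N := maxn (size (kdec c)) (size (kdec d)).
have ext (W : zmodType) (f : nat -> k -> W) (t : seq k) : (size t <= N)%N ->
    (forall n, f n 0 = 0) -> \sum_(n < size t) f n t`_n = \sum_(n < N) f n t`_n.
  move=> le f0; rewrite (big_ord_widen N (fun n => f n t`_n) le) big_mkcond /=.
  by apply: eq_bigr => n _; case: ltnP => // h; rewrite nth_default ?f0.
have g0 n : g n 0 = 0 by apply/addv0/hg.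
pose t := mkseq (fun n => (kdec c)`_n + (kdec d)`_n) N.
have tE m : t`_m = (kdec c)`_m + (kdec d)`_m.
  case: (ltnP m N) => h; first by rewrite nth_mkseq.
  rewrite !nth_default ?addr0 ?size_mkseq //; apply: leq_trans h;
    by rewrite leq_max leqnn ?orbT.
rewrite (@kglue_seq _ _ _ t) //.
- rewrite size_mkseq /kglue !ext ?leq_max ?leqnn ?orbT // -big_split /=.
  by apply: eq_bigr => n _; rewrite tE hg.
- by move=> m; rewrite tE; apply: kgrD => //; apply: kdec_gr.
- rewrite size_mkseq {1}(kdec_sum c) {1}(kdec_sum d).
  rewrite !(ext _ (fun _ x => x)) ?leq_max ?leqnn ?orbT // -big_split /=.
  by apply: eq_bigr => n _; rewrite tE.
Qed.

Lemma addv_kglue (V : zmodType) (g : nat -> k -> V) :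
  (forall n, addv (g n)) -> addv (kglue g).
Proof. by move=> hg c d; apply: kglueD. Qed.

Lemma kglueM (V : zmodType) (g : nat -> k -> V) c d :
  (forall n, addv (g n)) ->
  kglue g (c * d) = kglue (fun p x => kglue (fun q y => g (p + q)%N (x * y)) d) c.
Proof.
move=> hg; rewrite {1}(kdec_sum c) mulr_suml addv_sum; last exact: addv_kglue.
apply: eq_bigr => p _; rewrite {1}(kdec_sum d) mulr_sumr addv_sum; last exact: addv_kglue.
by apply: eq_bigr => q _; apply: kglue_homog => //; apply: (kgrM hk); apply: kdec_gr.
Qed.

Lemma kglue_const (V : zmodType) (g : k -> V) c : addv g -> kglue (fun _ => g) c = g c.
Proof. by move=> hg; rewrite {2}(kdec_sum c) addv_sum. Qed.
End Ground.

HB.instance Definition _ (I k : Type) := gen_eqMixin (tm I k).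

Section Grading.
Variables (D : satake_data) (hD : satake_axioms D).
Variables (P : structure_consts D) (hP : const_axioms P).
Notation I := (idx D).
Notation word := (seq I).
Notation wt := (iw_lattice D).
Notation k := (kk P).
Notation tm := (tm I k).
Implicit Types (i j : I) (l : wt) (u v w : word) (a b f g : tm) (c d : k).
Local Open Scope tm_scope.
Notation typed := (@typed D P).
Notation eq2 := (@eq2 D P).
Notation cls := (hom2_cls (P := P)).
Notation hk := (ca_ground hP).
Notation kdec := (kdec hk).
Notation kglue := (kglue hk).

Fixpoint tgt a : word := match a with
  | TId w => w | TDot i => [:: i] | TCap i => [::] | TCup i => [:: tau i; i]
  | TCross i j => [:: j; i] | TBub i n => [::] | TComp a _ => tgt a
  | TTens a b => tgt a ++ tgt b | TZero _ w => w | TAdd a _ => tgt a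
  | TScale _ a => tgt a end.

Lemma typed_tgt l v w a : typed l v w a -> w = tgt a.
Proof. by elim=> //= {l v w a} l u u' v v' a b _ IHa _ IHb; congr cat. Qed.

Definition gen_deg l a : int := match a with
  | TDot i => (2 * dd i)%:Z
  | TCap i | TCup i => (dd i)%:Z * (1 + vsig i - iwc i l)
  | TCross i j => - ((dd i)%:Z * cartan i j)
  | TBub i n => (2 * dd i * n)%:Z
  | _ => 0 end.

(** The homogeneous terms, with their degrees, into which a term expands. *)
Fixpoint cmp l a : seq (int * tm) := match a with
  | TComp a b => [seq (x.1 + y.1, TComp x.2 y.2) | x <- cmp l a, y <- cmp l b]
  | TTens a b =>
      [seq (x.1 + y.1, TTens x.2 y.2) | x <- cmp (l - wti (src b)) a, y <- cmp l b]
  | TZero _ _ => [::]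
  | TAdd a b => cmp l a ++ cmp l b
  | TScale c a => [seq (n%:Z + x.1, TScale (kdec c)`_n x.2)
                  | n <- iota 0 (size (kdec c)), x <- cmp l a]
  | a => [:: (gen_deg l a, a)]
  end.

Lemma cmp_typed l v w a x : typed l v w a -> x \in cmp l a -> typed l v w x.2.
Proof.
move=> ta; elim: ta x => {l v w a} /=;
  try by move=> *; match goal with H : is_true (_ \in _) |- _ =>
    move: H; rewrite ?inE => // /eqP -> /=; constructor end.
- by move=> l u v w a b ta IHa tb IHb x /allpairsP[[y z] /= [hy hz ->]] /=;
    apply: typed_comp; eauto.
- move=> l u u' v v' a b ta IHa tb IHb x /allpairsP[[y z] /= [hy hz ->]] /=.
  by apply: typed_tens; [apply: IHa; rewrite (typed_src tb) | apply: IHb].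
- by move=> l v w a b ta IHa tb IHb x; rewrite mem_cat => /orP[/IHa|/IHb].
- by move=> l v w c a ta IHa x /allpairsP[[y z] /= [hy hz ->]] /=;
    apply: typed_scale; eauto.
Qed.

Definition tot l v w (V : zmodType) (F : int -> hom2 P l v w -> V) a : V :=
  \sum_(x <- cmp l a) F x.1 (cls l v w x.2).

Definition addf l v w (V : zmodType) (F : int -> hom2 P l v w -> V) :=
  forall p, addv (F p).

Lemma addv_tot l v w (W V : zmodType) (G : W -> int -> hom2 P l v w -> V) a :
  (forall p z, addv (fun x => G x p z)) -> addv (fun x => tot (G x) a).
Proof.
by move=> h x y; rewrite /tot -big_split; apply: eq_bigr => z _; rewrite h.
Qed.

Lemma tot_ext l v w (V : zmodType) (F G : int -> hom2 P l v w -> V) a :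
  (forall p x, F p x = G p x) -> tot F a = tot G a.
Proof. by move=> h; apply: eq_bigr. Qed.

Lemma tot_add l v w (V : zmodType) (F : int -> hom2 P l v w -> V) a b :
  tot F (a ⊕ b) = tot F a + tot F b.
Proof. by rewrite /tot big_cat. Qed.

Lemma tot_comp l u v w (V : zmodType) (F : int -> hom2 P l u w -> V) a b :
  typed l v w a -> typed l u v b ->
  tot F (a ∘ b) =
    tot (fun p (x : hom2 P l v w) =>
      tot (fun q (y : hom2 P l u v) => F (p + q) (vcomp x y)) b) a.
Proof.
move=> ta tb; rewrite /tot /= big_allpairs_dep /= big_seq [RHS]big_seq.
apply: eq_bigr => x hx; rewrite big_seq [RHS]big_seq; apply: eq_bigr => y hy /=.
by rewrite vcomp_cls //; [apply: cmp_typed ta _ | apply: cmp_typed tb _].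
Qed.

Lemma tot_tens l u u' v v' (V : zmodType)
    (F : int -> hom2 P l (u ++ v) (u' ++ v') -> V) a b :
  typed (l - wti v) u u' a -> typed l v v' b ->
  tot F (a ⊗ b) =
    tot (fun p (x : hom2 P (l - wti v) u u') =>
      tot (fun q (y : hom2 P l v v') => F (p + q) (htens x y)) b) a.
Proof.
move=> ta tb; rewrite /tot /= -(typed_src tb) big_allpairs_dep /= big_seq [RHS]big_seq.
apply: eq_bigr => x hx; rewrite big_seq [RHS]big_seq; apply: eq_bigr => y hy /=.
by rewrite htens_cls //; [apply: cmp_typed ta _ | apply: cmp_typed tb _].
Qed.

Lemma tot_scale l v w (V : zmodType) (F : int -> hom2 P l v w -> V) c a :
  tot F (c ⊙ a) =
    kglue (fun m c' => tot (fun p x => F (m%:Z + p) (c' *: x)) a) c.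
Proof.
rewrite /tot /= big_allpairs_dep /= /kglue -[in RHS](big_mkord predT (fun n =>
  \sum_(x <- cmp l a) F (n%:Z + x.1) ((kdec c)`_n *: cls l v w x.2))) /=.
rewrite /index_iota subn0; apply: eq_bigr => n _; apply: eq_bigr => x _ /=.
by rewrite clsZ.
Qed.

Lemma tot_atom l v w (V : zmodType) (F : int -> hom2 P l v w -> V) a (d : int) :
  cmp l a = [:: (d, a)] -> tot F a = F d (cls l v w a).
Proof. by rewrite /tot => ->; rewrite big_seq1. Qed.

Lemma addv_scale l v w (V : zmodType) (F : int -> hom2 P l v w -> V) a m :
  addf F -> addv (fun c' => tot (fun p x => F (m%:Z + p) (c' *: x)) a).
Proof. by move=> hF; apply: addv_tot => p z x y; rewrite scalerDl hF. Qed.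

(** A term is homogeneous of degree [n] when all of it sits in degree [n] after
    expansion; zero coefficients then do not matter. *)
Definition sdeg l v w (n : int) a : Prop := typed l v w a /\
  forall (V : zmodType) (F : int -> hom2 P l v w -> V), addf F ->
    tot F a = F n (cls l v w a).

Definition geq l v w a b : Prop := [/\ typed l v w a, typed l v w b &
  forall (V : zmodType) (F : int -> hom2 P l v w -> V), addf F -> tot F a = tot F b].

Lemma sdeg_geq l v w n a b :
  eq2 l v w a b -> sdeg l v w n a -> sdeg l v w n b -> geq l v w a b.
Proof.
move=> e [ta ha] [tb hb]; split=> // V F hF.
by rewrite ha // hb // (cls_eq e).
Qed.

Lemma sdeg_cast l v w n m a : sdeg l v w n a -> n = m -> sdeg l v w m a.
Proof. by move=> h <-. Qed.

Lemma sdeg_atom l v w a (d : int) : typed l v w a -> cmp l a = [:: (d, a)] -> sdeg l v w d a.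
Proof. by move=> ta e; split=> // V F hF; apply: tot_atom. Qed.

Lemma sdeg_id l w : sdeg l w w 0 (TId w).
Proof. by apply: sdeg_atom => //; constructor. Qed.

Lemma sdeg_dot l i : sdeg l [:: i] [:: i] (2 * dd i)%:Z (TDot i).
Proof. by apply: sdeg_atom => //; constructor. Qed.

Lemma sdeg_cap l i :
  sdeg l [:: tau i; i] [::] ((dd i)%:Z * (1 + vsig i - iwc i l)) (TCap i).
Proof. by apply: sdeg_atom => //; constructor. Qed.

Lemma sdeg_cup l i :
  sdeg l [::] [:: tau i; i] ((dd i)%:Z * (1 + vsig i - iwc i l)) (TCup i).
Proof. by apply: sdeg_atom => //; constructor. Qed.

Lemma sdeg_cross l i j :
  sdeg l [:: i; j] [:: j; i] (- ((dd i)%:Z * cartan i j)) (TCross i j).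
Proof. by apply: sdeg_atom => //; constructor. Qed.

Lemma sdeg_bub l i n : n%:Z <= vsig i - iwc i l ->
  sdeg l [::] [::] (2 * dd i * n)%:Z (TBub i n).
Proof. by move=> h; apply: sdeg_atom => //; constructor. Qed.

Lemma sdeg_zero l v w n : sdeg l v w n (TZero v w).
Proof.
split=> [|V F hF]; first by constructor.
by rewrite /tot big_nil cls0 addv0.
Qed.

Lemma sdeg_comp l u v w m n a b :
  sdeg l u v n b -> sdeg l v w m a -> sdeg l u w (m + n) (a ∘ b).
Proof.
move=> [tb hb] [ta ha]; split=> [|V F hF]; first exact: typed_comp ta tb.
rewrite (tot_comp _ ta tb) ha => [|p].
  rewrite hb => [|p x y]; last by rewrite vcompDr hF.
  by rewrite vcomp_cls.
by apply: addv_tot => q z x y; rewrite vcompDl hF.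
Qed.

Lemma sdeg_tens l u u' v v' U W m n a b :
  sdeg l v v' n b -> sdeg (l - wti v) u u' m a -> U = u ++ v -> W = u' ++ v' ->
  sdeg l U W (m + n) (a ⊗ b).
Proof.
move=> [tb hb] [ta ha] -> ->; split=> [|V F hF]; first exact: typed_tens ta tb.
rewrite (tot_tens _ ta tb) ha => [|p].
  rewrite hb => [|p x y]; last by rewrite htensDr hF.
  by rewrite htens_cls.
by apply: addv_tot => q z x y; rewrite htensDl hF.
Qed.

Lemma sdeg_add l v w n a b :
  sdeg l v w n a -> sdeg l v w n b -> sdeg l v w n (a ⊕ b).
Proof.
move=> [ta ha] [tb hb]; split=> [|V F hF]; first exact: typed_add ta tb.
by rewrite tot_add ha // hb // clsD // hF.
Qed.

Lemma sdeg_scale l v w m n c a :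
  kgr m c -> sdeg l v w n a -> sdeg l v w (m%:Z + n) (c ⊙ a).
Proof.
move=> hc [ta ha]; split=> [|V F hF]; first exact: typed_scale.
rewrite tot_scale (kglue_homog _ (m := m)) // => [|p]; last exact: addv_scale.
rewrite ha => [|p x y]; last by rewrite scalerDr hF.
by rewrite clsZ.
Qed.

Lemma sdeg_scale0 l v w n c a : kgr 0 c -> sdeg l v w n a -> sdeg l v w n (c ⊙ a).
Proof. by move=> hc ha; apply: sdeg_cast (sdeg_scale hc ha) _; rewrite add0r. Qed.

Lemma sdeg_0scale l v w n a : typed l v w a -> sdeg l v w n (0 ⊙ a).
Proof.
move=> ta; split=> [|V F hF]; first exact: typed_scale.
rewrite tot_scale (kglue_homog _ (m := 0)) //; first last.
- exact: (kgr0 hk).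
- by move=> p; apply: addv_scale.
rewrite clsZ scale0r addv0 // /tot big1 // => x _.
by rewrite scale0r addv0.
Qed.

Lemma hdeg_sdeg l v w n a : hdeg l v w n a -> sdeg l v w n a.
Proof.
elim=> {l v w n a}.
- exact: sdeg_id.
- exact: sdeg_dot.
- exact: sdeg_cap.
- exact: sdeg_cup.
- exact: sdeg_cross.
- by move=> l i n h; apply: sdeg_bub.
- by move=> l u v w m n a b _ ha _ hb; apply: sdeg_comp hb ha.
- by move=> l u u' v v' m n a b _ ha _ hb; apply: sdeg_tens hb ha _ _.
- exact: sdeg_zero.
- by move=> l v w n a b _ ha _ hb; apply: sdeg_add.
- by move=> l v w m n c a hc _ ha; apply: sdeg_scale.
Qed.

End Grading.

Section Homogeneous.
Variables (D : satake_data) (hD : satake_axioms D).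
Variables (P : structure_consts D) (hP : const_axioms P).
Notation I := (idx D).
Notation word := (seq I).
Notation wt := (iw_lattice D).
Notation k := (kk P).
Notation tm := (tm I k).
Implicit Types (i j : I) (l : wt) (u v w : word) (a b f g : tm) (c : k).
Local Open Scope tm_scope.
Notation typed := (@typed D P).
Notation eq2 := (@eq2 D P).
Notation cls := (hom2_cls (P := P)).
Notation hk := (ca_ground hP).
Notation sdeg := (sdeg hP).
Notation geq := (geq hP).
Notation "1_ i" := (TId [:: i]) (at level 8, i at level 2, format "1_ i") : tm_scope.

Lemma sdeg_dots l i n : sdeg l [:: i] [:: i] (2 * dd i * n)%:Z (dots P i n).
Proof.
elim: n => [|n IH]; first by rewrite muln0; apply: sdeg_id.
by apply: sdeg_cast (sdeg_comp IH (sdeg_dot _ _ _)) _; lia.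
Qed.

Lemma sdeg_tsum l v w (d : int) n (F : nat -> tm) :
  (forall r, sdeg l v w d (F r)) -> sdeg l v w d (tsum v w n F).
Proof.
move=> h; rewrite /tsum; apply: big_ind => //; first exact: sdeg_zero.
exact: sdeg_add.
Qed.

Lemma sdeg_tif l v w (d : int) (t : bool) a :
  (t -> sdeg l v w d a) -> sdeg l v w d (tif t v w a).
Proof. by case: t => [/(_ isT)//|_]; apply: sdeg_zero. Qed.

Lemma sdeg_coef l v w (d n : int) c a : sdeg l v w n a ->
  (c != 0 -> exists m, kgr m c /\ m%:Z + n = d) -> sdeg l v w d (c ⊙ a).
Proof.
move=> ha; case: (eqVneq c 0) => [-> _|_ /(_ isT) [m [hm <-]]].
  by apply: sdeg_0scale; case: ha.
exact: sdeg_scale.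
Qed.

Lemma sdeg_poly l j (d : int) (p : {poly k}) :
  (forall n, p`_n != 0 -> exists m, kgr m p`_n /\ m%:Z + (2 * dd j * n)%:Z = d) ->
  sdeg l [:: j] [:: j] d (poly_dots j p).
Proof.
move=> h; rewrite /poly_dots; apply: big_ind; first exact: sdeg_zero.
  exact: sdeg_add.
by move=> n _; apply: sdeg_coef (sdeg_dots _ _ _) (h n).
Qed.

Lemma sdeg_conv l v w (d A B m : int) (F : int -> int -> tm) :
  (forall r s, r + s = m -> sdeg l v w d (F r s)) ->
  sdeg l v w d (conv v w A B F m).
Proof. by move=> h; apply: sdeg_tsum => r; apply: h; lia. Qed.

Lemma kunit0 c : kunit c -> kgr 0 c. Proof. by case. Qed.
Lemma kunitV c : kunit c -> kgr 0 c^-1. Proof. by case. Qed.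

Lemma kgr_rr i j : kgr 0 (rr P i j).
Proof.
rewrite /rr; case: eqVneq => h; first exact: (kgr1 hk).
by apply: (kgr0M hk); [apply/kunit0/ca_c|apply/kunitV/ca_t].
Qed.

Lemma kgr_rrV i j : kgr 0 (rr P i j)^-1.
Proof.
rewrite /rr; case: eqVneq => h; first by rewrite invr1; exact: (kgr1 hk).
have [h1 h2 _] := ca_t hP h; have [h3 h4 _] := ca_c hP i (sroot j).
rewrite invrM ?unitrV // invrK.
by apply: (kgr0M hk) => //; apply/kunitV/ca_c.
Qed.

Lemma kgr_gam i l : kgr 0 (gam P i l).
Proof.
rewrite /gam; case: eqP => _; first exact: (kgr_sign hk).
exact/kunit0/ca_c.
Qed.

Lemma kgr_sgk m : kgr 0 (sgk P m). Proof. exact: (kgr_sign hk). Qed.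

Lemma kgr_half i : i = tau i -> kgr 0 (- (2%:R)^-1 : k).
Proof. by move=> h; rewrite -(ca_zeta_fix hP h); apply/kunit0/ca_zeta. Qed.

Lemma sdeg_scale0' l v w n c a : sdeg l v w n a -> kgr 0 c -> sdeg l v w n (c ⊙ a).
Proof. by move=> ha hc; apply: sdeg_scale0. Qed.

Lemma sdeg_tens' l u u' v v' m n a b :
  sdeg l v v' n b -> sdeg (l - wti v) u u' m a ->
  sdeg l (u ++ v) (u' ++ v') (m + n) (a ⊗ b).
Proof. by move=> hb ha; apply: sdeg_tens hb ha _ _. Qed.

Lemma sdeg_comp' l u v w m n a b :
  sdeg l u v n b -> sdeg l v w m a -> sdeg l u w (m + n) (a ∘ b).
Proof. exact: sdeg_comp. Qed.

Lemma sdeg_beta l i (m : int) :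
  sdeg l [::] [::] (2 * (dd i)%:Z * (vsig i - iwc i l - m)) (beta_coef P i l m).
Proof.
case: m => n /=.
  case: ifP => [/andP[_ h]|_]; last exact: sdeg_zero.
  apply: sdeg_cast (sdeg_bub _ _) _; lia.
apply: sdeg_add.
  have h0 : sdeg l [:: tau i; i] [:: tau i; i] (2 * dd i * n)%:Z (1_ (tau i) ⊗ dots P i n).
    by apply: sdeg_cast (sdeg_tens' (sdeg_dots l i n) (sdeg_id _ _ [:: tau i])) _; rewrite add0r.
  apply: sdeg_cast (sdeg_comp (sdeg_cup _ _ _) (sdeg_comp h0 (sdeg_cap _ _ _))) _.
  lia.
case: ifP => [/andP[/eqP h /eqP ->]|_]; last exact: sdeg_zero.
apply: sdeg_scale0; first exact: kgr_half h.
apply: sdeg_cast (sdeg_id _ _ _) _.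
by rewrite (iwc_fix hD _ h); move: (sat_vsig hD i); rewrite -h (sat_diag hD); lia.
Qed.

Lemma sdeg_beta_neg l i (m : int) :
  sdeg l [::] [::] (2 * (dd i)%:Z * (vsig i - iwc i l - m)) (beta_neg P i l m).
Proof. by apply: sdeg_scale0; [apply: kgr_sgk|apply: sdeg_beta]. Qed.

Lemma Qi_homog i j r s : (Qi P i j)`_r`_s != 0 ->
  exists n, kgr n (Qi P i j)`_r`_s /\
    n%:Z + (2 * dd i * r)%:Z + (2 * dd j * s)%:Z = - (2 * sip i j).
Proof.
rewrite /Qi; case: (i =P tau j) => _; last first.
  by move=> /(ca_Qhomog hP) [n [h1 h2]]; exists n; split; rewrite // h2 /sip; ring.
rewrite !coefN oppr_eq0 => /(ca_Qhomog hP) [n [h1 h2]]; exists n.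
by split; [apply: (kgrN hk) | rewrite h2 /sip; ring].
Qed.

Lemma Rser_homog i j (b : int) n : (Rser P i j b)`_n != 0 ->
  exists m, kgr m (Rser P i j b)`_n /\
    m%:Z + (2 * dd j * n)%:Z = - (2 * sip i j) - 2 * (dd i)%:Z * b.
Proof.
case: b => r /=; case: (eqVneq i j) => hij; rewrite ?coef0 ?eqxx //.
- rewrite coefZ => h.
  have h' : (QQ P i j)`_r`_n != 0 by apply: contra_neq h => ->; rewrite mulr0.
  have [m [h1 h2]] := ca_Qhomog hP h'; exists m; split.
    by apply: (kgr0M hk) => //; apply: kgr_rr.
  by move: h2; rewrite /sip; lia.
- case: r => [|r]; first by rewrite scale0r coef0 eqxx.
  rewrite coefZ coefXn /= -hij; case: (n =P r) => [->|_]; last by rewrite mulr0 eqxx.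
  rewrite mulr1 => _; exists 0%N; split; first exact: (kgr_nat hk).
  by rewrite (sipii hD) NegzE; lia.
Qed.

End Homogeneous.

Section Structural.
Variables (D : satake_data) (hD : satake_axioms D).
Variables (P : structure_consts D) (hP : const_axioms P).
Notation I := (idx D).
Notation word := (seq I).
Notation wt := (iw_lattice D).
Notation k := (kk P).
Notation tm := (tm I k).
Implicit Types (i j : I) (l : wt) (u v w : word) (a b f g : tm) (c : k).
Local Open Scope tm_scope.
Notation typed := (@typed D P).
Notation eq2 := (@eq2 D P).
Notation cls := (hom2_cls (P := P)).
Notation hk := (ca_ground hP).
Notation sdeg := (sdeg hP).
Notation geq := (geq hP).
Notation tot := (tot hP).
Notation cmp := (cmp hP).
Notation kglue := (kglue hk).

Lemma geq_comp l u v w a a' b b' :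
  geq l v w a a' -> geq l u v b b' -> geq l u w (a ∘ b) (a' ∘ b').
Proof.
move=> [ta ta' ha] [tb tb' hb]; split=> [||V F hF]; [exact: typed_comp ta tb|exact: typed_comp ta' tb'|].
rewrite (tot_comp hP _ ta tb) (tot_comp hP _ ta' tb') ha => [|p]; last first.
  by apply: addv_tot => q z x y; rewrite vcompDl hF.
apply: tot_ext => p x; apply: hb => q y z; by rewrite vcompDr hF.
Qed.

Lemma geq_tens l u u' v v' a a' b b' :
  geq (l - wti v) u u' a a' -> geq l v v' b b' ->
  geq l (u ++ v) (u' ++ v') (a ⊗ b) (a' ⊗ b').
Proof.
move=> [ta ta' ha] [tb tb' hb]; split=> [||V F hF]; [exact: typed_tens ta tb|exact: typed_tens ta' tb'|].
rewrite (tot_tens hP _ ta tb) (tot_tens hP _ ta' tb') ha => [|p]; last first.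
  by apply: addv_tot => q z x y; rewrite htensDl hF.
apply: tot_ext => p x; apply: hb => q y z; by rewrite htensDr hF.
Qed.

Lemma geq_add l v w a a' b b' :
  geq l v w a a' -> geq l v w b b' -> geq l v w (a ⊕ b) (a' ⊕ b').
Proof.
move=> [ta ta' ha] [tb tb' hb]; split=> [||V F hF]; [exact: typed_add|exact: typed_add|].
by rewrite !tot_add ha // hb.
Qed.

Lemma geq_scale l v w c a a' : geq l v w a a' -> geq l v w (c ⊙ a) (c ⊙ a').
Proof.
move=> [ta ta' ha]; split=> [||V F hF]; [exact: typed_scale|exact: typed_scale|].
rewrite !tot_scale; apply: kglue_ext => m x; apply: ha => p y z.
by rewrite scalerDr hF.
Qed.

Lemma tot_kglue l v w (V : zmodType) (G : int -> hom2 P l v w -> nat -> k -> V) a c :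
  tot (fun p x => kglue (G p x) c) a = kglue (fun m c' => tot (fun p x => G p x m c') a) c.
Proof. by rewrite /tot /kglue exchange_big. Qed.

Lemma tot_sum l v w (V : zmodType) (F G : int -> hom2 P l v w -> V) a :
  tot (fun p x => F p x + G p x) a = tot F a + tot G a.
Proof. by rewrite /tot big_split. Qed.

Lemma typed_compE l u w a b : typed l u w (a ∘ b) ->
  typed l (tgt b) w a /\ typed l u (tgt b) b.
Proof.
move=> t; inversion t; subst.
match goal with H : Defs.typed _ _ _ b |- _ => by rewrite -(typed_tgt H) end.
Qed.

Lemma typed_tensE l u w a b : typed l u w (a ⊗ b) ->
  [/\ u = src a ++ src b, w = tgt a ++ tgt b,
      typed (l - wti (src b)) (src a) (tgt a) a & typed l (src b) (tgt b) b].
Proof.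
move=> t; inversion t; subst.
match goal with H : Defs.typed _ _ _ b, H' : Defs.typed _ _ _ a |- _ =>
  by rewrite -(typed_src H) -(typed_tgt H) -(typed_src H') -(typed_tgt H') end.
Qed.

Lemma typed_addE l u w a b : typed l u w (a ⊕ b) -> typed l u w a /\ typed l u w b.
Proof. by move=> t; inversion t. Qed.

Lemma typed_scaleE l u w c a : typed l u w (c ⊙ a) -> typed l u w a.
Proof. by move=> t; inversion t. Qed.

Lemma wti_sub l u v : l - wti v - wti u = l - wti (u ++ v).
Proof. by rewrite wti_cat opprD addrA addrAC. Qed.


Lemma tot_id l v w (V : zmodType) (F : int -> hom2 P l v w -> V) u :
  tot F (TId u) = F 0 (cls l v w (TId u)).
Proof. exact: big_seq1. Qed.

Lemma tot_compA l v w (V : zmodType) (F : int -> hom2 P l v w -> V) a b f :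
  typed l v w ((a ∘ b) ∘ f) -> tot F ((a ∘ b) ∘ f) = tot F (a ∘ (b ∘ f)).
Proof.
move=> /typed_compE [/typed_compE [ta tb] tf].
rewrite (tot_comp hP _ (typed_comp ta tb) tf) (tot_comp hP _ ta tb).
rewrite (tot_comp hP _ ta (typed_comp tb tf)).
apply: tot_ext => p x; rewrite (tot_comp hP _ tb tf).
apply: tot_ext => q y; apply: tot_ext => r z; rewrite addrA; congr (F _ _).
elim/cls_ind: x => a' ta'; elim/cls_ind: y => b' tb'; elim/cls_ind: z => c' tc'.
rewrite (vcomp_cls ta' tb') (vcomp_cls tb' tc') (vcomp_cls (typed_comp ta' tb') tc').
rewrite (vcomp_cls ta' (typed_comp tb' tc')).
apply: cls_rel; last exact: rel_compA.
  exact: typed_comp (typed_comp ta' tb') tc'.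
exact: typed_comp ta' (typed_comp tb' tc').
Qed.

Lemma tot_comp1l l v w (V : zmodType) (F : int -> hom2 P l v w -> V) u a :
  typed l v w (TId u ∘ a) -> tot F (TId u ∘ a) = tot F a.
Proof.
move=> /typed_compE [tu ta]; have e := typed_src tu; have e' := typed_tgt tu.
move: e e' ta tu => /= e e'; rewrite e -e' => ta tu.
rewrite (tot_comp hP _ tu ta) tot_id.
apply: tot_ext => p x; rewrite add0r; congr (F _ _).
elim/cls_ind: x => a' ta'; rewrite vcomp_cls //.
by apply: cls_rel => //; [exact: typed_comp tu ta' |exact: rel_comp1l].
Qed.

Lemma tot_comp1r l v w (V : zmodType) (F : int -> hom2 P l v w -> V) u a :
  typed l v w (a ∘ TId u) -> tot F (a ∘ TId u) = tot F a.
Proof.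
move=> /typed_compE [/= ta tu]; have /= e := typed_src tu.
move: ta tu; rewrite -e => ta tu.
rewrite (tot_comp hP _ ta tu).
apply: tot_ext => p x; rewrite tot_id addr0; congr (F _ _).
elim/cls_ind: x => a' ta'; rewrite vcomp_cls //.
by apply: cls_rel => //; [exact: typed_comp ta' tu |exact: rel_comp1r].
Qed.

Lemma tot_tensA l v w (V : zmodType) (F : int -> hom2 P l v w -> V) a b f :
  typed l v w ((a ⊗ b) ⊗ f) -> tot F ((a ⊗ b) ⊗ f) = tot F (a ⊗ (b ⊗ f)).
Proof.
move=> /typed_tensE [e e' /typed_tensE [_ _ ta tb] tf]; subst v w.
rewrite /tot /= !big_allpairs_dep /= -wti_sub.
rewrite ?big_allpairs_dep /= big_seq [RHS]big_seq; apply: eq_bigr => x hx.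
rewrite ?big_allpairs_dep /= big_seq [RHS]big_seq; apply: eq_bigr => y hy.
rewrite big_seq [RHS]big_seq; apply: eq_bigr => z hz /=.
rewrite addrA; congr (F _ _).
have [ta' tb' tf'] := And3 (cmp_typed ta hx) (cmp_typed tb hy) (cmp_typed tf hz).
apply: cls_rel; last exact: rel_tensA.
  exact: typed_tens (typed_tens ta' tb') tf'.
rewrite -!catA; apply: typed_tens; last exact: typed_tens.
by rewrite -wti_sub.
Qed.

Lemma tot_tens1l l v w (V : zmodType) (F : int -> hom2 P l v w -> V) a :
  typed l v w (TId [::] ⊗ a) -> tot F (TId [::] ⊗ a) = tot F a.
Proof.
move=> /typed_tensE [/= e e' _ ta]; subst v w.
rewrite /tot /= big_cat big_nil /= Monoid.mulm1 big_map big_seq [RHS]big_seq.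
apply: eq_bigr => x hx /=; rewrite add0r; congr (F _ _).
have ta' := cmp_typed ta hx; apply: cls_rel => //; last exact: rel_tens1l.
exact: (typed_tens (typed_id P _ [::]) ta').
Qed.

Lemma tot_tens1r l v w (V : zmodType) (F : int -> hom2 P l v w -> V) a :
  typed l v w (a ⊗ TId [::]) -> tot F (a ⊗ TId [::]) = tot F a.
Proof.
move=> /typed_tensE [/= e e' ta _]; rewrite wti_nil subr0 in ta; subst v w.
rewrite /tot /= big_flatten big_map /= wti_nil subr0 big_seq [RHS]big_seq.
apply: eq_bigr => x hx /=; rewrite big_seq1 addr0; congr (F _ _).
have ta' := cmp_typed ta hx; apply: cls_rel; last exact: rel_tens1r.
  by apply: typed_tens; rewrite ?wti_nil ?subr0 //; constructor.
by rewrite !cats0.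
Qed.

Lemma tot_tens_id l v w (V : zmodType) (F : int -> hom2 P l v w -> V) u u' :
  typed l v w (TId u ⊗ TId u') -> tot F (TId u ⊗ TId u') = tot F (TId (u ++ u')).
Proof.
move=> /typed_tensE [/= e e' _ _]; subst v w; rewrite /tot /= !big_seq1 addr0.
by congr (F _ _); apply: cls_rel; [| |exact: rel_tens_id]; repeat constructor.
Qed.

Lemma tot_interchange l v w (V : zmodType) (F : int -> hom2 P l v w -> V) a b f g :
  addf F ->
  typed l v w ((a ∘ b) ⊗ (f ∘ g)) -> typed l v w ((a ⊗ f) ∘ (b ⊗ g)) ->
  tot F ((a ∘ b) ⊗ (f ∘ g)) = tot F ((a ⊗ f) ∘ (b ⊗ g)).
Proof.
move=> hF /typed_tensE [/= e e' /typed_compE [ta tb] /typed_compE [tf tg]].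
move=> /typed_compE [/= /typed_tensE [e3 _ ta' tf'] /typed_tensE [_ _ tb' tg']].
have ef := typed_src tf; subst v w.
pose l1 := l - wti (src g); pose l2 := l - wti (src f).
transitivity (\sum_(x <- cmp l1 a) \sum_(y <- cmp l1 b) \sum_(z <- cmp l f)
    \sum_(t <- cmp l g) F ((x.1 + y.1) + (z.1 + t.1))
      (cls l (src b ++ src g) (tgt a ++ tgt f) ((x.2 ∘ y.2) ⊗ (z.2 ∘ t.2)))).
  rewrite /tot /= !big_allpairs_dep; apply: eq_bigr => x _; apply: eq_bigr => y _.
  by rewrite big_allpairs_dep.
transitivity (\sum_(x <- cmp l2 a) \sum_(z <- cmp l f) \sum_(y <- cmp l1 b)
    \sum_(t <- cmp l g) F ((x.1 + z.1) + (y.1 + t.1))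
      (cls l (src b ++ src g) (tgt a ++ tgt f) ((x.2 ⊗ z.2) ∘ (y.2 ⊗ t.2)))); last first.
  rewrite /tot /= !big_allpairs_dep; apply: eq_bigr => x _; apply: eq_bigr => y _.
  by rewrite big_allpairs_dep.
case: (eqVneq (wti (src g)) (wti (tgt g))) => [eg|ne].
  have -> : l2 = l1 by rewrite /l2 /l1 eg -ef.
  rewrite big_seq [RHS]big_seq; apply: eq_bigr => x hx; rewrite exchange_big /=.
  rewrite big_seq [RHS]big_seq; apply: eq_bigr => z hz.
  rewrite big_seq [RHS]big_seq; apply: eq_bigr => y hy.
  rewrite big_seq [RHS]big_seq; apply: eq_bigr => t ht.
  rewrite addrACA; congr (F _ _).
  have ta1 := cmp_typed ta hx; have tb1 := cmp_typed tb hy.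
  have tf1 := cmp_typed tf hz; have tg1 := cmp_typed tg ht.
  apply: cls_rel; last exact: rel_interchange.
    exact: typed_tens (typed_comp ta1 tb1) (typed_comp tf1 tg1).
  apply: (typed_comp _ (typed_tens tb1 tg1)); apply: (typed_tens _ tf1).
  by rewrite -eg.
have z0 z : z \in cmp l g -> cls l (src g) (tgt g) z.2 = 0.
  by move=> hz; apply: (typed_mismatch hD (cmp_typed tg hz)); rewrite ne.
transitivity (0 : V); last symmetry.
  rewrite big1_seq // => x /andP[_ hx]; rewrite big1_seq // => y /andP[_ hy].
  rewrite big1_seq // => z /andP[_ hz]; rewrite big1_seq // => t /andP[_ ht] /=.
  rewrite -(htens_cls (typed_comp (cmp_typed ta hx) (cmp_typed tb hy))
    (typed_comp (cmp_typed tf hz) (cmp_typed tg ht))).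
  by rewrite -(vcomp_cls (cmp_typed tf hz) (cmp_typed tg ht)) z0 // vcomp0r htens0r addv0.
rewrite big1_seq // => x /andP[_ hx]; rewrite big1_seq // => z /andP[_ hz].
rewrite big1_seq // => y /andP[_ hy]; rewrite big1_seq // => t /andP[_ ht] /=.
have ea := typed_src ta.
have tx : typed l (tgt b ++ tgt g) (tgt a ++ tgt f) (x.2 ⊗ z.2).
  apply: (typed_tens _ (cmp_typed tf hz)).
  by rewrite ea ef; apply: (cmp_typed ta' hx).
have tb1 := cmp_typed tb' hy; have tg1 := cmp_typed tg ht.
rewrite -(vcomp_cls tx (typed_tens tb1 tg1)).
by rewrite -(htens_cls tb1 tg1) z0 // htens0r vcomp0r addv0.
Qed.

Lemma addv_vcompl l u v w (V : zmodType) (F : int -> hom2 P l u w -> V) p q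
    (y : hom2 P l u v) : addf F -> addv (fun x : hom2 P l v w => F (p + q) (vcomp x y)).
Proof. by move=> hF x z; rewrite vcompDl hF. Qed.

Lemma tot_compZl l v w (V : zmodType) (F : int -> hom2 P l v w -> V) c a f :
  typed l v w ((c ⊙ a) ∘ f) -> tot F ((c ⊙ a) ∘ f) = tot F (c ⊙ (a ∘ f)).
Proof.
move=> /typed_compE [/typed_scaleE ta tf].
rewrite (tot_comp hP _ (typed_scale c ta) tf) !tot_scale; apply: kglue_ext => m x.
rewrite (tot_comp hP _ ta tf); apply: tot_ext => p y; apply: tot_ext => q z.
by rewrite addrA vcompZl.
Qed.

Lemma tot_compZr l v w (V : zmodType) (F : int -> hom2 P l v w -> V) c a f :
  typed l v w (f ∘ (c ⊙ a)) -> tot F (f ∘ (c ⊙ a)) = tot F (c ⊙ (f ∘ a)).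
Proof.
move=> /typed_compE [/= tf /typed_scaleE ta].
rewrite (tot_comp hP _ tf (typed_scale c ta)) tot_scale.
under tot_ext do rewrite tot_scale.
rewrite tot_kglue; apply: kglue_ext => m x.
rewrite (tot_comp hP _ tf ta); apply: tot_ext => p y; apply: tot_ext => q z.
by rewrite addrCA vcompZr.
Qed.

Lemma tot_tensZl l v w (V : zmodType) (F : int -> hom2 P l v w -> V) c a f :
  typed l v w ((c ⊙ a) ⊗ f) -> tot F ((c ⊙ a) ⊗ f) = tot F (c ⊙ (a ⊗ f)).
Proof.
move=> /typed_tensE [/= e e' /typed_scaleE ta tf]; subst v w.
rewrite (tot_tens hP _ (typed_scale c ta) tf) !tot_scale; apply: kglue_ext => m x.
rewrite (tot_tens hP _ ta tf); apply: tot_ext => p y; apply: tot_ext => q z.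
by rewrite addrA htensZl.
Qed.

Lemma tot_tensZr l v w (V : zmodType) (F : int -> hom2 P l v w -> V) c a f :
  typed l v w (f ⊗ (c ⊙ a)) -> tot F (f ⊗ (c ⊙ a)) = tot F (c ⊙ (f ⊗ a)).
Proof.
move=> /typed_tensE [/= e e' tf /typed_scaleE ta]; subst v w.
rewrite (tot_tens hP _ tf (typed_scale c ta)) tot_scale.
under tot_ext do rewrite tot_scale.
rewrite tot_kglue; apply: kglue_ext => m x.
rewrite (tot_tens hP _ tf ta); apply: tot_ext => p y; apply: tot_ext => q z.
by rewrite addrCA htensZr.
Qed.

Lemma tot_scaleDr l v w (V : zmodType) (F : int -> hom2 P l v w -> V) c a b :
  tot F (c ⊙ (a ⊕ b)) = tot F (c ⊙ a ⊕ c ⊙ b).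
Proof.
rewrite tot_add !tot_scale -big_split /=; apply: eq_bigr => m _; exact: tot_add.
Qed.

Lemma tot_scaleA l v w (V : zmodType) (F : int -> hom2 P l v w -> V) c c' a :
  addf F -> tot F (c ⊙ c' ⊙ a) = tot F ((c * c')%R ⊙ a).
Proof.
move=> hF; rewrite !tot_scale kglueM => [|n]; last exact: addv_scale.
apply: kglue_ext => m x; rewrite tot_scale; apply: kglue_ext => n y.
by apply: tot_ext => p z; rewrite addrA scalerA PoszD.
Qed.

Lemma tot_scale1 l v w (V : zmodType) (F : int -> hom2 P l v w -> V) a :
  addf F -> tot F (1 ⊙ a) = tot F a.
Proof.
move=> hF; rewrite tot_scale (kglue_homog _ (m := 0)); first last.
- exact: (kgr1 hk).
- by move=> n; apply: addv_scale.
by apply: tot_ext => p x; rewrite add0r scale1r.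
Qed.

End Structural.

Section Relations.
Variables (D : satake_data) (hD : satake_axioms D).
Variables (P : structure_consts D) (hP : const_axioms P).
Notation I := (idx D).
Notation word := (seq I).
Notation wt := (iw_lattice D).
Notation k := (kk P).
Notation tm := (tm I k).
Implicit Types (i j : I) (l : wt) (u v w : word) (a b f g : tm) (c : k).
Local Open Scope tm_scope.
Notation typed := (@typed D P).
Notation eq2 := (@eq2 D P).
Notation cls := (hom2_cls (P := P)).
Notation hk := (ca_ground hP).
Notation sdeg := (sdeg hP).
Notation geq := (geq hP).
Notation totn := (tot hP).
Notation "1_ i" := (TId [:: i]) (at level 8, i at level 2, format "1_ i") : tm_scope.

Definition homog_rel l a b :=
  exists n, sdeg l (src a) (tgt a) n a /\ sdeg l (src a) (tgt a) n b.

Lemma homog_rel_geq l v w a b :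
  typed l v w a -> typed l v w b -> rel2 l a b -> homog_rel l a b -> geq l v w a b.
Proof.
move=> ta tb r [n]; rewrite -(typed_src ta) -(typed_tgt ta) => -[ha hb].
by apply: sdeg_geq ha hb; apply: eq2_rel.
Qed.

Lemma homog_relI l v w n a b : v = src a -> w = tgt a ->
  sdeg l v w n a -> sdeg l v w n b -> homog_rel l a b.
Proof. by move=> -> -> ha hb; exists n. Qed.

Ltac cst h := apply: (sdeg_cast h).

Lemma sdeg_capid l i j :
  sdeg l [:: tau i; i; j] [:: j] ((dd i)%:Z * (1 + vsig i - iwc i (l - wti [:: j])))
    (TCap i ⊗ 1_ j).
Proof.
by cst (sdeg_tens' (sdeg_id hP l [:: j]) (sdeg_cap hP _ i)); rewrite addr0.
Qed.

Lemma sdeg_cupid l i j :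
  sdeg l [:: j] [:: tau i; i; j] ((dd i)%:Z * (1 + vsig i - iwc i (l - wti [:: j])))
    (TCup i ⊗ 1_ j).
Proof.
by cst (sdeg_tens' (sdeg_id hP l [:: j]) (sdeg_cup hP _ i)); rewrite addr0.
Qed.

Lemma sdeg_idcap l i j :
  sdeg l [:: j; tau i; i] [:: j] ((dd i)%:Z * (1 + vsig i - iwc i l)) (1_ j ⊗ TCap i).
Proof.
by cst (sdeg_tens' (sdeg_cap hP l i) (sdeg_id hP _ [:: j])); rewrite add0r.
Qed.

Lemma sdeg_idcup l i j :
  sdeg l [:: j] [:: j; tau i; i] ((dd i)%:Z * (1 + vsig i - iwc i l)) (1_ j ⊗ TCup i).
Proof.
by cst (sdeg_tens' (sdeg_cup hP l i) (sdeg_id hP _ [:: j])); rewrite add0r.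
Qed.

Lemma sdeg_crossid l i j h :
  sdeg l [:: i; j; h] [:: j; i; h] (- sip i j) (TCross i j ⊗ 1_ h).
Proof.
by cst (sdeg_tens' (sdeg_id hP l [:: h]) (sdeg_cross hP _ i j)); rewrite addr0.
Qed.

Lemma sdeg_idcross l i j h :
  sdeg l [:: h; i; j] [:: h; j; i] (- sip i j) (1_ h ⊗ TCross i j).
Proof.
by cst (sdeg_tens' (sdeg_cross hP l i j) (sdeg_id hP _ [:: h])); rewrite add0r.
Qed.

Lemma sdeg_dotsid l i j n :
  sdeg l [:: i; j] [:: i; j] (2 * dd i * n)%:Z (dots P i n ⊗ 1_ j).
Proof.
by cst (sdeg_tens' (sdeg_id hP l [:: j]) (sdeg_dots hP _ i n)); rewrite addr0.
Qed.

Lemma sdeg_iddots l i j n :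
  sdeg l [:: j; i] [:: j; i] (2 * dd i * n)%:Z (1_ j ⊗ dots P i n).
Proof.
by cst (sdeg_tens' (sdeg_dots hP l i n) (sdeg_id hP _ [:: j])); rewrite add0r.
Qed.

Lemma sdeg_dotid l i j :
  sdeg l [:: i; j] [:: i; j] (2 * dd i)%:Z (TDot i ⊗ 1_ j).
Proof.
by cst (sdeg_tens' (sdeg_id hP l [:: j]) (sdeg_dot hP _ i)); rewrite addr0.
Qed.

Lemma sdeg_iddot l i j :
  sdeg l [:: j; i] [:: j; i] (2 * dd i)%:Z (1_ j ⊗ TDot i).
Proof.
by cst (sdeg_tens' (sdeg_dot hP l i) (sdeg_id hP _ [:: j])); rewrite add0r.
Qed.

(* the shift of [lambda_i] by simple roots, multiplied out by [d_i] *)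
Lemma dd_shift i l u : (dd i)%:Z * iwc i (l - wti u) =
  (dd i)%:Z * iwc i l - \sum_(j <- u) (sip i j - sip (tau i) j).
Proof.
rewrite (iwcB hD) mulrBr; congr (_ - _).
elim: u => [|j u IH]; first by rewrite wti_nil (iwc0 hD) big_nil mulr0.
by rewrite wti_cons (iwcD hD) mulrDr (dd_iwc_root hD) IH big_cons.
Qed.

Lemma sdeg_sub l v w n a b :
  sdeg l v w n a -> sdeg l v w n b -> sdeg l v w n (a ⊖ b).
Proof.
move=> ha hb; apply: sdeg_add ha _; apply: sdeg_scale0 hb.
exact: (kgrN hk (kgr1 hk)).
Qed.

Lemma homog_leading l i m : vsig i - iwc i l <= m ->
  homog_rel l (beta_coef P i l m)
      (if m == vsig i - iwc i l then (zeta P i * gam P i l)%R ⊙ TId [::]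
       else TZero [::] [::]).
Proof.
move=> _; apply: homog_relI (sdeg_beta hD hP l i m) _.
- by case: m => n //=; case: ifP.
- by case: m => n //=; case: ifP.
- case: eqP => [->|_]; last exact: sdeg_zero.
  apply: sdeg_scale0; last by cst (sdeg_id hP l [::]); rewrite subrr mulr0.
  by apply: (kgr0M hk); [apply/kunit0/ca_zeta | apply: kgr_gam].
Qed.

Lemma src_tsum v w n F : (forall r, src (F r) = v) -> src (tsum v w n F : tm) = v.
Proof. by move=> h; rewrite /tsum; apply: (big_ind (fun a => src a = v)). Qed.
Lemma tgt_tsum v w n F : (forall r, tgt (F r) = w) -> tgt (tsum v w n F : tm) = w.
Proof. by move=> h; rewrite /tsum; apply: (big_ind (fun a => tgt a = w)). Qed.

Lemma sdeg_src l v w n a : sdeg l v w n a -> v = src a.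
Proof. by case=> ta _; apply: typed_src ta. Qed.
Lemma sdeg_tgt l v w n a : sdeg l v w n a -> w = tgt a.
Proof. by case=> ta _; apply: typed_tgt ta. Qed.

Lemma homog_relJ l v w n a b :
  sdeg l v w n a -> sdeg l v w n b -> homog_rel l a b.
Proof. by move=> ha hb; apply: homog_relI (sdeg_src ha) (sdeg_tgt ha) ha hb. Qed.

Lemma homog_grassmannian l i m :
  homog_rel l
      (conv [::] [::] (beta_top i l) (beta_top (tau i) l)
         (fun r s => beta_coef P i l r ∘ beta_neg P (tau i) l s) m)
      (TZero [::] [::]).
Proof.
apply: (@homog_relJ _ [::] [::] (2 * (dd i)%:Z * (vsig i + vsig (tau i) - m))).
  apply: sdeg_conv => r s <-.
  cst (sdeg_comp (sdeg_beta_neg hD hP l (tau i) s) (sdeg_beta hD hP l i r)).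
  by rewrite (sat_tau_d hD) (iwc_tau hD); lia.
exact: sdeg_zero.
Qed.

Lemma homog_slide l i j m :
    homog_rel l
      (conv [:: j] [:: j] (beta_top i (l - wti [:: j])) `|cartan i j|%N%:Z
         (fun r s => (beta_coef P i (l - wti [:: j]) r ⊗ 1_ j)
                       ∘ poly_dots j (Rser P i j s)) m)
      (conv [:: j] [:: j] `|cartan (tau i) j|%N%:Z (beta_top i l)
         (fun r s => poly_dots j (sgk P r *: Rser P (tau i) j r)
                       ∘ (1_ j ⊗ beta_coef P i l s)) m).
Proof.
have e := dd_shift i l [:: j]; rewrite big_seq1 in e.
apply: (@homog_relJ _ [:: j] [:: j]
  (2 * (dd i)%:Z * (vsig i - iwc i l - m) - 2 * sip (tau i) j)).
  apply: sdeg_conv => r s <-.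
  have h1 : sdeg l [:: j] [:: j] (- (2 * sip i j) - 2 * (dd i)%:Z * s)
      (poly_dots j (Rser P i j s)).
    by apply: sdeg_poly => n /(Rser_homog hD hP) [p [h1 h2]]; exists p.
  have h2 := sdeg_tens' (sdeg_id hP l [:: j]) (sdeg_beta hD hP (l - wti [:: j]) i r).
  cst (sdeg_comp h1 h2); move: e; lia.
apply: sdeg_conv => r s <-.
have h1 : sdeg l [:: j] [:: j] (- (2 * sip (tau i) j) - 2 * (dd i)%:Z * r)
    (poly_dots j (sgk P r *: Rser P (tau i) j r)).
  apply: sdeg_poly => n; rewrite coefZ => h.
  have h' : (Rser P (tau i) j r)`_n != 0 by apply: contra_neq h => ->; rewrite mulr0.
  have [p [h1 h2]] := Rser_homog hD hP h'; exists p; split.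
    by apply: (kgr0M hk) => //; apply: kgr_sgk.
  by rewrite h2 (sat_tau_d hD).
have h2 := sdeg_tens' (sdeg_beta hD hP l i s) (sdeg_id hP (l - wti [::]) [:: j]).
have h3 : sdeg l [:: j] [:: j] (0 + 2 * (dd i)%:Z * (vsig i - iwc i l - s))
   (1_ j ⊗ beta_coef P i l s) := h2.
cst (sdeg_comp h3 h1); lia.
Qed.


Lemma homog_zigzag_l l i :
  homog_rel l ((TCap (tau i) ⊗ 1_ i) ∘ (1_ i ⊗ TCup i)) (1_ i).
Proof.
have h := sdeg_capid l (tau i) i; rewrite (tau_tau hD) in h.
apply: homog_relJ (sdeg_id hP l [:: i]); cst (sdeg_comp (sdeg_idcup l i i) h).
have := dd_vsig hD i; have := dd_shift i l [:: i]; rewrite big_seq1.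
by rewrite (sat_tau_d hD) (iwc_tau hD) (sipii hD) (sipC hD i); lia.
Qed.

Lemma homog_zigzag_r l i :
  homog_rel l ((1_ i ⊗ TCap i) ∘ (TCup (tau i) ⊗ 1_ i)) (1_ i).
Proof.
have h := sdeg_cupid l (tau i) i; rewrite (tau_tau hD) in h.
apply: homog_relJ (sdeg_id hP l [:: i]); cst (sdeg_comp h (sdeg_idcap l i i)).
have := dd_vsig hD i; have := dd_shift i l [:: i]; rewrite big_seq1.
by rewrite (sat_tau_d hD) (iwc_tau hD) (sipii hD) (sipC hD i); lia.
Qed.

Lemma homog_dot_cup l i :
  homog_rel l ((TDot (tau i) ⊗ 1_ i) ∘ TCup i)
              ((-1) ⊙ ((1_ (tau i) ⊗ TDot i) ∘ TCup i)).
Proof.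
apply: homog_relJ; first exact: sdeg_comp (sdeg_cup hP l i) (sdeg_dotid l (tau i) i).
apply: sdeg_scale0; first exact: (kgrN hk (kgr1 hk)).
cst (sdeg_comp (sdeg_cup hP l i) (sdeg_iddot l i (tau i))).
by rewrite (sat_tau_d hD).
Qed.

Lemma homog_dot_cap l i :
  homog_rel l (TCap i ∘ (TDot (tau i) ⊗ 1_ i))
              ((-1) ⊙ (TCap i ∘ (1_ (tau i) ⊗ TDot i))).
Proof.
apply: homog_relJ; first exact: sdeg_comp (sdeg_dotid l (tau i) i) (sdeg_cap hP l i).
apply: sdeg_scale0; first exact: (kgrN hk (kgr1 hk)).
cst (sdeg_comp (sdeg_iddot l i (tau i)) (sdeg_cap hP l i)).
by rewrite (sat_tau_d hD).
Qed.

Lemma homog_pitchfork_cup l i j :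
  homog_rel l ((TCross j i ⊗ 1_ (tau i)) ∘ (1_ j ⊗ TCup (tau i)))
     ((rr P i j)^-1 ⊙ ((1_ i ⊗ TCross (tau i) j) ∘ (TCup (tau i) ⊗ 1_ j))).
Proof.
have h1 := sdeg_idcup l (tau i) j; have h2 := sdeg_cupid l (tau i) j.
rewrite (tau_tau hD) in h1 h2.
apply: homog_relJ; first exact: sdeg_comp h1 (sdeg_crossid l j i (tau i)).
apply: sdeg_scale0; first exact: kgr_rrV.
cst (sdeg_comp h2 (sdeg_idcross l (tau i) j i)).
have := dd_shift i l [:: j]; rewrite big_seq1.
by rewrite (sat_tau_d hD) !(iwc_tau hD) (sipC hD j); lia.
Qed.

Lemma homog_pitchfork_cap l i j :
  homog_rel l ((TCap i ⊗ 1_ j) ∘ (1_ (tau i) ⊗ TCross j i))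
     ((rr P i j)^-1 ⊙ ((1_ j ⊗ TCap i) ∘ (TCross (tau i) j ⊗ 1_ i))).
Proof.
apply: homog_relJ; first exact: sdeg_comp (sdeg_idcross l j i (tau i)) (sdeg_capid l i j).
apply: sdeg_scale0; first exact: kgr_rrV.
cst (sdeg_comp (sdeg_crossid l (tau i) j i) (sdeg_idcap l i j)).
have := dd_shift i l [:: j]; rewrite big_seq1.
by rewrite (sipC hD j); lia.
Qed.

Lemma sdeg_dot_cross_rhs l i j :
  sdeg l [:: i; j] [:: j; i] (2 * (dd i)%:Z - sip i j)
      (tif (i == j) [:: i; j] [:: j; i] (1_ i ⊗ 1_ j)
       ⊖ tif (i == tau j) [:: i; j] [:: j; i] (TCup i ∘ TCap j)).
Proof.
apply: sdeg_sub; apply: sdeg_tif => /eqP e.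
  subst j; cst (sdeg_tens' (sdeg_id hP l [:: i]) (sdeg_id hP (l - wti [:: i]) [:: i])).
  by rewrite (sipii hD); lia.
have ej : j = tau i by rewrite e (tau_tau hD).
have h1 := sdeg_cap hP l j; have h2 := sdeg_cup hP l i; rewrite -e in h1.
rewrite -ej in h2; cst (sdeg_comp h1 h2).
rewrite ej (sat_tau_d hD) (iwc_tau hD); have := dd_vsig hD i; lia.
Qed.

Lemma homog_dot_cross_l l i j :
  homog_rel l (TCross i j ∘ (TDot i ⊗ 1_ j) ⊖ (1_ j ⊗ TDot i) ∘ TCross i j)
      (tif (i == j) [:: i; j] [:: j; i] (1_ i ⊗ 1_ j)
       ⊖ tif (i == tau j) [:: i; j] [:: j; i] (TCup i ∘ TCap j)).
Proof.
apply: homog_relJ (sdeg_dot_cross_rhs l i j); apply: sdeg_sub.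
  by cst (sdeg_comp (sdeg_dotid l i j) (sdeg_cross hP l i j)); rewrite /sip; lia.
by cst (sdeg_comp (sdeg_cross hP l i j) (sdeg_iddot l i j)); rewrite /sip; lia.
Qed.

Lemma homog_dot_cross_r l i j :
  homog_rel l ((TDot j ⊗ 1_ i) ∘ TCross i j ⊖ TCross i j ∘ (1_ i ⊗ TDot j))
      (tif (i == j) [:: i; j] [:: j; i] (1_ i ⊗ 1_ j)
       ⊖ tif (i == tau j) [:: i; j] [:: j; i] (TCup i ∘ TCap j)).
Proof.
case: (eqVneq (dd i) (dd j)) => [e|ne].
  apply: homog_relJ (sdeg_dot_cross_rhs l i j); apply: sdeg_sub.
    by cst (sdeg_comp (sdeg_cross hP l i j) (sdeg_dotid l j i)); rewrite /sip -e; lia.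
  by cst (sdeg_comp (sdeg_iddot l j i) (sdeg_cross hP l i j)); rewrite /sip -e; lia.
rewrite /tif; case: (i =P j) => [e|_]; first by rewrite e eqxx in ne.
case: (i =P tau j) => [e|_]; first by rewrite e (sat_tau_d hD) eqxx in ne.
apply: (@homog_relJ _ [:: i; j] [:: j; i] (2 * (dd j)%:Z - sip i j)).
  apply: sdeg_sub.
    by cst (sdeg_comp (sdeg_cross hP l i j) (sdeg_dotid l j i)); rewrite /sip; lia.
  by cst (sdeg_comp (sdeg_iddot l j i) (sdeg_cross hP l i j)); rewrite /sip; lia.
by apply: sdeg_sub; apply: sdeg_zero.
Qed.

Lemma homog_curl l i :
  homog_rel l ((1_ i ⊗ TCap (tau i)) ∘ (TCross i i ⊗ 1_ (tau i))
              ∘ (1_ i ⊗ TCup (tau i))) (curl_rhs P l i).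
Proof.
have h1 := sdeg_idcup l (tau i) i; have h2 := sdeg_idcap l (tau i) i.
rewrite (tau_tau hD) in h1 h2.
apply: homog_relJ; first exact: sdeg_comp h1 (sdeg_comp (sdeg_crossid l i i (tau i)) h2).
apply: sdeg_tsum => n.
have h3 := sdeg_tens' (sdeg_beta_neg hD hP l (tau i) n) (sdeg_dots hP (l - wti [::]) i n).
cst h3; rewrite (sat_tau_d hD) (iwc_tau hD) (sipii hD); lia.
Qed.

Lemma sdeg_Qdots l i j : sdeg l [:: i; j] [:: i; j] (- (2 * sip i j)) (Q_dots P i j).
Proof.
apply: sdeg_tsum => r; apply: sdeg_tsum => s.
have h := sdeg_tens' (sdeg_dots hP l j s) (sdeg_dots hP (l - wti [:: j]) i r).
by apply: sdeg_coef h _ => /(Qi_homog hP) [n [h1 h2]]; exists n; rewrite addrA.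
Qed.

Lemma sdeg_cupcap l i j : i = tau j ->
  sdeg l [:: i; j] [:: i; j] (2 * (dd i)%:Z * (1 + vsig j - iwc j l)) (TCup j ∘ TCap j).
Proof.
move=> e; have h1 := sdeg_cap hP l j; have h2 := sdeg_cup hP l j.
rewrite -e in h1 h2; cst (sdeg_comp h1 h2); rewrite e (sat_tau_d hD); lia.
Qed.

Lemma homog_quadratic l i j :
  homog_rel l (TCross j i ∘ TCross i j) (quadratic_rhs P l i j).
Proof.
apply: (@homog_relJ _ [:: i; j] [:: i; j] (- (2 * sip i j))).
  by cst (sdeg_comp (sdeg_cross hP l i j) (sdeg_cross hP l j i));
    rewrite -/(sip i j) -/(sip j i) (sipC hD j); lia.
apply: sdeg_add; first exact: sdeg_Qdots.
apply: sdeg_tif => /eqP e; apply: sdeg_tsum => n; apply: sdeg_tsum => m.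
have h1 := sdeg_cap hP l j; have h2 := sdeg_cup hP l j; rewrite -e in h1 h2.
cst (sdeg_comp (sdeg_dotsid l i j m) (sdeg_comp h1 (sdeg_comp
  (sdeg_beta hD hP l i (n + m + 1)%N) (sdeg_comp h2 (sdeg_dotsid l i j n))))).
have := dd_vsig hD i; have ej : j = tau i by rewrite e (tau_tau hD).
rewrite ej (sat_tau_d hD) !(iwc_tau hD); lia.
Qed.


Lemma sdeg_Dsum l v w i j (e : int) (F : nat -> nat -> nat -> tm) :
  (forall p q r, sdeg l v w (e + (2 * dd i * (p + r) + 2 * dd j * q)%:Z) (F p q r)) ->
  sdeg l v w (e - 2 * sip i j - (2 * dd i)%:Z) (D_sum v w i j F).
Proof.
move=> h; apply: sdeg_tsum => p; apply: sdeg_tsum => q; apply: sdeg_tsum => r.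
apply: sdeg_coef (h p q r) _ => /(Qi_homog hP) [n [h1 h2]]; exists n; split=> //.
by move: h2; lia.
Qed.

Lemma sdeg_idr l v w i n a : sdeg (l - wti [:: i]) v w n a ->
  sdeg l (v ++ [:: i]) (w ++ [:: i]) n (a ⊗ 1_ i).
Proof. by move=> h; cst (sdeg_tens' (sdeg_id hP l [:: i]) h); rewrite addr0. Qed.

Lemma sdeg_idl l v w i n a : sdeg l v w n a -> sdeg l (i :: v) (i :: w) n (1_ i ⊗ a).
Proof.
move=> h; cst (sdeg_tens' h (sdeg_id hP (l - wti v) [:: i])); by rewrite add0r.
Qed.

Lemma sdeg_braid_lhs l i j h :
  sdeg l [:: i; j; h] [:: h; j; i] (- sip i j - sip i h - sip j h)
      ((TCross j h ⊗ 1_ i) ∘ (1_ j ⊗ TCross i h) ∘ (TCross i j ⊗ 1_ h)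
       ⊖ (1_ h ⊗ TCross i j) ∘ (TCross i h ⊗ 1_ j) ∘ (1_ i ⊗ TCross j h)).
Proof.
apply: sdeg_sub.
  cst (sdeg_comp (sdeg_crossid l i j h)
    (sdeg_comp (sdeg_idcross l i h j) (sdeg_crossid l j h i))); lia.
cst (sdeg_comp (sdeg_idcross l j h i)
    (sdeg_comp (sdeg_crossid l i h j) (sdeg_idcross l i j h))); lia.
Qed.

Lemma homog_braid l i j h :
  homog_rel l
      ((TCross j h ⊗ 1_ i) ∘ (1_ j ⊗ TCross i h) ∘ (TCross i j ⊗ 1_ h)
       ⊖ (1_ h ⊗ TCross i j) ∘ (TCross i h ⊗ 1_ j) ∘ (1_ i ⊗ TCross j h))
      (braid_rhs P l i j h).
Proof.
apply: homog_relJ; first exact: sdeg_braid_lhs.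
have sub_cast v w n m a : sdeg l v w n a -> n = m -> sdeg l v w m a by move=> ? <-.
apply: sdeg_sub; last first.
  apply: sdeg_tif => /eqP e; apply: sdeg_scale0; first exact: kgr_rrV.
  have eh : h = tau j by rewrite e (tau_tau hD).
  apply: sub_cast; first apply: (@sdeg_Dsum _ _ _ _ _
    ((dd h)%:Z * (1 + vsig h - iwc h l) + (dd j)%:Z * (1 + vsig j - iwc j (l - wti [:: i])))).
    move=> p q r.
    have c1 := sdeg_cap hP l h; have c2 := sdeg_cup hP (l - wti [:: i]) j.
    rewrite -e in c1; rewrite -eh in c2.
    have h1 := sdeg_idl i (sdeg_comp (sdeg_dotsid l j h r) c1).
    have h2 := sdeg_comp c2 (sdeg_iddots (l - wti [:: i]) j h p).
    have h3 := sdeg_idr h2.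
    cst (sdeg_comp h1 (sdeg_comp (sdeg_dots hP l i q) h3)); lia.
  have := dd_vsig hD j; have := dd_shift j l [:: i]; rewrite big_seq1.
  rewrite eh (iwc_tau hD) (sat_tau_d hD) (sipC hD i j) (sipC hD i (tau j)); lia.
apply: sdeg_sub; last first.
  apply: sdeg_tif => /eqP e; apply: sdeg_scale0; first exact: kgr_rr.
  have ej : j = tau i by rewrite e (tau_tau hD).
  apply: sub_cast; first apply: (@sdeg_Dsum _ _ _ _ _
    ((dd i)%:Z * (1 + vsig i - iwc i l) + (dd j)%:Z * (1 + vsig j - iwc j (l - wti [:: h])))).
    move=> p q r.
    have c1 := sdeg_cap hP (l - wti [:: h]) j; have c2 := sdeg_cup hP l i.
    rewrite -e in c1; rewrite -ej in c2.
    have h1 := sdeg_idr (sdeg_comp (sdeg_iddots (l - wti [:: h]) j i p) c1).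
    have h2 := sdeg_idl h (sdeg_comp c2 (sdeg_dotsid l j i r)).
    cst (sdeg_comp h1 (sdeg_comp (sdeg_dots hP l h q) h2)); lia.
  have := dd_vsig hD i; have := dd_shift i l [:: h]; rewrite big_seq1.
  rewrite [in iwc j _]ej ej !(iwc_tau hD) (sat_tau_d hD); lia.
apply: sdeg_add.
  apply: sdeg_tif => /eqP e; subst h.
  apply: sub_cast; first apply: (@sdeg_Dsum _ _ _ _ _ 0).
    move=> p q r.
    have h1 := sdeg_tens' (sdeg_dots hP (l - wti [:: i]) j q)
                 (sdeg_dots hP (l - wti [:: i] - wti [:: j]) i p).
    cst (sdeg_tens' (sdeg_dots hP l i r) h1); lia.
  by rewrite (sipii hD) (sipC hD j); lia.
apply: sdeg_tif => /andP[/eqP e1 /eqP e2].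
have ej : j = tau i by rewrite e1 (tau_tau hD).
have eh : h = i by rewrite e1 e2 (tau_tau hD).
subst h; have ew : wti [:: j; i] = 0.
  by rewrite wti_cons wti1 ej (iw_tau hD) addNr.
have dv := dd_vsig hD i; have dj : dd j = dd i by rewrite ej (sat_tau_d hD).
have vj x : iwc j x = - iwc i x by rewrite ej (iwc_tau hD).
have sj := dd_shift i l [:: i]; rewrite big_seq1 -ej (sipii hD) (sipC hD j) in sj.
have sij : sip j i = sip i j by rewrite (sipC hD).
rewrite -ej in dv.
apply: sdeg_sub; apply: sdeg_tsum => n; apply: sdeg_tsum => m; apply: sdeg_tsum => r.
  set l1 := l - wti [:: i] in sj *; set l2 := l1 - wti [::].
  have e12 : l2 = l1 by rewrite /l2 wti_nil subr0.
  have c1 := sdeg_cap hP l2 j; have c2 := sdeg_cup hP l2 j; rewrite -e1 in c1 c2.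
  have h1 := sdeg_comp (sdeg_dotsid l2 i j m) (sdeg_comp c1
     (sdeg_comp c2 (sdeg_dotsid l2 i j n))).
  have h2 := sdeg_tens' (sdeg_beta hD hP l1 i (n + m + r + 2)%N) h1.
  cst (sdeg_tens' (sdeg_dots hP l i r) h2); rewrite e12 dj !vj.
  rewrite (sipii hD); lia.
have c1 := sdeg_cap hP l i; have c2 := sdeg_cup hP l i; rewrite -ej in c1 c2.
have h1 := sdeg_comp (sdeg_iddots l i j m) (sdeg_comp c1
     (sdeg_comp c2 (sdeg_iddots l i j n))).
have b1 := sdeg_beta_neg hD hP (l - wti [:: j; i]) (tau i) (n + m + r + 2)%N.
have h2 := sdeg_tens' b1 (sdeg_dots hP (l - wti [:: j; i] - wti [::]) i r).
cst (sdeg_tens' h1 h2); rewrite ew subr0 -ej dj !vj (sipii hD) sij; lia.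
Qed.

Lemma rel2_geq l v w a b :
  typed l v w a -> typed l v w b -> rel2 l a b -> geq l v w a b.
Proof.
move=> ta tb r; have hom := homog_rel_geq ta tb r.
have str : (forall (V : zmodType) (F : int -> hom2 P l v w -> V),
  addf F -> totn F a = totn F b) -> geq l v w a b by split.
case: r ta tb hom str => {a b}.
- by move=> l' a b f ta tb _ ; apply=> V F hF; apply: tot_compA.
- by move=> l' u a ta tb _ ; apply=> V F hF; apply: tot_comp1l.
- by move=> l' u a ta tb _ ; apply=> V F hF; apply: tot_comp1r.
- by move=> l' a b f ta tb _ ; apply=> V F hF; apply: tot_tensA.
- by move=> l' a ta tb _ ; apply=> V F hF; apply: tot_tens1l.
- by move=> l' a ta tb _ ; apply=> V F hF; apply: tot_tens1r.
- by move=> l' u u' ta tb _ ; apply=> V F hF; apply: tot_tens_id.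
- by move=> l' a b f g ta tb _ ; apply=> V F hF; apply: (tot_interchange hD).
- by move=> l' a b f ta tb _ ; apply=> V F hF; rewrite !tot_add addrA.
- by move=> l' a b ta tb _ ; apply=> V F hF; rewrite !tot_add addrC.
- by move=> l' u u' a ta tb _ ; apply=> V F hF; rewrite tot_add /tot big_nil add0r.
- move=> l' u u' a ta tb + _; apply; exists 0.
  have ta' := typed_scaleE ta; have [e e'] := (typed_src tb, typed_tgt tb).
  rewrite /= in e e'; subst u u'; rewrite -(typed_src ta) -(typed_tgt ta).
  by split; [apply: sdeg_0scale | apply: sdeg_zero].
- by move=> l' a ta tb _; apply=> V F hF; apply: tot_scale1.
- by move=> l' c d a ta tb _; apply=> V F hF; apply: tot_scaleA.
- move=> l' c d a ta tb _; apply=> V F hF; rewrite tot_add !tot_scale.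
  by apply: kglueD => n; apply: addv_scale.
- by move=> l' c a b ta tb _; apply=> V F hF; apply: tot_scaleDr.
- move=> l' a b f /typed_compE [/typed_addE [ta tb] tf] _ _; apply=> V F hF.
  rewrite tot_add (tot_comp hP _ (typed_add ta tb) tf) tot_add.
  by rewrite (tot_comp hP _ ta tf) (tot_comp hP _ tb tf).
- move=> l' a b f /typed_compE [/= tf /typed_addE [ta tb]] _ _; apply=> V F hF.
  have /= e := typed_tgt tb; rewrite tot_add (tot_comp hP _ tf (typed_add ta tb)).
  rewrite (tot_comp hP _ tf ta) (tot_comp hP _ tf tb) -tot_sum.
  by apply: tot_ext => p x; rewrite tot_add.
- by move=> l' c a f ta tb _; apply=> V F hF; apply: tot_compZl.
- by move=> l' c a f ta tb _; apply=> V F hF; apply: tot_compZr.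
- move=> l' a b f /typed_tensE [/= e e' /typed_addE [ta tb] tf] _ _; apply=> V F hF.
  subst v w; rewrite tot_add (tot_tens hP _ (typed_add ta tb) tf) tot_add.
  have ea := typed_src tb; have eb := typed_tgt tb.
  by rewrite (tot_tens hP _ ta tf) (tot_tens hP _ tb tf).
- move=> l' a b f /typed_tensE [/= e e' tf /typed_addE [ta tb]] _ _; apply=> V F hF.
  subst v w; rewrite tot_add (tot_tens hP _ tf (typed_add ta tb)).
  rewrite (tot_tens hP _ tf ta) (tot_tens hP _ tf tb) -tot_sum.
  by apply: tot_ext => p x; rewrite tot_add.
- by move=> l' c a f ta tb _; apply=> V F hF; apply: tot_tensZl.
- by move=> l' c a f ta tb _; apply=> V F hF; apply: tot_tensZr.
- by move=> l' i m h ta tb + _; apply; apply: homog_leading.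
- by move=> l' i m h ta tb + _; apply; apply: homog_grassmannian.
- by move=> l' i j m ta tb + _; apply; apply: homog_slide.
- by move=> l' i ta tb + _; apply; apply: homog_zigzag_l.
- by move=> l' i ta tb + _; apply; apply: homog_zigzag_r.
- by move=> l' i ta tb + _; apply; apply: homog_dot_cup.
- by move=> l' i ta tb + _; apply; apply: homog_dot_cap.
- by move=> l' i j ta tb + _; apply; apply: homog_pitchfork_cup.
- by move=> l' i j ta tb + _; apply; apply: homog_pitchfork_cap.
- by move=> l' i j ta tb + _; apply; apply: homog_dot_cross_l.
- by move=> l' i j ta tb + _; apply; apply: homog_dot_cross_r.
- by move=> l' i ta tb + _; apply; apply: homog_curl.
- by move=> l' i j ta tb + _; apply; apply: homog_quadratic.
- by move=> l' i j h ta tb + _; apply; apply: homog_braid.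
Qed.

Theorem eq2_geq l v w a b : eq2 l v w a b -> geq l v w a b.
Proof.
elim=> {l v w a b}.
- exact: rel2_geq.
- by move=> l v w a ta; split.
- by move=> l v w a b _ [ta tb h]; split=> // V F hF; rewrite h.
- by move=> l v w a b f _ [ta tb h] _ [_ tf h']; split=> // V F hF; rewrite h // h'.
- by move=> l u v w a a' b b' _ ha _ hb; apply: geq_comp ha hb.
- by move=> l u u' v v' a a' b b' _ ha _ hb; apply: geq_tens.
- by move=> l v w a a' b b' _ ha _ hb; apply: geq_add.
- by move=> l v w c a a' _ ha; apply: geq_scale.
Qed.

(** The degree [n] component of a 2-morphism. *)
Definition hcomp l v w (n : int) (x : hom2 P l v w) : hom2 P l v w :=
  totn (fun p y => if p == n then y else 0) (sval (repr x)).

Lemma addf_hcomp l v w n :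
  addf (fun p (y : hom2 P l v w) => if p == n then y else 0).
Proof. by move=> p x y; case: eqP; rewrite ?addr0. Qed.

Lemma hcomp_cls l v w n a : typed l v w a ->
  hcomp n (cls l v w a) = totn (fun p (y : hom2 P l v w) => if p == n then y else 0) a.
Proof.
move=> ta; have [_ _ h] := eq2_geq (cls_repr_eq2 ta).
exact: h (@addf_hcomp _ _ _ _).
Qed.

Lemma hcompD l v w n : addv (@hcomp l v w n).
Proof.
elim/cls_ind=> a ta; elim/cls_ind=> b tb.
by rewrite -clsD // !hcomp_cls ?tot_add //; constructor.
Qed.

Lemma hcomp_homog l v w n m (x : hom2 P l v w) : homog m x ->
  hcomp n x = if m == n then x else 0.
Proof.
move=> [a [ta [ha ->]]]; rewrite -clsE hcomp_cls //.
by have [_ ->] := hdeg_sdeg hP ha; last exact: addf_hcomp.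
Qed.

Lemma hcomp0 l v w n : @hcomp l v w n 0 = 0.
Proof. exact/addv0/hcompD. Qed.

Lemma homog0 l v w n : homog n (0 : hom2 P l v w).
Proof. by exists (TZero v w), (typed_zero P l v w); split=> //; constructor. Qed.

Lemma hdeg_typed l v w n a : hdeg l v w n a -> typed l v w a.
Proof. by elim=> {l v w n a} *; econstructor; eauto. Qed.

Lemma homog_cls l v w n a : hdeg l v w n a -> homog n (cls l v w a).
Proof.
move=> h; have ta := hdeg_typed h; exists a, ta; split=> //; exact: clsE.
Qed.

Lemma homogD l v w n (x y : hom2 P l v w) : homog n x -> homog n y -> homog n (x + y).
Proof.
move=> [a [ta [ha ->]]] [b [tb [hb ->]]]; rewrite -!clsE -clsD //.
by apply: homog_cls; constructor.
Qed.

Lemma homogZ l v w m n c (x : hom2 P l v w) :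
  kgr m c -> homog n x -> homog (m%:Z + n) (c *: x).
Proof.
move=> hc [a [ta [ha ->]]]; rewrite -!clsE -clsZ.
by apply: homog_cls; constructor.
Qed.

Lemma homogN l v w n (x : hom2 P l v w) : homog n x -> homog n (- x).
Proof.
move=> h; rewrite -scaleN1r -[n]add0r; apply: homogZ h.
exact: (kgrN hk (kgr1 hk)).
Qed.

Lemma homog_sum l v w n (T : Type) (s : seq T) (Q : pred T) (F : T -> hom2 P l v w) :
  (forall x, Q x -> homog n (F x)) -> homog n (\sum_(x <- s | Q x) F x).
Proof.
move=> h; apply: big_ind => //; first exact: homog0.
by move=> x y; apply: homogD.
Qed.
End Relations.

(** * Graded rank *)

Section Coordinates.
Variables (R V : zmodType) (act : V -> R -> V) (K : choiceType) (b : K -> V).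
Hypothesis act_add : forall v, addv (act v).
Hypothesis hb : is_basis act b.

Lemma coord_ex v : exists c : K -> R, exists s : seq K,
  [/\ uniq s, v = \sum_(x <- s) act (b x) (c x) & forall x, x \notin s -> c x = 0].
Proof.
have [s [c [us e]]] := hb.2 v; exists (fun x => if x \in s then c x else 0), s.
split=> // [|x /negPf -> //].
by rewrite e big_seq [RHS]big_seq; apply: eq_bigr => x ->.
Qed.

Definition coord (v : V) : K -> R := sval (cid (coord_ex v)).

Lemma coordP v : exists s : seq K,
  [/\ uniq s, v = \sum_(x <- s) act (b x) (coord v x)
    & forall x, x \notin s -> coord v x = 0].
Proof. by rewrite /coord; case: cid. Qed.

Lemma sum_support (s t : seq K) (c : K -> R) : uniq s -> uniq t -> {subset s <= t} ->
  (forall x, x \notin s -> c x = 0) ->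
  \sum_(x <- s) act (b x) (c x) = \sum_(x <- t) act (b x) (c x).
Proof.
move=> us ut st hc; rewrite (bigID (fun x => x \in s) predT (r := t)) /=.
rewrite [X in _ = _ + X]big1 ?addr0; last by move=> x /hc ->; apply/addv0/act_add.
rewrite -[RHS]big_filter; apply: perm_big; apply: uniq_perm; rewrite ?filter_uniq //.
by move=> x; rewrite mem_filter; case: (boolP (x \in s)) => [/st ->|].
Qed.

Lemma coord_uniq v (s : seq K) (c : K -> R) : uniq s ->
  v = \sum_(x <- s) act (b x) (c x) -> (forall x, x \notin s -> c x = 0) ->
  forall x, coord v x = c x.
Proof.
move=> us e hc x; have [t [ut e' hc']] := coordP v.
pose r := undup (s ++ t).
have sr : {subset s <= r} by move=> y hy; rewrite mem_undup mem_cat hy.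
have tr : {subset t <= r} by move=> y hy; rewrite mem_undup mem_cat hy orbT.
have ur : uniq r by apply: undup_uniq.
have := @hb.1 r (fun y => coord v y - c y) ur.
have subE y : act (b y) (coord v y - c y) = act (b y) (coord v y) - act (b y) (c y).
  rewrite act_add; congr (_ + _); apply: (addrI (act (b y) (c y))).
  by rewrite -act_add !subrr; apply/addv0/act_add.
under eq_bigr do rewrite subE.
rewrite sumrB -(sum_support us ur sr hc) -(sum_support ut ur tr hc') -e -e' subrr.
move=> /(_ erefl) h; case: (boolP (x \in r)) => [/h/eqP|hx].
  by rewrite subr_eq0 => /eqP.
move: hx; rewrite mem_undup mem_cat negb_or => /andP[h1 h2].
by rewrite hc ?hc'.
Qed.

Lemma coordD x : addv (coord^~ x).
Proof.
move=> v w; have [s [us e hs]] := coordP v; have [t [ut e' ht]] := coordP w.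
pose r := undup (s ++ t).
have sr : {subset s <= r} by move=> y hy; rewrite mem_undup mem_cat hy.
have tr : {subset t <= r} by move=> y hy; rewrite mem_undup mem_cat hy orbT.
have ur : uniq r by apply: undup_uniq.
apply: (@coord_uniq _ r (fun y => coord v y + coord w y)) => // [|y].
  under eq_bigr do rewrite act_add.
  by rewrite big_split /= -(sum_support us ur sr hs) -(sum_support ut ur tr ht) -e -e'.
rewrite mem_undup mem_cat negb_or => /andP[h1 h2].
by rewrite hs ?ht ?addr0.
Qed.

Lemma coord_one x y (r : R) : coord (act (b x) r) y = if y == x then r else 0.
Proof.
apply: (@coord_uniq _ [:: x] (fun y => if y == x then r else 0)) => //.
  by rewrite big_seq1 eqxx.
by move=> z; rewrite inE => /negPf ->.
Qed.
End Coordinates.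

Section RightAction.
Variables (D : satake_data) (hD : satake_axioms D).
Variables (P : structure_consts D) (hP : const_axioms P).
Notation I := (idx D).
Notation wt := (iw_lattice D).
Notation k := (kk P).
Notation tm := (tm I k).
Implicit Types (i j : I) (l : wt) (u v w : seq I) (a b e f g : tm) (c : k).
Local Open Scope tm_scope.
Notation typed := (@typed D P).
Notation cls := (hom2_cls (P := P)).
Notation hk := (ca_ground hP).
Notation sdeg := (sdeg hP).
Notation hcmp := (hcomp hP).

Lemma ract_typed l v w a e : typed l v w a -> typed l [::] [::] e -> typed l v w (a ⊗ e).
Proof.
move=> ta te; rewrite -[v]cats0 -[w]cats0; apply: typed_tens => //.
by rewrite wti_nil subr0.
Qed.

Lemma ract_cls l v w a e : typed l v w a -> typed l [::] [::] e ->
  ract (cls l v w a) (cls l [::] [::] e : end1 P l) = cls l v w (a ⊗ e).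
Proof.
move=> ta te; rewrite /ract; apply: cls_eq.
rewrite -[v in eq2 _ v]cats0 -[w in eq2 _ _ w]cats0.
apply: eq2_tens; last exact: cls_repr_eq2.
by rewrite wti_nil subr0; apply: cls_repr_eq2.
Qed.

Lemma ractDl l v w (z : end1 P l) : addv (fun x : hom2 P l v w => ract x z).
Proof.
elim/cls_ind=> a ta; elim/cls_ind=> b tb; elim/cls_ind: (z) => e te.
have tab : typed l v w (a ⊕ b) by constructor.
rewrite -clsD // !ract_cls // -clsD; try exact: ract_typed.
apply: cls_rel; [exact: ract_typed| |exact: rel_tensDl].
by constructor; apply: ract_typed.
Qed.

Lemma ractDr l v w (x : hom2 P l v w) : addv (ract x).
Proof.
elim/cls_ind=> a ta; elim/cls_ind=> b tb; elim/cls_ind: (x) => e te.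
have tab : typed l [::] [::] (a ⊕ b) by constructor.
rewrite -clsD // !ract_cls // -clsD; try exact: ract_typed.
apply: cls_rel; [exact: ract_typed| |exact: rel_tensDr].
by constructor; apply: ract_typed.
Qed.

Lemma ractZr l v w c (x : hom2 P l v w) (z : end1 P l) : ract x (c *: z) = c *: ract x z.
Proof.
elim/cls_ind: z => e te; elim/cls_ind: x => a ta.
rewrite -(clsZ _ _ _ c e) !ract_cls //; last by constructor.
rewrite -clsZ; apply: cls_rel; last exact: rel_tensZr.
  by apply: ract_typed => //; constructor.
by constructor; apply: ract_typed.
Qed.

Lemma ract_id l v w (x : hom2 P l v w) : ract x (end_id P l) = x.
Proof.
elim/cls_ind: x => a ta; rewrite /end_id -clsE ract_cls //; last by constructor.
apply: cls_rel => //; last exact: rel_tens1r.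
by apply: ract_typed => //; constructor.
Qed.

Lemma ract0l l v w (z : end1 P l) : ract (0 : hom2 P l v w) z = 0.
Proof. exact/(addv0 (@ractDl _ _ _ z)). Qed.

Lemma ractA l v w (x : hom2 P l v w) (y z : end1 P l) :
  ract (ract x y) z = ract x (ract y z : end1 P l).
Proof.
elim/cls_ind: x => a ta; elim/cls_ind: y => b tb; elim/cls_ind: z => e te.
rewrite (ract_cls ta tb) (ract_cls (ract_typed ta tb) te).
rewrite (ract_cls tb te) (ract_cls ta (ract_typed tb te)).
apply: cls_rel; last exact: rel_tensA.
  exact: ract_typed (ract_typed ta tb) te.
exact: ract_typed ta (ract_typed tb te).
Qed.

Lemma homog_ract l v w m n (x : hom2 P l v w) (z : end1 P l) :
  homog m x -> homog n z -> homog (m + n) (ract x z).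
Proof.
move=> [a [ta [ha ->]]] [e [te [he ->]]]; rewrite -!clsE ract_cls //.
apply: homog_cls; rewrite -[v]cats0 -[w]cats0; apply: hdeg_tens => //.
by rewrite wti_nil subr0.
Qed.

Lemma homog_vcomp l u v w m n (x : hom2 P l v w) (y : hom2 P l u v) :
  homog m x -> homog n y -> homog (m + n) (vcomp x y).
Proof.
move=> [a [ta [ha ->]]] [e [te [he ->]]]; rewrite -!clsE vcomp_cls //.
by apply: homog_cls; apply: hdeg_comp ha he.
Qed.

Lemma cmp_hdeg l v w a x : typed l v w a -> x \in cmp hP l a -> hdeg l v w x.1 x.2.
Proof.
move=> ta; elim: ta x => {l v w a} /=;
  try by move=> *; match goal with H : is_true (_ \in _) |- _ =>
    move: H; rewrite ?inE => // /eqP -> /=; constructor end.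
- by move=> l u v w a b ta IHa tb IHb x /allpairsP[[y z] /= [hy hz ->]] /=;
    apply: hdeg_comp; eauto.
- move=> l u u' v v' a b ta IHa tb IHb x /allpairsP[[y z] /= [hy hz ->]] /=.
  by apply: hdeg_tens; [apply: IHa; rewrite (typed_src tb) | apply: IHb].
- by move=> l v w a b ta IHa tb IHb x; rewrite mem_cat => /orP[/IHa|/IHb].
- move=> l v w c a ta IHa x /allpairsP[[y z] /= [hy hz ->]] /=.
  by apply: hdeg_scale; [apply: kdec_gr | apply: IHa].
Qed.

Lemma tot_const l v w a : typed l v w a ->
  tot hP (fun _ (y : hom2 P l v w) => y) a = cls l v w a.
Proof.
suff h : typed l v w a -> forall (V : zmodType) (G : hom2 P l v w -> V), addv G ->
    tot hP (fun _ => G) a = G (cls l v w a) by move=> ta; apply: (h ta _ id).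
elim=> {l v w a} //.
- by move=> l w V G hG; rewrite /tot big_seq1.
- by move=> l w V G hG; rewrite /tot big_seq1.
- by move=> l w V G hG; rewrite /tot big_seq1.
- by move=> l w V G hG; rewrite /tot big_seq1.
- by move=> l i j V G hG; rewrite /tot big_seq1.
- by move=> l i j h V G hG; rewrite /tot big_seq1.
- move=> l u v w a b ta IHa tb IHb V G hG; rewrite (tot_comp hP _ ta tb).
  transitivity (tot hP (fun _ x => G (vcomp x (cls l u v b))) a).
    apply: tot_ext => p x; rewrite (IHb _ (fun y => G (vcomp x y))) // => y z.
    by rewrite vcompDr hG.
  rewrite (IHa _ (fun x => G (vcomp x (cls l u v b)))) ?vcomp_cls // => x y.
  by rewrite vcompDl hG.
- move=> l u u' v v' a b ta IHa tb IHb V G hG; rewrite (tot_tens hP _ ta tb).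
  transitivity (tot hP (fun _ x => G (htens x (cls l v v' b))) a).
    apply: tot_ext => p x; rewrite (IHb _ (fun y => G (htens x y))) // => y z.
    by rewrite htensDr hG.
  rewrite (IHa _ (fun x => G (htens x (cls l v v' b)))) ?htens_cls // => x y.
  by rewrite htensDl hG.
- by move=> l v w V G hG; rewrite /tot big_nil cls0 addv0.
- by move=> l v w a b ta IHa tb IHb V G hG; rewrite tot_add IHa // IHb // clsD // hG.
- move=> l v w c a ta IHa V G hG; rewrite tot_scale clsZ.
  rewrite (kglue_ext _ (g' := fun _ c' => G (c' *: cls l v w a))) => [|n x].
    by rewrite kglue_const // => x y; rewrite scalerDl hG.
  by rewrite (IHa _ (fun y => G (x *: y))) // => y z; rewrite scalerDr hG.
Qed.

Lemma homog_hcomp l v w n (x : hom2 P l v w) : homog n (hcmp n x).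
Proof.
rewrite /hcomp /tot big_seq; apply: homog_sum => // y hy; case: eqP => [<-|_].
  exact/homog_cls/cmp_hdeg/hy/typed_repr.
exact: homog0.
Qed.

Lemma hcomp_sum l v w (x : hom2 P l v w) : exists s : seq int,
  [/\ uniq s, x = \sum_(n <- s) hcmp n x & forall n, n \notin s -> hcmp n x = 0].
Proof.
exists (undup [seq y.1 | y <- cmp hP l (sval (repr x))]); split.
- exact: undup_uniq.
- rewrite /hcomp /tot exchange_big /= -{1}(cls_repr x) -(tot_const (typed_repr x)).
  rewrite /tot big_seq [RHS]big_seq; apply: eq_bigr => y hy.
  rewrite (bigD1_seq y.1) /= ?undup_uniq ?mem_undup ?map_f // eqxx.
  by rewrite big1 ?addr0 // => n /negPf; rewrite eq_sym => ->.
- move=> n; rewrite mem_undup => hn; rewrite /hcomp /tot big1_seq // => y /andP[_ hy].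
  by case: eqP => // e; move: hn; rewrite -e map_f.
Qed.

Lemma sdeg_homog l v w n a : sdeg l v w n a -> homog n (cls l v w a).
Proof.
move=> [ta h]; rewrite (_ : cls l v w a = hcmp n (cls l v w a)); first exact: homog_hcomp.
by rewrite (hcomp_cls hD) // h ?eqxx //; apply: addf_hcomp.
Qed.

Lemma hcomp_ract l v w m n (x : hom2 P l v w) (z : end1 P l) :
  homog m x -> hcmp n (ract x z) = ract x (hcmp (n - m) z : end1 P l).
Proof.
move=> hx; have [s [us e hs]] := hcomp_sum z.
rewrite {1}e (addv_sum _ _ _ (@ractDr _ _ _ x)) (addv_sum _ _ _ (hcompD hD hP n)).
rewrite (eq_bigr (fun q => if q == n - m then ract x (hcmp q z : end1 P l) else 0)).
  case: (boolP (n - m \in s)) => h.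
    by rewrite (bigD1_seq (n - m)) //= eqxx big1 ?addr0 // => q /negPf ->.
  rewrite hs // (addv0 (@ractDr _ _ _ x)) big1_seq // => q /andP[_ h'].
  by case: eqP => // e'; rewrite -e' h' in h.
move=> q _; rewrite (hcomp_homog hD hP _ (homog_ract hx (homog_hcomp q z))).
have -> : (m + q == n) = (q == n - m) by lia.
by [].
Qed.
End RightAction.

Section RankInvariance.
Variables (D : satake_data) (hD : satake_axioms D).
Variables (P : structure_consts D) (hP : const_axioms P).
Variables (C : nd_choices D) (hnd : non_degenerate P C).
Notation I := (idx D).
Notation wt := (iw_lattice D).
Notation k := (kk P).
Implicit Types (i j : I) (l : wt) (u v w : seq I).
Notation hk := (ca_ground hP).
Notation sdeg := (sdeg hP).
Notation hcomp := (hcomp hP).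
Notation kdec := (kdec hk).
Local Notation one l := (end_id P l).

Lemma homog_cast l v w (n m : int) (x : hom2 P l v w) : homog n x -> n = m -> homog m x.
Proof. by move=> h <-. Qed.

Lemma homog_id l : homog 0 (one l).
Proof.
exists (TId [::]), (typed_id P l [::]); split=> //; constructor.
Qed.

Lemma homog_beta_end l i (n : nat) : homog (2 * (dd i)%:Z * n%:Z) (beta_end P l i n).
Proof.
apply: homog_cast (sdeg_homog hD (sdeg_beta hD hP l i _)) _; lia.
Qed.

Lemma homog_bubbles l (s : seq (bubble_index C)) :
  homog (\sum_(x <- s) 2 * (dd (val x).1)%:Z * (val x).2%:Z)
    (\big[@vcomp D P l [::] [::] [::]/one l]_(x <- s) beta_end P l (val x).1 (val x).2).
Proof.
elim: s => [|x s IH]; first by rewrite !big_nil; apply: homog_id.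
by rewrite !big_cons; apply: homog_vcomp IH; apply: homog_beta_end.
Qed.

Lemma bubbles_deg (s : seq (bubble_index C)) :
  0 <= \sum_(x <- s) 2 * (dd (val x).1)%:Z * (val x).2%:Z :> int /\
  (\sum_(x <- s) 2 * (dd (val x).1)%:Z * (val x).2%:Z = 0 :> int -> s = [::]).
Proof.
elim: s => [|x s [h0 _]]; first by rewrite big_nil.
rewrite big_cons; have h1 : 0 < 2 * (dd (val x).1)%:Z * (val x).2%:Z :> int.
  have /andP[n0 _] := valP x.
  by rewrite !mulr_gt0 // ltz_nat ?(sat_d hD).
move: h0 h1; set S := \sum_(y <- s) _; move: (2 * _ * _) => a h0 h1.
by split=> [|h]; lia.
Qed.

(* a scalar multiple of a homogeneous element has nothing below its degree, and
   only the degree 0 part of the scalar at its degree *)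
Lemma hcomp_scale l v w c (e n : int) (x : hom2 P l v w) : homog e x -> n <= e ->
  hcomp n (c *: x) = if n == e then (kdec c)`_0 *: x else 0.
Proof.
move=> hx le; rewrite {1}(kdec_sum hk c) scaler_suml (addv_sum _ _ _ (hcompD hD hP n)).
have E (q : nat) : hcomp n ((kdec c)`_q *: x) =
    if (q == 0%N) && (n == e) then (kdec c)`_0 *: x else 0.
  rewrite (hcomp_homog hD hP _ (homogZ (kdec_gr hk c q) hx)).
  case: q => [|q] /=; first by rewrite add0r eq_sym.
  by case: eqP => // h; lia.
rewrite (eq_bigr _ (fun (q : 'I_(size (kdec c))) _ => E q)).
case: (size (kdec c)) (kdec_sum hk c) (@nth_default _ (0:k) (kdec c)) => [|s] _ nd.
  by rewrite big_ord0 nd ?scale0r ?if_same // -[size _]/(size (kdec c)) leqn0.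
by rewrite big_ord_recl /= big1 ?addr0.
Qed.

Lemma end_low l (n : int) (z : end1 P l) : homog n z -> n <= 0 ->
  exists c : k, z = c *: one l /\ (n < 0 -> z = 0).
Proof.
move=> hz n0; have [hi hs] := nd_end hnd l; have [s [c [us e]]] := hs z.
pose c0 (m : {mset bubble_index C}%mset) : k :=
  if (enum_mset m == [::]) && (n == 0) then (kdec (c m))`_0 else 0.
exists (\sum_(m <- s) c0 m); suff e' : z = (\sum_(m <- s) c0 m) *: one l.
  split=> // h; rewrite e' big1 ?scale0r // => m _; rewrite /c0.
  by rewrite (lt_eqF h) andbF.
have -> : z = hcomp n z by rewrite (hcomp_homog hD hP _ hz) eqxx.
rewrite {1}e (addv_sum _ _ _ (hcompD hD hP n)) scaler_suml; apply: eq_bigr => m _.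
have [d0 d1] := bubbles_deg (enum_mset m).
rewrite (hcomp_scale (c m) (homog_bubbles l (enum_mset m))); last exact: le_trans d0.
rewrite /c0; case: (eqVneq (enum_mset m) [::]) => [E|ne] /=.
  by rewrite /bubble_monomial E !big_nil; case: eqP; rewrite ?scale0r.
rewrite scale0r; case: eqP => // E.
case/eqP: ne; apply: d1; apply/eqP; rewrite eq_le d0 andbT -E //.
Qed.

Lemma end_inj l (c : k) : c *: one l = 0 -> c = 0.
Proof.
move=> h; have [hi _] := nd_end hnd l.
apply: (hi [:: mset0] (fun=> c) isT _ mset0); last by rewrite inE.
rewrite big_seq1 /bubble_monomial.
have -> : enum_mset (mset0 : {mset bubble_index C}%mset) = [::].
  by apply/eqP; rewrite -size_eq0 -/(size_mset _) size_mset0.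
by rewrite big_nil.
Qed.

Section TwoBases.
Variables (l : wt) (v w : seq I).
Notation H := (hom2 P l v w).
Notation act := (@ract D P l v w).

Section OneBasis.
Variables (K : choiceType) (b : K -> H) (deg : K -> int).
Hypotheses (hb : is_basis act b) (hdg : forall x, homog (deg x) (b x)).
Notation co := (coord hb).

Lemma coord_homog (h : H) d x : homog d h -> homog (d - deg x) (co h x : end1 P l).
Proof.
move=> hh; have [s [us e hs]] := coordP hb h.
rewrite (_ : co h x = hcomp (d - deg x) (co h x : end1 P l)).
  exact: homog_hcomp.
apply: (coord_uniq (@ractDr D P l v w) hb us
  (c := fun x => hcomp (d - deg x) (co h x : end1 P l))).
  have {1}-> : h = hcomp d h by rewrite (hcomp_homog hD hP _ hh) eqxx.
  rewrite {1}e (addv_sum _ _ _ (hcompD hD hP d)); apply: eq_bigr => y _.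
  by rewrite (hcomp_ract hD _ _ _ (hdg y)).
by move=> y /hs ->; apply: hcomp0.
Qed.

Lemma coord_ract (h : H) (z : end1 P l) x :
  co (ract h z) x = ract (co h x : end1 P l) z.
Proof.
have [s [us e hs]] := coordP hb h.
apply: (coord_uniq (@ractDr D P l v w) hb us (c := fun x => ract (co h x : end1 P l) z)).
  rewrite {1}e (addv_sum (g := fun x => ract x z)); last exact: ractDl.
  by apply: eq_bigr => y _; rewrite ractA.
by move=> y /hs ->; apply: ract0l.
Qed.

End OneBasis.

Variables (K K' : choiceType) (b : K -> H) (b' : K' -> H).
Variables (deg : K -> int) (deg' : K' -> int).
Hypotheses (hb : is_basis act b) (hdg : forall x, homog (deg x) (b x)).
Hypotheses (hb' : is_basis act b') (hdg' : forall x, homog (deg' x) (b' x)).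

(** Modulo positive degrees a change of homogeneous bases is block diagonal,
    with blocks over the ground ring, so each block is square. *)
Lemma rank_le (d : int) (s : seq K) (s' : seq K') :
  uniq s -> (forall x, (x \in s) = (deg x == d)) ->
  uniq s' -> (forall x, (x \in s') = (deg' x == d)) -> (size s' <= size s)%N.
Proof.
move=> us hs us' hs'.
case: (posnP (size s')) => [-> //|p0].
have x0 : K' by move: p0; case: (s') => // x.
pose M x y : end1 P l := coord hb' (b y) x.
pose N y x : end1 P l := coord hb (b' x) y.
have hM x y : homog (deg y - deg' x) (M x y) by apply: coord_homog.
have hN y x : homog (deg' x - deg y) (N y x) by apply: coord_homog.
have key x x1 : deg' x = d -> deg' x1 = d ->
    \sum_(y <- s) ract (M x y) (N y x1) = if x == x1 then one l else 0.
  move=> ex ex1; rewrite -(coord_one (@ractDr D P l v w) hb' x1 x (one l)) ract_id.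
  have [t [ut e ht]] := coordP hb (b' x1).
  rewrite [in RHS]e (addv_sum (g := (coord hb')^~ x)); last exact: coordD (@ractDr D P l v w) _ _.
  under [RHS]eq_bigr do rewrite coord_ract.
  pose F y := ract (M x y) (N y x1).
  rewrite -/(\sum_(y <- t) F y) -/(\sum_(y <- s) F y).
  pose r := undup (s ++ t).
  have ur : uniq r by apply: undup_uniq.
  have sup (q : seq K) : uniq q -> {subset q <= r} -> (forall y, y \notin q -> F y = 0) ->
      \sum_(y <- q) F y = \sum_(y <- r) F y.
    move=> uq qr hq; rewrite (bigID (fun y => y \in q) predT (r := r)) /=.
    rewrite [X in _ = _ + X]big1 ?addr0; last by move=> y /hq.
    rewrite -[RHS]big_filter; apply: perm_big; apply: uniq_perm; rewrite ?filter_uniq //.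
    by move=> y; rewrite mem_filter; case: (boolP (y \in q)) => [/qr ->|].
  rewrite (sup s) //; first (rewrite (sup t) //).
  - by move=> y hy; rewrite mem_undup mem_cat hy orbT.
  - by move=> y /ht h; rewrite /F /N h (addv0 (@ractDr _ _ _ _ _ _)).
  - by move=> y hy; rewrite mem_undup mem_cat hy.
  move=> y; rewrite hs => ne; have := hM x y; have := hN y x1; rewrite ex ex1.
  case: (ltgtP (deg y) d) => [lt|lt|eq]; last by rewrite eq eqxx in ne.
    move=> _ h; have [|_ [_ z]] := end_low h; first lia.
    by rewrite /F z ?ract0l //; lia.
  move=> h _; have [|_ [_ z]] := end_low h; first lia.
  by rewrite /F z ?(addv0 (@ractDr _ _ _ _ _ _)) //; lia.
have scal (z : end1 P l) : exists c : k, homog 0 z -> z = c *: one l.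
  case: (pselect (homog 0 z)) => [h|]; last by exists 0.
  by have [c [e _]] := end_low h (lexx _); exists c.
pose sc (z : end1 P l) := sval (cid (scal z)).
have scE (z : end1 P l) : homog 0 z -> z = sc z *: one l by rewrite /sc; case: cid.
have y0 : K.
  case: (s) (key (nth x0 s' 0) (nth x0 s' 0)) => [h|y //]; exfalso.
  have e : deg' (nth x0 s' 0) = d by apply/eqP; rewrite -hs' mem_nth.
  have := h e e; rewrite big_nil eqxx => h0.
  by have := @end_inj l 1; rewrite scale1r -h0 => /(_ erefl) /eqP; rewrite oner_eq0.
pose A := \matrix_(i < size s', j < size s) sc (M (nth x0 s' i) (nth y0 s j)).
pose B := \matrix_(j < size s, i < size s') sc (N (nth y0 s j) (nth x0 s' i)).
suff : A *m B = 1%:M by apply: mulmx1_min.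
have ds' (q : nat) : (q < size s')%N -> deg' (nth x0 s' q) = d.
  by move=> h; apply/eqP; rewrite -hs' mem_nth.
have ds (q : nat) : (q < size s)%N -> deg (nth y0 s q) = d.
  by move=> h; apply/eqP; rewrite -hs mem_nth.
apply/matrixP => i j; rewrite !mxE; apply/eqP; rewrite -subr_eq0; apply/eqP.
apply: (@end_inj l); rewrite scalerBl scaler_suml.
have := key _ _ (ds' i (ltn_ord i)) (ds' j (ltn_ord j)).
rewrite nth_uniq // -(inj_eq val_inj) => e.
have -> : (i == j)%:R *: one l = if (i : nat) == j then one l else 0.
  by rewrite -val_eqE /=; case: eqP; rewrite ?scale1r ?scale0r.
rewrite -e (big_nth y0) big_mkord -sumrB big1 // => q _; rewrite !mxE.
rewrite [in X in _ - X](scE (M _ _)); last first.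
  by apply: homog_cast (hM _ _) _; rewrite ds // ds' // subrr.
rewrite [in X in _ - X](scE (N _ _)); last first.
  by apply: homog_cast (hN _ _) _; rewrite ds // ds' // subrr.
by rewrite ractZr ract_id scalerA mulrC subrr.
Qed.
End TwoBases.

Lemma graded_rank_uniq l v w (m m' : int -> nat) :
  graded_rank P l v w m -> graded_rank P l v w m' -> m =1 m'.
Proof.
move=> [K [b [deg [hb hd _ hs]]]] [K' [b' [deg' [hb' hd' _ hs']]]] d.
have [s [us <- e]] := hs d; have [s' [us' <- e']] := hs' d.
apply/eqP; rewrite eqn_leq.
by rewrite (rank_le hb hd hb' hd' us e us' e') (rank_le hb' hd' hb hd us' e' us e).
Qed.

(** There are no nonzero 2-morphisms between words of lengths of different parity. *)
Lemma graded_rank_odd l v w :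
  odd (size v) != odd (size w) -> graded_rank P l v w (fun=> 0%N).
Proof.
move=> h; have z (x : hom2 P l v w) : x = 0.
  by elim/cls_ind: x => a ta; apply: (typed_mismatch hD ta); rewrite h orbT.
exists void, (@of_void _), (@of_void _); split.
- by split=> [s c _ _ []|x]; exists [::], (fun=> 0); split=> //; rewrite big_nil.
- by case.
- by exists 0 => -[].
- by move=> d; exists [::]; split=> // -[].
Qed.
End RankInvariance.

(** * The modified form and its bar involution *)

Section QuantumAlgebra.
Variables (D : satake_data) (hD : satake_axioms D).
Notation I := (idx D).
Notation U := (Uq D).
Notation X := (wlat D).
Notation wt := (iw_lattice D).
Implicit Types (i j : I) (x y z : X) (l : wt) (u v : U).
Notation K h := (ucls (UK h : uexp D)).
Notation E i := (ucls (UE i : uexp D)).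
Notation F i := (ucls (UF i : uexp D)).
Notation sc := (uscal D).

Lemma ucls_mul (a b : uexp D) : ucls (UMul a b) = ucls a * ucls b.
Proof. by rewrite -umulE. Qed.

Lemma ucls_add (a b : uexp D) : ucls (UAdd a b) = ucls a + ucls b.
Proof. by rewrite -uaddE. Qed.

Lemma sc_comm c u : sc c * u = u * sc c. Proof. exact: umulC1. Qed.

Lemma scM c d : sc (c * d) = sc c * sc d.
Proof. by rewrite /uscal -ucls_mul; apply/uclsP/ueq_CM. Qed.

Lemma scD c d : sc (c + d) = sc c + sc d. Proof. exact: uscalD. Qed.
Lemma sc1 : sc 1 = 1. Proof. by []. Qed.
Lemma sc0 : sc 0 = 0. Proof. by []. Qed.

Lemma scN c : sc (- c) = - sc c.
Proof. by apply: (addrI (sc c)); rewrite -scD !subrr sc0. Qed.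

Lemma scB c d : sc (c - d) = sc c - sc d.
Proof. by rewrite scD scN. Qed.

Lemma ucls_sub (a b : uexp D) : ucls (usub a b) = ucls a - ucls b.
Proof. by rewrite /usub ucls_add ucls_mul -[ucls (UC _)]/(sc _) scN sc1 mulN1r. Qed.

Lemma K0 : K 0 = 1. Proof. by apply/uclsP/ueq_K0. Qed.
Lemma KD h h' : K (h + h') = K h * K h'.
Proof. by rewrite -ucls_mul; apply/uclsP/ueq_KD. Qed.
Lemma KC h h' : K h * K h' = K h' * K h.
Proof. by rewrite -!KD addrC. Qed.

Lemma qq_neq0 : qq != 0.
Proof. by rewrite /qq tofrac_eq0 polyX_eq0. Qed.

Lemma qqD (m n : int) : qq ^ (m + n) = qq ^ m * qq ^ n.
Proof. by rewrite expfzDr ?qq_neq0. Qed.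

Lemma qq_inj (m n : int) : qq ^ m = qq ^ n -> m = n.
Proof.
wlog le : m n / m <= n.
  by move=> h; case: (leP m n) => [/h//|/ltW /h h'] /esym/h' ->.
have [p ->] : exists p : nat, n = m + p%:Z by exists `|(n - m)%R|%N; lia.
rewrite qqD -[X in X = _]mulr1 => /(mulfI _) h.
have : qq ^ p = 1 by apply/esym/h; rewrite expfz_neq0 ?qq_neq0.
rewrite -exprnP /qq -tofracXn -tofrac1 => /eqP; rewrite tofrac_eq => /eqP e.
have := congr1 (fun p : {poly rat} => size p) e.
by rewrite size_polyXn size_poly1 => -[->]; rewrite addr0.
Qed.

Lemma ev_nondeg x : (forall h : clat D, ev h x = 0) -> x = 0.
Proof.
move=> h0; have [Kx [bX [bY [[_ hX] _ hd]]]] := sat_perfect hD.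
have [s [c [us e]]] := hX x.
have ev_sum (h : clat D) (r : seq Kx) (f : Kx -> X) :
    ev h (\sum_(k <- r) f k) = \sum_(k <- r) ev h (f k).
  elim: r => [|k r IH]; rewrite ?big_nil ?big_cons ?(ev0r hD) //.
  by rewrite (sat_evDr hD) IH.
have evMz (h : clat D) y (n : int) : ev h (y *~ n) = ev h y * n.
  have evn (m : nat) : ev h (y *+ m) = ev h y * m%:Z.
    elim: m => [|m IH]; first by rewrite mulr0n (ev0r hD) mulr0.
    by rewrite mulrS (sat_evDr hD) IH -addn1 PoszD mulrDr mulr1 addrC.
  case: n => m; first exact: evn.
  by rewrite NegzE mulrNz (evNr hD) [y *~ _]/(y *+ _) evn mulrN.
rewrite e big1_seq // => k /andP[_ hk].
have := h0 (bY k); rewrite e ev_sum (bigD1_seq k) //= big1 => [|k' nk].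
  by rewrite addr0 evMz hd eqxx mul1r => ->; rewrite mulr0z.
by rewrite evMz hd eq_sym (negPf nk) mul0r.
Qed.

Lemma weightM x y u v : has_weight x u -> has_weight y v -> has_weight (x + y) (u * v).
Proof.
move=> hu hv h; rewrite mulrA hu -!mulrA hv (sat_evDr hD) qqD scM.
by rewrite !mulrA; congr (_ * _ * _); rewrite -!mulrA; congr (_ * _); apply/esym/sc_comm.
Qed.

Lemma weightD x u v : has_weight x u -> has_weight x v -> has_weight x (u + v).
Proof. by move=> hu hv h; rewrite mulrDr hu hv mulrDr mulrDl. Qed.

Lemma weight0 x : has_weight x (0 : U).
Proof. by move=> h; rewrite mulr0 mulr0 mul0r. Qed.

Lemma weight_sc c : has_weight 0 (sc c).
Proof. by move=> h; rewrite (ev0r hD) expr0z sc1 mul1r sc_comm. Qed.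

Lemma weight_K h : has_weight 0 (K h).
Proof. by move=> h'; rewrite (ev0r hD) expr0z sc1 mul1r KC. Qed.

Lemma weight_E i : has_weight (sroot i) (E i).
Proof.
move=> h; rewrite /uscal -!ucls_mul; apply/uclsP.
apply: ueq_trans (ueq_KE h i) _; exact: ueq_mulA.
Qed.

Lemma weight_F i : has_weight (- sroot i) (F i).
Proof.
move=> h; rewrite (evNr hD) /uscal -!ucls_mul; apply/uclsP.
apply: ueq_trans (ueq_KF h i) _; exact: ueq_mulA.
Qed.

(** Sums of elements whose weights have the same image in [X^iota]. *)
Definition wsum l u := exists (s : seq X) (f : X -> U),
  [/\ uniq s, u = \sum_(x <- s) f x, forall x, has_weight x (f x),
      forall x, x \notin s -> f x = 0 & forall x, x \in s -> iw x = l].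

Lemma wsum0 l : wsum l 0.
Proof. by exists [::], (fun=> 0); split; rewrite ?big_nil // => x; apply: weight0. Qed.

Lemma wsum1 x u : has_weight x u -> wsum (iw x) u.
Proof.
move=> hu; exists [:: x], (fun y => if y == x then u else 0); split=> //.
- by rewrite big_seq1 eqxx.
- by move=> y; case: eqP => [->|_] //; apply: weight0.
- by move=> y; rewrite inE => /negPf ->.
- by move=> y; rewrite inE => /eqP ->.
Qed.

Lemma wsumD l u v : wsum l u -> wsum l v -> wsum l (u + v).
Proof.
move=> [s [f [us -> hf nf hs]]] [t [g [ut -> hg ng ht]]].
have ext (r q : seq X) (p : X -> U) : uniq r -> uniq q -> {subset r <= q} ->
    (forall x, x \notin r -> p x = 0) -> \sum_(x <- r) p x = \sum_(x <- q) p x.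
  move=> ur uq rq hp; rewrite (bigID (fun y => y \in r) predT (r := q)) /=.
  rewrite [X in _ = _ + X]big1 ?addr0; last by move=> y /hp.
  rewrite -[RHS]big_filter; apply: perm_big; apply: uniq_perm; rewrite ?filter_uniq //.
  by move=> y; rewrite mem_filter; case: (boolP (y \in r)) => [/rq ->|].
exists (undup (s ++ t)), (fun x => f x + g x); split.
- exact: undup_uniq.
- rewrite big_split /=; congr (_ + _); apply: ext; rewrite ?undup_uniq //;
    by move=> x hx; rewrite mem_undup mem_cat hx ?orbT.
- by move=> x; apply: weightD.
- by move=> x; rewrite mem_undup mem_cat negb_or => /andP[/nf -> /ng ->]; rewrite addr0.
- by move=> x; rewrite mem_undup mem_cat => /orP[/hs|/ht].
Qed.

Lemma wsum_sum l (T : Type) (s : seq T) (G : T -> U) :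
  (forall t, wsum l (G t)) -> wsum l (\sum_(t <- s) G t).
Proof.
by move=> h; apply: big_ind => //; [apply: wsum0 | move=> *; apply: wsumD].
Qed.

Lemma wsumM l l' u v : wsum l u -> wsum l' v -> wsum (l + l') (u * v).
Proof.
move=> [s [f [us -> hf nf hs]]] [t [g [ut -> hg ng ht]]].
rewrite mulr_suml; apply: wsum_sum => x; rewrite mulr_sumr; apply: wsum_sum => y.
case: (boolP (x \in s)) => [/hs <-|/nf ->]; last by rewrite mul0r; apply: wsum0.
case: (boolP (y \in t)) => [/ht <-|/ng ->]; last by rewrite mulr0; apply: wsum0.
by rewrite -iwD; apply/wsum1/weightM.
Qed.

Lemma bgenE i : bgen i = F i + sc (qi i ^ vsig i) * (E (tau i) * ucls (kinv i)).
Proof. by rewrite /bgen ucls_add !ucls_mul. Qed.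

Lemma wsum_b i : wsum (- iw (sroot i)) (bgen i).
Proof.
rewrite bgenE; apply: wsumD.
  rewrite (_ : - iw (sroot i) = iw (- sroot i)); first exact/wsum1/weight_F.
  by rewrite -[in RHS]sub0r iwB iw0 sub0r.
rewrite -(iw_tau hD) -[sroot _]add0r -[sroot _]addr0.
by apply/wsum1/weightM; [exact: weight_sc | apply: weightM; [exact: weight_E|exact: weight_K]].
Qed.

Lemma bword_cons i (w : seq I) : bword (i :: w) = bgen i * bword w.
Proof. by rewrite /bword big_cons. Qed.

Lemma bword_cat (w w' : seq I) : bword (w ++ w') = bword w * bword w'.
Proof. by rewrite /bword big_cat. Qed.

Lemma wsum_bword (w : seq I) : wsum (- wti w) (bword w).
Proof.
elim: w => [|i w IH].
  by rewrite wti_nil oppr0 /bword big_nil -iw0 -sc1; apply/wsum1/weight_sc.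
by rewrite bword_cons wti_cons opprD; apply: wsumM => //; apply: wsum_b.
Qed.

Lemma in_Ui_bword (w : seq I) : in_Ui (bword w).
Proof.
elim: w => [|i w IH]; first by rewrite /bword big_nil -sc1; constructor.
by rewrite bword_cons; constructor => //; constructor.
Qed.

Section Blocks.
Variables x y : X.
Notation G := (block_gen (D := D) x y).

Lemma zspan_sc c u : zspan G u -> zspan G (sc c * u).
Proof.
elim=> [|a b _ ha _ hb|a [h [v [->|->]]]].
- by rewrite mulr0; apply: zspan0.
- by rewrite mulrBr; apply: zspanB.
- apply: zspan_gen; exists h, (sc c * v); left.
  by rewrite !mulrA; congr (_ * _); apply: sc_comm.
- by apply: zspan_gen; exists h, (sc c * v); right; rewrite mulrA.
Qed.

Lemma block_weight z u : has_weight z u -> z != x - y -> zpi G u = 0.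
Proof.
move=> hu ne; have [h hne] : exists h : clat D, ev h x - ev h y - ev h z != 0.
  apply: contrapT => hn; case/eqP: ne; apply/esym/eqP; rewrite -subr_eq0; apply/eqP.
  apply: ev_nondeg => h; rewrite !(evBr hD).
  by apply: contrapT => h1; apply: hn; exists h; apply/eqP.
pose c := qq ^ ev h x - qq ^ (ev h z + ev h y).
have nc : c != 0.
  rewrite subr_eq0; apply: contra hne => /eqP /qq_inj ->; apply/eqP; lia.
rewrite -(zpi0 G); apply/zpi_eqP; rewrite subr0.
have <- : sc c^-1 * (sc c * u) = u by rewrite mulrA -scM mulVf // sc1 mul1r.
apply: zspan_sc; rewrite /c scB mulrBl.
have -> : sc (qq ^ ev h x) * u - sc (qq ^ (ev h z + ev h y)) * u =
   sc (qq ^ ev h z) * (u * (K h - sc (qq ^ ev h y))) - (K h - sc (qq ^ ev h x)) * u.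
  rewrite mulrBr mulrBr mulrBl (mulrA _ u) -hu -(sc_comm _ u) mulrA -scM -qqD opprB.
  by rewrite [RHS]addrC addrA subrK.
apply: zspanB; last by apply: zspan_gen; exists h, u; left.
by apply/zspan_sc/zspan_gen; exists h, u; right.
Qed.
End Blocks.
End QuantumAlgebra.

Section BarInvolution.
Variables (D : satake_data) (hD : satake_axioms D).
Notation I := (idx D).
Notation U := (Uq D).
Notation X := (wlat D).
Notation wt := (iw_lattice D).
Implicit Types (i j : I) (x y z : X) (l : wt) (u v : U).
Notation K h := (ucls (UK h : uexp D)).
Notation sc := (uscal D).
Notation G x y := (block_gen (D := D) x y).

Lemma zspan_block_mulr x y z u v : zspan (G x z) u -> has_weight (z - y) v ->
  zspan (G x y) (u * v).
Proof.
move=> hu hv; elim: hu => [|a b _ ha _ hb|a [h [w [->|->]]]].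
- by rewrite mul0r; apply: zspan0.
- by rewrite mulrBl; apply: zspanB.
- by apply: zspan_gen; exists h, (w * v); left; rewrite mulrA.
- apply: zspan_gen; exists h, (sc (qq ^ ev h (z - y)) * (w * v)); right.
  have -> : qq ^ ev h z = qq ^ ev h (z - y) * qq ^ ev h y.
    by rewrite -qqD -(sat_evDr hD) subrK.
  set c := qq ^ _; rewrite -mulrA mulrBl hv -/c scM !mulrBr -!mulrA -(sc_comm _ v).
  by rewrite !(mulrA w (sc c)) -!(sc_comm c w) -!mulrA.
Qed.

Lemma zspan_block_mull x y z u v : zspan (G z y) v -> has_weight (x - z) u ->
  zspan (G x y) (u * v).
Proof.
move=> hv hu; elim: hv => [|a b _ ha _ hb|a [h [w [->|->]]]].
- by rewrite mulr0; apply: zspan0.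
- by rewrite mulrBr; apply: zspanB.
- pose c := qq ^ ev h (x - z).
  have -> : u * ((K h - sc (qq ^ ev h z)) * w) =
      sc c^-1 * ((K h - sc (qq ^ ev h x)) * (u * w)).
    have -> : qq ^ ev h x = c * qq ^ ev h z by rewrite /c -qqD -(sat_evDr hD) subrK.
    have cu : sc c^-1 * sc c = 1.
      by rewrite -scM mulVf ?sc1 // expfz_neq0 ?qq_neq0.
    rewrite !mulrBl mulrBr mulrBr (mulrA (K h)) hu -/c scM !mulrA cu mul1r.
    by rewrite mul1r -(sc_comm _ u).
  by apply/zspan_sc/zspan_gen; exists h, (u * w); left.
- by apply: zspan_gen; exists h, (u * w); right; rewrite mulrA.
Qed.

Lemma block_liftP x y u : has_weight (x - y) u ->
  has_weight (x - y) (block_lift (zpi (G x y) u)) /\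
  zpi (G x y) (block_lift (zpi (G x y) u)) = zpi (G x y) u.
Proof. by move=> hu; rewrite /block_lift; case: xgetP => [a _ []//|/(_ u) /= []]. Qed.

(** The product of [1_x u 1_z] and [1_z v 1_y] is [1_x u v 1_y] for weight vectors. *)
Lemma block_mul x y z u v : has_weight (x - z) u -> has_weight (z - y) v ->
  zpi (G x y) (block_lift (zpi (G x z) u) * block_lift (zpi (G z y) v)) =
  zpi (G x y) (u * v).
Proof.
move=> hu hv; have [lu eu] := block_liftP hu; have [lv ev] := block_liftP hv.
set a := block_lift _ in lu eu *; set b := block_lift _ in lv ev *.
have -> : a * b = (a - u) * b + u * (b - v) + u * v.
  by rewrite mulrBl mulrBr addrA subrK subrK.
rewrite 2!zpiD.
have -> : zpi (G x y) ((a - u) * b) = 0.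
  rewrite -(zpi0 (G x y)); apply/zpi_eqP; rewrite subr0.
  by apply: zspan_block_mulr lv; apply/zpi_eqP.
have -> : zpi (G x y) (u * (b - v)) = 0.
  rewrite -(zpi0 (G x y)); apply/zpi_eqP; rewrite subr0.
  by apply: zspan_block_mull hu; apply/zpi_eqP.
by rewrite !add0r.
Qed.

Lemma zpi_sum x y (T : Type) (s : seq T) (f : T -> U) :
  zpi (G x y) (\sum_(t <- s) f t) = \sum_(t <- s) zpi (G x y) (f t).
Proof.
by elim: s => [|t s IH]; rewrite ?big_nil ?zpi0 // !big_cons zpiD IH.
Qed.

(* [1_x u 1_y] only sees the component of [u] of weight [x - y] *)
Lemma zpi_component x y (s : seq X) (f : X -> U) : uniq s ->
  (forall t, has_weight t (f t)) -> (forall t, t \notin s -> f t = 0) ->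
  zpi (G x y) (\sum_(t <- s) f t) = zpi (G x y) (f (x - y)).
Proof.
move=> us hf nf; rewrite zpi_sum; case: (boolP (x - y \in s)) => h.
  rewrite (bigD1_seq (x - y)) //= big1 ?addr0 // => t ne.
  exact: (block_weight hD (hf t)).
rewrite nf // zpi0 big1_seq // => t /andP[_ ht]; apply: (block_weight hD (hf t)).
by apply: contraNneq h => <-.
Qed.

Lemma m_right_mul l l' u v : wsum l' v ->
  (exists l'', wsum l'' u) ->
  mmul (m_right u (l + l')) (m_right v l) = m_right (u * v) l.
Proof.
move=> [t [g [ut ev hg ng ht]]] [l'' [s [f [us eu hf nf _]]]].
apply: functional_extensionality_dep => x; apply: functional_extensionality_dep => y.
rewrite /mmul [in RHS]/m_right; case: (iw y =P l) => [ey|ney]; last first.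
  apply: fsbig1 => z _; rewrite [m_right v l z y]/m_right; case: (iw y =P l) => // _.
  have mu : exists a, m_right u (l + l') x z = zpi (G x z) a /\ has_weight (x - z) a.
    rewrite /m_right; case: (iw z =P _) => _; last by exists 0; rewrite zpi0; split=> //; apply: weight0.
    by exists (f (x - z)); rewrite {1}eu zpi_component.
  case: mu => a [-> ha]; rewrite -(zpi0 (G z y)) block_mul ?mulr0 ?zpi0 //.
  exact: weight0.
have term z : zpi (G x y) (block_lift (m_right u (l + l') x z) * block_lift (m_right v l z y))
    = zpi (G x y) (f (x - z) * g (z - y)).
  rewrite [m_right v l z y]/m_right ey eqxx {1}ev zpi_component // /m_right.
  case: (iw z =P _) => [_|ne]; first by rewrite {1}eu zpi_component // block_mul.
  have -> : g (z - y) = 0.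
    apply: ng; apply/negP => /ht h; apply: ne.
    by rewrite -ey -h -iwD addrC subrK.
  rewrite -(zpi0 (G x z)) block_mul ?mul0r ?mulr0 //; exact: weight0.
under eq_fsbigr do rewrite term.
rewrite -(@fsbig_widen _ _ _ _ [set` [seq y + r | r <- t]]%classic) //; last first.
  move=> z /= [_ nz]; rewrite ng ?mulr0 ?zpi0 //; apply/negP => h; apply: nz.
  by apply/mapP; exists (z - y) => //; rewrite addrC subrK.
rewrite -fsbig_seq; last by rewrite map_inj_uniq //; apply: addrI.
rewrite big_map eu ev mulr_sumr zpi_sum; apply: eq_bigr => r _.
rewrite [in LHS](addrC y) addrK mulr_suml zpi_sum.
rewrite opprD addrA [x - r - y]addrAC.
case: (boolP (x - y - r \in s)) => h.
  rewrite (bigD1_seq (x - y - r)) //= big1 ?addr0 // => q ne.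
  apply: (block_weight hD (weightM hD (hf q) (hg r))).
  by apply: contra ne => /eqP <-; rewrite addrK.
rewrite nf // mul0r zpi0 big1_seq // => q /andP[_ hq].
apply: (block_weight hD (weightM hD (hf q) (hg r))).
by apply: contraNneq h => <-; rewrite addrK.
Qed.

Lemma m_right_both l l' u : wsum l' u -> m_right u l = m_both (l + l') u l.
Proof.
move=> [s [f [us eu hf nf hs]]].
apply: functional_extensionality_dep => x; apply: functional_extensionality_dep => y.
rewrite /m_right /m_both; case: (eqVneq (iw y) l) => [ey|_]; last by rewrite andbF.
rewrite andbT; case: eqP => // ne; rewrite eu zpi_component // nf ?zpi0 //.
by apply/negP => /hs h; apply: ne; rewrite -ey -h -iwD addrC subrK.
Qed.

Lemma in_Uidot_bword (w : seq I) l : in_Uidot (m_right (bword w) l).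
Proof.
rewrite (m_right_both _ (wsum_bword hD w)); constructor; exact: in_Ui_bword.
Qed.

(** The bar involution fixes products of the generators [b_i]. *)
Lemma bar_bword (psi : matrix_U D -> matrix_U D) : bar_involution psi ->
  forall (w : seq I) l, psi (m_right (bword w) l) = m_right (bword w) l.
Proof.
move=> h; elim=> [|i w IH] l; first by rewrite /bword big_nil (bar_one h).
have e : m_right (bword (i :: w)) l =
    mmul (m_right (bgen i) (l - wti w)) (m_right (bword w) l).
  rewrite bword_cons m_right_mul //; first exact: wsum_bword.
  by exists (- iw (sroot i)); apply: wsum_b.
rewrite {1}e (bar_mul h) ?IH ?(bar_b h) -?e //; last exact: in_Uidot_bword.
have := in_Uidot_bword [:: i] (l - wti w).
by rewrite bword_cons /bword big_nil mulr1.
Qed.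
End BarInvolution.

(** * The anti-involution [rho] *)

Section Rho.
Variables (D : satake_data) (hD : satake_axioms D).
Notation I := (idx D).
Notation U := (Uq D).
Notation X := (wlat D).
Implicit Types (i j : I) (u v : U).
Notation K h := (ucls (UK h : uexp D)).
Notation E i := (ucls (UE i : uexp D)).
Notation F i := (ucls (UF i : uexp D)).
Notation sc := (uscal D).

Lemma scAr c u v : u * (sc c * v) = sc c * (u * v).
Proof. by rewrite mulrA -sc_comm mulrA. Qed.

Lemma scsc c d u : sc c * (sc d * u) = sc (c * d) * u.
Proof. by rewrite mulrA scM. Qed.

Lemma qiE i : qi i = qq ^ (dd i)%:Z. Proof. by []. Qed.

Lemma ev_kel i (y : X) : ev (scoroot i *+ dd i) y = (dd i)%:Z * ev (scoroot i) y.
Proof. by rewrite (evMl hD) -mulr_natl natz. Qed.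

Lemma ev_kel_root i j : ev (scoroot i *+ dd i) (sroot j) = sip i j.
Proof. by rewrite ev_kel (sat_ev hD). Qed.

Definition nserre i j : nat := `|cartan i j|%N.+1.

Definition srr (Z : I -> U) i j : U :=
  \sum_(r < (nserre i j).+1) sc ((-1) ^+ r * qbin i (nserre i j) r)
     * (Z i ^+ (nserre i j - r) * (Z j * Z i ^+ r)).

Lemma ucls_upow (x : uexp D) n : ucls (upow x n) = ucls x ^+ n.
Proof. by elim: n => [|n IH] //; rewrite exprS -IH -ucls_mul. Qed.

Lemma ucls_serre (x : I -> uexp D) i j : ucls (serre x i j) = srr (fun t => ucls (x t)) i j.
Proof.
rewrite /serre /srr (big_morph (@ucls D) (@ucls_add D) (erefl (ucls (UC 0)))).
by apply: eq_bigr => r _; rewrite !ucls_mul !ucls_upow.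
Qed.

Lemma srr_E i j : i != j -> srr (fun t => E t) i j = 0.
Proof. by move=> h; rewrite -(ucls_serre (@UE D)); apply/uclsP/ueq_serreE. Qed.

Lemma srr_F i j : i != j -> srr (fun t => F t) i j = 0.
Proof. by move=> h; rewrite -(ucls_serre (@UF D)); apply/uclsP/ueq_serreF. Qed.

(** The Serre relations are homogeneous, so they survive rescaling the
    generators by elements that commute with them up to a symmetric power of q. *)
Section Twist.
Variables (Z Kt : I -> U) (c : I -> Qq).
Hypothesis KtC : forall s t, Kt s * Kt t = Kt t * Kt s.
Hypothesis ZK : forall s t, Z s * Kt t = sc (qq ^ sip s t) * (Kt t * Z s).
Let Y t := sc (c t) * (Kt t * Z t).

Fixpoint twist_exp (w : seq I) : int :=
  if w is s :: w' then \sum_(t <- w') sip s t + twist_exp w' else 0.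

Lemma twist_exp_sum w :
  2 * twist_exp w + \sum_(s <- w) sip s s = \sum_(s <- w) \sum_(t <- w) sip s t.
Proof.
elim: w => [|s w IH]; first by rewrite !big_nil.
rewrite /= !big_cons; under [X in _ = _ + X]eq_bigr do rewrite big_cons (sipC hD).
by rewrite big_split /= -IH; ring.
Qed.

Lemma twist_exp_perm w w' : perm_eq w w' -> twist_exp w = twist_exp w'.
Proof.
move=> h; suff : 2 * twist_exp w = 2 * twist_exp w' by lia.
apply: (addIr (\sum_(s <- w) sip s s)); rewrite {2}(perm_big _ h) !twist_exp_sum.
rewrite (perm_big _ h); apply: eq_bigr => s _; exact: perm_big.
Qed.

Lemma twist_prod w : \prod_(t <- w) Y t =
  sc (\prod_(t <- w) c t * qq ^ twist_exp w) * (\prod_(t <- w) Kt t * \prod_(t <- w) Z t).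
Proof.
elim: w => [|s w IH]; first by rewrite !big_nil /= !mulr1 sc1.
have ZKs : Z s * \prod_(t <- w) Kt t =
    sc (qq ^ (\sum_(t <- w) sip s t)) * (\prod_(t <- w) Kt t * Z s).
  elim: (w) => [|t r IHr]; first by rewrite !big_nil mulr1 mul1r sc1 mul1r.
  by rewrite !big_cons mulrA ZK -!mulrA IHr qqD !(scsc, scAr).
rewrite !big_cons IH /= qqD /Y -!mulrA !(scsc, scAr) (mulrA (Z s)) ZKs -!mulrA.
rewrite !(scsc, scAr) -!mulrA; congr (sc _ * _).
by ring.
Qed.

Lemma srr_twist i j : srr Z i j = 0 -> srr Y i j = 0.
Proof.
move=> h; set n := nserre i j; pose w0 := nseq n i ++ [:: j].
have e (r : 'I_n.+1) : Y i ^+ (n - r) * (Y j * Y i ^+ r) =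
    sc (c i ^+ n * c j * qq ^ twist_exp w0) * (Kt i ^+ n * Kt j) *
    (Z i ^+ (n - r) * (Z j * Z i ^+ r)).
  have prodw (M : pzSemiRingType) (f : I -> M) : \prod_(t <- nseq (n - r) i ++ j :: nseq r i) f t =
      f i ^+ (n - r) * (f j * f i ^+ r).
    by rewrite big_cat big_cons !big_nseq -!Monoid.iteropE.
  rewrite -(prodw _ Y) twist_prod !prodw.
  have r_le : (r <= n)%N by rewrite -ltnS.
  have -> : twist_exp (nseq (n - r) i ++ j :: nseq r i) = twist_exp w0.
    have en : nseq n i = nseq (n - r) i ++ nseq r i by rewrite -nseqD subnK.
    apply: twist_exp_perm; rewrite /w0 en -catA perm_cat2l.
    by rewrite -cat1s perm_catC.
  have -> : Kt i ^+ (n - r) * (Kt j * Kt i ^+ r) = Kt i ^+ n * Kt j.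
    rewrite (commrX r (KtC j i)) mulrA -exprD subnK //.
  have -> : c i ^+ (n - r) * (c j * c i ^+ r) = c i ^+ n * c j.
    by rewrite mulrCA -exprD subnK // mulrC.
  by rewrite !mulrA.
rewrite /srr -/n (eq_bigr _ (fun r _ => congr1 _ (e r))).
under eq_bigr do rewrite -(mulrA (sc _)) scAr -(scAr _ (_ ^+ _ * _)).
by rewrite -!mulr_sumr -/(srr Z i j) h !mulr0.
Qed.
End Twist.

Lemma qbin_sym i n r : (r <= n)%N -> qbin i n (n - r) = qbin i n r.
Proof. by move=> h; rewrite /qbin subKn // [qfact i r * _]mulrC. Qed.

Lemma rho_serre (x : I -> uexp D) i j : ucls (rho_exp (serre x i j)) =
  sc ((-1) ^+ nserre i j) * srr (fun t => ucls (rho_exp (x t))) i j.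
Proof.
have up y n : ucls (rho_exp (upow y n)) = ucls (rho_exp y) ^+ n.
  by elim: n => [|n IH] //; rewrite exprSr -IH /= ucls_mul.
have -> : ucls (rho_exp (serre x i j)) =
   \sum_(r < (nserre i j).+1) sc ((-1) ^+ r * qbin i (nserre i j) r) *
     (ucls (rho_exp (x i)) ^+ r * (ucls (rho_exp (x j)) *
        ucls (rho_exp (x i)) ^+ (nserre i j - r))).
  have hm : {morph (fun y : uexp D => ucls (rho_exp y)) : a b / UAdd a b >-> a + b}.
    by move=> a b; rewrite /= ucls_add.
  rewrite /serre (big_morph _ (id1 := 0) (id2 := UC 0) hm erefl).
  by apply: eq_bigr => r _; rewrite /= !ucls_mul !up -[ucls (UC _)]/(sc _) -sc_comm -!mulrA.
rewrite /srr mulr_sumr (reindex_inj rev_ord_inj) /=; apply: eq_bigr => r _.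
rewrite subSS; have le : (r <= nserre i j)%N by rewrite -ltnS.
rewrite subKn // qbin_sym // scsc; congr (sc _ * _).
by rewrite [RHS]mulrA -exprD -[in LHS]signr_odd oddB // -oddD signr_odd.
Qed.

Definition rhoE i : U := ucls (rho_exp (UE i)).
Definition rhoF i : U := ucls (rho_exp (UF i)).

Lemma rhoE_eq i : rhoE i = sc (qi i) * (K (scoroot i *+ dd i) * F i).
Proof. by rewrite /rhoE /= !ucls_mul. Qed.

Lemma E_K h i : E i * K h = sc (qq ^ (- ev h (sroot i))) * (K h * E i).
Proof.
rewrite (weight_E i h) -!mulrA scsc -qqD addNr expr0z sc1 mul1r //.
Qed.

Lemma F_K h i : F i * K h = sc (qq ^ ev h (sroot i)) * (K h * F i).
Proof.
rewrite (weight_F hD i h) (evNr hD) -!mulrA scsc -qqD addrN expr0z sc1 mul1r //.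
Qed.

Lemma rhoF_eq i : rhoF i = sc (qi i) * (K (- (scoroot i *+ dd i)) * E i).
Proof.
rewrite /rhoF /= !ucls_mul E_K (evNl hD) ev_kel_root opprK (sipii hD) scsc.
congr (sc _ * _); rewrite qiE invr_expz -qqD; congr (qq ^ _); lia.
Qed.

Lemma weight_comm h x u : has_weight x u ->
  u * K h = sc (qq ^ (- ev h x)) * (K h * u).
Proof.
by move=> hu; rewrite (hu h) -!mulrA scsc -qqD addNr expr0z sc1 mul1r.
Qed.

Lemma weight_rhoE i : has_weight (- sroot i) (rhoE i).
Proof.
have := weightM hD (weight_sc hD (qi i)) (weightM hD (weight_K hD _) (weight_F hD i)).
by rewrite !add0r rhoE_eq; apply.
Qed.

Lemma weight_rhoF i : has_weight (sroot i) (rhoF i).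
Proof.
have := weightM hD (weight_sc hD (qi i)) (weightM hD (weight_K hD _) (weight_E i)).
by rewrite !add0r rhoF_eq; apply.
Qed.

Lemma srr_ext (Z Z' : I -> U) i j : (forall t, Z t = Z' t) -> srr Z i j = srr Z' i j.
Proof. by move=> h; apply: eq_bigr => r _; rewrite !h. Qed.

Lemma srr_rhoE i j : i != j -> srr rhoE i j = 0.
Proof.
move=> h; rewrite (srr_ext _ _ rhoE_eq); apply: srr_twist (srr_F h) => [s t|s t].
  exact: KC.
by rewrite F_K ev_kel_root (sipC hD).
Qed.

Lemma srr_rhoF i j : i != j -> srr rhoF i j = 0.
Proof.
move=> h; rewrite (srr_ext _ _ rhoF_eq); apply: srr_twist (srr_E h) => [s t|s t].
  exact: KC.
by rewrite E_K (evNl hD) opprK ev_kel_root (sipC hD).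
Qed.

Lemma ucls_kel i : ucls (kel i) = K (scoroot i *+ dd i). Proof. by []. Qed.
Lemma ucls_kinv i : ucls (kinv i) = K (- (scoroot i *+ dd i)). Proof. by []. Qed.

Lemma EF_comm i j : E i * F j - F j * E i =
  if i == j then sc (qi i - (qi i)^-1)^-1 *
    (K (scoroot i *+ dd i) - K (- (scoroot i *+ dd i))) else 0.
Proof.
have := uclsP (ueq_EF i j); rewrite ucls_sub !ucls_mul => ->.
case: eqP => // _.
by rewrite ucls_mul ucls_sub.
Qed.

Lemma rho_compat (a b : uexp D) : ueq a b -> ucls (rho_exp a) = ucls (rho_exp b).
Proof.
elim=> {a b} //=.
- by move=> x y z _ -> _ ->.
- by move=> x x' y y' _ h _ h'; rewrite !ucls_add h h'.
- by move=> x x' y y' _ h _ h'; rewrite !ucls_mul h h'.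
- by move=> x y z; rewrite !ucls_add addrA.
- by move=> x y; rewrite !ucls_add addrC.
- by move=> x; rewrite ucls_add -[ucls (UC 0)]/(sc 0) sc0 add0r.
- by move=> x y z; rewrite !ucls_mul mulrA.
- by move=> x; rewrite ucls_mul -[ucls (UC 1)]/(sc 1) sc1 mulr1.
- by move=> x y z; rewrite !(ucls_mul, ucls_add) mulrDr.
- by move=> x y z; rewrite !(ucls_mul, ucls_add) mulrDl.
- by move=> x; rewrite ucls_mul -[ucls (UC 0)]/(sc 0) sc0 mulr0.
- by move=> c d; rewrite ucls_add -!/(sc _) scD.
- by move=> c d; rewrite ucls_mul -!/(sc _) -scM mulrC.
- by move=> c x; rewrite !ucls_mul -!/(sc _) sc_comm.
- by rewrite K0.
- by move=> h h'; rewrite ucls_mul KD KC.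
- move=> h i; rewrite !(ucls_mul _ (UK _)) !(ucls_mul _ (UC _)) (ucls_mul (UK h)).
  by rewrite -/(rhoE i) (weight_comm h (weight_rhoE i)) (evNr hD) opprK sc_comm.
- move=> h i; rewrite !(ucls_mul _ (UK _)) !(ucls_mul _ (UC _)) (ucls_mul (UK h)).
  by rewrite -/(rhoF i) (weight_comm h (weight_rhoF i)) sc_comm.
- move=> i j; rewrite ucls_add (ucls_mul (rho_exp (UF j)) (rho_exp (UE i))).
  rewrite (ucls_mul _ (UC (-1))) (ucls_mul (rho_exp (UE i)) (rho_exp (UF j))).
  rewrite -/(rhoE i) -/(rhoF j).
  rewrite -[ucls (UC (-1))]/(sc (-1)) scN sc1 mulrN1 rhoE_eq rhoF_eq.
  rewrite -!mulrA !(scsc, scAr) (mulrA (E j)) E_K (mulrA (F i)) F_K -!mulrA.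
  rewrite !(scsc, scAr) !ev_kel_root (evNl hD) ev_kel_root (sipC hD j i).
  rewrite (mulrA (K _) (K _)) [K (- _) * K _]KC -!mulrA [qi j * (_ * _)]mulrCA.
  rewrite -!mulrBr EF_comm eq_sym.
  case: eqP => [->|_]; last by rewrite !mulr0.
  rewrite (mulrA (K _) (K _)) -KD addrN K0 mul1r (sipii hD) !qiE -!qqD.
  rewrite (_ : (dd j)%:Z + _ = 0 :> int); last by lia.
  rewrite expr0z sc1 mul1r /= !ucls_mul ucls_add ucls_mul -[ucls (UC (-1))]/(sc (-1)).
  by rewrite scN sc1 mulrN1 -[ucls (UC _)]/(sc _) -sc_comm.
- by move=> i j h; rewrite rho_serre srr_rhoE // mulr0.
- by move=> i j h; rewrite rho_serre srr_rhoF // mulr0.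
Qed.

Lemma rhoP (a : uexp D) : rho (ucls a) = ucls (rho_exp a).
Proof. by rewrite /rho; apply: rho_compat; apply: ueq_repr. Qed.

(** [rho(b_i) = q_i^(1 + vsig_i) k_i^{-1} k_{tau i} b_{tau i}]. *)
Lemma rho_b i : rho (bgen i) =
  sc (qq ^ ((dd i)%:Z * (1 + vsig i))) *
    (K (scoroot (tau i) *+ dd i - scoroot i *+ dd i) * bgen (tau i)).
Proof.
have -> : rho (bgen i) = rhoF i + K (- (scoroot i *+ dd i)) * rhoE (tau i) * sc (qi i ^ vsig i).
  rewrite /bgen rhoP -[rho_exp _]/(UAdd (rho_exp (UF i)) (UMul (UMul (kinv i)
    (rho_exp (UE (tau i)))) (UC (qi i ^ vsig i)))).
  by rewrite ucls_add (ucls_mul _ (UC _)) (ucls_mul (kinv i)).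
have dt : dd (tau i) = dd i by rewrite (sat_tau_d hD).
rewrite bgenE rhoF_eq rhoE_eq (tau_tau hD) ucls_kinv !qiE dt addrC.
rewrite (mulrDr (K _)) mulrDr -[_ * sc _]sc_comm !(scsc, scAr) E_K !(scsc, scAr).
rewrite !(mulrA (K _) (K _)) -!KD !exprz_exp -!qqD (evNl hD).
rewrite -[in ev _ _]dt ev_kel_root.
congr (sc (qq ^ _) * (K _ * _) + sc (qq ^ _) * (K _ * _)).
- by ring.
- by rewrite addrC.
- by have := dd_vsig hD i; rewrite (sipC hD (tau i)); lia.
- by rewrite addrAC subrr add0r.
Qed.
End Rho.

(** * Matrix coefficients of highest weight modules *)

Section Picks.
Variable T : eqType.

(* the ways to write [u] as [s.1 ++ x :: s.2] with [a x] *)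
Fixpoint picks (a : pred T) (u : seq T) : seq (T * (seq T * seq T)) :=
  if u is x :: u' then
    (if a x then [:: (x, ([::], u'))] else [::]) ++
      [seq (s.1, (x :: s.2.1, s.2.2)) | s <- picks a u']
  else [::].

Lemma picksP a u s : s \in picks a u -> a s.1 /\ u = s.2.1 ++ s.1 :: s.2.2.
Proof.
elim: u s => [//|x u IH] s /=; rewrite mem_cat => /orP[|/mapP[t /IH [h ->] ->] //].
by case: ifP => // h; rewrite inE => /eqP ->.
Qed.
End Picks.

Section HighestWeight.
Variables (D : satake_data) (hD : satake_axioms D).
Variables (L : hw_data D) (x : wlat D) (hL : is_hw_module x L).
Notation I := (idx D).
Notation U := (Uq D).
Notation X := (wlat D).
Implicit Types (i j : I) (u w : seq I).
Notation K h := (ucls (UK h : uexp D)).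
Notation E i := (ucls (UE i : uexp D)).
Notation F i := (ucls (UF i : uexp D)).
Notation sc := (uscal D).
Notation eta := (hw_vec L).
Notation form := (@hw_form D L).
Notation alpha w := (\sum_(i <- w) sroot i).

Definition fv w : hw_mod L := (\prod_(i <- w) F i) *: eta.

Lemma fv_nil : fv [::] = eta.
Proof. by rewrite /fv big_nil scale1r. Qed.

Lemma fv_cons i w : fv (i :: w) = F i *: fv w.
Proof. by rewrite /fv big_cons scalerA. Qed.

Lemma scZ c (u : U) (v : hw_mod L) : u *: (sc c *: v) = sc c *: (u *: v).
Proof. by rewrite !scalerA sc_comm. Qed.

Lemma scscZ c d (v : hw_mod L) : sc c *: (sc d *: v) = sc (c * d) *: v.
Proof. by rewrite scalerA scM. Qed.

Lemma K_fv h w : K h *: fv w = sc (qq ^ ev h (x - alpha w)) *: fv w.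
Proof.
elim: w => [|i w IH]; first by rewrite fv_nil big_nil subr0 (hw_K hL).
rewrite fv_cons scalerA (weight_F hD i h) -!scalerA IH scZ scscZ -qqD.
by rewrite big_cons -(sat_evDr hD) opprD addrCA.
Qed.

Definition qnum i (n : int) : Qq :=
  (qi i - (qi i)^-1)^-1 * (qq ^ ((dd i)%:Z * n) - qq ^ (- ((dd i)%:Z * n))).

Lemma E_fv j w : E j *: fv w = \sum_(s <- picks (pred1 j) w)
  sc (qnum j (ev (scoroot j) (x - alpha s.2.2))) *: fv (s.2.1 ++ s.2.2).
Proof.
elim: w => [|i w IH]; first by rewrite big_nil fv_nil (hw_E hL).
have -> : E j *: fv (i :: w) = (E j * F i - F i * E j) *: fv w + F i *: (E j *: fv w).
  by rewrite scalerBl fv_cons (scalerA (E j) (F i)) (scalerA (F i) (E j)) subrK.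
rewrite /= big_cat big_map /= EF_comm IH scaler_sumr; congr (_ + _).
  rewrite [i == j]eq_sym; case: eqP => [<-|_]; last by rewrite big_nil scale0r.
  rewrite big_seq1 /= -scalerA scalerBl !K_fv (evNl hD) -scalerBl -scB scalerA.
  by rewrite -scM /qnum ev_kel.
by apply: eq_bigr => s _; rewrite scZ -fv_cons.
Qed.

Lemma formDr v v1 v2 : form v (v1 + v2) = form v v1 + form v v2.
Proof.
have := hw_lin hL 1 v1 v2 v; rewrite sc1 scale1r mul1r.
by rewrite !(hw_sym hL _ v).
Qed.

Lemma form0r v : form v 0 = 0.
Proof. by apply: (addrI (form v 0)); rewrite -formDr !addr0. Qed.

Lemma form_sumr v (T : Type) (s : seq T) (G : T -> hw_mod L) :
  form v (\sum_(t <- s) G t) = \sum_(t <- s) form v (G t).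
Proof.
by elim: s => [|t s IH]; rewrite ?big_nil ?big_cons ?form0r // formDr IH.
Qed.

Lemma form_scr v c v' : form v (sc c *: v') = c * form v v'.
Proof.
have := hw_lin hL c v' 0 v; rewrite addr0 !(hw_sym hL _ v) form0r addr0; exact.
Qed.

Lemma form_eta_fv w : form eta (fv w) = (w == [::])%:R.
Proof.
case: w => [|i w]; first by rewrite fv_nil (hw_one hL).
rewrite fv_cons (hw_sym hL) (hw_rho hL) rhoP // -/(rhoF i) rhoF_eq // -!scalerA (hw_E hL).
by rewrite !scaler0 form0r.
Qed.

Definition qsum (s : seq int) : Qq := \sum_(e <- s) qq ^ e.

Lemma qsum_shift c s : qsum [seq c + e | e <- s] = qq ^ c * qsum s.
Proof. by rewrite /qsum big_map mulr_sumr; apply: eq_bigr => e _; rewrite qqD. Qed.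

(** For [n >= 0] a quantum integer is a sum of powers of q. *)
Lemma qnum_sum i (n : nat) :
  qnum i n = qsum [seq (dd i)%:Z * (n%:Z - 1 - 2 * k%:Z) | k : nat <- iota 0 n].
Proof.
have d0 : qi i - (qi i)^-1 != 0.
  rewrite qiE invr_expz subr_eq0; apply/negP => /eqP /qq_inj h.
  by have := sat_d hD i; lia.
rewrite /qnum; apply: (mulfI d0); rewrite mulrA divff // mul1r.
pose f (k : nat) := qq ^ ((dd i)%:Z * (n%:Z - 2 * k%:Z)).
have -> : (qi i - (qi i)^-1) *
   qsum [seq (dd i)%:Z * (n%:Z - 1 - 2 * k%:Z) | k : nat <- iota 0 n] =
   \sum_(0 <= k < n) (f k - f k.+1).
  rewrite /index_iota subn0 /qsum big_map mulr_sumr; apply: eq_bigr => k _.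
  rewrite mulrBl qiE invr_expz -!qqD /f; congr (qq ^ _ - qq ^ _); lia.
rewrite (eq_bigr (fun k => - (f k.+1 - f k))) => [|k _]; last by rewrite opprB.
rewrite sumrN telescope_sumr // opprB /f; congr (qq ^ _ - qq ^ _); lia.
Qed.

(* the exponents in the expansion of the coefficient of [eta] in
   [b_{rev r} f_u eta] *)
Definition wexp i w : int := (dd i)%:Z * (vsig i - ev (scoroot i) (x - alpha w)).
Definition wlen i w : nat := `|ev (scoroot i) (x - alpha w)|%N.

Fixpoint wexps (r u : seq I) : seq int :=
  if r is i :: r' then
    wexps r' (i :: u) ++
    flatten [seq flatten [seq
        [seq wexp i u + (dd i)%:Z * ((wlen (tau i) s.2.2)%:Z - 1 - 2 * k%:Z) + e
           | e <- wexps r' (s.2.1 ++ s.2.2)]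
      | k : nat <- iota 0 (wlen (tau i) s.2.2)]
    | s <- picks (pred1 (tau i)) u]
  else if u is [::] then [:: 0] else [::].

Lemma qsum_cat s t : qsum (s ++ t) = qsum s + qsum t.
Proof. by rewrite /qsum big_cat. Qed.

Lemma qsum_flatten (T : Type) (s : seq T) (f : T -> seq int) :
  qsum (flatten [seq f t | t <- s]) = \sum_(t <- s) qsum (f t).
Proof. by rewrite /qsum big_flatten big_map. Qed.

Lemma wexpsP (S : seq I) (n : nat) :
  (forall i w, i \in S -> {subset w <= S} -> (size w <= n)%N ->
     0 <= ev (scoroot (tau i)) (x - alpha w)) ->
  forall r u, {subset r <= S} -> {subset u <= S} -> (size r + size u <= n)%N ->
  form eta (bword (rev r) *: fv u) = qsum (wexps r u).
Proof.
move=> hn; elim=> [|i r IH] u hr hu le /=.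
  rewrite /bword big_nil scale1r form_eta_fv.
  by case: u {hu le} => [|i u]; rewrite /qsum ?big_seq1 ?big_nil // expr0z.
have iS : i \in S by apply: hr; rewrite inE eqxx.
have rS : {subset r <= S} by move=> y hy; apply: hr; rewrite inE hy orbT.
rewrite rev_cons -cats1 bword_cat {2}/bword big_seq1 -scalerA bgenE scalerDl -fv_cons.
rewrite scalerDr formDr qsum_cat; congr (_ + _).
  apply: IH => //; last by rewrite /= addnS.
  by move=> y; rewrite inE => /orP[/eqP -> //|/hu].
rewrite qsum_flatten -!scalerA K_fv (scZ _ (E _)) scscZ E_fv scaler_sumr scaler_sumr form_sumr.
rewrite big_seq [RHS]big_seq; apply: eq_bigr => s /picksP [/eqP e1 e2].
have sS : {subset s.2.1 ++ s.2.2 <= S}.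
  by move=> y; rewrite mem_cat => h; apply: hu; rewrite e2 mem_cat inE orbCA h orbT.
rewrite scscZ scZ form_scr IH //; last by move: le; rewrite e2 !size_cat /=; lia.
have h0 : 0 <= ev (scoroot (tau i)) (x - alpha s.2.2).
  apply: hn => //; last by move: le; rewrite e2 size_cat /=; lia.
  by move=> y hy; apply: sS; rewrite mem_cat hy orbT.
have e3 : ev (scoroot (tau i)) (x - alpha s.2.2) = (wlen (tau i) s.2.2)%:Z.
  by rewrite /wlen gez0_abs.
rewrite e3 qnum_sum (sat_tau_d hD) qsum_flatten.
set B := qsum (wexps _ _); rewrite mulrAC /qsum big_map mulr_sumr.
apply: eq_bigr => k _; rewrite -/(qsum _) qsum_shift mulrAC; congr (_ * _).
rewrite qqD; congr (_ * _); rewrite qiE exprz_exp -qqD (evNl hD) ev_kel /wexp.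
by congr (qq ^ _); ring.
all: exact: hD.
Qed.

(** The adjoint of [b_i] is [b_{tau i}] up to a power of q depending on the
    weight, so a pairing of words is a coefficient of one longer word. *)
Lemma K_bword i w : let h := scoroot (tau i) *+ dd i - scoroot i *+ dd i in
  K h *: (bword w *: eta) = sc (qq ^ (- ((dd i)%:Z * iwc i (iw x - wti w)))) *: (bword w *: eta).
Proof.
move=> h; have dt : dd (tau i) = dd i by rewrite (sat_tau_d hD).
have evh y : ev h y = - ((dd i)%:Z * iwc i (iw y)).
  by rewrite /h (evBl hD) !(evMl hD) (iwc_iw hD) -(mulr_natl (ev (scoroot (tau i)) y)) -(mulr_natl (ev (scoroot i) y)) !natz; ring.
have Kb j : K h * bgen j = sc (qq ^ (- ev h (sroot j))) * (bgen j * K h).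
  rewrite bgenE mulrDr mulrDl mulrDr; congr (_ + _).
    by rewrite (weight_F hD j h) (evNr hD) mulrA.
  rewrite scAr (mulrA (K h)) (weight_E (tau j) h) -!mulrA [ucls (kinv j) * _]KC.
  rewrite !scsc; congr (sc _ * _).
  rewrite mulrC; congr (qq ^ _ * _).
  by rewrite !evh (iw_tau hD) (iwcN hD); ring.
elim: w => [|j w IH].
  by rewrite /bword big_nil !scale1r (hw_K hL) evh wti_nil subr0.
rewrite bword_cons -scalerA scalerA Kb -!scalerA IH scZ scscZ -qqD.
congr (sc (qq ^ _) *: _); rewrite evh wti_cons !(iwcB hD) (iwcD hD); ring.
Qed.

Fixpoint adj_exp w (v : seq I) : int :=
  if w is i :: w' then
    (dd i)%:Z * (1 + vsig i - iwc i (iw x - wti (tau i :: v))) + adj_exp w' (tau i :: v)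
  else 0.

Lemma form_words w v : form (bword w *: eta) (bword v *: eta) =
  qq ^ adj_exp w v * form eta (bword (catrev (map (@tau D) w) v) *: eta).
Proof.
elim: w v => [|i w IH] v; first by rewrite /= expr0z mul1r /bword big_nil scale1r.
rewrite bword_cons -scalerA (hw_rho hL) rho_b // -!scalerA.
rewrite [bgen (tau i) *: _]scalerA -bword_cons K_bword scscZ form_scr IH -qqD mulrA -qqD; congr (qq ^ _ * _).
rewrite /=; ring.
Qed.
End HighestWeight.

(** * Matchings and their degrees *)

Section NameLists.
Implicit Types (L A B : seq nat) (S Z x y : nat).

Lemma count_consE x y L : count_mem y (x :: L) = ((x == y) + count_mem y L)%N.
Proof. by []. Qed.

(* number of occurrences of [S] followed, not necessarily directly, by [Z] *)
Fixpoint inv S Z L : nat :=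
  if L is x :: L' then (if x == S then count_mem Z L' else 0) + inv S Z L' else 0.

Lemma inv_consE S Z x L :
  inv S Z (x :: L) = ((if x == S then count_mem Z L else 0) + inv S Z L)%N.
Proof. by []. Qed.

Lemma inv_cat S Z A B :
  inv S Z (A ++ B) = (inv S Z A + inv S Z B + count_mem S A * count_mem Z B)%N.
Proof.
elim: A => [|x A IH] /=; first by rewrite addn0.
by rewrite IH count_cat; case: eqP => _ /=; lia.
Qed.

Lemma inv0 S Z L : count_mem S L = 0%N \/ count_mem Z L = 0%N -> inv S Z L = 0%N.
Proof.
elim: L => [//|x L IH] /= h; rewrite IH ?addn0; last first.
  by case: h => /eqP; rewrite addn_eq0 => /andP[_ /eqP ->]; [left|right].
case: eqP h => // -> [|] /eqP; rewrite addn_eq0 ?eqxx // => /andP[_ /eqP //].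
Qed.

Lemma inv_sym S Z L : S != Z -> (inv S Z L + inv Z S L = count_mem S L * count_mem Z L)%N.
Proof.
move=> ne; elim: L => [|x L IH] //=.
case: (eqVneq x S) => [->|xS]; first by rewrite (negPf ne) /= add1n mulSn -IH; lia.
by case: (eqVneq x Z) => _ /=; rewrite add0n ?add1n ?mulnS -IH; lia.
Qed.

Lemma inv_le S Z L : S != Z -> (inv S Z L <= count_mem S L * count_mem Z L)%N.
Proof. by move=> /inv_sym <-; rewrite leq_addr. Qed.

Lemma count_filterN S x L : x != S -> count_mem x [seq y <- L | y != S] = count_mem x L.
Proof.
move=> ne; rewrite count_filter; apply: eq_count => y /=.
by case: eqP => // ->.
Qed.

Lemma inv_filter S Y Z L : Y != S -> Z != S -> inv Y Z [seq y <- L | y != S] = inv Y Z L.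
Proof.
move=> hY hZ; elim: L => [//|x L IH] /=.
case: (eqVneq x S) => [->|ne] /=; last by rewrite count_filterN // IH.
by rewrite IH eq_sym (negPf hY).
Qed.

Definition twice L := forall x, x \in L -> count_mem x L = 2%N.

Lemma twice_le L x : twice L -> (count_mem x L <= 2)%N.
Proof.
move=> h; case: (boolP (x \in L)) => [/h -> //|]; by move=> /count_memPn ->.
Qed.

Lemma twice_filter L S : twice L -> twice [seq y <- L | y != S].
Proof.
move=> h x; rewrite mem_filter => /andP[ne hx].
by rewrite count_filterN // h.
Qed.

Lemma undup_filter_perm L S : S \in L ->
  perm_eq (undup L) (S :: undup [seq y <- L | y != S]).
Proof.
move=> h; apply: uniq_perm; rewrite ?undup_uniq //=.
  by rewrite undup_uniq mem_undup mem_filter eqxx.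
by move=> x; rewrite inE !mem_undup mem_filter; case: eqP => [->|].
Qed.
End NameLists.

Section Degrees.
Variables (D : satake_data) (hD : satake_axioms D) (l : iw_lattice D).
Notation I := (idx D).
Implicit Types (i j : I) (lab : nat -> I) (L A B : seq nat) (S Z : nat).

(* the labels of the endpoints of a matching, given those of the right ends *)
Fixpoint vlab lab L : seq I :=
  if L is x :: L' then (if x \in L' then tau (lab x) else lab x) :: vlab lab L' else [::].

Lemma size_vlab lab L : size (vlab lab L) = size L.
Proof. by elim: L => //= x L ->. Qed.

(** The contribution of two strings with right ends labelled [a] and [b], which
    meet the boundary in a disjoint, crossing or nested pattern according to
    whether [n] is 0 or 4, odd, or 2. *)
Definition gpair (n : nat) (a b : I) : int :=
  if n == 2%N then sip a b - sip (tau a) b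
  else if odd n then - sip (tau a) b else 0.

Definition cap_deg i (m : iw_lattice D) : int := (dd i)%:Z * (1 + vsig i - iwc i m).

Definition gnames lab L S Z : int := gpair (inv S Z L) (lab S) (lab Z).

Lemma gnames_sym lab L S Z : twice L -> S \in L -> Z \in L -> S != Z ->
  gnames lab L S Z = gnames lab L Z S.
Proof.
move=> h hS hZ ne; have := inv_sym L ne; rewrite (h _ hS) (h _ hZ) /gnames /gpair => e.
have -> : (inv S Z L == 2)%N = (inv Z S L == 2)%N by lia.
have -> : odd (inv S Z L) = odd (inv Z S L).
  have -> : inv S Z L = (2 * 2 - inv Z S L)%N by lia.
  by rewrite oddB //; lia.
by rewrite (sipC hD (lab S)) (sip_taul hD (lab S)) (sipC hD (lab S)).
Qed.

Fixpoint pair_deg lab L (ns : seq nat) : int :=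
  if ns is n :: ns' then \sum_(Z <- ns') gnames lab L n Z + pair_deg lab L ns' else 0.

Definition match_deg lab L : int :=
  \sum_(S <- undup L) cap_deg (lab S) l + pair_deg lab L (undup L).

Lemma pair_deg_ext lab lab' L L' ns :
  (forall S Z, S \in ns -> Z \in ns -> S != Z -> gnames lab L S Z = gnames lab' L' S Z) ->
  uniq ns -> pair_deg lab L ns = pair_deg lab' L' ns.
Proof.
elim: ns => [//|S ns IH] h /= /andP[nS un]; congr (_ + _).
  rewrite big_seq [RHS]big_seq; apply: eq_bigr => Z hZ.
  apply: h; rewrite ?inE ?eqxx ?hZ ?orbT //; by apply: contraNneq nS => ->.
apply: IH => // S' Z hS hZ ne; apply: h; rewrite ?inE ?hS ?hZ ?orbT //.
Qed.

Lemma pair_deg_rem lab L ns S : twice L -> {subset ns <= L} -> uniq ns -> S \in ns ->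
  pair_deg lab L ns = \sum_(Z <- rem S ns) gnames lab L S Z + pair_deg lab L (rem S ns).
Proof.
move=> tL; elim: ns => [//|x ns IH] sub /= /andP[nx un].
rewrite inE; case: (eqVneq x S) => [-> _|ne] //= hS.
rewrite IH //; last by move=> y hy; apply: sub; rewrite inE hy orbT.
rewrite (perm_big _ (perm_to_rem hS)) !big_cons /=.
rewrite (gnames_sym lab tL (S := x)) //; last 2 first.
- by apply: sub; rewrite inE eqxx.
- by apply: sub; rewrite inE hS orbT.
by ring.
Qed.

Lemma pair_deg_perm lab L ns ns' : twice L -> {subset ns <= L} -> uniq ns ->
  perm_eq ns ns' -> pair_deg lab L ns = pair_deg lab L ns'.
Proof.
move=> tL; elim: ns ns' => [|x ns IH] ns' sub un hp.
  by move: hp; rewrite perm_sym => /perm_nilP ->.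
have hx : x \in ns' by rewrite -(perm_mem hp) inE eqxx.
have un' : uniq ns' by rewrite -(perm_uniq hp).
rewrite (pair_deg_rem lab tL _ un' hx); last by move=> y; rewrite -(perm_mem hp) => /sub.
have hp' : perm_eq ns (rem x ns').
  by rewrite -(perm_cons x) (perm_trans hp (perm_to_rem hx)).
rewrite /= (perm_big _ hp') (IH (rem x ns')) //.
  by move=> y hy; apply: sub; rewrite inE hy orbT.
by case/andP: un.
Qed.

(** Splitting off one string. *)
Lemma match_deg_rem lab L S : twice L -> S \in L ->
  match_deg lab L = cap_deg (lab S) l +
    \sum_(Z <- undup [seq y <- L | y != S]) gnames lab L S Z +
    match_deg lab [seq y <- L | y != S].
Proof.
move=> tL hS; rewrite /match_deg; have hp := undup_filter_perm hS.
rewrite (perm_big _ hp) big_cons (pair_deg_perm lab tL _ (undup_uniq _) hp); last first.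
  by move=> y; rewrite mem_undup.
rewrite /= (@pair_deg_ext lab lab _ [seq y <- L | y != S] (undup _)) ?undup_uniq //; first by ring.
move=> Y Z; rewrite !mem_undup !mem_filter => /andP[hY _] /andP[hZ _] _.
by rewrite /gnames inv_filter.
Qed.

Lemma match_deg_perm2 lab L L' : twice L -> perm_eq L L' ->
  (forall S Z, S \in L -> Z \in L -> S != Z -> gnames lab L S Z = gnames lab L' S Z) ->
  match_deg lab L = match_deg lab L'.
Proof.
move=> tL hp h; rewrite /match_deg.
have tL' : twice L' by move=> x; rewrite -(perm_mem hp) => /tL <-; apply/permP; rewrite perm_sym.
have hu : perm_eq (undup L) (undup L').
  by apply: uniq_perm; rewrite ?undup_uniq // => x; rewrite !mem_undup (perm_mem hp).
rewrite (perm_big _ hu) -(pair_deg_perm lab tL' _ (undup_uniq _) (ns := undup L)); last 2 first.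
- by move=> x; rewrite mem_undup (perm_mem hp).
- exact: hu.
congr (_ + _); apply: pair_deg_ext; last exact: undup_uniq.
by move=> S Z; rewrite !mem_undup; apply: h.
Qed.

(** Renaming strings. *)
Lemma match_deg_map lab lab' (f : nat -> nat) L : {in L &, injective f} ->
  (forall x, x \in L -> lab' (f x) = lab x) -> match_deg lab' (map f L) = match_deg lab L.
Proof.
move=> fi hl.
have uE A : {in A &, injective f} -> undup (map f A) = map f (undup A).
  elim: A => [//|x A IH] h /=; rewrite IH; last first.
    by move=> y z hy hz; apply: h; rewrite inE ?hy ?hz orbT.
  have -> : (f x \in map f A) = (x \in A).
    apply/mapP/idP => [[y hy e]|hx]; last by exists x.
    by rewrite (h x y) ?inE ?eqxx ?hy ?orbT.
  by case: (x \in A).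
have cE A Z : {subset A <= L} -> Z \in L -> count_mem (f Z) (map f A) = count_mem Z A.
  move=> sA hZ; rewrite count_map; apply: eq_in_count => y hy /=.
  by apply/eqP/eqP => [|-> //]; apply: fi => //; apply: sA.
have iE A S Z : {subset A <= L} -> S \in L -> Z \in L -> inv (f S) (f Z) (map f A) = inv S Z A.
  elim: A => [//|x A IH] sA hS hZ /=.
  have sA' : {subset A <= L} by move=> y hy; apply: sA; rewrite inE hy orbT.
  rewrite IH // cE //; congr (_ + _)%N.
  have -> // : (f x == f S) = (x == S).
  by apply/eqP/eqP => [|-> //]; apply: fi => //; apply: sA; rewrite inE eqxx.
rewrite /match_deg uE // big_map; congr (_ + _).
  by rewrite big_seq [RHS]big_seq; apply: eq_bigr => S; rewrite mem_undup => /hl ->.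
have : {subset undup L <= L} by move=> y; rewrite mem_undup.
elim: (undup L) => [//|x ns IH] sub /=; congr (_ + _).
  rewrite big_map big_seq [RHS]big_seq; apply: eq_bigr => Z hZ.
  have hx : x \in L by apply: sub; rewrite inE eqxx.
  have hZL : Z \in L by apply: sub; rewrite inE hZ orbT.
  by rewrite /gnames iE // !hl.
by apply: IH => y hy; apply: sub; rewrite inE hy orbT.
Qed.

(* a function odd under [tau] only sees the names occurring once *)
Lemma vlab_sum lab B (f : I -> int) : (forall x, count_mem x B <= 2)%N ->
  (forall t, f (tau t) = - f t) ->
  \sum_(t <- vlab lab B) f t = \sum_(Z <- undup B | count_mem Z B == 1%N) f (lab Z).
Proof.
move=> + fo; elim: B => [|x B IH] h; first by rewrite !big_nil.
rewrite /= big_cons IH => [|y]; last by apply: leq_trans (h y); rewrite /= leq_addl.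
case: (boolP (x \in B)) => hx.
  have c1 : count_mem x B = 1%N.
    apply/eqP; rewrite eqn_leq -has_count has_pred1 hx andbT.
    by have := h x; rewrite /= eqxx add1n.
  rewrite big_mkcond [RHS]big_mkcond !(bigD1_seq x) ?mem_undup ?undup_uniq //= eqxx c1 /=.
  rewrite fo addrA addNr !add0r; apply: eq_bigr => y ne.
  by rewrite [x == y]eq_sym (negPf ne).
have c0 : count_mem x B = 0%N by apply/count_memPn.
rewrite big_cons /= eqxx c0 /=; congr (_ + _).
rewrite big_seq_cond [RHS]big_seq_cond; apply: eq_bigl => y.
case: (boolP (y \in undup B)) => //=; rewrite mem_undup => hy.
by case: (eqVneq x y) => // e; rewrite e hy in hx.
Qed.

Lemma cap_deg_shift i (w : seq I) :
  cap_deg i (l - wti w) = cap_deg i l + \sum_(t <- w) (sip i t - sip (tau i) t).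
Proof.
rewrite /cap_deg (iwcB hD) opprB.
suff : (dd i)%:Z * iwc i (wti w) = \sum_(t <- w) (sip i t - sip (tau i) t).
  by move=> <-; ring.
elim: w => [|j w IH]; first by rewrite wti_nil (iwc0 hD) big_nil mulr0.
by rewrite wti_cons (iwcD hD) mulrDr (dd_iwc_root hD) IH big_cons.
Qed.

Lemma shift_names lab i B : (forall x, count_mem x B <= 2)%N ->
  cap_deg i (l - wti (vlab lab B)) = cap_deg i l +
    \sum_(Z <- undup B | count_mem Z B == 1%N) (sip i (lab Z) - sip (tau i) (lab Z)).
Proof.
move=> h; rewrite cap_deg_shift vlab_sum // => t.
by rewrite (sip_tau hD) -(sip_taul hD); ring.
Qed.

Lemma big_undup_ext (A B : seq nat) (F : nat -> int) : {subset B <= A} ->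
  (forall Z, Z \in A -> Z \notin B -> F Z = 0) ->
  \sum_(Z <- undup A) F Z = \sum_(Z <- undup B) F Z.
Proof.
move=> sub h; rewrite (bigID (fun Z => Z \in B) predT (r := undup A)) /=.
rewrite [X in _ + X]big1_seq ?addr0; last first.
  by move=> Z; rewrite mem_undup => /andP[nB hA]; apply: h.
rewrite -[LHS]big_filter; apply: perm_big; apply: uniq_perm; rewrite ?filter_uniq ?undup_uniq //.
by move=> y; rewrite mem_filter !mem_undup; case: (boolP (y \in B)) => [/sub ->|].
Qed.

Lemma filter_notin S A : S \notin A -> [seq y <- A | y != S] = A.
Proof.
move=> h; apply/all_filterP/allP => y hy; by apply: contraNneq h => <-.
Qed.

(** A cap joining neighbours. *)
Lemma match_deg_cap lab A B S : twice (A ++ S :: S :: B) ->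
  match_deg lab (A ++ S :: S :: B) =
    match_deg lab (A ++ B) + cap_deg (lab S) (l - wti (vlab lab B)).
Proof.
move=> tL; set L := A ++ _ in tL *.
have hS : S \in L by rewrite mem_cat inE eqxx orbT.
have := tL _ hS; rewrite count_cat !count_consE eqxx !add1n => cS.
have nA : S \notin A by apply/count_memPn; lia.
have nB : S \notin B by apply/count_memPn; lia.
have eL : [seq y <- L | y != S] = A ++ B.
  by rewrite filter_cat /= eqxx /= !filter_notin.
rewrite (match_deg_rem lab tL hS) eL shift_names; last first.
  by move=> x; apply: leq_trans (twice_le x tL); rewrite count_cat !count_consE; lia.
rewrite [RHS]addrC; congr (_ + _ + _); rewrite (big_undup_ext (B := B)).
- rewrite [RHS]big_mkcond [LHS]big_seq [RHS]big_seq; apply: eq_bigr => Z; rewrite mem_undup => hZ.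
  have nZ : S != Z by apply: contraNneq nB => ->.
  have := twice_le Z tL; rewrite count_cat !count_consE (negPf nZ) !add0n => cZ.
  rewrite /gnames inv_cat /= eqxx (negPf nZ) !(@inv0 S Z) ?(count_memPn nA) ?(count_memPn nB);
    try by [left].
  rewrite !add0n addn0 mul0n addn0.
  have : (0 < count_mem Z B)%N by rewrite -has_count has_pred1.
  by rewrite /gpair; case: (count_mem Z B) cZ => [|[|[|n]]] //; lia.
- by move=> y; rewrite mem_cat => ->; rewrite orbT.
move=> Z hZ /count_memPn cZ.
have nZ : S != Z by apply: contraTneq hZ => <-; rewrite mem_cat negb_or nA.
rewrite /gnames inv_cat /= eqxx cZ (negPf nZ) !(@inv0 S Z) ?(count_memPn nA) ?(count_memPn nB);
  by [|left].
Qed.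

End Degrees.

Section DegreeMoves.
Variables (D : satake_data) (hD : satake_axioms D) (l : iw_lattice D).
Notation I := (idx D).
Implicit Types (i j : I) (lab : nat -> I) (L A B : seq nat) (S Z y z N : nat).
Notation mdeg := (match_deg l).
Notation gnm := (@gnames D).
Notation vlab := (@vlab D).

(** Crossing two neighbouring strings that did not cross. *)
Lemma match_deg_cross lab A B y z : twice (A ++ y :: z :: B) -> y != z ->
  ~~ odd (inv y z (A ++ y :: z :: B)) ->
  mdeg lab (A ++ z :: y :: B) = mdeg lab (A ++ y :: z :: B) -
    sip (if z \in B then tau (lab z) else lab z) (if y \in B then tau (lab y) else lab y).
Proof.
move=> tL' ne ev; set L' := A ++ y :: _ in tL' ev *; set L := A ++ z :: _.
have hp : perm_eq L' L by rewrite perm_cat2l (perm_catCA [:: y] [:: z] B).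
have tL : twice L by move=> x; rewrite -(perm_mem hp) => /tL' <-; apply/permP; rewrite perm_sym.
have yL' : y \in L' by rewrite mem_cat inE eqxx orbT.
have yL : y \in L by rewrite -(perm_mem hp).
have zy : z != y by rewrite eq_sym.
have cy := tL' _ yL'; have zL' : z \in L' by rewrite mem_cat !inE eqxx !orbT.
have cz := tL' _ zL'.
rewrite count_cat !count_consE eqxx (negPf zy) add0n add1n in cy.
rewrite count_cat !count_consE eqxx (negPf ne) add0n add1n in cz.
rewrite (match_deg_rem hD l lab tL yL) (match_deg_rem hD l lab tL' yL').
have -> : [seq x <- L | x != y] = [seq x <- L' | x != y].
  by rewrite !filter_cat /= eqxx (negPf zy).
set R := [seq x <- L' | x != y].
have zR : z \in undup R by rewrite mem_undup mem_filter zy.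
rewrite !(bigD1_seq z zR (undup_uniq _)) /=.
rewrite (eq_bigr (fun Z => gnm lab L' y Z)); last first.
  move=> Z nZ; rewrite /gnames /L /L' !inv_cat; congr (gpair _ _ _).
  rewrite !(inv_consE, count_consE) [z == Z]eq_sym eqxx (negPf nZ) (negPf zy); lia.
suff : gnm lab L y z - gnm lab L' y z =
  - sip (if z \in B then tau (lab z) else lab z) (if y \in B then tau (lab y) else lab y).
  by move=> /(canRL (subrK _)) ->; ring.
have e' : inv y z L' = (inv y z L).+1.
  by rewrite /L /L' !(inv_cat, inv_consE, count_consE) eqxx (negPf zy) (negPf ne); lia.
have eL : inv y z L = (inv y z A + (count_mem z B + inv y z B +
    count_mem y A * (count_mem z B).+1))%N.
  by rewrite /L !(inv_cat, inv_consE, count_consE) eqxx (negPf zy) (negPf ne); lia.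
have iA := inv_le A ne; have iB := inv_le B ne.
have mB x : (x \in B) = (0 < count_mem x B)%N by rewrite -has_count has_pred1.
rewrite /gnames /gpair !mB e'; rewrite e' in ev.
have cyA : count_mem y A = (1 - count_mem y B)%N by lia.
have czA : count_mem z A = (1 - count_mem z B)%N by lia.
have [cyB czB] : (count_mem y B <= 1)%N /\ (count_mem z B <= 1)%N by lia.
rewrite {}cyA {}czA in iA eL; clear cy cz e'; move: ev eL iA iB.
move: (inv y z L) (inv y z A) (inv y z B) => n nA nB.
case: (count_mem y B) cyB => [|[|//]] _; case: (count_mem z B) czB => [|[|//]] _ /=;
  rewrite ?subn0 ?subnn ?mul0n ?muln0 ?muln1 ?mul1n ?leqn0 => ev en hA hB.
- have [e|e] : n = 1%N \/ n = 2%N by lia.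
    by rewrite e /=; rewrite (sipC hD (lab z)); lia.
  by rewrite e in ev.
- have -> : n = 3 by lia.
  by rewrite /= (sipC hD (tau (lab z))) -(sip_taul hD); lia.
- by have e : n = 0%N by [lia]; rewrite e in ev.
have [e|e] : n = 1%N \/ n = 2%N by lia.
  by rewrite e /=; rewrite (sip_tau hD) (sipC hD (lab z)); lia.
by rewrite e in ev.
Qed.

(** A cup whose ends both run on to the left, without any other string crossing
    both of them. *)
Lemma match_deg_cup lab T1 T2 T3 B y z : let L' := T1 ++ z :: T2 ++ y :: T3 ++ y :: z :: B in
  twice L' -> y != z -> lab y = tau (lab z) ->
  (forall Z, Z \in L' -> ~~ (odd (inv y Z L') && odd (inv z Z L'))) ->
  mdeg lab (T1 ++ z :: T2 ++ z :: T3 ++ B) =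
    mdeg lab L' + cap_deg (lab z) (l - wti (vlab lab B)).
Proof.
move=> L' tL' ne ly nc; set L := T1 ++ _.
have zy : z != y by rewrite eq_sym.
have yL' : y \in L' by rewrite !(mem_cat, inE) eqxx !orbT.
have zL' : z \in L' by rewrite !(mem_cat, inE) eqxx !orbT.
have cE x : count_mem x L' = (count_mem x T1 + ((z == x) + (count_mem x T2 +
    ((y == x) + (count_mem x T3 + ((y == x) + ((z == x) + count_mem x B)))))))%N.
  by rewrite /L' !(count_cat, count_consE).
have := tL' _ yL'; have := tL' _ zL'; rewrite !cE !eqxx (negPf ne) (negPf zy) !add0n !add1n.
move=> cz cy.
have nm x A : count_mem x A = 0%N -> x \notin A by move/count_memPn.
have [y1 y2 y3 yB] : [/\ y \notin T1, y \notin T2, y \notin T3 & y \notin B].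
  by split; apply: nm; lia.
have [z1 z2 z3 zB] : [/\ z \notin T1, z \notin T2, z \notin T3 & z \notin B].
  by split; apply: nm; lia.
pose L1 := T1 ++ z :: T2 ++ T3 ++ z :: B; pose R := T1 ++ T2 ++ T3 ++ B.
have fy : [seq x <- L' | x != y] = L1.
  by rewrite /L'; do ?[rewrite filter_cat /= | rewrite eqxx /= | rewrite zy /=]; rewrite !filter_notin.
have fz1 : [seq x <- L1 | x != z] = R.
  by rewrite /L1; do ?[rewrite filter_cat /= | rewrite eqxx /=]; rewrite !filter_notin.
have fz : [seq x <- L | x != z] = R.
  by rewrite /L; do ?[rewrite filter_cat /= | rewrite eqxx /=]; rewrite !filter_notin.
have tL1 : twice L1 by rewrite -fy; apply: twice_filter.
have cL x : count_mem x L = if x == y then 0%N else count_mem x L1.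
  rewrite /L /L1 !(count_cat, count_consE); case: (eqVneq x y) => [->|_]; last first.
    by congr (_ + (_ + (_ + _)))%N; exact: addnCA.
  by rewrite (count_memPn y1) (count_memPn y2) (count_memPn y3) (count_memPn yB) (negPf zy).
have tL : twice L.
  move=> x hx; rewrite cL; case: eqP => [e|_].
    by move: hx; rewrite e -has_pred1 has_count cL eqxx.
  apply: tL1; move: hx; rewrite !(mem_cat, inE).
  by move=> /or4P [->|->|->|/or3P[->|->|->]]; rewrite ?orbT.
have zL1 : z \in L1 by rewrite !(mem_cat, inE) eqxx !orbT.
have zL : z \in L by rewrite !(mem_cat, inE) eqxx !orbT.
rewrite (match_deg_rem hD l lab tL' yL') fy (match_deg_rem hD l lab tL1 zL1) fz1.
rewrite (match_deg_rem hD l lab tL zL) fz.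
have hp := undup_filter_perm zL1; rewrite fz1 in hp.
rewrite (perm_big _ hp) big_cons shift_names //; last first.
  by move=> x; apply: leq_trans (twice_le x tL'); rewrite cE !addnA leq_addl.
have e1 : cap_deg (lab y) l + cap_deg (lab z) l + gnm lab L' y z = 0.
  have ei : inv y z L' = 2%N.
    rewrite /L' !(inv_cat, inv_consE, count_cat, count_consE) !eqxx.
    rewrite !(@inv0 y z) ?(negPf zy) ?(negPf ne); try by [left; apply/count_memPn].
    by rewrite (count_memPn z2) (count_memPn z3) (count_memPn zB) (count_memPn y1)
       (count_memPn y2) (count_memPn y3).
  rewrite /gnames ei /gpair eqxx ly (tau_tau hD) (sipii hD) /cap_deg (iwc_tau hD).
  rewrite (sat_tau_d hD) (sipC hD (tau _)).
  by have := dd_vsig hD (lab z); clear; lia.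
have e2 : \sum_(Z <- undup R) gnm lab L z Z =
    \sum_(Z <- undup R) gnm lab L' y Z + \sum_(Z <- undup R) gnm lab L1 z Z +
    \sum_(Z <- undup B | count_mem Z B == 1%N) (sip (lab z) (lab Z) - sip (tau (lab z)) (lab Z)).
  rewrite [X in _ = _ + X]big_mkcond /=.
  rewrite -(@big_undup_ext R B) => [|Z hZ|Z _ /count_memPn -> //]; last first.
    by rewrite !mem_cat hZ !orbT.
  rewrite -!big_split /= big_seq [RHS]big_seq; apply: eq_bigr => Z; rewrite mem_undup => hZ.
  have nZy : y != Z.
    by apply: contraTneq hZ => <-; rewrite !mem_cat !negb_or y1 y2 y3 yB.
  have nZz : z != Z.
    by apply: contraTneq hZ => <-; rewrite !mem_cat !negb_or z1 z2 z3 zB.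
  have hZ' : Z \in L'.
    by move: hZ; rewrite /R /L' !(mem_cat, inE) => /or4P[] ->; rewrite ?orbT.
  have := tL' _ hZ'; rewrite cE (negPf nZy) (negPf nZz) !add0n => cZ.
  have iy : inv y Z L' = (count_mem Z T3 + 2 * count_mem Z B)%N.
    rewrite /L' !(inv_cat, inv_consE, count_cat, count_consE) !eqxx.
    rewrite (negPf zy) (negPf nZz) (negPf nZy) !(@inv0 y Z); try by [left; apply/count_memPn].
    by rewrite (count_memPn y1) (count_memPn y2) (count_memPn y3); clear; lia.
  have iz : inv z Z L1 = (count_mem Z T2 + count_mem Z T3 + 2 * count_mem Z B)%N.
    rewrite /L1 !(inv_cat, inv_consE, count_cat, count_consE) !eqxx.
    rewrite (negPf nZz) !(@inv0 z Z); try by [left; apply/count_memPn].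
    by rewrite (count_memPn z1) (count_memPn z2) (count_memPn z3); clear; lia.
  have iz' : inv z Z L' = inv z Z L1.
    by rewrite -fy inv_filter // eq_sym.
  have iL : inv z Z L = (count_mem Z T2 + 2 * (count_mem Z T3 + count_mem Z B))%N.
    rewrite /L !(inv_cat, inv_consE, count_cat, count_consE) !eqxx.
    rewrite (negPf nZz) !(@inv0 z Z); try by [left; apply/count_memPn].
    by rewrite (count_memPn z1) (count_memPn z2) (count_memPn z3); clear; lia.
  have := nc Z hZ'; rewrite iz' iy iz /gnames iy iz iL ly /gpair.
  move: cZ; case: (count_mem Z T1) (count_mem Z T2) (count_mem Z T3) (count_mem Z B)
    => [|[|[|?]]] [|[|[|?]]] [|[|[|?]]] [|[|[|?]]] //= _; rewrite ?andbF //= ?(tau_tau hD) => _;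
    clear; lia.
rewrite e2 /=.
have -> : cap_deg (lab y) l = 0 - cap_deg (lab z) l - gnm lab L' y z.
  by rewrite -{1}e1; ring.
by ring.
Qed.

(** Joining a new left end to the open end [N]. *)
Lemma match_deg_join lab M u1 u2 N : let L := M ++ N :: u1 ++ N :: u2 in
  twice L -> uniq (u1 ++ u2) ->
  mdeg lab L = mdeg lab (M ++ u1 ++ u2) + cap_deg (lab N) l
    + \sum_(Z <- u2) (sip (lab N) (lab Z) - sip (tau (lab N)) (lab Z))
    - \sum_(Z <- u1) sip (tau (lab N)) (lab Z).
Proof.
move=> L tL un; have NL : N \in L by rewrite mem_cat inE eqxx orbT.
have := tL _ NL; rewrite /L count_cat count_consE count_cat count_consE eqxx => cN.
have [n0 n1 n2] : [/\ N \notin M, N \notin u1 & N \notin u2].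
  by split; apply/count_memPn; lia.
have fN : [seq x <- L | x != N] = M ++ u1 ++ u2.
  by rewrite /L; do ?[rewrite filter_cat /= | rewrite eqxx /=]; rewrite !filter_notin.
rewrite (match_deg_rem hD l lab tL NL) fN (@big_undup_ext _ (u1 ++ u2)) => [|Z|Z]; last 2 first.
- by rewrite !mem_cat => ->; rewrite orbT.
- rewrite mem_cat => hZ hZ'; have nZ : N != Z.
    by apply: contraTneq hZ => <-; rewrite negb_or n0 mem_cat negb_or n1.
  move: hZ'; rewrite mem_cat negb_or => /andP[hZ1 hZ2].
  rewrite /gnames /L !inv_cat /= !inv_cat /= !(count_cat, count_consE) !eqxx.
  rewrite !(@inv0 N Z); try by [left; apply/count_memPn].
  by rewrite (negPf nZ) (count_memPn hZ1) (count_memPn hZ2) (count_memPn n0) (count_memPn n1).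
have term Z : Z \in u1 ++ u2 -> inv N Z L = (count_mem Z u1 + 2 * count_mem Z u2)%N.
  move=> hZ; have nZ : N != Z.
    by apply: contraTneq hZ => <-; rewrite mem_cat negb_or n1.
  rewrite /L !(inv_cat, inv_consE, count_cat, count_consE) !eqxx.
  rewrite !(@inv0 N Z); try by [left; apply/count_memPn].
  by rewrite (negPf nZ) (count_memPn n0) (count_memPn n1); clear; lia.
rewrite (undup_id un) big_cat /=; move: un; rewrite cat_uniq => /and3P[un1 /hasPn dis un2].
have -> : \sum_(Z <- u1) gnm lab L N Z = - \sum_(Z <- u1) sip (tau (lab N)) (lab Z).
  rewrite -sumrN big_seq [RHS]big_seq; apply: eq_bigr => Z hZ.
  have h2 : count_mem Z u2 = 0%N.
    by apply/count_memPn; apply: contraL hZ => /dis.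
  by rewrite /gnames term ?mem_cat ?hZ // h2 (count_uniq_mem _ un1) hZ.
have -> : \sum_(Z <- u2) gnm lab L N Z =
    \sum_(Z <- u2) (sip (lab N) (lab Z) - sip (tau (lab N)) (lab Z)).
  rewrite big_seq [RHS]big_seq; apply: eq_bigr => Z hZ.
  by rewrite /gnames term ?mem_cat ?hZ ?orbT // (count_uniq_mem _ un2) hZ
     (count_uniq_mem _ un1) (negPf (dis _ hZ)).
by ring.
Qed.
End DegreeMoves.

(** * Counting matchings *)

Section DotLists.
Implicit Types (ds : seq nat) (e : int).

(* the ways to put dots on strings, a dot on the r-th one having degree
   [2 * ds_r], such that the total degree is [e] *)
Fixpoint dot_lists ds e : seq (seq nat) :=
  if ds is d :: ds' then
    if e is Posz m then
      flatten [seq [seq k :: t | t <- dot_lists ds' (e - (2 * d * k)%:Z)] | k <- iota 0 m.+1]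
    else [::]
  else if e == 0 then [:: [::]] else [::].

Definition dot_deg ds (t : seq nat) : nat := \sum_(p <- zip ds t) 2 * p.1 * p.2.

Lemma dot_deg_cons d ds k t : dot_deg (d :: ds) (k :: t) = (2 * d * k + dot_deg ds t)%N.
Proof. by rewrite /dot_deg /= big_cons. Qed.

Lemma dot_lists_cons d ds (m : nat) : dot_lists (d :: ds) m =
  flatten [seq [seq k :: t | t <- dot_lists ds (m%:Z - (2 * d * k)%:Z)] | k <- iota 0 m.+1].
Proof. by []. Qed.

Lemma mem_dot_lists ds e t : all (leq 1) ds ->
  (t \in dot_lists ds e) = (size t == size ds) && ((dot_deg ds t)%:Z == e).
Proof.
elim: ds e t => [|d ds IH] e t.
  move=> _; rewrite /dot_deg /=.
  by case: t => [|k t]; rewrite ?big_nil eq_sym; case: (0%Z =P e) => // <-.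
move=> /andP[d0 hds].
have pos s : (0 : int) <= (dot_deg (d :: ds) s)%:Z by [].
case: e => [m|m]; last by rewrite in_nil; apply/esym/negP => /andP[_ /eqP h]; have := pos t; rewrite h.
rewrite dot_lists_cons.
case: t => [|k t]; first by rewrite andFb; apply/flattenP => -[z /mapP[k _ ->] /mapP[]].
rewrite eqSS dot_deg_cons; apply/flattenP/andP.
  move=> [z /mapP[k' _ ->] /mapP[t' ht' [-> ->]]].
  by move: ht'; rewrite IH // => /andP[-> /eqP h]; split => //; apply/eqP; lia.
move=> [hs /eqP h]; exists [seq k :: t | t <- dot_lists ds (m%:Z - (2 * d * k)%:Z)].
  apply/mapP; exists k => //; rewrite mem_iota; nia.
apply/mapP; exists t => //; rewrite IH // hs /=; apply/eqP; lia.
Qed.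

Lemma dot_lists_uniq ds e : uniq (dot_lists ds e).
Proof.
elim: ds e => [|d ds IH] e; first by rewrite /=; case: ifP.
case: e => // m; rewrite dot_lists_cons; elim: (iota 0 m.+1) (iota_uniq 0 m.+1) => [//|k s IHs] /= /andP[ks us].
rewrite cat_uniq IHs // map_inj_uniq ?IH //= ?andbT; last by move=> ? ? [].
apply/hasPn => z /flattenP [y /mapP[k' hk' ->] /mapP[t _ ->]].
by apply/negP => /mapP[t' _ [e' _]]; rewrite e' (negPf ks) in hk'.
Qed.

Definition dot_count ds e : nat := size (dot_lists ds e).

Lemma dot_count_neg ds e : e < 0 -> dot_count ds e = 0%N.
Proof. by rewrite /dot_count; case: ds => [|d ds] /=; case: e => // -[]. Qed.

Lemma dot_countS d ds e n : (0 < d)%N -> e < n%:Z ->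
  dot_count (d :: ds) e = (\sum_(k <- iota 0 n) dot_count ds (e - (2 * d * k)%:Z))%N.
Proof.
move=> d0 hn; case: e hn => [m|m] hn; last first.
  by rewrite big1_seq // => k _; apply: dot_count_neg; lia.
have -> : (n = m.+1 + (n - m.+1))%N by lia.
rewrite iotaD big_cat /= [X in (_ + X)%N]big1_seq ?addn0; last first.
  by move=> k; rewrite mem_iota => hk; apply: dot_count_neg; nia.
rewrite /dot_count /= size_cat size_map size_flatten /shape -map_comp sumnE !big_map big_cons.
by congr (_ + _)%N; apply: eq_bigr => k _; rewrite /= size_map.
Qed.

Lemma dot_count_swap d d' ds e : (0 < d)%N -> (0 < d')%N ->
  dot_count [:: d, d' & ds] e = dot_count [:: d', d & ds] e.
Proof.
move=> h h'; have [n hn] : exists n : nat, e < n%:Z by exists `|e|%N.+1; lia.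
have E a b : (0 < a)%N -> (0 < b)%N -> dot_count [:: a, b & ds] e =
    (\sum_(k <- iota 0 n) \sum_(j <- iota 0 n)
       dot_count ds (e - (2 * a * k)%:Z - (2 * b * j)%:Z))%N.
  move=> a0 b0; rewrite (dot_countS _ a0 hn); apply: eq_bigr => k _.
  by apply: dot_countS => //; lia.
rewrite !E // exchange_big /=; apply: eq_bigr => k _; apply: eq_bigr => j _.
by congr dot_count; lia.
Qed.

Lemma dot_count_ext d ds ds' : (0 < d)%N -> (forall e, dot_count ds e = dot_count ds' e) ->
  forall e, dot_count (d :: ds) e = dot_count (d :: ds') e.
Proof.
move=> h E e; have [n hn] : exists n : nat, e < n%:Z by exists `|e|%N.+1; lia.
by rewrite !(@dot_countS _ _ _ n) //; apply: eq_bigr => k _.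
Qed.

Lemma dot_count_perm ds ds' e : all (leq 1) ds -> perm_eq ds ds' ->
  dot_count ds e = dot_count ds' e.
Proof.
elim: ds ds' e => [|d ds IH] ds' e /=; first by rewrite perm_sym => _ /perm_nilP ->.
move=> /andP[d0 hds] hp.
have : d \in ds' by rewrite -(perm_mem hp) inE eqxx.
move=> hd; case/splitPr: hd hp => s1 s2 hp.
have hp' : perm_eq ds (s1 ++ s2).
  by rewrite -(perm_cons d) (perm_trans hp) // -cat1s perm_catCA.
have a12 : all (leq 1) (s1 ++ s2) by rewrite -(perm_all _ hp').
rewrite (dot_count_ext d0 (fun e => IH _ e hds hp')).
elim: s1 {hp hp'} a12 e => [//|d1 s1 IH1] /= /andP[d1p a12] e.
by rewrite dot_count_swap //; apply: dot_count_ext => // e'; apply: IH1.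
Qed.
End DotLists.

Lemma picks_map (T T' : eqType) (f : T -> T') a u :
  picks a (map f u) =
  [seq (f s.1, (map f s.2.1, map f s.2.2)) | s <- picks (fun x => a (f x)) u].
Proof.
elim: u => [//|x u IH] /=; rewrite map_cat IH -!map_comp.
by case: ifP.
Qed.

Lemma picks_mem (T : eqType) (a : pred T) x u1 u2 :
  a x -> (x, (u1, u2)) \in picks a (u1 ++ x :: u2).
Proof.
move=> h; elim: u1 => [|y u1 IH] /=; first by rewrite h inE eqxx.
by rewrite mem_cat; apply/orP; right; apply/mapP; exists (x, (u1, u2)).
Qed.

Lemma picks_uniq (T : eqType) (a : pred T) u : uniq (picks a u).
Proof.
elim: u => [//|x u IH] /=; rewrite cat_uniq map_inj_uniq ?IH; last first.
  by move=> [y [u1 u2]] [z [v1 v2]] /= [-> -> ->].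
rewrite andbT; apply/andP; split; first by case: ifP.
by apply/hasPn => z /mapP[s _ ->] /=; case: (a x); rewrite ?inE ?xpair_eqE /= ?andbF.
Qed.

Section Wick.
Variables (D : satake_data) (lab : nat -> idx D).
Implicit Types (k n N : nat) (u M : seq nat).

(** The name lists of the matchings of [k] further points to the left of the
    points [u]; the points are numbered from the right, those in [u] are smaller
    than [n], and a string is named by the number of its right end. *)
Fixpoint wick k n u : seq (seq nat) :=
  if k is k'.+1 then
    [seq rcons M n | M <- wick k' n.+1 (n :: u)] ++
    flatten [seq [seq rcons M s.1 | M <- wick k' n.+1 (s.2.1 ++ s.2.2)]
      | s <- picks (fun N => lab N == tau (lab n)) u]
  else if u is [::] then [:: [::]] else [::].

Lemma wick_names k n u M x : M \in wick k n u -> x \in M -> x \in u \/ (n <= x)%N.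
Proof.
elim: k n u M => [|k IH] n u M /=; first by case: u => //; rewrite inE => /eqP ->.
rewrite mem_cat => /orP[/mapP[M' hM' ->]|/flattenP[z /mapP[s /picksP[hs hu] ->] /mapP[M' hM' ->]]].
  rewrite mem_rcons inE => /orP[/eqP ->|/(IH _ _ _ hM')]; first by right.
  by rewrite inE => -[/orP[/eqP ->|->]|]; [right|left|right; apply: ltnW].
rewrite mem_rcons inE hu mem_cat inE => /orP[->|/(IH _ _ _ hM')]; first by left; rewrite orbT.
rewrite mem_cat => -[/orP[]->|]; rewrite ?orbT; [by left|by left|by right; apply: ltnW].
Qed.
End Wick.

Section WickMembers.
Variables (D : satake_data) (lab : nat -> idx D).
Implicit Types (k n N : nat) (u M : seq nat).
Notation wick := (wick lab).

Lemma twice_join M N u1 u2 : N \notin M -> N \notin u1 ++ u2 ->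
  twice (M ++ N :: u1 ++ N :: u2) <-> twice (M ++ u1 ++ u2).
Proof.
move=> nM; rewrite mem_cat negb_or => /andP[n1 n2].
have cE x : count_mem x (M ++ N :: u1 ++ N :: u2) =
    if N == x then 2%N else count_mem x (M ++ u1 ++ u2).
  rewrite !(count_cat, count_consE); case: eqP => [<-|_]; last by lia.
  by rewrite (count_memPn nM) (count_memPn n1) (count_memPn n2).
split=> h x hx.
  have := h x; rewrite cE; case: eqP => [e _|_ -> //].
    by rewrite -e !mem_cat (negPf nM) (negPf n1) (negPf n2) in hx.
  by move: hx; rewrite !(mem_cat, inE) => /or3P[]->; rewrite ?orbT.
rewrite cE; case: eqP => // ne; apply: h; move: hx; rewrite !(mem_cat, inE).
by rewrite [x == N]eq_sym (introF eqP ne).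
Qed.

Lemma wick_size k n u M : M \in wick k n u -> size M = k.
Proof.
elim: k n u M => [|k IH] n u M /=; first by case: u => //; rewrite inE => /eqP ->.
rewrite mem_cat => /orP[/mapP[M' /IH h ->]|/flattenP[z /mapP[s _ ->] /mapP[M' /IH h ->]]];
by rewrite size_rcons h.
Qed.

Definition wick_state n u := uniq u /\ {in u, forall x, (x < n)%N}.

Lemma wick_state_cons n u : wick_state n u -> wick_state n.+1 (n :: u).
Proof.
move=> [h1 h2]; split=> [|x]; first by rewrite /= h1 andbT; apply/negP => /h2; rewrite ltnn.
by rewrite inE => /orP[/eqP ->|/h2 /ltnW].
Qed.

Lemma wick_state_rem n N u1 u2 :
  wick_state n (u1 ++ N :: u2) -> wick_state n.+1 (u1 ++ u2) /\ N \notin u1 ++ u2.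
Proof.
move=> [h1 h2]; have hp : perm_eq (u1 ++ N :: u2) (N :: u1 ++ u2).
  by rewrite -(cat1s N) perm_catCA.
move: (h1); rewrite (perm_uniq hp) /= => /andP[nN un]; split=> //; split=> // x hx.
by apply/ltnW/h2; rewrite (perm_mem hp) inE hx orbT.
Qed.

Lemma wick_fresh k n N u1 u2 M : wick_state n (u1 ++ N :: u2) ->
  M \in wick k n.+1 (u1 ++ u2) -> N \notin M.
Proof.
move=> hs hM; have [_ nN] := wick_state_rem hs; apply/negP => /(wick_names hM) [h|h].
  by rewrite h in nN.
have := hs.2 N; rewrite mem_cat inE eqxx orbT => /(_ isT); lia.
Qed.

Lemma wick_twice k n u M : wick_state n u -> M \in wick k n u -> twice (M ++ u).
Proof.
elim: k n u M => [|k IH] n u M hs /=; first by case: u hs => // _; rewrite inE => /eqP ->.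
rewrite mem_cat => /orP[/mapP[M' hM' ->]|/flattenP[z /mapP[s /picksP[_ hu] ->] /mapP[M' hM' ->]]].
  by rewrite cat_rcons; apply: IH hM'; apply: wick_state_cons.
rewrite hu in hs *; have [hs' nN] := wick_state_rem hs; rewrite cat_rcons.
by apply/(twice_join (wick_fresh hs hM') nN); apply: IH hM'.
Qed.

Lemma wick_uniq k n u : wick_state n u -> uniq (wick k n u).
Proof.
elim: k n u => [|k IH] n u hs /=; first by case: u hs.
have ri (N : nat) : injective (fun M => rcons M N) by move=> ? ? /rcons_inj [].
rewrite cat_uniq (map_inj_uniq (@ri n)) IH ?andTb; last exact: wick_state_cons.
apply/andP; split.
  apply/hasPn => z /flattenP[y /mapP[s /picksP[_ hu] ->] /mapP[M' hM' ->]].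
  apply/negP => /mapP[M2 _ /rcons_inj [_ e]].
  by have := hs.2 s.1; rewrite {1}hu mem_cat inE eqxx orbT => /(_ isT); rewrite e ltnn.
set a := (fun N => _); suff H ss : {subset ss <= picks a u} -> uniq ss ->
    uniq (flatten [seq [seq rcons M s.1 | M <- wick k n.+1 (s.2.1 ++ s.2.2)] | s <- ss]).
  by apply: H => //; apply: picks_uniq.
elim: ss => [//|s ss IHs] sub /= /andP[ns us]; have [_ hu] := picksP (sub s (mem_head _ _)).
rewrite cat_uniq (map_inj_uniq (@ri _)) IH ?andTb; last first.
  by rewrite hu in hs; have [] := wick_state_rem hs.
rewrite IHs // ?andbT; last by move=> t ht; apply: sub; rewrite inE ht orbT.
apply/hasPn => z /flattenP[y /mapP[t ht ->] /mapP[M' hM' ->]].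
apply/negP => /mapP[M2 _ /rcons_inj [_ e]].
have [_ hu'] := picksP (sub t (mem_behead (s := s :: ss) ht)).
suff es : t = s by rewrite es (negPf ns) in ht.
case: s t hu hu' e {ht ns sub hM'} => [N [u1 u2]] [N' [v1 v2]] /= hu hu' e; subst N'.
have iE w1 w2 : uniq (w1 ++ N :: w2) -> index N (w1 ++ N :: w2) = size w1.
  rewrite index_cat /= eqxx addn0 cat_uniq => /and3P[_ /hasPn h _].
  by have := h N; rewrite inE eqxx => /(_ isT) /negPf ->.
have es : size u1 = size v1 by rewrite -(iE u1 u2) -?hu ?hs.1 // -(iE v1 v2) -?hu' ?hs.1.
have /eqP := hu'; rewrite {1}hu eqseq_cat // eqseq_cons eqxx => /andP[/eqP -> /eqP ->] //.
Qed.
End WickMembers.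

Lemma split_last (x : nat) (M : seq nat) : x \in M -> exists A B, M = A ++ x :: B /\ x \notin B.
Proof.
elim: M => [//|y M IH]; case: (boolP (x \in M)) => [/IH[A [B [-> h]]] _|h].
  by exists (y :: A), B.
rewrite inE (negPf h) orbF => /eqP e; rewrite e in h *.
by exists [::], M.
Qed.

Section CanonicalNames.
Variables (D : satake_data) (hD : satake_axioms D).
Notation I := (idx D).
Implicit Types (lab : nat -> I) (k n N : nat) (u M L T : seq nat).
Notation vlab := (@vlab D).

Lemma vlab_cat lab M T T' : {in M, forall x, (x \in T) = (x \in T')} ->
  exists A, [/\ size A = size M, vlab lab (M ++ T) = A ++ vlab lab T
    & vlab lab (M ++ T') = A ++ vlab lab T'].
Proof.
elim: M => [|x M IH] h; first by exists [::].
have [y hy|A [sA e e']] := IH; first by apply: h; rewrite inE hy orbT.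
exists ((if x \in M ++ T then tau (lab x) else lab x) :: A); split; rewrite /= ?sA ?e //.
by rewrite e' !mem_cat h // inE eqxx.
Qed.

Lemma vlab_uniq lab u : uniq u -> vlab lab u = map lab u.
Proof. by elim: u => //= x u IH /andP[/negPf -> /IH ->]. Qed.

(* strings are named by the numbers of their right ends, when the right end of
   [M] has number [n] *)
Definition named n u M :=
  forall A x B, M = A ++ x :: B -> x \notin B ++ u -> x = (n + size B)%N.

Lemma named_rcons n u M N : named n u (rcons M N) ->
  forall A x B, M = A ++ x :: B -> x \notin B ++ N :: u -> x = (n.+1 + size B)%N.
Proof.
move=> h A x B e hx; rewrite (h A x (rcons B N)) ?size_rcons ?addnS ?addSn //.
  by rewrite e rcons_cat.
by rewrite cat_rcons.
Qed.

Lemma wick_named lab k n u M : wick_state n u -> M \in wick lab k n u -> named n u M.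
Proof.
elim: k n u M => [|k IH] n u M hs /=.
  by case: u hs => // _; rewrite inE => /eqP -> [].
rewrite mem_cat => /orP[/mapP[M' hM' ->]|/flattenP[z /mapP[s /picksP[_ hu] ->] /mapP[M' hM' ->]]] A x B.
  case/lastP: B => [|B y]; rewrite ?cats1 -?rcons_cons -?rcons_cat.
    by move=> /rcons_inj[_ <-]; rewrite addn0.
  move=> /rcons_inj[e <-]; rewrite cat_rcons => hx.
  by rewrite (IH _ _ _ (wick_state_cons hs) hM' A x B e hx) size_rcons addnS.
rewrite hu in hs *; have [hs' nN] := wick_state_rem hs.
case/lastP: B => [|B y]; rewrite ?cats1 -?rcons_cons -?rcons_cat.
  by move=> /rcons_inj[_ <-]; rewrite /= mem_cat inE eqxx orbT.
move=> /rcons_inj[e _]; rewrite cat_rcons => hx.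
rewrite (IH _ _ _ hs' hM' A x B e) ?size_rcons ?addnS //.
by apply: contra hx; rewrite !(mem_cat, inE) => /or3P[]->; rewrite ?orbT.
Qed.

Lemma wick_vlab lab k n u M : wick_state n u -> M \in wick lab k n u ->
  vlab lab (M ++ u) = rev [seq lab j | j <- iota n k] ++ [seq lab j | j <- u].
Proof.
elim: k n u M => [|k IH] n u M hs /=.
  by case: u hs => // _; rewrite inE => /eqP ->.
rewrite rev_cons cat_rcons.
rewrite mem_cat => /orP[/mapP[M' hM' ->]|/flattenP[z /mapP[s /picksP[hN hu] ->] /mapP[M' hM' ->]]].
  by rewrite cat_rcons (IH _ _ _ (wick_state_cons hs) hM').
move: s hN hu hM' => [N [u1 u2]] /= hN hu hM'; have us := hs.1; rewrite hu in hs us *.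
have [hs' nN] := wick_state_rem hs; have nM := wick_fresh hs hM'.
have [x hx|A [sA e e']] := @vlab_cat lab M' (u1 ++ u2) (N :: u1 ++ N :: u2).
  have nx : x != N by apply: contraNneq nM => <-.
  by rewrite !(mem_cat, inE) (negPf nx).
have := IH _ _ _ hs' hM'; rewrite e vlab_uniq; last by case: hs'.
move=> /eqP; rewrite eqseq_cat ?sA ?size_rev ?size_map ?size_iota ?(wick_size hM') //.
move=> /andP[/eqP eA _]; rewrite cat_rcons e' eA /= -/(cat _ _) vlab_uniq //.
by rewrite mem_cat inE eqxx orbT (eqP hN) (tau_tau hD).
Qed.

Lemma mem_wick lab k n u M : wick_state n u -> size M = k -> twice (M ++ u) ->
  vlab lab (M ++ u) = rev [seq lab j | j <- iota n k] ++ [seq lab j | j <- u] ->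
  named n u M -> M \in wick lab k n u.
Proof.
elim: k n u M => [|k IH] n u M hs.
  move=> /size0nil -> {M}; case: u hs => // x u [us _] /(_ x); rewrite inE eqxx => /(_ isT).
  by move: us => /= /andP[/count_memPn h _]; rewrite h eqxx.
case/lastP: M => [//|M N]; rewrite size_rcons => -[sM] tw hv hn.
rewrite /= mem_cat; apply/orP; move: tw hv; rewrite rev_cons !cat_rcons => tw hv.
case: (boolP (N \in u)) => [Nu|Nu]; last first.
  left; have eN : N = n by rewrite (hn M N [::]) ?addn0 ?cats1.
  subst N; apply/mapP; exists M => //; apply: IH => //; first exact: wick_state_cons.
  exact: named_rcons.
right; case/splitPr: Nu hs tw hv hn => u1 u2 hs tw hv hn.
have [hs' nN] := wick_state_rem hs.
have nM : N \notin M.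
  apply/count_memPn; have := tw N; rewrite !(mem_cat, inE) eqxx orbT => /(_ isT).
  by rewrite !(count_cat, count_consE) eqxx; lia.
have [x hx|A [sA e e']] := @vlab_cat lab M (u1 ++ u2) (N :: u1 ++ N :: u2).
  have nx : x != N by apply: contraNneq nM => <-.
  by rewrite !(mem_cat, inE) (negPf nx).
move: hv; rewrite e' => /eqP.
rewrite eqseq_cat ?sA ?size_rev ?size_map ?size_iota ?sM // => /andP[/eqP eA].
rewrite /= eqseq_cons mem_cat inE eqxx orbT => /andP[/eqP eN _].
apply/flattenP; exists [seq rcons M' N | M' <- wick lab k n.+1 (u1 ++ u2)].
  apply/mapP; exists (N, (u1, u2)) => //; apply: picks_mem.
  by rewrite -eN (tau_tau hD).
apply/mapP; exists M => //; apply: IH => //.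
- by apply/(twice_join nM nN).
- by rewrite e eA vlab_uniq //; case: hs'.
move=> B x C eM hx; apply: (named_rcons hn eM).
have nx : x != N by apply: contraNneq nM => <-; rewrite eM mem_cat inE eqxx orbT.
by move: hx; rewrite !(mem_cat, inE) (negPf nx).
Qed.

(** Renaming each string by the number of its right end. *)
Definition canon L := [seq index x (rev L) | x <- L].

Lemma canon_inj L : {in L &, injective (fun x : nat => index x (rev L))}.
Proof.
move=> x y hx hy /= e.
have ix z : z \in L -> nth 0%N (rev L) (index z (rev L)) = z.
  by move=> hz; rewrite nth_index // mem_rev.
by rewrite -(ix x hx) e ix.
Qed.

Lemma index_last (A : seq nat) x B : x \notin B -> index x (rev (A ++ x :: B)) = size B.
Proof.
move=> h; rewrite rev_cat rev_cons cat_rcons index_cat mem_rev (negPf h) /= eqxx.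
by rewrite size_rev addn0.
Qed.

Lemma canon_named M : named 0 [::] M -> canon M = M.
Proof.
move=> h; rewrite -[RHS]map_id; apply/eq_in_map => x /split_last[A [B [e nx]]].
by rewrite {1}e index_last // (h _ _ _ e) ?cats0.
Qed.

Lemma named_canon L : named 0 [::] (canon L).
Proof.
move=> A y B; rewrite /canon => e; rewrite cats0.
have hs : (size A < size L)%N.
  by have := size_map (fun x => index x (rev L)) L; rewrite e size_cat /= => <-; lia.
have eL := cat_take_drop (size A) L; rewrite (drop_nth 0%N hs) in eL.
move: e; rewrite -{2}eL map_cat /= => /eqP; rewrite eqseq_cat; last first.
  by rewrite size_map size_takel // ltnW.
rewrite eqseq_cons => /and3P[_ /eqP <- /eqP <-] hx.
rewrite -{2}eL index_last ?size_map //; apply: contra hx => hx.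
by apply/mapP; exists (nth 0%N L (size A)).
Qed.

Lemma mem_map_in (f : nat -> nat) L x A : {in L &, injective f} -> x \in L ->
  {subset A <= L} -> (f x \in map f A) = (x \in A).
Proof.
move=> fi hx sA; apply/mapP/idP => [[y hy e]|h]; last by exists x.
by rewrite (fi x y) ?(sA _ hy).
Qed.

Lemma twice_map (f : nat -> nat) L : {in L &, injective f} -> twice L -> twice (map f L).
Proof.
move=> fi tL _ /mapP[x hx ->]; rewrite -(tL x hx) count_map; apply: eq_in_count => y hy /=.
by apply/eqP/eqP => [|-> //]; apply: fi.
Qed.

Lemma vlab_map lab lab' (f : nat -> nat) L : {in L &, injective f} ->
  {in L, forall x, lab' (f x) = lab x} -> vlab lab' (map f L) = vlab lab L.
Proof.
move=> fi hl; suff H A : {subset A <= L} -> vlab lab' (map f A) = vlab lab A by apply: H.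
elim: A => [//|x A IH] sA /=; have hx : x \in L by apply: sA; rewrite inE eqxx.
have sA' : {subset A <= L} by move=> y hy; apply: sA; rewrite inE hy orbT.
by rewrite (mem_map_in fi) // hl // IH.
Qed.

Lemma nth_vlab i0 lab A x B : x \notin B -> nth i0 (vlab lab (A ++ x :: B)) (size A) = lab x.
Proof. by move=> h; elim: A => [|y A IH] //=; rewrite (negPf h). Qed.

Lemma canon_lab i0 lab L x : x \in L ->
  nth i0 (rev (vlab lab L)) (index x (rev L)) = lab x.
Proof.
move=> /split_last[A [B [e nx]]]; rewrite {2}e index_last // e.
rewrite nth_rev size_vlab size_cat /= ?addnS ?ltnS ?leq_addl //.
by rewrite subSS addnK nth_vlab.
Qed.

Lemma canon_wick i0 lab L : twice L ->
  canon L \in wick (nth i0 (rev (vlab lab L))) (size L) 0 [::].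
Proof.
move=> tL; apply: mem_wick => //; rewrite ?cats0 ?size_map //.
- exact: twice_map (@canon_inj L) tL.
- rewrite (vlab_map (lab := lab) (@canon_inj L)); last by move=> x; apply: canon_lab.
  rewrite -{1}[vlab lab L]revK -{1}(size_vlab lab L) -size_rev; congr rev.
  by rewrite map_nth_iota0 // take_size.
exact: named_canon.
Qed.
End CanonicalNames.

Section Laurent.

Lemma pmul_Xn (N : nat) (t : laurent) n : pmul 'X^N t n = t (n - N%:Z).
Proof.
rewrite /pmul size_polyXn big_ord_recr /= coefXn eqxx mul1r big1 ?add0r // => i _.
by rewrite coefXn (ltn_eqF (ltn_ord i)) mul0r.
Qed.

Lemma expands_qsum (E : seq int) t n : expands (qsum E) t -> t n = (count_mem n E)%:R.
Proof.
move=> [_ h]; have [N hN] : exists N : nat, forall e, e \in E -> 0 <= e + N%:Z.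
  elim: E {h} => [|e E [N hN]]; first by exists 0%N.
  exists (N + `|e|)%N => e'; rewrite inE => /orP[/eqP ->|/hN]; lia.
pose a : {poly rat} := \sum_(e <- E) 'X^(absz (e + N%:Z)).
have Xn0 : ('X^N : {poly rat}) != 0 by rewrite -size_poly_eq0 size_polyXn.
have qX m : FracField.tofrac ('X^m : {poly rat}) = qq ^ m%:Z :> Qq by rewrite rmorphXn.
have ea : qsum E = FracField.tofrac a / FracField.tofrac 'X^N.
  rewrite /qsum /a rmorph_sum /= mulr_suml big_seq [RHS]big_seq; apply: eq_bigr => e he.
  by rewrite !qX invr_expz -qqD; congr (qq ^ _); have := hN e he; lia.
have := congr1 (fun f => f (n + N%:Z)) (h a 'X^N Xn0 ea).
rewrite pmul_Xn addrK => ->.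
have aE m : a`_m = (count_mem m [seq absz (e + N%:Z) | e <- E])%:R.
  rewrite /a coef_sum; elim: (E) => [|e E' IH]; first by rewrite big_nil.
  by rewrite big_cons IH /= coefXn natrD eq_sym.
rewrite /laurent_poly; case em: (n + N%:Z) => [m|m].
  rewrite aE count_map; congr (_%:R); apply: eq_in_count => e he /=.
  by have := hN e he => ?; apply/eqP/eqP; lia.
suff -> : count_mem n E = 0%N by [].
by apply/count_memPn; apply/negP => /hN; rewrite em.
Qed.
End Laurent.

(** * The limit of the form *)

Section Limit.
Variables (D : satake_data) (hD : satake_axioms D) (l : iw_lattice D).
Notation I := (idx D).
Notation X := (wlat D).
Implicit Types (i : I) (x : X) (Q : X -> Prop).

Definition eventually Q := exists F m, forall x, deep l F m x -> Q x.

Lemma eventually_and Q Q' : eventually Q -> eventually Q' ->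
  eventually (fun x => Q x /\ Q' x).
Proof.
move=> [F [m h]] [F' [m' h']]; exists (F ++ F'), (Num.max m m') => x [h1 h2 h3].
split; [apply: h|apply: h']; split=> // i hi.
  by apply: le_trans (h3 i _); rewrite ?le_max ?lexx ?mem_cat ?hi.
by apply: le_trans (h3 i _); rewrite ?le_max ?lexx ?mem_cat ?hi ?orbT.
Qed.

Lemma eventually_imp Q Q' : (forall x, iw x = l -> Q x -> Q' x) ->
  eventually Q -> eventually Q'.
Proof. by move=> h [F [m hF]]; exists F, m => x hx; apply: h; [case: hx|apply: hF]. Qed.

Lemma eventually_all (T : eqType) (ss : seq T) (Q : T -> X -> Prop) :
  (forall s, s \in ss -> eventually (Q s)) ->
  eventually (fun x => forall s, s \in ss -> Q s x).
Proof.
elim: ss => [_|s ss IH h]; first by exists [::], 0.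
have h' : eventually (fun x => forall t, t \in ss -> Q t x).
  by apply: IH => t ht; apply: h; rewrite inE ht orbT.
apply: eventually_imp (eventually_and (h s (mem_head _ _)) h') => x _ [h1 h2] t.
by rewrite inE => /orP[/eqP ->|/h2].
Qed.

Lemma eventually_large i (w : seq I) (m : int) :
  eventually (fun x => m <= ev (scoroot i) (x - \sum_(j <- w) sroot j)).
Proof.
exists [:: i], (m + ev (scoroot i) (\sum_(j <- w) sroot j)) => x [_ _ h].
by rewrite (evBr hD) lerBrDr h // inE.
Qed.

Lemma dd_ev_sum i (w : seq I) :
  (dd i)%:Z * ev (scoroot i) (\sum_(j <- w) sroot j) = \sum_(j <- w) sip i j.
Proof.
elim: w => [|j w IH]; first by rewrite !big_nil (ev0r hD) mulr0.
by rewrite !big_cons (sat_evDr hD) mulrDr IH (sat_ev hD).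
Qed.

Variable lab : nat -> I.
Notation wick := (wick lab).
Notation mdeg := (match_deg l lab).

(* the exponent of the leading power of q when a new point is joined to the
   open end [s.1] among [s.2.1 ++ s.1 :: s.2.2] *)
Definition join_exp (s : nat * (seq nat * seq nat)) : int :=
  \sum_(Z <- s.2.1) sip (tau (lab s.1)) (lab Z)
  - \sum_(Z <- s.2.2) (sip (lab s.1) (lab Z) - sip (tau (lab s.1)) (lab Z))
  - cap_deg (lab s.1) l.

Lemma wexp_join x i s : iw x = l -> lab s.1 = tau i ->
  wexp x i [seq lab j | j <- s.2.1 ++ s.1 :: s.2.2] + (dd i)%:Z *
    (ev (scoroot (tau i)) (x - \sum_(j <- [seq lab j | j <- s.2.2]) sroot j) - 1) = join_exp s.
Proof.
case: s => N [u1 u2] /= hx hN; rewrite /wexp /join_exp /cap_deg /= hN (tau_tau hD).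
have dt : dd (tau i) = dd i by rewrite (sat_tau_d hD).
rewrite map_cat big_cat /= big_cons !(evBr hD) !(sat_evDr hD) (iwc_tau hD) dt -hx (iwc_iw hD).
have f1 := dd_ev_sum i [seq lab j | j <- u1]; have f2 := dd_ev_sum i [seq lab j | j <- u2].
have f3 := dd_ev_sum (tau i) [seq lab j | j <- u2].
rewrite !big_map in f1 f2 f3; rewrite dt in f3.
rewrite !big_map sumrB -f1 -f2 -f3; apply/eqP; rewrite -subr_eq0; apply/eqP.
have := dd_vsig hD i; rewrite /sip -(sat_ev hD) => h.
have := congr1 (fun z => z + (dd i)%:Z * ev (scoroot i) (sroot (tau i))) h.
rewrite addNr => <-; rewrite hN; ring.
Qed.

Lemma wexps_cons x i r u : wexps x (i :: r) u = wexps x r (i :: u) ++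
    flatten [seq flatten [seq
        [seq wexp x i u + (dd i)%:Z * ((wlen x (tau i) s.2.2)%:Z - 1 - 2 * k%:Z) + e
           | e <- wexps x r (s.2.1 ++ s.2.2)]
      | k : nat <- iota 0 (wlen x (tau i) s.2.2)]
    | s <- picks (pred1 (tau i)) u].
Proof. by []. Qed.

Definition string_degs (L : seq nat) : seq nat := [seq dd (lab Z) | Z <- undup L].

Lemma string_degs_pos L : all (leq 1) (string_degs L).
Proof. by apply/allP => _ /mapP[Z _ ->]; apply: sat_d hD _. Qed.

(** In the limit, the pairing counts dotted matchings by degree: each step of
    the recursion for the exponents either opens a new string or closes one, and
    in the latter case the geometric series of powers of q counts dots. *)
Lemma wick_count k n u (B : int) : wick_state n u -> eventually (fun x => forall e : int, e <= B ->
  count_mem (- e) (wexps x [seq lab j | j <- iota n k] [seq lab j | j <- u]) =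
  (\sum_(M <- wick k n u) dot_count (string_degs (M ++ u)) (e - mdeg (M ++ u)))%N).
Proof.
elim: k n u B => [|k IH] n u B hs.
  exists [::], 0 => x _ e _; case: u hs => [|y u] _ /=; last by rewrite big_nil.
  rewrite big_seq1 /string_degs /= /match_deg /= big_nil addr0 /dot_count /= addn0.
  by rewrite eq_sym oppr_eq0; case: (e == 0).
pose a : pred nat := fun N => lab N == tau (lab n); pose W (s : nat * (seq nat * seq nat)) := wick k n.+1 (s.2.1 ++ s.2.2).
pose C (s : nat * (seq nat * seq nat)) M := B + join_exp s - mdeg (M ++ s.2.1 ++ s.2.2).
have h0 := IH n.+1 (n :: u) B (wick_state_cons hs).
have h1 : eventually (fun x => forall s, s \in picks a u ->
    (forall e : int, e <= B + join_exp s -> count_mem (- e) (wexps x [seq lab j | j <- iota n.+1 k]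
       [seq lab j | j <- s.2.1 ++ s.2.2]) =
     (\sum_(M <- W s) dot_count (string_degs (M ++ s.2.1 ++ s.2.2))
       (e - mdeg (M ++ s.2.1 ++ s.2.2)))%N) /\
    (\sum_(M <- W s) `|C s M| + 1 <=
       ev (scoroot (tau (lab n))) (x - \sum_(j <- [seq lab j | j <- s.2.2]) sroot j))).
  apply: eventually_all => s /picksP[_ hu]; apply: eventually_and; last exact: eventually_large.
  by apply: IH; rewrite hu in hs; have [] := wick_state_rem hs.
apply: eventually_imp (eventually_and h0 h1) => x hx [{}h0 {}h1] e he.
rewrite [iota n k.+1]/= map_cons wexps_cons count_cat -/(map lab (n :: u)) h0 // /=.
rewrite -/a -/wick -/(wick k n.+1 (n :: u)) big_cat big_map /=; congr (_ + _)%N.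
  by apply: eq_bigr => M _; rewrite cat_rcons.
rewrite count_flatten sumnE !big_map big_flatten /= big_map picks_map big_map.
rewrite big_seq [RHS]big_seq; apply: eq_bigr => s hsp.
have [/eqP ha hu] := picksP hsp; have [hc hl] := h1 s hsp.
rewrite big_map count_flatten sumnE !big_map /=.
set nn := ev _ _ in hl; have nn0 : 0 <= nn.
  by apply: le_trans hl; rewrite addr_ge0 // sumr_ge0.
have en : (wlen x (tau (lab n)) [seq lab j | j <- s.2.2])%:Z = nn by rewrite /wlen gez0_abs.
have ew := wexp_join hx ha; rewrite -hu -/nn in ew.
under eq_bigr => j _.
  rewrite count_map (eq_count (a2 := pred1 (- (e + join_exp s - (2 * dd (lab n) * j)%:Z)))); last first.
    by move=> z /=; rewrite en -ew; apply/eqP/eqP; lia.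
  rewrite -map_cat hc; last by lia.
  over.
rewrite exchange_big /=; rewrite big_seq [RHS]big_seq; apply: eq_bigr => M hM.
rewrite hu in hs; have [hs' nN] := wick_state_rem hs; have nM := wick_fresh hs hM.
have tM := wick_twice hs' hM.
have tL : twice (M ++ s.1 :: s.2.1 ++ s.1 :: s.2.2) by apply/(twice_join nM nN).
have hdd : dd (lab s.1) = dd (lab n) by rewrite ha (sat_tau_d hD).
rewrite cat_rcons hu.
have -> : mdeg (M ++ s.1 :: s.2.1 ++ s.1 :: s.2.2) =
    mdeg (M ++ s.2.1 ++ s.2.2) - join_exp s.
  by rewrite (match_deg_join hD) //; [rewrite /join_exp; ring|case: hs'].
have -> : dot_count (string_degs (M ++ s.1 :: s.2.1 ++ s.1 :: s.2.2)) =
    dot_count (dd (lab n) :: string_degs (M ++ s.2.1 ++ s.2.2)).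
  apply/funext => z; apply: dot_count_perm; first exact: string_degs_pos.
  have hN : s.1 \in M ++ s.1 :: s.2.1 ++ s.1 :: s.2.2 by rewrite mem_cat inE eqxx orbT.
  rewrite -hdd -[_ :: string_degs _]/(map (fun Z => dd (lab Z)) (s.1 :: _)); apply: perm_map.
  apply: perm_trans (undup_filter_perm hN) _; rewrite !filter_cat /= eqxx filter_cat /= eqxx /=.
  by move: nN; rewrite mem_cat negb_or => /andP[n1 n2]; rewrite !filter_notin.
rewrite (dot_countS _ (sat_d hD _) (n := `|nn|%N)).
  rewrite -en absz_nat; apply: eq_bigr => j _; congr dot_count; ring.
rewrite gez0_abs //; apply: lt_le_trans hl; rewrite ltzD1.
apply: (@le_trans _ _ `|C s M|); last first.
  by rewrite (perm_big _ (perm_to_rem hM)) big_cons lerDl sumr_ge0.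
apply: le_trans (ler_norm _); rewrite /C; move: he (mdeg _) (join_exp s); clear => he a b; lia.
Qed.
End Limit.

(** * Names of strings *)

Section Names.
Variable D : satake_data.
Notation I := (idx D).
Notation word := (seq I).
Notation point := (nat * nat)%type.
Notation shape := Defs.shape.
Implicit Types (w wi : word) (s : shape D) (R : seq (seq nat)).

Definition merge (y z a : nat) : nat := if a == y then z else a.
Definition pmap2 (f : nat -> nat) (c : nat * nat) := (f c.1, f c.2).

(** Names for the strings of a shape, read from the top layer down: [R] lists the
    names of the points at each height, [C] the name of the string that is
    critical at each layer, [X] the names of the two strings that cross there.
    The strings are numbered at the top; a cap brings in a new name, and a cup
    identifies two names. *)
Inductive names : word -> word -> shape D -> seq (seq nat) ->
    seq (option nat) -> seq (option (nat * nat)) -> Prop :=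
| names_nil w : names w w [::] [:: iota 0 (size w)] [::] [::]
| names_cup u i v wi s A y z B R C X : size A = size u -> size B = size v ->
    names (u ++ [:: tau i, i & v]) wi s ((A ++ y :: z :: B) :: R) C X ->
    names (u ++ v) wi ((size u, PCup i) :: s)
      (map (merge y z) (A ++ B) :: map (map (merge y z)) ((A ++ y :: z :: B) :: R))
      (Some z :: map (omap (merge y z)) C) (None :: map (omap (pmap2 (merge y z))) X)
| names_cap u i v wi s A B R C X : size A = size u -> size B = size v ->
    names (u ++ v) wi s ((A ++ B) :: R) C X ->
    names (u ++ [:: tau i, i & v]) wi ((size u, PCap) :: s)
      ((map S A ++ 0%N :: 0%N :: map S B) :: map (map S) ((A ++ B) :: R))
      (Some 0%N :: map (omap S) C) (None :: map (omap (pmap2 S)) X)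
| names_cross u i j v wi s A y z B R C X : size A = size u -> size B = size v ->
    names (u ++ [:: j, i & v]) wi s ((A ++ y :: z :: B) :: R) C X ->
    names (u ++ [:: i, j & v]) wi ((size u, PCross) :: s)
      ((A ++ z :: y :: B) :: (A ++ y :: z :: B) :: R) (None :: C) (Some (z, y) :: X).

Lemma run_cons x w s : run w (x :: s) = obind (fun w1 => run w1 s) (layer_run x w).
Proof.
rewrite /run /=; case: (layer_run x w) => [//|] /=.
by elim: s.
Qed.

Inductive layer_spec : layer D -> word -> word -> Prop :=
| layer_cup u i v : layer_spec (size u, PCup i) (u ++ v) (u ++ [:: tau i, i & v])
| layer_cap u i v : layer_spec (size u, PCap) (u ++ [:: tau i, i & v]) (u ++ v)
| layer_cross u i j v :
    layer_spec (size u, PCross) (u ++ [:: i, j & v]) (u ++ [:: j, i & v]).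

Lemma layer_runP x w w1 : layer_run x w = Some w1 -> layer_spec x w w1.
Proof.
case: x => p c; rewrite /layer_run /=; have [hp|hp] := leqP p (size w); last first.
  by rewrite (drop_oversize (ltnW hp)); case: c.
have hs : size (take p w) = p by rewrite size_takel.
move: (cat_take_drop p w) hs; move: (take p w) (drop p w) => u v <- <- {p hp}.
case: c => [i||]; first by move=> [<-]; constructor.
- by case: v => [//|j [//|i v]]; case: eqP => // -> [<-]; constructor.
by case: v => [//|j [//|i v]] [<-]; constructor.
Qed.

Lemma layer_specE x w w1 : layer_spec x w w1 -> layer_run x w = Some w1.
Proof.
by case=> *; rewrite /layer_run /= ?take_size_cat ?drop_size_cat ?size_cat ?leq_addr ?eqxx.
Qed.

Lemma levelS x w w1 s t : layer_run x w = Some w1 -> level w (x :: s) t.+1 = level w1 s t.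
Proof. by move=> h; rewrite /level /= run_cons h. Qed.

Lemma split_at (H : seq nat) (u v : word) : size H = (size u + size v)%N ->
  exists A B, [/\ H = A ++ B, size A = size u & size B = size v].
Proof.
move=> h; exists (take (size u) H), (drop (size u) H); rewrite cat_take_drop size_drop h addKn.
by rewrite size_takel // h leq_addr.
Qed.

Lemma names_ex w wi s : run w s = Some wi ->
  exists H R C X, names w wi s (H :: R) C X /\ size H = size w.
Proof.
elim: s w => [|x s IH] w.
  by move=> [<-]; exists (iota 0 (size w)), [::], [::], [::]; split; [constructor|rewrite size_iota].
rewrite run_cons; case e: (layer_run x w) => [w1|//] /= /IH [H [R [C [X []]]]].
case: (layer_runP e) => {x w w1 e} [u i v|u i v|u i j v] hn hs.
- have [A [B [eH sA sB]]] : exists A B, [/\ H = A ++ B, size A = size u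
      & size B = size [:: tau i, i & v]] by apply: split_at; rewrite hs size_cat.
  subst H; case: B sB hn hs => [//|y [//|z B]] [sB] hn hs.
  by do 4 eexists; split; [apply: (names_cup sA sB hn)|rewrite size_map !size_cat sA sB].
- have [A [B [eH sA sB]]] := split_at (etrans hs (size_cat _ _)); subst H.
  do 4 eexists; split; [apply: (names_cap _ sA sB hn)|].
  by rewrite !size_cat /= !size_map sA sB.
have [A [B [eH sA sB]]] : exists A B, [/\ H = A ++ B, size A = size u
    & size B = size [:: j, i & v]] by apply: split_at; rewrite hs size_cat.
subst H; case: B sB hn hs => [//|y [//|z B]] [sB] hn hs.
by do 4 eexists; split; [apply: (names_cross sA sB hn)|rewrite !size_cat /= sA sB].
Qed.

Lemma names_run w wi s R C X : names w wi s R C X -> run w s = Some wi.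
Proof.
elim=> {w wi s R C X} [//|u i v wi s A y z B R C X _ _ _ IH|u i v wi s A B R C X _ _ _ IH
  |u i j v wi s A y z B R C X _ _ _ IH];
by rewrite run_cons (layer_specE (layer_cup _ _ _)) || rewrite run_cons (layer_specE (layer_cap _ _ _))
  || rewrite run_cons (layer_specE (layer_cross _ _ _ _)).
Qed.

Lemma names_size w wi s R C X : names w wi s R C X ->
  [/\ size C = size s, size X = size s & map size R = [seq size (level w s t) | t <- iota 0 (size s).+1]].
Proof.
have shift x (w0 w1 : word) s0 : layer_run x w0 = Some w1 ->
    [seq size (level w0 (x :: s0) t) | t <- iota 0 (size (x :: s0)).+1] =
    size w0 :: [seq size (level w1 s0 t) | t <- iota 0 (size s0).+1].
  move=> e; rewrite -[iota 0 (size (x :: s0)).+1]/(0%N :: iota (1 + 0) (size s0).+1).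
  rewrite map_cons iotaDl -map_comp; congr (_ :: _); apply: eq_map => t.
  by rewrite -(levelS _ _ e).
have mm (f : nat -> nat) (R0 : seq (seq nat)) : map size (map (map f) R0) = map size R0.
  by rewrite -map_comp; apply: eq_map => L /=; rewrite size_map.
elim=> {w wi s R C X} [w|u i v wi s A y z B R C X sA sB _ [h1 h2 h3]
  |u i v wi s A B R C X sA sB _ [h1 h2 h3]|u i j v wi s A y z B R C X sA sB _ [h1 h2 h3]].
- by split=> //=; rewrite size_iota.
- split; [by rewrite /= size_map h1|by rewrite /= size_map h2|].
  rewrite (shift _ _ _ _ (layer_specE (layer_cup _ _ _))) -h3 map_cons mm.
  by rewrite size_map !size_cat sA sB.
- split; [by rewrite /= size_map h1|by rewrite /= size_map h2|].
  rewrite (shift _ _ _ _ (layer_specE (layer_cap _ _ _))) -h3 map_cons mm.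
  by rewrite !size_cat /= !size_map sA sB.
split; [by rewrite /= h1|by rewrite /= h2|].
rewrite (shift _ _ _ _ (layer_specE (layer_cross _ _ _ _))) -h3 /=.
by rewrite !size_cat /= sA sB.
Qed.

(* the name of a point *)
Definition nm R (x : point) : option nat := onth (nth [::] R x.1) x.2.

Lemma nmS L R t p : nm (L :: R) (t.+1, p) = nm R (t, p). Proof. by []. Qed.

Lemma nm_map f R x : nm (map (map f) R) x = omap f (nm R x).
Proof.
rewrite /nm; have [h|h] := ltnP x.1 (size R); first by rewrite (nth_map [::]) // onth_map.
by rewrite !nth_default ?size_map // onth0n.
Qed.

Lemma nm_point w wi s R C X x : names w wi s R C X -> is_point w s x = (nm R x : bool).
Proof.
move=> hn; have [_ _ h] := names_size hn; rewrite /is_point /nm onthTE.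
have sR : size R = (size s).+1 by rewrite -(size_map size) h size_map size_iota.
have [hx|hx] := leqP x.1 (size s); last by rewrite nth_default ?sR.
have -> // : size (nth [::] R x.1) = size (level w s x.1).
rewrite -(nth_map _ 0%N size) ?sR ?ltnS // h (nth_map 0%N) ?size_iota ?ltnS //.
by rewrite nth_iota ?ltnS.
Qed.

Definition lift_pt (x : point) : point := (x.1.+1, x.2).

Lemma joined_lift x w w1 s a b : layer_run x w = Some w1 ->
  joined w1 s a b -> joined w (x :: s) (lift_pt a) (lift_pt b).
Proof.
move=> e; have lS t := levelS s t e.
case=> [t p i h|t p i r h hr|t p i r h hr|t p h|t p r h hr|t p r h hr hr'|t p h|t p h|t p r h hr hr' hr2].
- exact: (@joined_cup _ _ (x :: s) t.+1 p i).
- exact: (@joined_cup_left _ _ (x :: s) t.+1 p i).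
- by apply: (@joined_cup_right _ _ (x :: s) t.+1 p i) => //; rewrite lS.
- exact: (@joined_cap _ _ (x :: s) t.+1 p).
- exact: (@joined_cap_left _ _ (x :: s) t.+1 p).
- by apply: (@joined_cap_right _ _ (x :: s) t.+1 p) => //; rewrite lS.
- exact: (@joined_cross_up _ _ (x :: s) t.+1 p).
- exact: (@joined_cross_down _ _ (x :: s) t.+1 p).
by apply: (@joined_cross_other _ _ (x :: s) t.+1 p) => //; rewrite lS.
Qed.

Lemma joined_inv x w w1 s a b : layer_run x w = Some w1 -> joined w (x :: s) a b ->
  joined w [:: x] a b \/ exists a' b', [/\ a = lift_pt a', b = lift_pt b' & joined w1 s a' b'].
Proof.
move=> e; have lS t := levelS s t e.
case=> [[|t] p i h|[|t] p i r h hr|[|t] p i r h hr|[|t] p h|[|t] p r h hr|[|t] p r h hr hr'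
  |[|t] p h|[|t] p h|[|t] p r h hr hr' hr2]; try (rewrite lS in hr); try (rewrite lS in hr'); try (rewrite lS in hr2);
  try (left; by [exact: (joined_cup (t := 0) (s := [:: x]) _ h)
    | exact: (joined_cup_left (t := 0) (s := [:: x]) _ h hr)
    | exact: (joined_cup_right (t := 0) (s := [:: x]) h hr)
    | exact: (joined_cap (t := 0) (s := [:: x]) _ h)
    | exact: (joined_cap_left (t := 0) (s := [:: x]) _ h hr)
    | exact: (joined_cap_right (t := 0) (s := [:: x]) h hr hr')
    | exact: (joined_cross_up (t := 0) (s := [:: x]) _ h)
    | exact: (joined_cross_down (t := 0) (s := [:: x]) _ h)
    | exact: (joined_cross_other (t := 0) (s := [:: x]) h hr hr' hr2)]); right.
- by exists (t.+1, p), (t.+1, p.+1); split=> //; eapply joined_cup; eassumption.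
- by exists (t, r), (t.+1, r); split=> //; eapply joined_cup_left; eassumption.
- by exists (t, r), (t.+1, r.+2); split=> //; eapply joined_cup_right; eassumption.
- by exists (t, p), (t, p.+1); split=> //; eapply joined_cap; eassumption.
- by exists (t, r), (t.+1, r); split=> //; eapply joined_cap_left; eassumption.
- by exists (t, r.+2), (t.+1, r); split=> //; eapply joined_cap_right; eassumption.
- by exists (t, p), (t.+1, p.+1); split=> //; eapply joined_cross_up; eassumption.
- by exists (t, p.+1), (t.+1, p); split=> //; eapply joined_cross_down; eassumption.
by exists (t, r), (t.+1, r); split=> //; eapply joined_cross_other; eassumption.
Qed.
End Names.

Section NamesOfStrings.
Variable D : satake_data.
Notation I := (idx D).
Notation point := (nat * nat)%type.
Notation shape := Defs.shape.
Implicit Types (w wi : seq I) (s : shape D) (R : seq (seq nat)).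

Lemma nm0 (L : seq nat) R p : nm (L :: R) (0%N, p) = onth L p. Proof. by []. Qed.

Lemma nm_mapc f (L : seq nat) R x :
  nm (map f L :: map (map f) R) x = omap f (nm (L :: R) x).
Proof. exact: nm_map f (L :: R) x. Qed.

Lemma joined_nil w a b : ~ @joined D w [::] a b.
Proof. by case=> t p; rewrite onth0n. Qed.


Lemma joined_cup1 u i v a b : @joined D (u ++ v) [:: (size u, PCup i)] a b ->
  [\/ a = (1, size u)%N /\ b = (1, (size u).+1)%N,
      exists2 r, (r < size u)%N & a = (0, r)%N /\ b = (1, r)%N
    | exists2 r, (size u <= r)%N & a = (0, r)%N /\ b = (1, r.+2)%N].
Proof.
case=> [t p j|t p j r|t p j r|t p|t p r|t p r|t p|t p|t p r] /onth1P[-> []] //.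
- by move=> <- _; constructor 1.
- by move=> <- _ h; constructor 2; exists r.
by move=> <- _ /andP[h _]; constructor 3; exists r.
Qed.

Lemma joined_cap1 u i v a b : @joined D (u ++ [:: tau i, i & v]) [:: (size u, PCap)] a b ->
  [\/ a = (0, size u)%N /\ b = (0, (size u).+1)%N,
      exists2 r, (r < size u)%N & a = (0, r)%N /\ b = (1, r)%N
    | exists2 r, (size u <= r)%N & a = (0, r.+2)%N /\ b = (1, r)%N].
Proof.
case=> [t p j|t p j r|t p j r|t p|t p r|t p r|t p|t p|t p r] /onth1P[-> []] //.
- by move=> <-; constructor 1.
- by move=> <- h; constructor 2; exists r.
by move=> <- h _; constructor 3; exists r.
Qed.

Lemma joined_cross1 u i j v a b : @joined D (u ++ [:: i, j & v]) [:: (size u, PCross)] a b ->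
  [\/ a = (0, size u)%N /\ b = (1, (size u).+1)%N, a = (0, (size u).+1)%N /\ b = (1, size u)%N
    | exists r, [/\ r != size u, r != (size u).+1, a = (0, r)%N & b = (1, r)%N]].
Proof.
case=> [t p k|t p k r|t p k r|t p|t p r|t p r|t p|t p|t p r] /onth1P[-> []] //.
- by move=> <-; constructor 1.
- by move=> <-; constructor 2.
by move=> <- h h' _; constructor 3; exists r.
Qed.

Lemma names_joined w wi s R C X a b : names w wi s R C X -> joined w s a b -> nm R a = nm R b.
Proof.
move=> hn; elim: hn a b => {w wi s R C X} [w|u i v wi s A y z B R C X sA sB _ IH
  |u i v wi s A B R C X sA sB _ IH|u i j v wi s A y z B R C X sA sB _ IH] a b.
- by move/joined_nil.
- case/(joined_inv (layer_specE (layer_cup _ _ _))) => [/joined_cup1|[a' [b' [-> -> /IH e]]]];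
    last by rewrite !nmS !nm_map; move: e; case: a' b' => [? ?] [? ?] ->.
  case=> [[-> ->]|[r hr [-> ->]]|[r hr [-> ->]]]; rewrite ?map_cons ?nmS ?nm0 !onth_map !onth_cat sA.
  + by rewrite ltnn subnn ltnNge leqnSn /= subSnn /= /merge eqxx; case: eqP.
  + by rewrite hr.
  by rewrite !ltnNge hr ltnW ?ltnS ?(leqW hr) //= !subSn ?(leqW hr).
- case/(joined_inv (layer_specE (layer_cap _ _ _))) => [/joined_cap1|[a' [b' [-> -> /IH e]]]];
    last by rewrite !nmS !nm_map; move: e; case: a' b' => [? ?] [? ?] ->.
  case=> [[-> ->]|[r hr [-> ->]]|[r hr [-> ->]]]; rewrite ?map_cons ?nmS ?nm0 ?onth_map !onth_cat ?size_map sA.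
  + by rewrite ltnn subnn ltnNge leqnSn /= subSnn.
  + by rewrite hr onth_map.
  by rewrite !ltnNge hr ltnW ?ltnS ?(leqW hr) //= !subSn ?(leqW hr) //= onth_map.
case/(joined_inv (layer_specE (layer_cross _ _ _ _))) => [/joined_cross1|[a' [b' [-> -> /IH e]]]];
  last by rewrite !nmS; move: e; case: a' b' => [? ?] [? ?] ->.
case=> [[-> ->]|[-> ->]|[r [hr hr' -> ->]]]; rewrite ?map_cons ?nmS ?nm0 !onth_cat sA.
- by rewrite ltnn subnn ltnNge leqnSn /= subSnn.
- by rewrite ltnn subnn ltnNge leqnSn /= subSnn.
case: ltnP => // h; case e: (r - size u)%N => [|[|m]] //=; by [move: hr; lia|move: hr'; lia].
Qed.

Lemma same_nm w wi s R C X a b : names w wi s R C X -> same_string w s a b -> nm R a = nm R b.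
Proof.
by move=> hn; elim=> {a b} [a b /(names_joined hn)|//|a b _ ->|a b c _ -> _ ->].
Qed.

Lemma same_lift x w w1 s a b : layer_run x w = Some w1 ->
  same_string w1 s a b -> same_string w (x :: s) (lift_pt a) (lift_pt b).
Proof.
move=> e; elim=> {a b} [a b h|a|a b _ h|a b c _ h _ h'].
- exact/rst_step/(joined_lift e).
- exact: rst_refl.
- exact: rst_sym.
exact: rst_trans h h'.
Qed.

Lemma nm_same w wi s R C X a b c : names w wi s R C X ->
  nm R a = Some c -> nm R b = Some c -> same_string w s a b.
Proof.
move=> hn; elim: hn a b c => {w wi s R C X} [w|u i v wi s A y z B R C X sA sB _ IH
  |u i v wi s A B R C X sA sB _ IH|u i j v wi s A y z B R C X sA sB _ IH].
- have h t p c : nm [:: iota 0 (size w)] (t, p) = Some c -> (t, p) = (0, c)%N.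
    case: t => [|t]; rewrite /nm /= ?nth_nil ?onth0n // onthE => e.
    have hp : (p < size w)%N.
      by rewrite ltnNge; apply/negP => h; rewrite nth_default ?size_map ?size_iota in e.
    by move: e; rewrite (nth_map 0%N) ?size_iota // nth_iota // => -[<-].
  by move=> [t p] [t' p'] c /h -> /h ->; apply: rst_refl.
- set x := (size u, PCup i); set R1 := (A ++ _) :: R.
  have e : layer_run x (u ++ v) = Some _ := layer_specE (layer_cup u i v).
  have low a c : nm (map (merge y z) (A ++ B) :: map (map (merge y z)) R1) a = Some c ->
      exists a' c', [/\ same_string (u ++ v) (x :: s) a (lift_pt a'), nm R1 a' = Some c'
        & merge y z c' = c].
    case: a => [[|t] r]; last first.
      rewrite nmS nm_map; case e': (nm R1 (t, r)) => [c'|//] /= [<-].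
      by exists (t, r), c'; split=> //; apply: rst_refl.
    rewrite ?/R1 ?nmS ?nm0 onth_map; case e': (onth (A ++ B) r) => [c'|//] /= [<-].
    have hr : (r < size (u ++ v))%N by rewrite size_cat -sA -sB -size_cat -onthTE e'.
    rewrite onth_cat sA in e'; case: ltnP e' => h e'.
      exists (0%N, r), c'; split=> //; first exact: rst_step (joined_cup_left (t := 0) (s := x :: s) _ (erefl _) h).
      by rewrite ?/R1 ?nmS ?nm0 onth_cat sA h.
    exists (0%N, r.+2), c'; split=> //.
      by apply: rst_step; apply: (joined_cup_right (t := 0) (s := x :: s) (erefl _)); rewrite h.
    by rewrite ?/R1 ?nmS ?nm0 onth_cat sA ltnNge ltnW ?ltnS ?(leqW h) //= !subSn ?(leqW h).
  have ny : nm R1 (0%N, size u) = Some y by rewrite ?/R1 ?nmS ?nm0 onth_cat sA ltnn subnn.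
  have nz : nm R1 (0%N, (size u).+1) = Some z.
    by rewrite ?/R1 ?nmS ?nm0 onth_cat sA ltnNge leqnSn /= subSnn.
  have hj : same_string (u ++ v) (x :: s) (lift_pt (0, size u)%N) (lift_pt (0, (size u).+1)%N).
    exact: rst_step (joined_cup (t := 0) (s := x :: s) _ (erefl _)).
  move=> a b c /low[a' [c1 [sa na <-]]] /low[b' [c2 [sb nb]]] ec.
  apply: rst_trans sa _; apply: rst_trans (rst_sym _ _ _ _ sb).
  have lft p q d : nm R1 p = Some d -> nm R1 q = Some d ->
      same_string (u ++ v) (x :: s) (lift_pt p) (lift_pt q).
    by move=> hp hq; apply: (same_lift e); apply: IH hp hq.
  case: (eqVneq c1 c2) => [e12|ne]; first by rewrite e12 in na; apply: lft na nb.
  move: ec; rewrite /merge; case: (eqVneq c1 y) => [e1|n1]; case: (eqVneq c2 y) => [e2|n2].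
  + by rewrite e1 e2 eqxx in ne.
  + by move=> e2; subst c1 c2; apply: rst_trans (lft _ _ _ na ny) (rst_trans _ _ _ _ _ hj (lft _ _ _ nz nb)).
  + move=> e1; subst c1 c2; apply: rst_trans (lft _ _ _ na nz) _.
    by apply: rst_trans (rst_sym _ _ _ _ hj) (lft _ _ _ ny nb).
  by move=> e'; rewrite e' eqxx in ne.
- set x : layer D := (size u, PCap); set R1 := (A ++ _) :: R.
  have e : layer_run x (u ++ [:: tau i, i & v]) = Some _ := layer_specE (layer_cap u i v).
  set w := u ++ [:: tau i, i & v].
  have low a c : nm ((map S A ++ 0%N :: 0%N :: map S B) :: map (map S) R1) a = Some c ->
      (c = 0%N /\ same_string w (x :: s) a (0, size u)%N) \/
      exists a' c', [/\ same_string w (x :: s) a (lift_pt a'), nm R1 a' = Some c' & c = c'.+1].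
    case: a => [[|t] r]; last first.
      rewrite nmS nm_map; case e': (nm R1 (t, r)) => [c'|//] /= [<-].
      by right; exists (t, r), c'; split=> //; apply: rst_refl.
    rewrite ?/R1 ?nmS ?nm0 onth_cat size_map sA; case: ltnP => h.
      rewrite onth_map; case e': (onth A r) => [c'|//] /= [<-]; right.
      exists (0%N, r), c'; split=> //; first exact: rst_step (joined_cap_left (t := 0) (s := x :: s) _ (erefl _) h).
      by rewrite ?/R1 ?nmS ?nm0 onth_cat sA h.
    case er : (r - size u)%N => [|[|m]] /=.
    + by move=> [<-]; left; split=> //; have -> : r = size u by [lia]; apply: rst_refl.
    + move=> [<-]; left; split=> //; have -> : r = (size u).+1 by lia.
      exact/rst_sym/rst_step/(joined_cap (t := 0) (s := x :: s) _ (erefl _)).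
    rewrite onth_map; case e': (onth B m) => [c'|//] /= [<-]; right.
    have hm : (m < size v)%N by rewrite -sB -onthTE e'.
    exists (0%N, size u + m)%N, c'; split=> //; last first.
      by rewrite ?/R1 ?nmS ?nm0 onth_cat sA ltnNge leq_addr /= addKn.
    have -> : r = (size u + m).+2 by lia.
    apply: rst_step; apply: (joined_cap_right (t := 0) (s := x :: s) (erefl _)).
      exact: leq_addr.
    by rewrite /level /= /w size_cat /= !addnS !ltnS ltn_add2l.
  move=> a b c /low[[-> sa]|[a' [c1 [sa na ->]]]] /low[[]|[b' [c2 [sb nb]]]] //.
    by move=> _ sb; apply: rst_trans sa (rst_sym _ _ _ _ sb).
  move=> [ec]; subst c2; apply: rst_trans sa _; apply: rst_trans (rst_sym _ _ _ _ sb).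
  by apply: (same_lift e); apply: IH na nb.
set x : layer D := (size u, PCross); set R1 := (A ++ _ :: _ :: B) :: R.
have e : layer_run x (u ++ [:: i, j & v]) = Some _ := layer_specE (layer_cross u i j v).
set w := u ++ [:: i, j & v].
have low a c : nm ((A ++ z :: y :: B) :: R1) a = Some c ->
    exists2 a', same_string w (x :: s) a (lift_pt a') & nm R1 a' = Some c.
  case: a => [[|t] r] hc; last by exists (t, r) => //; apply: rst_refl.
  have hr : (r < size w)%N.
    move: hc; rewrite ?/R1 ?nmS ?nm0 => hc; have : onth (A ++ z :: y :: B) r by rewrite hc.
    by rewrite onthTE !size_cat /= sA sB.
  move: hc; rewrite ?/R1 ?nmS ?nm0 onth_cat sA; case: (ltnP r (size u)) => h.
    exists (0%N, r); last by rewrite ?/R1 ?nmS ?nm0 onth_cat sA h.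
    apply: rst_step; apply: (joined_cross_other (t := 0) (s := x :: s) (erefl _)) => //; lia.
  case er : (r - size u)%N => [|[|m]] /= hc.
  - have -> : r = size u by lia.
    exists (0, (size u).+1)%N; first exact: rst_step (joined_cross_up (t := 0) (s := x :: s) _ (erefl _)).
    by rewrite ?/R1 ?nmS ?nm0 onth_cat sA ltnNge leqnSn /= subSnn.
  - have -> : r = (size u).+1 by lia.
    exists (0, size u)%N; first exact: rst_step (joined_cross_down (t := 0) (s := x :: s) _ (erefl _)).
    by rewrite ?/R1 ?nmS ?nm0 onth_cat sA ltnn subnn.
  exists (0%N, r); last by rewrite ?/R1 ?nmS ?nm0 onth_cat sA ltnNge h er.
  apply: rst_step; apply: (joined_cross_other (t := 0) (s := x :: s) (erefl _)) => //; lia.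
move=> a b c /low[a' sa na] /low[b' sb nb]; apply: rst_trans sa _.
by apply: rst_trans (rst_sym _ _ _ _ sb); apply: (same_lift e); apply: IH na nb.
Qed.

Lemma names_crit w wi s R C X t : names w wi s R C X ->
  nth None C t = obind (nm R) (critical s t).
Proof.
move=> hn; elim: hn t => {w wi s R C X} [w|u i v wi s A y z B R C X sA sB _ IH
  |u i v wi s A B R C X sA sB _ IH|u i j v wi s A y z B R C X sA sB _ IH] t.
- by rewrite nth_nil /critical onth0n.
- case: t => [|t] /=.
    by rewrite /critical /= ?map_cons ?nmS ?nm0 onth_map onth_cat sA ltnn subnn /= /merge eqxx.
  have [h|h] := ltnP t (size C); last first.
    rewrite nth_default ?size_map //; move: (IH t); rewrite nth_default // /critical /=.
    by case: (onth s t) => [[p [k||]]|] //=; rewrite ?nmS ?nm_mapc ?nm_map => <-.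
  rewrite (nth_map None) // IH /critical /=.
  by case: (onth s t) => [[p [k||]]|] //=; rewrite ?nmS ?nm_mapc ?nm_map.
- case: t => [|t] /=.
    by rewrite /critical /= ?map_cons ?nmS ?nm0 onth_cat size_map sA ltnn subnn.
  have [h|h] := ltnP t (size C); last first.
    rewrite nth_default ?size_map //; move: (IH t); rewrite nth_default // /critical /=.
    by case: (onth s t) => [[p [k||]]|] //=; rewrite ?nmS ?nm_mapc ?nm_map => <-.
  rewrite (nth_map None) // IH /critical /=.
  by case: (onth s t) => [[p [k||]]|] //=; rewrite ?nmS ?nm_mapc ?nm_map.
by case: t => [//|t] /=; rewrite IH /critical /=; case: (onth s t) => [[p [k||]]|].
Qed.

Definition cross_at s R t : option (nat * nat) :=
  if onth s t is Some (p, PCross) then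
    if nm R (t, p) is Some a then omap (pair a) (nm R (t, p.+1)) else None
  else None.

Lemma names_cross_at w wi s R C X t : names w wi s R C X ->
  nth None X t = cross_at s R t /\
  (forall p, onth s t = Some (p, PCross) -> nth None X t != None).
Proof.
have mE (f : nat -> nat) s0 R0 t0 L :
    cross_at s0 R0 t0 = nth None L t0 -> forall x (H : seq nat),
    nth None (map (omap (pmap2 f)) L) t0 = cross_at (x :: s0) (H :: map (map f) R0) t0.+1.
  move=> e x H; have -> : nth None (map (omap (pmap2 f)) L) t0 = omap (pmap2 f) (nth None L t0).
    have [h|h] := ltnP t0 (size L); first by rewrite (nth_map None).
    by rewrite !nth_default ?size_map.
  rewrite -e /cross_at /=; case: (onth s0 t0) => [[p [k||]]|] //=; rewrite !nmS !nm_map.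
  by case: (nm R0 (t0, p)) => //= a; case: (nm R0 (t0, p.+1)).
have mN (f : nat -> nat) (L : seq (option (nat * nat))) t0 :
    nth None L t0 != None -> nth None (map (omap (pmap2 f)) L) t0 != None.
  have [h|h] := ltnP t0 (size L); last by rewrite nth_default.
  by rewrite (nth_map None) //; case: nth.
move=> hn; elim: hn t => {w wi s R C X} [w|u i v wi s A y z B R C X sA sB _ IH
  |u i v wi s A B R C X sA sB _ IH|u i j v wi s A y z B R C X sA sB _ IH] t.
- by rewrite nth_nil /cross_at onth0n.
- case: t => [|t]; first by split=> [|p []].
  have [e h] := IH t; split=> [|p /= /h /mN //]; exact: mE (esym e) _ _.
- case: t => [|t]; first by split=> [|p []].
  have [e h] := IH t; split=> [|p /= /h /mN //]; exact: mE (esym e) _ _.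
case: t => [|t]; last by have [e h] := IH t.
split=> //=; rewrite /cross_at /= ?map_cons ?nmS ?nm0 !onth_cat sA ltnn subnn ltnNge leqnSn /= subSnn.
by [].
Qed.
End NamesOfStrings.

(** * Reduced shapes in terms of names *)

Ltac odd_cases :=
  repeat match goal with |- context [odd ?n] => case: (odd n) end; by [].

Section Reduced.
Variable D : satake_data.
Notation I := (idx D).
Notation shape := Defs.shape.
Implicit Types (w wi : seq I) (s : shape D) (R : seq (seq nat)).
Implicit Types (C : seq (option nat)) (X : seq (option (nat * nat))).

(* unordered pairs *)
Definition nrm (c : nat * nat) := (minn c.1 c.2, maxn c.1 c.2).

Lemma nrmE a b c d :
  (nrm (a, b) == nrm (c, d)) = ((a == c) && (b == d)) || ((a == d) && (b == c)).
Proof.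
rewrite /nrm /= xpair_eqE; apply/idP/idP.
  by move=> /andP[/eqP h /eqP h']; move: h h'; rewrite /minn /maxn; case: (ltnP a b) => ?;
    case: (ltnP c d) => ? ? ?; subst; rewrite ?eqxx ?orbT //=; apply/orP; left; lia.
by move=> /orP[] /andP[/eqP -> /eqP ->]; rewrite ?eqxx // minnC maxnC !eqxx.
Qed.

Lemma nrmC a b : nrm (a, b) = nrm (b, a).
Proof. by apply/eqP; rewrite nrmE !eqxx orbT. Qed.

Definition red C X := [/\ uniq (pmap id C), forall a b, Some (a, b) \in X -> a != b
  & uniq (pmap (omap nrm) X)].

Lemma uniq_pmapE (T U : eqType) (g : option T -> option U) (L : seq (option T)) :
  g None = None -> uniq (pmap g L) <->
  forall t t' a, t != t' -> g (nth None L t) = Some a -> g (nth None L t') <> Some a.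
Proof.
move=> g0; elim: L => [|o L IH]; first by split=> // _ t t' a; rewrite !nth_nil g0.
have mem a t : g (nth None L t) = Some a -> a \in pmap g L.
  move=> h; rewrite mem_pmap -h; apply: map_f; apply: mem_nth.
  by rewrite ltnNge; apply/negP => hs; rewrite nth_default // g0 in h.
split=> [h [|t] [|t'] a //= ne|h].
- move: h => /=; case: (g o) => [b|] //= /andP[nb _] [<-] /mem hb; by rewrite hb in nb.
- move: h => /=; case: (g o) => [b|] //= /andP[nb _] /mem hb [e]; by rewrite e hb in nb.
- apply: (IH.1 _ t t' a) => //; move: h => /=; by case: (g o) => //= b /andP[].
have uL : uniq (pmap g L) by apply/IH => t t' a ne; exact: (h t.+1 t'.+1 a).
rewrite /=; case eo: (g o) => [b|] //=; rewrite uL andbT; apply/negP.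
rewrite mem_pmap => /mapP[c /(nthP None) [t _ <-] e].
by have := h 0%N t.+1 b isT eo; rewrite /= e.
Qed.

Lemma nth_omap (T : Type) (f : T -> T) (L : seq (option T)) t :
  nth None (map (omap f) L) t = omap f (nth None L t).
Proof.
have [h|h] := ltnP t (size L); first by rewrite (nth_map None).
by rewrite !nth_default ?size_map.
Qed.

Lemma nrm_map f c c' : nrm c = nrm c' -> nrm (pmap2 f c) = nrm (pmap2 f c').
Proof.
case: c c' => [a b] [c d] /eqP; rewrite nrmE => h; apply/eqP; rewrite nrmE /=.
by case/orP: h => /andP[/eqP -> /eqP ->]; rewrite !eqxx ?orbT.
Qed.

Lemma red_map f o o' C X :
  red (o :: map (omap f) C) (o' :: map (omap (pmap2 f)) X) -> red C X.
Proof.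
move=> [/uniq_pmapE h1 h2 /uniq_pmapE h3]; split.
- apply/uniq_pmapE => // t t' a ne e e'.
  by have := h1 erefl t.+1 t'.+1 (f a) ne; rewrite /= !nth_omap e e' => /(_ erefl).
- move=> a b hab; have := h2 (f a) (f b); rewrite inE.
  have -> : Some (f a, f b) \in map (omap (pmap2 f)) X.
    by apply/mapP; exists (Some (a, b)).
  by rewrite orbT => /(_ isT); apply: contraNneq => ->.
apply/uniq_pmapE => // t t' a ne; case e: (nth None X t) => [c|] //= [ec].
case e': (nth None X t') => [c'|] //= [ec'].
have := h3 erefl t.+1 t'.+1 (nrm (pmap2 f c)) ne; rewrite /= !nth_omap e e' /= => /(_ erefl).
by apply; congr Some; apply: nrm_map; rewrite ec.
Qed.

Lemma red_cross C X a b : red (None :: C) (Some (a, b) :: X) <->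
  [/\ red C X, a != b & Some (nrm (a, b)) \notin map (omap nrm) X].
Proof.
rewrite /red /= -mem_pmap; split=> [[h1 h2 /andP[h3 h4]]|[[h1 h2 h3] h4 h5]]; split=> //.
- by split=> // c d hc; apply: h2; rewrite inE hc orbT.
- by apply: h2; rewrite inE eqxx.
- by move=> c d; rewrite inE => /orP[/eqP[-> ->]|/h2].
by rewrite h5.
Qed.

Lemma cross_atP w wi s R C X t a b : names w wi s R C X -> nth None X t = Some (a, b) ->
  exists p, [/\ onth s t = Some (p, PCross), nm R (t, p) = Some a & nm R (t, p.+1) = Some b].
Proof.
move=> hn; have [-> _] := names_cross_at t hn; rewrite /cross_at.
case: (onth s t) => [[p [k||]]|] //; case e: (nm R (t, p)) => [c|] //.
by case e': (nm R (t, p.+1)) => [d|] //= [<- <-]; exists p.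
Qed.

Lemma red_of_reduced w wi s R C X : names w wi s R C X -> reduced w s -> red C X.
Proof.
move=> hn [h1 h2 h3]; split.
- apply/uniq_pmapE => // t t' a ne; rewrite /= !(names_crit _ hn).
  case e: (critical s t) => [x|] //= hx; case e': (critical s t') => [x'|] //= hx'.
  exact: (h1 t t' x x' ne e e') (nm_same hn hx hx').
- move=> a b /(nthP None)[t _ /(cross_atP hn)[p [ho ha hb]]]; apply/eqP => e.
  by apply: (h2 t p ho); apply: (nm_same hn ha); rewrite e.
apply/uniq_pmapE => // t t' q ne; case e: (nth None X t) => [[a b]|] //= [eq].
case e': (nth None X t') => [[c d]|] //= [eq'].
have [p [ho ha hb]] := cross_atP hn e; have [p' [ho' hc hd]] := cross_atP hn e'.
have [g1 g2] := h3 t t' p p' ne ho ho'.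
have /eqP := etrans eq (esym eq'); rewrite nrmE => /orP[] /andP[/eqP ea /eqP eb]; subst a b.
  by apply: g1; split; [exact: nm_same hn ha hc|exact: nm_same hn hb hd].
by apply: g2; split; [exact: nm_same hn ha hd|exact: nm_same hn hb hc].
Qed.

Lemma names_critS w wi s R C X t x : names w wi s R C X ->
  critical s t = Some x -> exists a, nm R x = Some a.
Proof.
move=> hn hc; suff h : nth None C t != None.
  by move: h; rewrite (names_crit _ hn) hc /=; case: (nm R x) => // a _; exists a.
have {hc x} : critical s t != None by rewrite hc.
rewrite /critical; elim: hn t => {w wi s R C X} [w|u i v wi s A y z B R C X sA sB _ IH
  |u i v wi s A B R C X sA sB _ IH|u i j v wi s A y z B R C X sA sB _ IH] [|t] //=;
  rewrite ?onth0n //; move: (IH t);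
  by case: (onth s t) => [[p [k||]]|] //= h _; rewrite ?nth_omap; case: (nth None C t) (h isT).
Qed.

Lemma reduced_of_red w wi s R C X : names w wi s R C X -> red C X -> reduced w s.
Proof.
have crossS t p : names w wi s R C X -> onth s t = Some (p, PCross) -> exists a b,
    [/\ nth None X t = Some (a, b), nm R (t, p) = Some a & nm R (t, p.+1) = Some b].
  move=> hn ho; have [_ /(_ p ho)] := names_cross_at t hn.
  case e: (nth None X t) => [[a b]|] // _; exists a, b.
  by have [p' []] := cross_atP hn e; rewrite ho => -[<-].
have memX t c : nth None X t = Some c -> Some c \in X.
  move=> e; rewrite -e; apply: mem_nth; rewrite ltnNge; apply/negP => h.
  by rewrite nth_default in e.
move=> hn [/uniq_pmapE h1 h2 /uniq_pmapE h3]; split.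
- move=> t t' x x' ne e e' /(same_nm hn) hx.
  have [a ha] := names_critS hn e.
  have := h1 erefl t t' a ne; rewrite !(names_crit _ hn) e e' /= -hx ha; exact.
- move=> t p ho; have [a [b [e ha hb]]] := crossS _ _ hn ho => /(same_nm hn).
  rewrite ha hb => -[eab]; move: (h2 a b (memX _ _ e)); by rewrite eab eqxx.
move=> t t' p p' ne ho ho'; have [a [b [e ha hb]]] := crossS _ _ hn ho.
have [c [d [e' hc hd]]] := crossS _ _ hn ho'.
have g : nrm (c, d) <> nrm (a, b).
  move=> en; have := h3 erefl t t' (nrm (a, b)) ne; rewrite e e' /= en; exact.
by split=> -[/(same_nm hn) q1 /(same_nm hn) q2]; move: q1 q2; rewrite ha hb hc hd => -[ea] [eb];
  apply: g; rewrite ea eb // nrmC.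
Qed.

Definition ends R : seq nat := rev (last [::] R) ++ head [::] R.

Lemma ends_map f (H N : seq nat) R :
  ends (map f N :: map (map f) (H :: R)) = map f (rev (last H R) ++ N).
Proof. by rewrite /ends /= last_map map_cat map_rev. Qed.

Lemma inv_rev S Z L : inv S Z (rev L) = inv Z S L.
Proof.
elim: L => [//|x L IH]; rewrite rev_cons -cats1 inv_cat IH !inv_consE /= count_rev.
by rewrite [x == Z]eq_sym eq_sym; case: eqP; case: eqP => /=; lia.
Qed.

Lemma count_merge y z x L : y != z -> count_mem x (map (merge y z) L) =
  if x == y then 0%N else if x == z then (count_mem y L + count_mem z L)%N else count_mem x L.
Proof.
move=> ne; elim: L => [|a L IH]; first by case: (x == y); case: (x == z).
rewrite /= IH /merge; case: (eqVneq x y) => [->|nx].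
  by case: (eqVneq a y) => [_|na]; rewrite ?(eq_sym z) ?(negPf ne) ?(negPf na).
case: (eqVneq a y) => [->|na]; rewrite ?(eq_sym z x) ?(eq_sym y x) ?(negPf nx) ?(negPf ne) /=.
  by case: (eqVneq x z) => _ //=; lia.
by case: (eqVneq x z) => [->|_] //=; lia.
Qed.

Lemma merge_id y L : map (merge y y) L = L.
Proof. by elim: L => //= a L ->; rewrite /merge; case: eqP => [->|]. Qed.

Lemma inv_merge0 y z x Z L : y != z -> x != y -> x != z -> Z != y -> Z != z ->
  inv x Z (map (merge y z) L) = inv x Z L.
Proof.
move=> ne hx hx' hZ hZ'; elim: L => [//|a L IH]; rewrite map_cons !inv_consE IH count_merge //.
rewrite (negPf hZ) (negPf hZ'); congr (_ + _)%N; rewrite /merge.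
by case: (eqVneq a y) => [->|//]; rewrite eq_sym (negPf hx') eq_sym (negPf hx).
Qed.

Lemma inv_mergeL y z Z L : y != z -> Z != y -> Z != z ->
  inv z Z (map (merge y z) L) = (inv y Z L + inv z Z L)%N.
Proof.
move=> ne hZ hZ'; elim: L => [//|a L IH]; rewrite map_cons !inv_consE IH count_merge //.
rewrite (negPf hZ) (negPf hZ') /merge; case: (eqVneq a y) => [->|na].
  by rewrite eqxx (negPf ne); lia.
by case: (a == z); lia.
Qed.

Lemma inv_mergeR y z x L : y != z -> x != y -> x != z ->
  inv x z (map (merge y z) L) = (inv x y L + inv x z L)%N.
Proof.
move=> ne hx hx'; elim: L => [//|a L IH]; rewrite map_cons !inv_consE IH count_merge //.
rewrite [z == y]eq_sym (negPf ne) eqxx /merge; case: (eqVneq a y) => [->|na].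
  by rewrite ![_ == x]eq_sym (negPf hx) (negPf hx'); lia.
by case: (a == x); lia.
Qed.

Definition ncross S Z X := count_mem (Some (nrm (S, Z))) (map (omap nrm) X).

Lemma ncross_consN S Z X : ncross S Z (None :: X) = ncross S Z X.
Proof. by []. Qed.

Lemma ncrossC S Z X : ncross S Z X = ncross Z S X.
Proof. by rewrite /ncross nrmC. Qed.

Lemma ncross_merge y z S Z X : y != z -> S != Z ->
  ncross S Z (map (omap (pmap2 (merge y z))) X) =
  if (S == y) || (Z == y) then 0%N else
  if S == z then (ncross y Z X + ncross z Z X)%N else
  if Z == z then (ncross S y X + ncross S z X)%N else ncross S Z X.
Proof.
move=> ne nSZ; elim: X => [|o X IH].
  by rewrite /ncross /=; do !case: ifP.
move: IH; rewrite /ncross /=; case: o => [[a b]|] //= IH; rewrite IH {IH}.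
have SE (p q : nat * nat) : (Some p == Some q) = (p == q) by [].
have fy c : (merge y z c == y) = false.
  by rewrite /merge; case: (eqVneq c y) => [_|/negPf //]; rewrite eq_sym (negPf ne).
have fz c : (merge y z c == z) = (c == y) || (c == z).
  by rewrite /merge; case: (eqVneq c y) => // ->; rewrite eqxx.
have fx c x : x != y -> x != z -> (merge y z c == x) = (c == x).
  move=> h h'; rewrite /merge; case: (eqVneq c y) => // ->.
  by rewrite ![_ == x]eq_sym (negPf h) (negPf h').
rewrite !SE /pmap2 /= !nrmE.
have [eS|nS] := eqVneq S y; first by rewrite eS !fy andbF.
have [eZ|nZ] := eqVneq Z y; first by rewrite eZ !fy andbF.
have key (x : nat) : x != y -> x != z ->
    ((merge y z a == z) && (merge y z b == x) || (merge y z a == x) && (merge y z b == z) : nat) =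
    (((a == y) && (b == x) || (a == x) && (b == y)) + ((a == z) && (b == x) || (a == x) && (b == z)))%N.
  move=> h h'; rewrite !fz !(fx _ x) //.
  case: (eqVneq a x) => [->|na]; rewrite ?(negPf h) ?(negPf h') /=.
    by case: (eqVneq b y) => [->|nb]; rewrite ?(negPf ne) //; case: (b == z).
  rewrite !orbF; case: (eqVneq a y) => [->|na']; rewrite ?(negPf ne) /=;
  by case: (b == x); rewrite ?andbF //; case: (a == z).
rewrite /=; have [eS'|nS'] := eqVneq S z.
  by subst S; rewrite addnACA key // 1?eq_sym // eq_sym.
have [eZ'|nZ'] := eqVneq Z z.
  subst Z; rewrite addnACA; congr (_ + _)%N.
  by rewrite orbC key //; congr (_ + _)%N; rewrite orbC.
by rewrite !fx.
Qed.

(** Two strings cross an odd number of times exactly when their ends alternate. *)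
Lemma names_inv w wi s R C X S Z : names w wi s R C X -> S != Z ->
  odd (inv S Z (ends R)) = odd (ncross S Z X).
Proof.
move=> hn; elim: hn S Z => {w wi s R C X} [w|u i v wi s A y z B R C X sA sB _ IH
  |u i v wi s A B R C X sA sB _ IH|u i j v wi s A y z B R C X sA sB _ IH] S Z ne.
- rewrite /ends /= inv_cat inv_rev; set L := iota _ _.
  by rewrite addnC (@inv_sym Z S) 1?eq_sym // count_rev mulnC addnn odd_double.
- rewrite ends_map ncross_consN catA; set Q := _ ++ A.
  have E S' Z' : S' != Z' -> odd (ncross S' Z' X) = odd (inv S' Z' (Q ++ y :: z :: B)).
    by move=> h; rewrite -(IH _ _ h) /ends /= catA.
  clearbody Q; case: (eqVneq y z) => [e|yz].
    subst z; rewrite merge_id (_ : map _ X = X); last first.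
      rewrite -[RHS]map_id; apply: eq_map => -[[a b]|] //=; congr (Some (_, _)); rewrite /merge;
      by case: eqP.
    rewrite E // !inv_cat !inv_consE !count_consE.
    case: (eqVneq y S) => [e1|_]; case: (eqVneq y Z) => [e2|_];
      first (by rewrite -e1 -e2 eqxx in ne); rewrite !(oddD, oddM) /=; odd_cases.
  rewrite ncross_merge //.
  have [eS|nS] := eqVneq S y; first by rewrite /= inv0 //; left; rewrite count_merge // eS eqxx.
  have [eZ|nZ] := eqVneq Z y; first by rewrite /= inv0 //; right; rewrite count_merge // eZ eqxx.
  rewrite /=; have [eS'|nS'] := eqVneq S z.
    subst S; rewrite inv_mergeL // 1?eq_sym // !oddD !E // 1?eq_sym //.
    rewrite !inv_cat !inv_consE !count_consE !eqxx (negPf yz) [z == y]eq_sym (negPf yz).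
    rewrite (eq_sym y Z) (negPf nZ) (negPf ne) !(oddD, oddM) /=; odd_cases.
  have [eZ'|nZ'] := eqVneq Z z.
    subst Z; rewrite inv_mergeR // !oddD !E //.
    rewrite !inv_cat !inv_consE !count_consE !eqxx (negPf yz) [z == y]eq_sym (negPf yz).
    rewrite (eq_sym y S) (negPf nS) (eq_sym z S) (negPf nS') !(oddD, oddM) /=; odd_cases.
  rewrite inv_merge0 // E // !inv_cat !inv_consE !count_consE.
  by rewrite (eq_sym y S) (eq_sym z S) (eq_sym y Z) (eq_sym z Z) (negPf nS) (negPf nS') (negPf nZ) (negPf nZ').
- rewrite ncross_consN /ends [last _ _]/= last_map -map_rev [head _ _]/= catA -map_cat.
  set Q := _ ++ A; have E S' Z' : S' != Z' -> odd (ncross S' Z' X) = odd (inv S' Z' (Q ++ B)).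
    by move=> h; rewrite -(IH _ _ h) /ends /= catA.
  clearbody Q; have c0 L : count_mem 0%N (map succn L) = 0%N by apply/count_memPn/mapP => -[].
  have cS a L : count_mem a.+1 (map succn L) = count_mem a L by rewrite count_map; apply: eq_count.
  have iS a b L : inv a.+1 b.+1 (map succn L) = inv a b L.
    by elim: L => //= x L IHL; rewrite IHL eqSS cS.
  have n0 a : ncross 0 a (map (omap (pmap2 succn)) X) = 0%N.
    rewrite /ncross -map_comp; apply/count_memPn/mapP => -[[[b c]|] // _ /= [e]].
    by move=> _; move: e; rewrite min0n /minn; case: ifP.
  have nS a b : ncross a.+1 b.+1 (map (omap (pmap2 succn)) X) = ncross a b X.
    rewrite /ncross -map_comp !count_map; apply: eq_count => -[[c d]|] //=.
    have SE (p q : nat * nat) : (Some p == Some q) = (p == q) by [].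
    by rewrite !SE /pmap2 /= !nrmE.
  case: S Z ne => [|a] [|b] // ne.
  + rewrite n0 !inv_cat !inv_consE !count_consE !c0 !cS !(@inv0 0%N) ?c0; auto; rewrite !(oddD, oddM) /=; odd_cases.
  + rewrite ncrossC n0 !inv_cat !inv_consE !count_consE !c0 !cS !(@inv0 _ 0%N) ?c0; auto; rewrite !(oddD, oddM) /=; odd_cases.
  by rewrite nS E // !inv_cat !inv_consE !count_consE !iS !cS /=; congr odd; lia.
have E : odd (ncross S Z X) = odd (inv S Z ((rev (last (A ++ y :: z :: B) R) ++ A) ++ y :: z :: B)).
  by rewrite -(IH _ _ ne) /ends /= catA.
rewrite /ends [last _ _]/= [head _ _]/= catA; move: E; set Q := _ ++ A => E; clearbody Q.
have -> : ncross S Z (Some (z, y) :: X) = ((nrm (z, y) == nrm (S, Z)) + ncross S Z X)%N by [].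
rewrite oddD E nrmE.
rewrite !inv_cat !inv_consE !count_consE.
have n1 : ~~ ((z == S) && (z == Z)) by apply: contra ne => /andP[/eqP <- /eqP <-].
have n2 : ~~ ((y == S) && (y == Z)) by apply: contra ne => /andP[/eqP <- /eqP <-].
move: n1 n2; case: (z == S); case: (y == S); case: (z == Z); case: (y == Z) => //= _ _;
  rewrite ?(oddD, oddM) /=; odd_cases.
Qed.

Lemma names_twice w wi s R C X : names w wi s R C X -> twice (ends R).
Proof.
elim=> {w wi s R C X} [w|u i v wi s A y z B R C X sA sB _ IH
  |u i v wi s A B R C X sA sB _ IH|u i j v wi s A y z B R C X sA sB _ IH].
- move=> x; rewrite /ends /= mem_cat mem_rev orbb count_cat count_rev => h.
  by rewrite count_uniq_mem ?iota_uniq // h.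
- rewrite ends_map; move: IH; rewrite /ends [last _ _]/= [head _ _]/= !catA; set Q := _ ++ A => tw.
  have cE x : count_mem x (Q ++ y :: z :: B) = ((y == x) + (z == x) + count_mem x (Q ++ B))%N.
    by rewrite !count_cat !count_consE; lia.
  have mE x : x \in Q ++ B -> x \in Q ++ y :: z :: B.
    by rewrite !(mem_cat, inE) => /orP[]->; rewrite ?orbT.
  case: (eqVneq y z) => [e|yz].
    subst z; rewrite merge_id => x hx; have := tw x (mE x hx); rewrite cE.
    case: eqP => [e|_ //]; subst x => h; have : (0 < count_mem y (Q ++ B))%N.
      by rewrite -has_count has_pred1.
    by move=> /lt0n_neq0; rewrite -(eqn_add2l 2) h.
  have cy : count_mem y (Q ++ B) = 1%N.
    have := tw y; rewrite cE eqxx eq_sym (negPf yz) !(mem_cat, inE) eqxx orbT => /(_ isT); lia.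
  have cz : count_mem z (Q ++ B) = 1%N.
    have := tw z; rewrite cE eqxx (negPf yz) !(mem_cat, inE) eqxx !orbT => /(_ isT); lia.
  move=> x hx; rewrite count_merge // cy cz.
  have c1 : count_mem x (map (merge y z) (Q ++ B)) != 0%N.
    by apply/eqP => /count_memPn; rewrite hx.
  move: c1; rewrite count_merge //; case: (eqVneq x y) => // nx; case: (eqVneq x z) => // nz.
  move=> c1; rewrite -(tw x) ?cE 1?(eq_sym y) 1?(eq_sym z) ?(negPf nx) ?(negPf nz) //.
  by apply: mE; apply: contraR c1 => /count_memPn ->.
- rewrite /ends [last _ _]/= last_map -map_rev [head _ _]/= catA -map_cat.
  move: IH; rewrite /ends [last _ _]/= [head _ _]/= catA; set Q := _ ++ A => tw [|x].
    by rewrite count_cat !count_consE !(count_memPn _) //; apply/mapP => -[].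
  rewrite !(mem_cat, inE) /= !(mem_map succn_inj) -mem_cat => /tw.
  have cS L : count_mem x.+1 (map S L) = count_mem x L by rewrite count_map; apply: eq_count.
  by clearbody Q; move=> <-; rewrite !count_cat !count_consE !cS.
move: IH; rewrite /ends [last _ _]/= [head _ _]/= !catA; set Q := _ ++ A => tw x.
have hp : perm_eq (Q ++ z :: y :: B) (Q ++ y :: z :: B).
  by rewrite perm_cat2l (perm_catCA [:: z] [:: y] B).
by rewrite (perm_mem hp) => /tw <-; apply/permP.
Qed.

(** A string joins two points at the bottom exactly when it has an odd number of
    critical points, or has its ends at the top and an even number. *)
Lemma names_crits w wi s R C X x : names w wi s R C X -> x \in ends R ->
  odd (count_mem x (head [::] R)) = ~~ odd (count_mem (Some x) C).
Proof.
move=> hn; elim: hn x => {w wi s R C X} [w|u i v wi s A y z B R C X sA sB hn IH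
  |u i v wi s A B R C X sA sB _ IH|u i j v wi s A y z B R C X sA sB _ IH] x.
- rewrite /ends /= mem_cat mem_rev orbb => h.
  by rewrite count_uniq_mem ?iota_uniq // h.
- rewrite ends_map [head _ _]/= => hx.
  have tw := names_twice hn; move: IH tw hx; rewrite /ends [last _ _]/= [head _ _]/= => IH tw.
  have cCE a : count_mem (Some a) (map (omap (merge y z)) C) =
      if y == z then count_mem (Some a) C else
      if a == y then 0%N else if a == z then (count_mem (Some y) C + count_mem (Some z) C)%N
      else count_mem (Some a) C.
    case: (eqVneq y z) => [->|yz].
      rewrite (_ : map _ C = C) // -[RHS]map_id; apply: eq_map => -[b|] //=; congr Some.
      by rewrite /merge; case: eqP.
    have := fun L => count_merge a L yz; move=> cm.
    have pE b : count_mem (Some b) C = count_mem b (pmap id C).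
      by elim: (C) => [//|[c|] C' IHC] /=; rewrite IHC.
    rewrite !pE -cm; elim: (C) => [//|[c|] C' IHC] /=; by rewrite IHC.
  case: (eqVneq y z) => [e|yz] hx.
    subst z; rewrite merge_id in hx; rewrite merge_id /= cCE eqxx.
    have nx : y == x = false.
      apply/negP => /eqP e; subst x; have := tw y; rewrite !(mem_cat, inE) eqxx !orbT => /(_ isT).
      rewrite !count_cat !count_consE eqxx; have : (0 < count_mem y (rev (last (A ++ [:: y, y & B]) R) ++ A ++ B))%N.
        by rewrite -has_count has_pred1.
      by rewrite !count_cat; lia.
    rewrite -[Some y == Some x]/(y == x) nx add0n -IH; last first.
      by move: hx; rewrite !(mem_cat, inE) => /or3P[]->; rewrite ?orbT.
    by rewrite !count_cat !count_consE nx.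
  rewrite count_merge // /= cCE (negPf yz) -[Some z == Some x]/(z == x).
  have memL a : a \in [:: y; z] -> a \in rev (last (A ++ [:: y, z & B]) R) ++ A ++ [:: y, z & B].
    by rewrite !(mem_cat, inE) => /orP[]->; rewrite ?orbT.
  have nxy : x != y.
    by apply/eqP => e; move/count_memPn: hx; rewrite count_merge // e eqxx; case.
  rewrite (negPf nxy) [z == x]eq_sym; case: (eqVneq x z) => [e|nz].
    have := IH y (memL y _); have := IH z (memL z _); rewrite !inE !eqxx orbT => /(_ isT) h1 /(_ isT) h2.
    move: h1 h2; rewrite !count_cat !count_consE !eqxx (negPf yz) eq_sym (negPf yz) !oddD /=.
    odd_cases.
  rewrite add0n -IH ?count_cat ?count_consE; last first.
    have : count_mem x (map (merge y z) (rev (last (A ++ [:: y, z & B]) R) ++ A ++ B)) != 0%N.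
      by apply/eqP => /count_memPn; rewrite hx.
    rewrite count_merge // (negPf nxy) (negPf nz) -lt0n -has_count has_pred1.
    by rewrite !(mem_cat, inE) => /or3P[]->; rewrite ?orbT.
  by rewrite [y == x]eq_sym [z == x]eq_sym (negPf nxy) (negPf nz).
- rewrite /ends [last _ _]/= last_map -map_rev [head _ _]/=; case: x => [_|x].
    have c0 L : count_mem 0%N (map S L) = 0%N by apply/count_memPn/mapP => -[].
    rewrite count_cat !count_consE !c0 /= (_ : count_mem _ _ = 0%N) //.
    by apply/count_memPn/mapP => -[[]].
  rewrite !(mem_cat, inE) /= !(mem_map succn_inj) => hx.
  have -> : count_mem (Some x.+1) (map (omap S) C) = count_mem (Some x) C.
    by rewrite count_map; apply: eq_count => -[].
  by rewrite -[X in ~~ odd X]add0n -IH ?mem_cat // !count_cat !count_consE !count_map.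
rewrite /ends [last _ _]/= [head _ _]/= /= => hx; rewrite add0n -IH.
  by rewrite [head _ _]/= !count_cat !count_consE; congr (odd (_ + _)); exact: addnCA.
by move: hx; rewrite /ends /= !(mem_cat, inE) => /or3P[->|->|/or3P[]->]; rewrite ?orbT.
Qed.
End Reduced.

(** * The degree of a reduced shape *)

Section ShapeDegree.
Variables (D : satake_data) (hD : satake_axioms D) (P : structure_consts D).
Variable l : iw_lattice D.
Notation I := (idx D).
Notation shape := Defs.shape.
Implicit Types (w wi : seq I) (s : shape D) (R : seq (seq nat)).
Implicit Types (C : seq (option nat)) (X : seq (option (nat * nat))).
Notation vlab := (@vlab D).
Notation mdeg := (match_deg l).
Notation cap_deg := (@cap_deg D).

Definition word_dots (f : nat -> nat) w : nat :=
  \sum_(x <- zip (iota 0 (size w)) w) 2 * dd x.2 * f x.1.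

Lemma hdeg_dots m i n : hdeg m [:: i] [:: i] (2 * dd i * n)%:Z (dots P i n).
Proof.
elim: n => [|n IH]; first by rewrite muln0; constructor.
rewrite mulnS PoszD; exact: hdeg_comp (hdeg_dot _ _ _) IH.
Qed.

Lemma hdeg_dotted_word f w : hdeg l w w (word_dots f w)%:Z (dotted_word P f w).
Proof.
suff H n : hdeg l w w (\sum_(x <- zip (iota n (size w)) w) 2 * dd x.2 * f x.1)%N%:Z
    (foldr (fun x a => TTens (dots P x.2 (f x.1)) a) (TId [::]) (zip (iota n (size w)) w)) by exact: H.
elim: w n => [|i w IH] n /=; first by rewrite big_nil; exact: hdeg_id.
by rewrite big_cons PoszD -[i :: w]/([:: i] ++ w); apply: hdeg_tens (hdeg_dots _ _ _) (IH _).
Qed.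

Lemma hdeg_between u v v1 v2 d a : hdeg (P := P) (l - wti v) v1 v2 d a ->
  hdeg l (u ++ v1 ++ v) (u ++ v2 ++ v) d (TTens (TTens (TId u) a) (TId v)).
Proof.
move=> h; rewrite !catA -[d]addr0 -[d]add0r; apply: hdeg_tens; last exact: hdeg_id.
by apply: hdeg_tens h; apply: hdeg_id.
Qed.

Lemma hdeg_cons x w w1 wi s nu d dl : layer_run x w = Some w1 ->
  hdeg l w w1 dl (layer_tm P x w) ->
  hdeg l w1 wi d (dotted_shape P (fun t => nu t.+1) w1 s) ->
  hdeg l w wi (d + dl + (word_dots (nu 0%N) w)%:Z) (dotted_shape P nu w (x :: s)).
Proof.
move=> e h1 h2; rewrite /= e; apply: hdeg_comp (hdeg_dotted_word _ _).
exact: hdeg_comp h2 h1.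
Qed.

(* the degree of the cups joining the ends of two copies of [w] *)
Fixpoint nest_deg w : int :=
  if w is i :: w' then cap_deg i (l - wti w') + nest_deg w' else 0.

Lemma twice_nest (L : seq nat) : uniq L -> twice (rev L ++ L).
Proof.
by move=> u x; rewrite mem_cat mem_rev orbb count_cat count_rev => h; rewrite count_uniq_mem // h.
Qed.

Lemma match_deg_nest lab L : uniq L -> mdeg lab (rev L ++ L) = nest_deg (map lab L).
Proof.
elim: L => [_|a L IH u]; first by rewrite /match_deg /= big_nil addr0.
have tw := twice_nest u; rewrite rev_cons cat_rcons in tw *.
rewrite (match_deg_cap hD) //= addrC IH; last by case/andP: u.
by rewrite vlab_uniq //; case/andP: u.
Qed.

Lemma vlab_sub lab M T : {subset M <= T} ->
  vlab lab (M ++ T) = [seq tau (lab x) | x <- M] ++ vlab lab T.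
Proof.
elim: M => [//|x M IH] h /=; rewrite mem_cat h ?inE ?eqxx // orbT IH // => y hy.
by apply: h; rewrite inE hy orbT.
Qed.

Fixpoint ndots (lab : nat -> I) (nu : nat -> nat -> nat) R : nat :=
  if R is H :: R' then
    (\sum_(x <- zip (iota 0 (size H)) H) 2 * dd (lab x.2) * nu 0%N x.1 +
     ndots lab (fun t => nu t.+1) R')%N
  else 0%N.

Lemma zip_mapr (T T' U : Type) (f : T' -> U) (a : seq T) b :
  zip a (map f b) = [seq (x.1, f x.2) | x <- zip a b].
Proof. by elim: a b => [|x a IH] [|y b] //=; rewrite IH. Qed.

Lemma ndots_map lab lab' f nu R : (forall x, dd (lab' (f x)) = dd (lab x)) ->
  ndots lab' nu (map (map f) R) = ndots lab nu R.
Proof.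
move=> h; elim: R nu => [//|H R IH] nu /=; rewrite IH; congr (_ + _)%N.
by rewrite size_map zip_mapr big_map; apply: eq_bigr => x _; rewrite h.
Qed.

Lemma word_dots_vlab lab f H : word_dots f (vlab lab H) =
  (\sum_(x <- zip (iota 0 (size H)) H) 2 * dd (lab x.2) * f x.1)%N.
Proof.
rewrite /word_dots size_vlab.
suff E n : (\sum_(x <- zip (iota n (size H)) (vlab lab H)) 2 * dd x.2 * f x.1 =
  \sum_(x <- zip (iota n (size H)) H) 2 * dd (lab x.2) * f x.1)%N by exact: E.
elim: H n => [|x H IH] n; first by rewrite !big_nil.
by rewrite /= !big_cons IH /=; case: ifP => // _; rewrite (sat_tau_d hD).
Qed.

Lemma vlab_suffix lab Q B W v : size B = size v -> vlab lab (Q ++ B) = W ++ v ->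
  vlab lab B = v.
Proof.
move=> hs; have [//|A [sA e _]] := @vlab_cat D lab Q B B; rewrite e => h.
have hA : size A = size W.
  by move: (congr1 size h); rewrite !size_cat size_vlab hs => /addIn.
by move/eqP: h; rewrite eqseq_cat // => /andP[_ /eqP].
Qed.

(** The strings identified by a cup of a reduced shape are distinct, run to the
    top without crossing each other, and no other string crosses both. *)
Lemma cup_strings w wi s A y z B R C X :
  names w wi s ((A ++ y :: z :: B) :: R) C X ->
  red (Some z :: map (omap (merge y z)) C) (None :: map (omap (pmap2 (merge y z))) X) ->
  let Q := rev (last (A ++ y :: z :: B) R) ++ A in
  let L' := Q ++ y :: z :: B in
  y != z /\ exists T1 T2 T3,
    [/\ Q = T1 ++ z :: T2 ++ y :: T3, y \notin T1 ++ T2 ++ T3 ++ B, z \notin T1 ++ T2 ++ T3 ++ B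
      & forall Z, Z \in L' -> ~~ (odd (inv y Z L') && odd (inv z Z L'))].
Proof.
move=> hn hr Q L'; have [h1 h2 h3] := hr; have [g1 g2 g3] := red_map hr.
have eL : ends ((A ++ y :: z :: B) :: R) = L' by rewrite /ends /= catA.
have tw := names_twice hn; rewrite eL in tw.
have yL : y \in L' by rewrite !(mem_cat, inE) eqxx !orbT.
have zL : z \in L' by rewrite !(mem_cat, inE) eqxx !orbT.
have nC a : a \in [:: y; z] -> count_mem (Some a) C = 0%N.
  move=> ha; apply/count_memPn/negP => hC; move: h1 => /=; case/andP => /negP + _; apply.
  rewrite mem_pmap map_id; apply/mapP; exists (Some a) => //=; congr Some.
  by move: ha; rewrite !inE /merge => /orP[]/eqP ->; [rewrite eqxx|case: eqP].
have cr a : a \in [:: y; z] -> odd (count_mem a (A ++ y :: z :: B)).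
  move=> ha; have := names_crits hn (x := a); rewrite eL nC // => -> //.
  by move: ha; rewrite !inE => /orP[]/eqP ->.
have cy := cr y (mem_head _ _); have cz := cr z (mem_last y [:: z]).
have le a := twice_le a tw; have ley := le y; have lez := le z.
have yz : y != z.
  apply/eqP => e; subst z; move: cy ley; rewrite /L' !count_cat !count_consE eqxx; lia.
have zy : z != y by rewrite eq_sym.
move: cy cz ley lez (tw y yL) (tw z zL).
rewrite /L' ![count_mem _ (Q ++ _)]count_cat ![count_mem _ (A ++ _)]count_cat !count_consE.
rewrite !eqxx (negPf yz) (negPf zy) !add0n !add1n => cy cz ley lez ty tz.
have qA a : (count_mem a A <= count_mem a Q)%N by rewrite /Q [count_mem a (_ ++ _)]count_cat leq_addl.
have := qA y; have := qA z => qz qy.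
have sy : (count_mem y A + count_mem y B = 0)%N.
  have [//|e] : (count_mem y A + count_mem y B = 0 \/ count_mem y A + count_mem y B = 1)%N by lia.
  by move: cy; rewrite addnS e.
have sz : (count_mem z A + count_mem z B = 0)%N.
  have [//|e] : (count_mem z A + count_mem z B = 0 \/ count_mem z A + count_mem z B = 1)%N by lia.
  by move: cz; rewrite addnS e.
have [yA yB yQ] : [/\ count_mem y A = 0%N, count_mem y B = 0%N & count_mem y Q = 1%N] by split; lia.
have [zA zB zQ] : [/\ count_mem z A = 0%N, count_mem z B = 0%N & count_mem z Q = 1%N] by split; lia.
have x0 : ncross y z X = 0%N.
  apply/count_memPn/mapP => -[[[a b]|] // hab he].
  have /eqP : nrm (y, z) = nrm (a, b) := congr1 (odflt (0, 0)%N) he.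
  rewrite eq_sym nrmE => e.
  have hm : Some (z, z) \in None :: map (omap (pmap2 (merge y z))) X.
    rewrite inE /=; apply/mapP; exists (Some (a, b)) => //=; rewrite /pmap2 /=; move: e.
    by case/orP => /andP[/eqP -> /eqP ->]; rewrite /merge eqxx (negPf zy).
  by have := h2 z z hm; rewrite eqxx.
have ev : odd (inv y z L') = false by rewrite -eL (names_inv hn yz) x0.
have ev' : odd (inv z y L') = false by rewrite -eL (names_inv hn zy) ncrossC x0.
split=> //; have : y \in Q by rewrite -has_pred1 has_count yQ.
have : z \in Q by rewrite -has_pred1 has_count zQ.
move=> zQi /splitPr hQ; move: hQ zQi yQ zQ ev ev' tw yL zL eL => hQ.
clear le ley lez ty tz qy qz qA sy sz; rewrite /L'; clear L'; clearbody Q; case: hQ => Q1 Q2 zQi yQ zQ ev ev' tw yL zL eL.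
rewrite !count_cat !count_consE eqxx in yQ; rewrite !count_cat !count_consE (negPf yz) in zQ.
have [y1 y2] : count_mem y Q1 = 0%N /\ count_mem y Q2 = 0%N by lia.
have z1 : z \in Q1.
  rewrite -has_pred1 has_count lt0n; apply/eqP => z1; move: ev; have z2 : count_mem z Q2 = 1%N by lia.
  rewrite !inv_cat !inv_consE !(@inv0 y z) ?y1 ?y2 ?z1 ?yB ?zB; auto.
  by rewrite !(count_cat, count_consE) !eqxx ?(negPf yz) ?(negPf zy) ?y1 ?y2 ?z1 ?z2 ?yB ?zB.
case/splitPr: z1 zQ y1 zQi yQ ev ev' tw yL zL eL => T1 T2 zQ y1 zQi yQ ev ev' tw yL zL eL.
rewrite !count_cat !count_consE eqxx in zQ; rewrite !count_cat !count_consE (negPf zy) in y1.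
exists T1, T2, Q2; split.
- by rewrite -catA.
- by rewrite !mem_cat -!has_pred1 !has_count y2 yB; apply/negP; lia.
- by rewrite !mem_cat -!has_pred1 !has_count zB; apply/negP; lia.
move=> Z hZ; case: (eqVneq Z y) => [->|Zy]; first by rewrite ev' andbF.
case: (eqVneq Z z) => [->|Zz]; first by rewrite ev.
rewrite -eL !(names_inv hn) 1?eq_sym //; apply/negP => /andP[o1 o2].
have := ncross_merge X yz (S := z) (Z := Z); rewrite eq_sym => /(_ Zz).
rewrite (negPf zy) (negPf Zy) eqxx /= => e.
have : (ncross z Z (map (omap (pmap2 (merge y z))) X) <= 1)%N.
  move: h3; rewrite /ncross /=; move: (map _ X) => X'.
  have -> : count_mem (Some (nrm (z, Z))) (map (omap nrm) X') =
      count_mem (nrm (z, Z)) (pmap (omap nrm) X').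
    by elim: X' => [//|[c|] X' IHX] /=; rewrite IHX.
  by move=> u; rewrite count_uniq_mem //; case: (_ \in _).
by rewrite e; move: o1 o2; case: (ncross y Z X) (ncross z Z X) => [//|a] [//|b] _ _; rewrite addnS.
Qed.

(** The degree of a reduced shape depends only on the matching of its endpoints,
    up to a correction that depends on the top word only. *)
Lemma names_degree w wi s R C X (i0 : I) : names w wi s R C X -> red C X ->
  exists lab, vlab lab (ends R) = [seq tau i | i <- rev wi] ++ w /\
    forall nu, hdeg l w wi (mdeg lab (ends R) - nest_deg wi + (ndots lab nu R)%:Z)
      (dotted_shape P nu w s).
Proof.
move=> hn; elim: hn => {w wi s R C X} [w|u i v wi s A y z B R C X sA sB hn IH
  |u i v wi s A B R C X sA sB hn IH|u i j v wi s A y z B R C X sA sB hn IH] hr.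
- pose lab := nth i0 w; have hm : map lab (iota 0 (size w)) = w.
    by rewrite map_nth_iota0 // take_size.
  exists lab; have u0 := iota_uniq 0 (size w); rewrite /ends /=; split.
    rewrite vlab_sub => [|x]; last by rewrite mem_rev.
    by rewrite vlab_uniq // hm; congr (_ ++ _); rewrite -{2}hm -map_rev -map_comp.
  move=> nu; rewrite (match_deg_nest lab u0) hm subrr add0r addn0.
  by rewrite -(word_dots_vlab lab) vlab_uniq // hm; exact: hdeg_dotted_word.
- have [lab [hv hd]] := IH (red_map hr); exists lab.
  have [yz [T1 [T2 [T3 [eQ ny nz nc]]]]] := cup_strings hn hr.
  set Q := rev _ ++ A in eQ nc; have tw := names_twice hn.
  have eL : ends ((A ++ y :: z :: B) :: R) = Q ++ y :: z :: B by rewrite /ends /= catA.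
  rewrite eL in hv hd tw; have hsuf : vlab lab (y :: z :: B) = [:: tau i, i & v].
    by apply: (vlab_suffix (Q := Q)); [rewrite /= sB|rewrite hv catA].
  move: (ny) (nz); rewrite !mem_cat !negb_or => /and4P[y1 y2 y3 yB] /and4P[z1 z2 z3 zB].
  rewrite /= inE (negPf yz) (negPf yB) (negPf zB) /= in hsuf; case: hsuf => ly lz hB.
  have fid (L : seq nat) : y \notin L -> map (merge y z) L = L.
    move=> h; rewrite -[RHS]map_id; apply/eq_in_map => x hx; rewrite /merge.
    by case: eqP => // e; rewrite -e hx in h.
  have eN : ends (map (merge y z) (A ++ B) :: map (map (merge y z)) ((A ++ y :: z :: B) :: R)) =
      T1 ++ z :: T2 ++ z :: T3 ++ B.
    rewrite ends_map catA -/Q eQ -!catA /= !map_cat /= !map_cat /= !fid //.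
    have -> : merge y z z = z by rewrite /merge eq_sym (negPf yz).
    by rewrite {1}/merge eqxx -catA.
  have mc := @match_deg_cup D hD l lab T1 T2 T3 B y z.
  have eL' : Q ++ y :: z :: B = T1 ++ z :: T2 ++ y :: T3 ++ y :: z :: B.
    by rewrite eQ -!catA /= -!catA.
  rewrite /= -eL' lz in mc; have := mc tw yz ly nc => {}mc.
  have ddm x : dd (lab (merge y z x)) = dd (lab x).
    by rewrite /merge; case: eqP => // ->; rewrite ly lz (sat_tau_d hD).
  have nyz (T : seq nat) x : x \in T -> y \notin T -> z \notin T -> x != y /\ x != z.
    by move=> hx h h'; split; apply: contraTneq hx => ->.
  have hv' : vlab lab (T1 ++ z :: T2 ++ z :: T3 ++ B) = [seq tau i | i <- rev wi] ++ u ++ v.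
    move: hv; rewrite eL'.
    have [x hx|A1 [s1 -> ->]] := @vlab_cat D lab T1 (z :: T2 ++ y :: T3 ++ y :: z :: B)
        (z :: T2 ++ z :: T3 ++ B).
      have [/negPf n1 /negPf n2] := nyz _ _ hx y1 z1; by rewrite !(inE, mem_cat) n1 n2.
    rewrite /= !(mem_cat, inE) !eqxx !orbT.
    have [x hx|A2 [s2 -> ->]] := @vlab_cat D lab T2 (y :: T3 ++ y :: z :: B) (z :: T3 ++ B).
      have [/negPf n1 /negPf n2] := nyz _ _ hx y2 z2; by rewrite !(inE, mem_cat) n1 n2.
    rewrite /= !(mem_cat, inE) !eqxx !orbT (negPf z3) (negPf zB) /=.
    have [x hx|A3 [s3 -> ->]] := @vlab_cat D lab T3 (y :: z :: B) B.
      have [/negPf n1 /negPf n2] := nyz _ _ hx y3 z3; by rewrite !(inE, mem_cat) n1 n2.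
    rewrite /= inE (negPf yz) (negPf yB) (negPf zB) /= hB ly lz (tau_tau hD) => h.
    have : (A1 ++ tau i :: A2 ++ i :: A3) ++ [:: tau i, i & v] =
           ([seq tau i | i <- rev wi] ++ u) ++ [:: tau i, i & v].
      by rewrite -!catA /= -!catA /= in h *.
    by move=> /(congr1 rev); rewrite !rev_cat => /eqP; rewrite eqseq_cat // eqxx /=
       => /eqP/(congr1 rev); rewrite -!rev_cat !revK catA => <-; rewrite -!catA /= -!catA.
  rewrite eN; split=> // nu; rewrite mc.
  have e := layer_specE (layer_cup u i v).
  have hl : hdeg l (u ++ v) (u ++ [:: tau i, i & v]) (cap_deg i (l - wti v))
      (layer_tm P (size u, PCup i) (u ++ v)).
    rewrite /layer_tm /= take_size_cat // drop_size_cat //.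
    exact: (hdeg_between u (v1 := [::]) (v2 := [:: tau i; i])) (hdeg_cup _ _ _).
  have := hdeg_cons e hl (hd (fun t => nu t.+1)).
  have -> : word_dots (nu 0%N) (u ++ v) = (\sum_(x <- zip (iota 0 (size (map (merge y z) (A ++ B))))
      (map (merge y z) (A ++ B))) 2 * dd (lab x.2) * nu 0%N x.1)%N.
    rewrite -word_dots_vlab; congr word_dots; apply/esym.
    apply: (vlab_suffix (Q := rev (map (merge y z) (last (A ++ y :: z :: B) R)))
       (W := [seq tau i | i <- rev wi])); first by rewrite size_map !size_cat sA sB.
    by rewrite -hv' -eN /ends /= last_map.
  rewrite -[ndots lab nu _]/(_ + ndots lab (fun t => nu t.+1)
     (map (map (merge y z)) ((A ++ y :: z :: B) :: R)))%N (ndots_map _ _ ddm) hB PoszD.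
  by congr hdeg; ring.
- have [lab [hv hd]] := IH (red_map hr).
  pose lab' n := if n is m.+1 then lab m else i; exists lab'.
  set Q := rev (last (A ++ B) R) ++ A; have tw := names_twice hn.
  have eL : ends ((A ++ B) :: R) = Q ++ B by rewrite /ends /= catA.
  have eN : ends ((map S A ++ 0%N :: 0%N :: map S B) :: map (map S) ((A ++ B) :: R)) =
      map S Q ++ 0%N :: 0%N :: map S B.
    by rewrite /ends [last _ _]/= last_map -map_rev [head _ _]/= catA -map_cat.
  have twN := names_twice (names_cap i sA sB hn); rewrite eN in twN.
  rewrite eL in hv hd tw; have hB : vlab lab B = v.
    by apply: (vlab_suffix (Q := Q)) sB _; rewrite hv catA.
  have vm L : vlab lab' (map S L) = vlab lab L.
    by apply: vlab_map => [? ? _ _ []|].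
  have n0 L : 0%N \in map S L = false by apply/negP => /mapP[].
  have hv' : vlab lab' (map S Q ++ 0%N :: 0%N :: map S B) =
      [seq tau i | i <- rev wi] ++ u ++ [:: tau i, i & v].
    have [x /mapP[x' _ ->] //|A1 [s1 -> e1]] := @vlab_cat D lab' (map S Q) (0%N :: 0%N :: map S B) (map S B).
    rewrite -map_cat vm hv vm hB catA in e1; rewrite /= ?inE ?eqxx /= ?n0 vm hB.
    move: (congr1 rev e1); rewrite !rev_cat => /eqP; rewrite -!rev_cat; clear e1.
    rewrite !rev_cat eqseq_cat // eqxx /= => /eqP /(congr1 rev).
    by rewrite -rev_cat !revK => <-; rewrite -catA.
  rewrite eN; split=> // nu.
  have md : mdeg lab' (map S Q ++ 0%N :: 0%N :: map S B) =
      mdeg lab (Q ++ B) + cap_deg i (l - wti v).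
    rewrite (match_deg_cap hD) // vm hB -map_cat; congr (_ + _).
    by apply: match_deg_map => // ? ? _ _ [].
  rewrite md; have e := layer_specE (layer_cap u i v).
  have hl : hdeg l (u ++ [:: tau i, i & v]) (u ++ v) (cap_deg i (l - wti v))
      (layer_tm P (size u, PCap) (u ++ [:: tau i, i & v])).
    rewrite /layer_tm /= take_size_cat // drop_size_cat //.
    exact: (hdeg_between u (v1 := [:: tau i; i]) (v2 := [::])) (hdeg_cap _ _ _).
  have := hdeg_cons e hl (hd (fun t => nu t.+1)).
  set H := map S A ++ _.
  have -> : word_dots (nu 0%N) (u ++ [:: tau i, i & v]) =
      (\sum_(x <- zip (iota 0 (size H)) H) 2 * dd (lab' x.2) * nu 0%N x.1)%N.
    rewrite -word_dots_vlab; congr word_dots; apply/esym.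
    apply: (vlab_suffix (Q := map S (rev (last (A ++ B) R)))
       (W := [seq tau i | i <- rev wi])); first by rewrite /H !size_cat /= !size_map sA sB.
    by rewrite -hv' /H catA -map_cat.
  rewrite -[ndots lab' nu _]/(_ + ndots lab' (fun t => nu t.+1) (map (map S) ((A ++ B) :: R)))%N.
  rewrite (@ndots_map lab lab' S) // PoszD.
  by congr hdeg; ring.
have [hr' zy nx] := (red_cross C X z y).1 hr; have [lab [hv hd]] := IH hr'; exists lab.
set Q := rev (last (A ++ y :: z :: B) R) ++ A; have tw := names_twice hn.
have eL : ends ((A ++ y :: z :: B) :: R) = Q ++ y :: z :: B by rewrite /ends /= catA.
have eN : ends ((A ++ z :: y :: B) :: (A ++ y :: z :: B) :: R) = Q ++ z :: y :: B.
  by rewrite /ends /= catA.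
have yz : y != z by rewrite eq_sym.
have ev : ~~ odd (inv y z (Q ++ y :: z :: B)).
  by rewrite -eL (names_inv hn yz) ncrossC /ncross (count_memPn nx).
rewrite eL in hv hd tw; have hs : vlab lab (y :: z :: B) = [:: j, i & v].
  by apply: (vlab_suffix (Q := Q)); [rewrite /= sB|rewrite hv catA].
rewrite /= inE (negPf yz) /= in hs; case: hs => ly lz hB.
have hv' : vlab lab (Q ++ z :: y :: B) = [seq tau i | i <- rev wi] ++ u ++ [:: i, j & v].
  move: hv; have [x _|A1 [s1 -> ->]] := @vlab_cat D lab Q (y :: z :: B) (z :: y :: B).
    by rewrite !inE orbCA.
  rewrite /= !inE (negPf yz) (negPf zy) /= ly lz hB catA => /(congr1 rev).
  rewrite !rev_cat => /eqP; rewrite eqseq_cat // eqxx /= => /eqP /(congr1 rev).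
  by rewrite -rev_cat !revK => ->; rewrite -catA.
rewrite eN; split=> // nu; rewrite (match_deg_cross hD l lab tw yz ev) lz ly.
have e := layer_specE (layer_cross u i j v).
have hl : hdeg l (u ++ [:: i, j & v]) (u ++ [:: j, i & v]) (- sip i j)
    (layer_tm P (size u, PCross) (u ++ [:: i, j & v])).
  rewrite /layer_tm /= take_size_cat // drop_size_cat //.
  exact: (hdeg_between u (v1 := [:: i; j]) (v2 := [:: j; i])) (hdeg_cross _ _ _ _).
have := hdeg_cons e hl (hd (fun t => nu t.+1)).
set H := A ++ z :: _.
have -> : word_dots (nu 0%N) (u ++ [:: i, j & v]) =
    (\sum_(x <- zip (iota 0 (size H)) H) 2 * dd (lab x.2) * nu 0%N x.1)%N.
  rewrite -word_dots_vlab; congr word_dots; apply/esym.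
  apply: (vlab_suffix (Q := rev (last (A ++ y :: z :: B) R))
     (W := [seq tau i | i <- rev wi])); first by rewrite /H !size_cat /= sA sB.
  by rewrite -hv' /H catA.
rewrite -[ndots lab nu (H :: _)]/(_ + ndots lab (fun t => nu t.+1) ((A ++ y :: z :: B) :: R))%N PoszD.
by congr hdeg; ring.
Qed.
End ShapeDegree.

(** * Every matching comes from a reduced shape *)

Ltac cats := do ?[rewrite -catA /=].

Section Existence.
Variables (D : satake_data) (hD : satake_axioms D).
Notation I := (idx D).
Notation shape := Defs.shape.
Implicit Types (w wi : seq I) (s : shape D) (R : seq (seq nat)) (T A B L : seq nat).
Implicit Types (C : seq (option nat)) (X : seq (option (nat * nat))).
Notation vlab := (@vlab D).

Lemma split_prefix (T : eqType) (a b c d : seq T) : a ++ b = c ++ d -> (size c <= size a)%N ->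
  exists u, a = c ++ u /\ d = u ++ b.
Proof.
move=> e h; exists (drop (size c) a); move: e; rewrite -{1}(cat_take_drop (size c) a) -catA.
move/eqP; rewrite eqseq_cat ?size_takel // => /andP[/eqP e1 /eqP e2].
by rewrite -{1}e1 cat_take_drop.
Qed.

Lemma cat_suffix_inj (T : eqType) (a b c d : seq T) : a ++ b = c ++ d -> size b = size d ->
  a = c /\ b = d.
Proof.
move=> e h; have hs : size a = size c.
  by move: (congr1 size e); rewrite !size_cat h => /addIn.
by move/eqP: e; rewrite eqseq_cat // => /andP[/eqP -> /eqP ->].
Qed.

Lemma inv_map (g : nat -> nat) L S Z : {in L &, injective g} -> S \in L -> Z \in L ->
  inv (g S) (g Z) (map g L) = inv S Z L.
Proof.
move=> gi hS hZ; have : {subset L <= L} by []. 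
elim: {1 3 4}L => [//|x A IH] sA; have hx : x \in L by apply: sA; rewrite inE eqxx.
have sA' : {subset A <= L} by move=> a ha; apply: sA; rewrite inE ha orbT.
rewrite map_cons !inv_consE IH //; congr (_ + _)%N.
have -> : (g x == g S) = (x == S) by apply/eqP/eqP => [|-> //]; apply: gi.
case: eqP => // _; rewrite count_map; apply: eq_in_count => a ha /=.
by apply/eqP/eqP => [|-> //]; apply: gi => //; apply: sA'.
Qed.

Lemma count_map_in (g : nat -> nat) L A x : {in L &, injective g} -> x \in L ->
  {subset A <= L} -> count_mem (g x) (map g A) = count_mem x A.
Proof.
move=> gi hx sA; rewrite count_map; apply: eq_in_count => a ha /=.
by apply/eqP/eqP => [|-> //]; apply: gi => //; apply: sA.
Qed.

Lemma count_lt (T : eqType) (p p' : pred T) (L : seq T) x :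
  (forall a, p' a -> p a) -> x \in L -> p x -> ~~ p' x -> (count p' L < count p L)%N.
Proof.
move=> h; elim: L => [//|a L IH]; rewrite inE => /orP[/eqP <-|hx] hp hp' /=.
  by rewrite hp (negPf hp') add0n add1n ltnS sub_count.
apply: leq_ltn_trans (_ : p a + count p' L < _)%N; last by rewrite ltn_add2l IH.
by rewrite leq_add2r; case: (p' a) (h a) => // ->.
Qed.

Definition ndup T := count (fun x => 1 < count_mem x T)%N T.
Definition nalt L := count (fun p => odd (inv p.1 p.2 L)) [seq (a, b) | a <- L, b <- L].

Lemma ncross_le1 C X S Z : red C X -> (ncross S Z X <= 1)%N.
Proof.
move=> [_ _ u]; rewrite /ncross.
have -> : count_mem (Some (nrm (S, Z))) (map (omap nrm) X) =
    count_mem (nrm (S, Z)) (pmap (omap nrm) X).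
  by elim: (X) => [//|[c|] X' IHX] /=; rewrite IHX.
by rewrite count_uniq_mem //; case: (_ \in _).
Qed.

Lemma ncross0 w wi s R C X S Z : names w wi s R C X -> red C X -> S != Z ->
  ~~ odd (inv S Z (ends R)) -> ncross S Z X = 0%N.
Proof.
move=> hn hr ne; rewrite (names_inv hn ne); have := ncross_le1 S Z hr.
by case: (ncross S Z X) => [|[|]].
Qed.

Lemma red_crit a C X : red (Some a :: C) (None :: X) <-> Some a \notin C /\ red C X.
Proof.
rewrite /red /= mem_pmap map_id; split=> [[/andP[h1 h2] h3 h4]|[h1 [h2 h3 h4]]].
  by split=> //; split=> // b d h; apply: h3; rewrite inE h orbT.
by split; rewrite ?h1 // => b d; rewrite inE => /orP[/eqP //|/h3].
Qed.

Lemma red_succ C X : red C X -> red (map (omap succn) C) (map (omap (pmap2 succn)) X).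
Proof.
move=> [/uniq_pmapE h1 h2 /uniq_pmapE h3]; split.
- apply/uniq_pmapE => // t t' a ne; rewrite /= !nth_omap.
  case e: (nth None C t) => [b|] //= [<-]; case e': (nth None C t') => [d|] //= [ed].
  by apply: (h1 erefl t t' b ne e); rewrite e' ed.
- by move=> a b /mapP[[[c d]|] // hc [-> ->]]; rewrite eqSS; apply: h2.
apply/uniq_pmapE => // t t' a ne; rewrite /= !nth_omap.
case e: (nth None X t) => [[b1 b2]|] //= [<-]; case e': (nth None X t') => [[d1 d2]|] //= ed.
have /eqP : nrm (pmap2 succn (d1, d2)) = nrm (pmap2 succn (b1, b2)) := congr1 (odflt (0, 0)%N) ed.
rewrite /pmap2 /= nrmE !eqSS -nrmE => /eqP en.
by apply: (h3 erefl t t' (nrm (b1, b2)) ne); rewrite ?e ?e' /= ?en.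
Qed.

Lemma names_top w wi s H R C X : names w wi s (H :: R) C X -> size (last H R) = size wi.
Proof.
move: {1 3}(H :: R) (erefl (H :: R)) => R0 e hn; elim: hn H R e => {w wi s R0 C X}
  [w|u i v wi s A y z B R0 C X sA sB _ IH|u i v wi s A B R0 C X sA sB _ IH
  |u i j v wi s A y z B R0 C X sA sB _ IH] H R [<- <-] /=.
- by rewrite size_iota.
- by rewrite last_map size_map (IH _ _ erefl).
- by rewrite last_map size_map (IH _ _ erefl).
by rewrite (IH _ _ erefl).
Qed.

Lemma names_cons w wi s R C X : names w wi s R C X -> exists H R', R = H :: R'.
Proof. by case=> *; do 2 eexists. Qed.

Lemma names_bottom w wi s H R C X : names w wi s (H :: R) C X -> size H = size w.
Proof. by move=> /names_size[_ _ [-> _]]; rewrite /level take0. Qed.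

Definition realizes w wi L := exists s R C X (g : nat -> nat),
  [/\ names w wi s R C X, red C X, {in ends R &, injective g} & map g (ends R) = L].

Lemma realizes_cap lab wi w T A S B : twice (rev T ++ A ++ S :: S :: B) ->
  size T = size wi -> vlab lab (rev T ++ A ++ S :: S :: B) = [seq tau i | i <- rev wi] ++ w ->
  (forall w1, vlab lab (rev T ++ A ++ B) = [seq tau i | i <- rev wi] ++ w1 ->
     realizes w1 wi (rev T ++ A ++ B)) ->
  realizes w wi (rev T ++ A ++ S :: S :: B).
Proof.
rewrite !catA; set Q := rev T ++ A => tw sT hv IH.
have := tw S; rewrite !(mem_cat, inE) eqxx orbT => /(_ isT).
rewrite count_cat !count_consE eqxx !add1n => cS.
have nQ : S \notin Q by apply/count_memPn; move: cS; clear; lia.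
have nB : S \notin B by apply/count_memPn; move: cS; clear; lia.
have [x hx|A1 [s1 e1 e2]] := @vlab_cat D lab Q (S :: S :: B) B.
  by rewrite !inE; case: eqP => // e; rewrite -e hx in nQ.
rewrite e1 /= inE eqxx /= (negPf nB) in hv.
have [|u [eA ew]] := split_prefix hv.
  by rewrite s1 size_map size_rev /Q size_cat size_rev sT leq_addr.
have su : size u = size A.
  by move: s1; rewrite eA /Q !size_cat size_map !size_rev sT => /addnI.
have [|s [R [C [X [g [hn hr gi hg]]]]]] := IH (u ++ vlab lab B); first by rewrite e2 eA catA.
have [H [R' eR]] := names_cons hn; subst R; rename R' into R; have sH := names_bottom hn.
have [A0 [B0 [eH sA sB]]] := split_at (etrans sH (size_cat _ _)); subst H.
have hn' := names_cap (lab S) sA sB hn.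
set f := fun n => if n is m.+1 then g m else S.
have eE : ends ((map succn A0 ++ 0%N :: 0%N :: map succn B0) :: map (map succn) ((A0 ++ B0) :: R)) =
    map succn (rev (last (A0 ++ B0) R) ++ A0) ++ 0%N :: 0%N :: map succn B0.
  by rewrite /ends [last _ _]/= last_map -map_rev [head _ _]/= catA -map_cat.
set Q0 := rev _ ++ A0 in eE; have eE0 : ends ((A0 ++ B0) :: R) = Q0 ++ B0 by rewrite /ends /= catA.
rewrite eE0 in gi hg.
have [gQ gB] : map g Q0 = Q /\ map g B0 = B.
  by apply: cat_suffix_inj; [rewrite -map_cat|rewrite size_map sB size_vlab].
clearbody Q0.
have fS L : map f (map succn L) = map g L by rewrite -map_comp.
have mS (a : nat) L : (a.+1 \in map succn L) = (a \in L) by rewrite mem_map //; exact: succn_inj.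
rewrite ew; exists ((size u, PCap) :: s); do 3 eexists; exists f; split; first exact: hn'.
- apply/red_crit; split; last by apply: red_succ.
  by apply/negP => /mapP[[c|]].
- rewrite eE => a b; have nm0 : S \notin map g (Q0 ++ B0) by rewrite hg mem_cat negb_or nQ.
  have mE (c : nat) : c.+1 \in map succn Q0 ++ 0%N :: 0%N :: map succn B0 -> c \in Q0 ++ B0.
    by rewrite !(mem_cat, inE) /= !mS.
  have gS (c : nat) : c.+1 \in map succn Q0 ++ 0%N :: 0%N :: map succn B0 -> S <> g c.
    by move=> /mE hc e; case/negP: nm0; rewrite e; apply: map_f.
  case: a b => [|a] [|b] //= ha hb; first by move/gS: hb.
    by move/esym/(gS _ ha).
  by move=> /gi -> //; apply: mE.
by rewrite eE map_cat /= !fS gQ gB.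
Qed.

Lemma realizes_cross lab w wi T A y z B : twice (rev T ++ A ++ z :: y :: B) -> z != y ->
  odd (inv y z (rev T ++ A ++ z :: y :: B)) ->
  size T = size wi -> vlab lab (rev T ++ A ++ z :: y :: B) = [seq tau i | i <- rev wi] ++ w ->
  (forall w1, vlab lab (rev T ++ A ++ y :: z :: B) = [seq tau i | i <- rev wi] ++ w1 ->
     realizes w1 wi (rev T ++ A ++ y :: z :: B)) ->
  realizes w wi (rev T ++ A ++ z :: y :: B).
Proof.
rewrite !catA; set Q := rev T ++ A => tw zy hodd sT hv IH; have yz : y != z by rewrite eq_sym.
have [x _|A1 [s1 e1 e2]] := @vlab_cat D lab Q (z :: y :: B) (y :: z :: B).
  by rewrite !inE orbCA.
rewrite e1 /= inE (negPf zy) /= in hv; rewrite /= inE (negPf yz) /= in e2.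
have [|u [eA ew]] := split_prefix hv.
  by rewrite s1 size_map size_rev /Q size_cat size_rev sT leq_addr.
set ly := (X in _ = _ ++ X :: _ :: _) in e2; set lz := (X in _ = _ ++ _ :: X :: _) in e2.
have [|s [R [C [X [g [hn hr gi hg]]]]]] := IH (u ++ [:: ly, lz & vlab lab B]).
  by rewrite e2 eA catA.
have [H [R' eR]] := names_cons hn; subst R; rename R' into R; have sH := names_bottom hn.
have [A0 [B0 [eH sA sB]]] : exists A' B', [/\ H = A' ++ B', size A' = size u
      & size B' = size [:: ly, lz & vlab lab B]] by apply: split_at; rewrite sH size_cat.
subst H; case: B0 sB hn gi hg sH => [//|y0 [//|z0 B0]] [sB] hn gi hg sH.
have eE0 : ends ((A0 ++ y0 :: z0 :: B0) :: R) = (rev (last (A0 ++ y0 :: z0 :: B0) R) ++ A0) ++ y0 :: z0 :: B0.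
  by rewrite /ends /= catA.
set Q0 := rev _ ++ A0 in eE0; rewrite eE0 in gi hg.
have [gQ [gy gz gB]] : map g Q0 = Q /\ map g (y0 :: z0 :: B0) = y :: z :: B.
  by apply: cat_suffix_inj; [rewrite -map_cat|rewrite size_map /= sB size_vlab].
have yE : y0 \in Q0 ++ y0 :: z0 :: B0 by rewrite !(mem_cat, inE) eqxx !orbT.
have zE : z0 \in Q0 ++ y0 :: z0 :: B0 by rewrite !(mem_cat, inE) eqxx !orbT.
have zy0 : z0 != y0 by apply: contraNneq zy => e; rewrite -gz -gy e.
have hn' := @names_cross D u lz ly (vlab lab B) wi s A0 y0 z0 B0 R C X sA sB hn.
have eE : ends ((A0 ++ z0 :: y0 :: B0) :: (A0 ++ y0 :: z0 :: B0) :: R) = Q0 ++ z0 :: y0 :: B0.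
  by rewrite /ends /= catA.
rewrite ew; exists ((size u, PCross) :: s); do 3 eexists; exists g; split; first exact: hn'.
- apply/red_cross; split=> //; apply/count_memPn; rewrite -/(ncross z0 y0 X) ncrossC.
  apply: (ncross0 hn hr); rewrite 1?eq_sym // eE0 -(inv_map gi yE zE) hg gy gz.
  move: hodd; rewrite !inv_cat !inv_consE !count_consE !eqxx (negPf yz) (negPf zy).
  by rewrite !(oddD, oddM) /=; odd_cases.
- rewrite eE => a b ha hb; apply: gi.
  + by move: ha; rewrite !(mem_cat, inE) => /or4P[]->; rewrite ?orbT.
  by move: hb; rewrite !(mem_cat, inE) => /or4P[]->; rewrite ?orbT.
by rewrite eE map_cat /= gQ gy gz gB.
Qed.

Lemma realizes_cup lab w wi T1 T2 T3 c B y : let T := T1 ++ c :: T2 ++ c :: T3 in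
  twice (rev T ++ T1 ++ B) -> y \notin rev T ++ T1 ++ B ->
  size T = size wi -> vlab lab (rev T ++ T1 ++ B) = [seq tau i | i <- rev wi] ++ w ->
  let L' := rev (T1 ++ y :: T2 ++ c :: T3) ++ T1 ++ y :: c :: B in
  (forall lab' w1, vlab lab' L' = [seq tau i | i <- rev wi] ++ w1 -> realizes w1 wi L') ->
  realizes w wi (rev T ++ T1 ++ B).
Proof.
move=> T tw ny sT hv L' IH.
have cT : c \in rev T ++ T1 ++ B by rewrite mem_cat mem_rev /T !(mem_cat, inE) eqxx !orbT.
have cc := tw c cT; rewrite count_cat count_rev /T !(count_cat, count_consE) eqxx !add1n in cc.
have [c1 c2 c3 cB] : [/\ c \notin T1, c \notin T2, c \notin T3 & c \notin B].
  by split; apply/count_memPn; move: cc; clear; lia.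
have ny' := ny; rewrite mem_cat mem_rev /T !(mem_cat, inE) !negb_or in ny'.
case/andP: ny' => /and5P[y1 yc y2 _ y3] /andP[_ yB]; have cy : c != y by rewrite eq_sym.
have eL : rev T ++ T1 ++ B = rev T3 ++ c :: rev T2 ++ c :: rev T1 ++ T1 ++ B.
  by rewrite /T !(rev_cat, rev_cons, cat_rcons); cats.
have eL' : L' = rev T3 ++ c :: rev T2 ++ y :: rev T1 ++ T1 ++ y :: c :: B.
  by rewrite /L' !(rev_cat, rev_cons, cat_rcons); cats.
pose lab' n := if n == y then tau (lab c) else lab n.
have labE (M N : seq nat) : {in M, forall x, x != y} -> {in M, forall x, lab' x = lab x}.
  by move=> h x hx; rewrite /lab' (negPf (h x hx)).
have vE (M : seq nat) : y \notin M -> vlab lab' M = vlab lab M.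
  elim: M => [//|x M IHM]; rewrite inE negb_or => /andP[nx nM]; rewrite /= IHM //.
  by rewrite /lab' eq_sym (negPf nx).
rewrite eL in hv.
have [u [v [ew sv hv']]] : exists u v, [/\ w = u ++ v, size v = size B &
    vlab lab' L' = [seq tau i | i <- rev wi] ++ u ++ [:: tau (lab c), lab c & v]].
  rewrite eL' -!(vE (rev T3 ++ _)) in hv *; last first.
    by rewrite !(mem_cat, inE, mem_rev) !negb_or y3 y2 y1 yc yB.
  have nyc (M : seq nat) x : x \in M -> y \notin M -> c \notin M -> x != y /\ x != c.
    by move=> hx h h'; split; apply: contraTneq hx => ->.
  have [x|A3 [s3 e3 e3']] := @vlab_cat D lab' (rev T3) (c :: rev T2 ++ c :: rev T1 ++ T1 ++ B)
      (c :: rev T2 ++ y :: rev T1 ++ T1 ++ y :: c :: B).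
    rewrite mem_rev => hx; have [/negPf n1 /negPf n2] := nyc _ _ hx y3 c3.
    by rewrite !(inE, mem_cat) n1 n2.
  have [x|A2 [s2 e2 e2']] := @vlab_cat D lab' (rev T2) (c :: rev T1 ++ T1 ++ B)
      (y :: rev T1 ++ T1 ++ y :: c :: B).
    rewrite mem_rev => hx; have [/negPf n1 /negPf n2] := nyc _ _ hx y2 c2.
    by rewrite !(inE, mem_cat) n1 n2.
  have [x|A1 [s1 e1 e1']] := @vlab_cat D lab' (rev T1 ++ T1) B (y :: c :: B).
    rewrite mem_cat mem_rev orbb => hx; have [/negPf n1 /negPf n2] := nyc _ _ hx y1 c1.
    by rewrite !(inE, mem_cat) n1 n2.
  rewrite -catA in e1; rewrite -catA in e1'.
  rewrite e3 /= e2 /= e1 !(mem_cat, inE, mem_rev) !eqxx !orbT (negPf c1) (negPf cB) /= in hv.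
  rewrite e3' /= e2' /= e1' /= !(mem_cat, inE, mem_rev) !eqxx !orbT /=.
  rewrite (negPf yc) (negPf yB) (negPf cB) /=.
  have ly : lab' y = tau (lab c) by rewrite /lab' eqxx.
  have lc : lab' c = lab c by rewrite /lab' (negPf cy).
  rewrite ly (tau_tau hD) !lc in hv *.
  have hv2 : (A3 ++ tau (lab c) :: A2 ++ lab c :: A1) ++ vlab lab' B =
     [seq tau i | i <- rev wi] ++ w by rewrite -hv; cats.
  have [|u [eA ew]] := split_prefix hv2.
    rewrite !size_cat /= !size_cat /= s3 s2 s1 !size_cat !size_map !size_rev -sT /T.
    by rewrite !size_cat /= !size_cat /=; lia.
  exists u, (vlab lab' B); split; rewrite ?size_vlab //.
  by rewrite catA -eA; cats.
have [s [R [C [X [g [hn hr gi hg]]]]]] := IH _ _ hv'.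
have [H [R' eR]] := names_cons hn; subst R; rename R' into R; have sH := names_bottom hn.
have [A0 [B0 [eH sA sB]]] : exists A B, [/\ H = A ++ B, size A = size u
      & size B = size [:: tau (lab c), lab c & v]] by apply: split_at; rewrite sH size_cat.
subst H; case: B0 sB hn gi hg sH => [//|y0 [//|z0 B0]] [sB] hn gi hg sH.
have eE0 : ends ((A0 ++ y0 :: z0 :: B0) :: R) = (rev (last (A0 ++ y0 :: z0 :: B0) R) ++ A0) ++ y0 :: z0 :: B0.
  by rewrite /ends /= catA.
set Q0 := rev _ ++ A0 in eE0.
have sBB : size B0 = size B by rewrite sB sv.
have [gQ [gy gz gB]] : map g Q0 = rev (T1 ++ y :: T2 ++ c :: T3) ++ T1 /\
    map g (y0 :: z0 :: B0) = y :: c :: B.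
  by apply: cat_suffix_inj; [rewrite -map_cat -eE0 hg /L' catA|rewrite size_map /= sBB].
have yE : y0 \in ends ((A0 ++ y0 :: z0 :: B0) :: R) by rewrite eE0 !(mem_cat, inE) eqxx !orbT.
have zE : z0 \in ends ((A0 ++ y0 :: z0 :: B0) :: R) by rewrite eE0 !(mem_cat, inE) eqxx !orbT.
have yz0 : y0 != z0 by apply: contraNneq cy => e; rewrite -gz -gy e.
(* the new string is chosen so that it crosses no other *)
have ev Z : Z != y -> ~~ odd (inv y Z L').
  move=> nZ; rewrite eL' !(inv_cat, inv_consE, count_cat, count_consE, count_rev) !eqxx.
  rewrite (negPf cy) !(@inv0 y Z (rev _)) ?count_rev; try by [left; apply/count_memPn].
  rewrite !(@inv0 y Z) ; try by [left; apply/count_memPn].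
  rewrite ?count_rev (count_memPn y1) (count_memPn y2) (count_memPn y3) [y == Z]eq_sym (negPf nZ).
  by rewrite ?(oddD, oddM) /=; odd_cases.
have nX Z : Z != y0 -> ncross y0 Z X = 0%N.
  move=> nZ; apply: (ncross0 hn hr); first by rewrite eq_sym.
  case: (boolP (Z \in ends ((A0 ++ y0 :: z0 :: B0) :: R))) => hZ.
    rewrite -(inv_map gi yE hZ) hg gy ev //; apply: contraNneq nZ => e.
    by apply/eqP; apply: gi => //; rewrite gy.
  by rewrite inv0 //; right; apply/count_memPn.
have [h1 h2 h3] := hr.
have noy (a b : nat) : Some (a, b) \in X -> a != y0 /\ b != y0.
  move=> hab; have ne := h2 _ _ hab; have hm : Some (nrm (a, b)) \in map (omap nrm) X.
    by apply/mapP; exists (Some (a, b)).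
  split; apply: contraTneq hm => e; apply/count_memPn.
    by rewrite e; apply: nX; rewrite -e eq_sym.
  by rewrite nrmC e; apply: nX; rewrite -e.
have sub : {subset A0 ++ y0 :: z0 :: B0 <= ends ((A0 ++ y0 :: z0 :: B0) :: R)}.
  by move=> x hx; rewrite /ends mem_cat /= hx orbT.
have gH : map g (A0 ++ y0 :: z0 :: B0) = T1 ++ y :: c :: B.
  rewrite map_cat /= gy gz gB; congr (_ ++ _).
  suff [] : map g (rev (last (A0 ++ y0 :: z0 :: B0) R)) = rev (T1 ++ y :: T2 ++ c :: T3) /\
    map g A0 = T1 by [].
  apply: cat_suffix_inj; first by rewrite -map_cat.
  have := congr1 size gQ; rewrite !size_map /Q0 !size_cat !size_rev (names_top hn) -sT /T.
  by rewrite !size_cat /= !size_cat /= => /addnI.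
have nC a : a \in [:: y0; z0] -> Some a \notin C.
  move=> ha; have aE : a \in ends ((A0 ++ y0 :: z0 :: B0) :: R).
    by move: ha; rewrite !inE => /orP[]/eqP ->.
  have := names_crits hn aE; rewrite /= -(count_map_in gi aE sub) gH.
  have -> : count_mem (g a) (T1 ++ y :: c :: B) = 1%N.
    move: ha; rewrite !inE count_cat !count_consE => /orP[]/eqP ->.
      by rewrite gy eqxx (negPf cy) (count_memPn y1) (count_memPn yB).
    by rewrite gz eqxx (negPf yc) (count_memPn c1) (count_memPn cB).
  have -> : count_mem (Some a) C = count_mem a (pmap id C).
    by elim: (C) => [//|[d|] C' IHC] /=; rewrite IHC.
  rewrite (count_uniq_mem _ h1) mem_pmap map_id; by case: (_ \in C).
have eC : map (omap (merge y0 z0)) C = C.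
  rewrite -[RHS]map_id; apply/eq_in_map => -[a|] // ha /=; congr Some; rewrite /merge.
  by case: eqP => // e; have := nC y0 (mem_head _ _); rewrite -e ha.
have eX : map (omap (pmap2 (merge y0 z0))) X = X.
  rewrite -[RHS]map_id; apply/eq_in_map => -[[a b]|] // hab /=; congr Some; rewrite /pmap2 /merge /=.
  by have [/negPf -> /negPf ->] := noy _ _ hab.
have hn' := names_cup sA sB hn; have eE : ends (map (merge y0 z0) (A0 ++ B0) ::
    map (map (merge y0 z0)) ((A0 ++ y0 :: z0 :: B0) :: R)) = map (merge y0 z0) (Q0 ++ B0).
  by rewrite ends_map catA.
have sQB : {subset Q0 ++ B0 <= ends ((A0 ++ y0 :: z0 :: B0) :: R)}.
  by move=> x; rewrite eE0 !(mem_cat, inE) => /orP[]->; rewrite ?orbT.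
rewrite ew; exists ((size u, PCup (lab c)) :: s); do 3 eexists; exists g; split; first exact: hn'.
- rewrite eC eX; apply/red_crit; split=> //; apply: nC; exact: mem_last y0 [:: z0].
- have hE x : x \in map (merge y0 z0) (Q0 ++ B0) -> x \in ends ((A0 ++ y0 :: z0 :: B0) :: R).
    by move=> /mapP[a /sQB ha ->]; rewrite /merge; case: eqP.
  by rewrite eE => a b /hE ha /hE hb; apply: gi.
have gm x : x \in Q0 ++ B0 -> g (merge y0 z0 x) = merge y c (g x).
  move=> hx; rewrite /merge; case: (eqVneq x y0) => [->|nx]; first by rewrite gy eqxx.
  case: eqP => // e; case/eqP: nx; apply: gi => //; first exact: sQB.
  by rewrite gy.
rewrite eE -map_comp (_ : map _ _ = map (merge y c) (map g (Q0 ++ B0))); last first.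
  by rewrite -map_comp; apply/eq_in_map => x /gm.
have fid (M : seq nat) : y \notin M -> map (merge y c) M = M.
  move=> h; rewrite -[RHS]map_id; apply/eq_in_map => x hx; rewrite /merge.
  by case: eqP => // e; rewrite -e hx in h.
have eQL : (rev (T1 ++ y :: T2 ++ c :: T3) ++ T1) ++ B =
    rev T3 ++ c :: rev T2 ++ y :: rev T1 ++ T1 ++ B.
  by rewrite !(rev_cat, rev_cons, cat_rcons); cats.
rewrite map_cat gQ gB eQL eL !map_cat /= !map_cat /= !map_cat !fid ?mem_rev //.
by rewrite /merge eqxx (negPf cy).
Qed.

Lemma realizes_all lab T B w wi : twice (rev T ++ B) -> size T = size wi ->
  vlab lab (rev T ++ B) = [seq tau i | i <- rev wi] ++ w -> realizes w wi (rev T ++ B).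
Proof.
suff H d b x T' B' lab' w' : (ndup T' < d)%N -> (size B' < b)%N -> (nalt (rev T' ++ B') < x)%N ->
    twice (rev T' ++ B') -> size T' = size wi ->
    vlab lab' (rev T' ++ B') = [seq tau i | i <- rev wi] ++ w' -> realizes w' wi (rev T' ++ B').
  by move=> h1 h2 h3; apply: (H _ _ _ T B lab w (ltnSn _) (ltnSn _) (ltnSn _)).
clear T B lab w; elim: d b x T' B' lab' w' => [//|d IHd]; elim=> [//|b IHb]; elim=> [//|x IHx].
move=> T B lab w hd hb hx tw sT hv.
case: (pselect (exists A S B', B = A ++ S :: S :: B')) => [[A [S [B' eB]]]|n1].
  subst B; have hcap := realizes_cap tw sT hv; apply: hcap => w1 hv1.
  apply: (IHb (nalt (rev T ++ A ++ B')).+1 T (A ++ B') lab) => //.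
    by move: hb; rewrite !size_cat /= !addnS !ltnS => h; apply: ltnW.
  have nS : S \notin rev T ++ A ++ B'.
    apply/count_memPn; have := tw S; rewrite !(mem_cat, inE) eqxx !orbT => /(_ isT).
    by rewrite !count_cat !count_consE eqxx; clear; lia.
  move=> a ha; have na : a != S by apply: contraNneq nS => <-.
  rewrite -(tw a); last by move: ha; rewrite !(mem_cat, inE) => /or3P[]->; rewrite ?orbT.
  by rewrite !count_cat !count_consE eq_sym (negPf na).
case: (pselect (exists A z y B', [/\ B = A ++ z :: y :: B', z != y
    & odd (inv y z (rev T ++ B))])) => [[A [z [y [B' [eB zy ho]]]]]|n2].
  subst B; apply: (realizes_cross tw zy ho sT hv) => w1 hv1.
  have hp : perm_eq (rev T ++ A ++ y :: z :: B') (rev T ++ A ++ z :: y :: B').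
    by rewrite !perm_cat2l (perm_catCA [:: y] [:: z] B').
  have yz : y != z by rewrite eq_sym.
  apply: (IHx T (A ++ y :: z :: B') lab) => //.
  - by move: hb; rewrite !size_cat.
  - move: hx; rewrite ltnS; apply: leq_trans; rewrite /nalt.
    rewrite (permP (perm_allpairs (fun a b => (a, b)) hp hp)).
    have yL : y \in rev T ++ A ++ z :: y :: B' by rewrite !(mem_cat, inE) eqxx !orbT.
    have zL : z \in rev T ++ A ++ z :: y :: B' by rewrite !(mem_cat, inE) eqxx !orbT.
    apply: (@count_lt _ _ _ _ (y, z)) => //.
    + move=> [a e] /=; move: ho tw; rewrite !catA; move: (rev T ++ A) => Q ho tw.
      have yQ : y \in Q ++ z :: y :: B' by rewrite !(mem_cat, inE) eqxx !orbT.
      have zQ : z \in Q ++ z :: y :: B' by rewrite !(mem_cat, inE) eqxx !orbT.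
      case: (boolP ((a == y) && (e == z) || (a == z) && (e == y))) => [hab _|nab].
        case/orP: hab => /andP[/eqP -> /eqP ->] //.
        have := inv_sym (Q ++ z :: y :: B') yz; rewrite !tw // => e4.
        have -> : inv z y (Q ++ z :: y :: B') = (4 - inv y z (Q ++ z :: y :: B'))%N.
          by move: e4; clear; lia.
        by rewrite oddB ?ho //; move: e4; clear; lia.
      suff -> : inv a e (Q ++ y :: z :: B') = inv a e (Q ++ z :: y :: B') by [].
      rewrite !inv_cat !inv_consE !count_consE; move: nab.
      rewrite ![a == _]eq_sym ![e == _]eq_sym.
      by case: (y == a); case: (z == e); case: (z == a); case: (y == e) => //= _; clear; lia.
    + by apply/allpairsP; exists (y, z).
    move: ho => /=; rewrite !catA; move: (rev T ++ A) => Q.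
    rewrite !inv_cat !inv_consE !count_consE !eqxx (negPf yz) (negPf zy).
    by rewrite !(oddD, oddM) /=; odd_cases.
  by move=> a; rewrite (perm_mem hp) => /tw <-; apply/permP.
have uB : uniq B.
  apply/negPn/negP => nB; have [A [S [B1 [eB u1 hS]]]] :
      exists A S B1, [/\ B = A ++ S :: B1, uniq B1 & S \in B1].
    elim: (B) nB => [//|a B' IH]; rewrite /= negb_and negbK; case: (boolP (uniq B')) => h.
      by rewrite orbF => ha; exists [::], a, B'.
    by move=> _; have [A [S [B1 [-> ? ?]]]] := IH h; exists (a :: A), S, B1.
  case/splitPr: hS eB u1 => [[|y M] N] eB u1; first by apply: n1; exists A, S, N.
  apply: n2; exists A, S, y, (M ++ S :: N).
  move: u1; rewrite /= mem_cat inE !negb_or => /andP[/and3P[yM yS yN]].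
  rewrite cat_uniq /= => /and3P[_ /norP[SM _] /andP[SN _]].
  have Sy : S != y by rewrite eq_sym.
  split=> //; rewrite eB catA; set Q := rev T ++ A; move: tw; rewrite eB catA -/Q => tw; clearbody Q.
  have := tw y; have := tw S; rewrite !(mem_cat, inE) !eqxx !orbT => /(_ isT) + /(_ isT).
  rewrite /= !count_cat !count_consE !count_cat !count_consE !eqxx (negPf Sy) (negPf yS).
  rewrite (count_memPn yM) (count_memPn yN) (count_memPn SM) (count_memPn SN) !(add0n, add1n) ?addn0.
  move=> cS cy; have c1 : count_mem y Q = 1%N by apply: (@addIn 1); exact: cy.
  have c0 : count_mem S Q = 0%N by apply: (@addIn 2); exact: cS.
  rewrite !(inv_cat, inv_consE, count_cat, count_consE) !eqxx (negPf Sy) (negPf yS) /=.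
  rewrite !(@inv0 y S) ?c0 ?(count_memPn yM) ?(count_memPn yN); auto.
  by rewrite c1 (count_memPn SM) (count_memPn SN).
have [T1 [T' [B2 [eT eB hh]]]] : exists T1 T' B2, [/\ T = T1 ++ T', B = T1 ++ B2
    & forall a b T'' B'', T' = a :: T'' -> B2 = b :: B'' -> a != b].
  elim: (T) (B) => [|a T0 IH] [|b1 B0]; first by exists [::], [::], [::].
  - by exists [::], [::], (b1 :: B0).
  - by exists [::], (a :: T0), [::].
  case: (eqVneq a b1) => [<-|ne].
    by have [T1 [T' [B2 [-> -> h]]]] := IH B0; exists (a :: T1), T', B2.
  by exists [::], (a :: T0), (b1 :: B0); split=> // ? ? ? ? [<- _] [<- _].
case: T' eT hh => [|c T'] eT hh.
  have B20 : B2 = [::].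
    case: B2 eB hh => [//|a B2] eB _; have : a \in B by rewrite eB mem_cat inE eqxx orbT.
    move=> ha; have := count_uniq_mem a uB; rewrite ha => ca.
    have := tw a; rewrite mem_cat ha orbT => /(_ isT); rewrite count_cat count_rev ca => cT.
    have : (0 < count_mem a T)%N by move: cT; clear; lia.
    rewrite -has_count has_pred1 eT cats0 => aT1; move: uB; rewrite eB cat_uniq => /and3P[_ /hasPn h _].
    by have := h a; rewrite inE eqxx => /(_ isT); rewrite aT1.
  subst B2; rewrite cats0 in eT eB; subst T B.
  have sw : size w = size wi.
    by move: (congr1 size hv); rewrite size_vlab !size_cat size_rev size_map size_rev sT => /addnI.
  have uT := uB; have ewi : w = wi.
    move: hv; rewrite vlab_sub => [|a]; last by rewrite mem_rev.
    move=> /eqP; rewrite eqseq_cat ?size_map ?size_rev // => /andP[/eqP h1 /eqP <-].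
    rewrite vlab_uniq //; move: h1; rewrite (map_comp (@tau D) lab).
    move=> /(inj_map (inv_inj (sat_tauK hD))); rewrite map_rev => /(congr1 rev).
    by rewrite !revK.
  rewrite ewi; have hm : map (nth 0%N T1) (iota 0 (size wi)) = T1.
    by rewrite -sT map_nth_iota0 // take_size.
  exists [::]; do 3 eexists; exists (nth 0%N T1); split; first exact: names_nil.
  - by split.
  - rewrite /ends /= => a1 b1; rewrite !mem_cat !mem_rev !orbb !mem_iota /= -sT => ha1 hb1 /eqP.
    by rewrite nth_uniq // => /eqP.
  by rewrite /ends /= map_cat map_rev hm.
have cT : c \in T by rewrite eT mem_cat inE eqxx orbT.
have twc := tw c; rewrite mem_cat mem_rev cT in twc; have {}twc := twc isT.
rewrite count_cat count_rev in twc.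
have cB := count_uniq_mem c uB.
have nc1 : c \notin T1.
  apply/negP => h; move: twc; rewrite cB eB mem_cat h eT count_cat count_consE eqxx.
  have : (0 < count_mem c T1)%N by rewrite -has_count has_pred1.
  by rewrite add1n; clear; lia.
case: (boolP (c \in T')) => hc.
  case/splitPr: hc eT hh => T2 T3 eT _.
  have eT' : T = T1 ++ c :: T2 ++ c :: T3 by rewrite eT.
  pose y := (sumn (rev T ++ B)).+1.
  have ny : y \notin rev T ++ B.
    have ub (A0 : seq nat) a : a \in A0 -> (a <= sumn A0)%N.
      elim: A0 => [//|a0 A0 IH] /=; rewrite inE => /orP[/eqP ->|/IH h]; first exact: leq_addr.
      exact: leq_trans h (leq_addl _ _).
    by apply/negP => /ub; rewrite ltnn.
  rewrite eB eT' in ny tw hv sT *; apply: (realizes_cup tw ny sT hv) => lab' w1 hv1.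
  have cc2 : c \notin T2 /\ c \notin T3.
    move: twc; rewrite cB eT' count_cat count_consE count_cat count_consE eqxx => h.
    by split; apply/count_memPn; move: h; clear; lia.
  have [cT2 cT3] := cc2.
  move: (ny); rewrite !(mem_cat, inE, mem_rev) !negb_or => /and3P[/and5P[y1 yc y2 _ y3] _ yB].
  have cy : c != y by rewrite eq_sym.
  apply: (IHd _ _ _ _ lab') => //; last by rewrite -sT !size_cat /= !size_cat.
    move: hd; rewrite ltnS; apply: leq_trans; rewrite eT' /ndup.
    rewrite !(count_cat, count_consE) /= !count_cat /=.
    set p := (fun a => 1 < _)%N; set q := (fun a => 1 < _)%N.
    have cE a : a != c -> a != y -> p a = q a.
      move=> h h'; rewrite /p /q !(count_cat, count_consE) /= ?count_cat /=.
      by rewrite ![_ == a]eq_sym (negPf h) (negPf h').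
    have cnt M : c \notin M -> y \notin M -> count p M = count q M.
      move=> h h'; apply: eq_in_count => a ha; apply: cE.
        by apply: contraNneq h => <-.
      by apply: contraNneq h' => <-.
    rewrite !cnt //.
    rewrite ?(count_cat, count_consE) !eqxx ?(negPf cy) ?[y == c]eq_sym ?(negPf cy).
    rewrite (count_memPn y1) (count_memPn y2) (count_memPn y3).
    rewrite (count_memPn nc1) (count_memPn cT2) (count_memPn cT3).
    rewrite -[X in (X < _)%N]/(count q T1 + (0 + (count q T2 + (0 + count q T3))))%N.
    rewrite -[X in (_ < X)%N]/(count q T1 + (1 + (count q T2 + (1 + count q T3))))%N.
    by clear; lia.
  move=> a; case: (eqVneq a y) => [-> _|nay].
    rewrite !(count_cat, count_rev, count_consE) /= ?(count_cat, count_consE) /= !eqxx (negPf cy).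
    by rewrite (count_memPn y1) (count_memPn y2) (count_memPn y3) (count_memPn yB).
  case: (eqVneq a c) => [-> _|nac].
    rewrite !(count_cat, count_rev, count_consE) /= ?(count_cat, count_consE) /= !eqxx [y == c]eq_sym (negPf cy).
    rewrite (count_memPn nc1) (count_memPn cT2) (count_memPn cT3).
    move: twc; rewrite cB eT' count_cat count_consE count_cat count_consE eqxx eB mem_cat (negPf nc1) /=.
    by case: (boolP (c \in B2)) => [_|/count_memPn ->]; rewrite ?add1n //; clear; lia.
  move=> ha; rewrite -(tw a); last first.
    move: ha; rewrite !(mem_cat, inE, mem_rev) (negPf nay) (negPf nac) /=.
    by case: (a \in T1); case: (a \in T2); case: (a \in T3); case: (a \in B2); rewrite /= ?orbT ?orbF.
  rewrite !(count_cat, count_rev, count_consE) /= ?(count_cat, count_consE) /=.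
  by rewrite ![_ == a]eq_sym (negPf nay) (negPf nac).
have ccB : c \in B2.
  move: twc; rewrite cB eT count_cat count_consE eqxx (count_memPn nc1) (count_memPn hc) eB mem_cat (negPf nc1).
  by case: (c \in B2).
case/splitPr: ccB eB hh => M B3 eB hh; case/lastP: M eB hh => [|M z] eB hh.
  by have := hh c c T' B3 erefl erefl; rewrite eqxx.
exfalso; apply: n2; exists (T1 ++ M), z, c, B3; rewrite cat_rcons in eB.
have eB' : B = (T1 ++ M) ++ z :: c :: B3 by rewrite eB -catA.
have := uB; rewrite eB' cat_uniq /= => /and3P[_ /norP[zA /norP[cA _]] /and3P[zcB cB3 _]].
move: zcB; rewrite inE negb_or => /andP[zc zB]; split=> //.
move: zA; rewrite mem_cat negb_or => /andP[z1 zM]; move: cA; rewrite mem_cat negb_or => /andP[_ cM].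
have cz : c != z by rewrite eq_sym.
have := tw z; rewrite mem_cat eB' !(mem_cat, inE) eqxx !orbT => /(_ isT).
rewrite eT !(count_cat, count_rev, count_consE) !eqxx (negPf cz) (count_memPn z1) (count_memPn zM) (count_memPn zB).
rewrite !add0n !addn0 => cz'; have cz1 : count_mem z T' = 1%N by move: cz' => /=; clear; lia.
rewrite !(rev_cat, rev_cons, cat_rcons) !(inv_cat, inv_consE, count_cat, count_rev, count_consE) !eqxx.
rewrite (negPf cz) (negPf zc) !inv_rev !(@inv0 z c) ?(@inv0 c z) ?(count_memPn nc1) ?(count_memPn hc) ?(count_memPn cM) ?(count_memPn cB3); auto.
rewrite ?(count_memPn z1) ?(count_memPn zM) ?(count_memPn zB) ?cz1; by clear; lia.
Qed.
End Existence.

(** * Basis elements and matchings *)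

Section Marks.
Variable D : satake_data.
Notation I := (idx D).
Notation point := (nat * nat)%type.
Implicit Types (R : seq (seq nat)) (lab : nat -> I).

Lemma sum_index (T : eqType) (m : seq T) (n : seq nat) (F : T -> nat -> nat) :
  uniq m -> size n = size m ->
  (\sum_(x <- m) F x (nth 0 n (index x m)) = \sum_(p <- zip m n) F p.1 p.2)%N.
Proof.
elim: m n => [|x m IH] [|k n] //=; first by rewrite !big_nil.
move=> /andP[nx um] [hs]; rewrite !big_cons eqxx /= -IH //; congr (_ + _)%N.
rewrite big_seq [RHS]big_seq; apply: eq_bigr => y hy.
by case: eqP => // e; rewrite e hy in nx.
Qed.

Fixpoint points R : seq point :=
  if R is H :: R' then [seq (0%N, p) | p <- iota 0 (size H)] ++ map lift_pt (points R')
  else [::].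

Lemma mem_points R x : (x \in points R) = (nm R x : bool).
Proof.
elim: R x => [|H R IH] [t p]; first by rewrite /nm nth_nil onth0n.
rewrite /= mem_cat; case: t => [|t].
  rewrite nm0 onthTE [X in _ || X](_ : _ = false) ?orbF; last by apply/negP => /mapP[].
  by apply/mapP/idP => [[q + [->]]|h]; [rewrite mem_iota|exists p; rewrite ?mem_iota].
rewrite nmS -IH (_ : (_ \in _) = false) ?orFb; last by apply/negP => /mapP[].
apply/mapP/idP => [[[t' p'] h [-> ->]] //|h]; by exists (t, p).
Qed.

Lemma points_uniq R : uniq (points R).
Proof.
elim: R => [//|H R IH] /=; rewrite cat_uniq map_inj_uniq ?iota_uniq; last by move=> ? ? [].
rewrite map_inj_uniq ?IH ?andbT; last by move=> [? ?] [? ?] [-> ->].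
by apply/hasPn => x /mapP[y _ ->]; apply/negP => /mapP[].
Qed.

Lemma ndots_points lab nu R : ndots lab nu R =
  (\sum_(x <- points R) 2 * dd (lab (odflt 0 (nm R x))) * nu x.1 x.2)%N.
Proof.
elim: R nu => [|H R IH] nu; first by rewrite big_nil.
rewrite /= IH big_cat /= !big_map; congr (_ + _)%N.
rewrite -(sum_index (fun p a => 2 * dd (lab a) * nu 0 p)%N (iota_uniq _ _)) ?size_iota //.
rewrite big_seq [RHS]big_seq; apply: eq_bigr => p; rewrite mem_iota /= => hp.
rewrite nm0 odflt_onth; congr (2 * dd (lab (nth _ _ _)) * _)%N.
by have := index_uniq 0 (_ : p < size (iota 0 (size H)))%N (iota_uniq 0 _);
  rewrite size_iota nth_iota // => ->.
Qed.

Lemma ndots_marks lab R (m : seq point) n : uniq m -> {subset m <= points R} ->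
  size n = size m -> ndots lab (fun t p => nth 0%N n (index (t, p) m)) R =
    dot_deg [seq dd (lab (odflt 0%N (nm R x))) | x <- m] n.
Proof.
move=> um sm hs; rewrite ndots_points (bigID (fun x => x \in m)) /= [X in (_ + X)%N]big1 ?addn0.
  rewrite -big_filter (perm_big m); last first.
    apply: uniq_perm; rewrite ?filter_uniq ?points_uniq // => x.
    by rewrite mem_filter; case: (boolP (x \in m)) => // /sm ->.
  under eq_bigr => x _ do rewrite -surjective_pairing.
  rewrite (sum_index (fun x a => 2 * dd (lab (odflt 0 (nm R x))) * a)%N um hs) /dot_deg.
  elim: m n {um sm} hs => [|x m IH] [|k n] //=; first by rewrite !big_nil.
  by move=> [hs]; rewrite !big_cons IH.
move=> x nx; rewrite -surjective_pairing [nth _ _ _]nth_default ?muln0 //.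
by rewrite hs leqNgt index_mem.
Qed.
End Marks.

Section Matchings.
Variable D : satake_data.
Notation I := (idx D).
Notation shape := Defs.shape.
Implicit Types (wi wj : seq I) (s : shape D) (R : seq (seq nat)) (L : seq nat).

Lemma index_ext (a b : seq nat) x y : size a = size b ->
  (forall k, (k < size a)%N -> (nth 0%N a k == x) = (nth 0%N b k == y)) -> index x a = index y b.
Proof.
elim: a b => [|c a IH] [|d b] //= [hs] h; rewrite (h 0%N) //.
by case: (d == y) => //; rewrite (IH b) // => k hk; apply: (h k.+1).
Qed.

Lemma canon_pattern L L' : size L = size L' -> (canon L = canon L' <->
  forall j k, (j < size L)%N -> (k < size L)%N ->
    (nth 0%N L j = nth 0%N L k <-> nth 0%N L' j = nth 0%N L' k)).
Proof.
move=> hs; have cn A j : (j < size A)%N -> nth 0%N (canon A) j = index (nth 0%N A j) (rev A).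
  by move=> h; rewrite (nth_map 0%N).
split=> [e j k hj hk|h].
  have e1 := congr1 (nth 0%N ^~ j) e; have e2 := congr1 (nth 0%N ^~ k) e.
  rewrite /= !cn -?hs // in e1 e2.
  by split=> q; [apply: (@canon_inj L')|apply: (@canon_inj L)];
    rewrite ?mem_nth -?hs //; rewrite q in e1 *; rewrite ?e1 -?e2 // -?e1 ?e2.
apply: (@eq_from_nth _ 0%N); first by rewrite !size_map.
rewrite size_map => j hj; rewrite !cn -?hs //; apply: index_ext; rewrite !size_rev // => k hk.
rewrite !nth_rev -?hs //; have hk' : (size L - k.+1 < size L)%N by lia.
by apply/eqP/eqP => /(h _ _ hk' hj).
Qed.

Lemma twice_even L : twice L -> ~~ odd (size L).
Proof.
move=> tw; rewrite -(perm_size (perm_count_undup L)) size_flatten /Defs.shape sumnE.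
rewrite /seq.shape -map_comp big_map big_seq; elim/big_ind: _ => // [a b|x].
  by rewrite oddD => /negPf -> /negPf ->.
by rewrite mem_undup => /tw h; rewrite /= size_nseq h.
Qed.

Lemma mem_ends wi wj s R C X : names wj wi s R C X -> forall c,
  c \in ends R <-> exists e, nm R (endpoint s e) = Some c.
Proof.
move=> hn c; have [H [R2 e]] := names_cons hn; subst R.
have [_ _ /(congr1 size)] := names_size hn; rewrite !size_map size_iota => -[sR].
have topE p : nm (H :: R2) (endpoint s (true, p)) = onth (last H R2) p.
  by rewrite /endpoint /nm /= -sR -[size R2]/(size (H :: R2)).-1 nth_last.
rewrite /ends mem_cat mem_rev; split=> [/orP[] /onthP[p hp]|[[[] p]]].
- by exists (true, p); rewrite topE.
- by exists (false, p).
- by rewrite topE => hp; apply/orP; left; apply/onthP; exists p.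
by move=> hp; apply/orP; right; apply/onthP; exists p.
Qed.

Lemma names_sub wi wj s R C X : names wj wi s R C X -> red C X ->
  {subset flatten R <= ends R}.
Proof.
elim=> {wj wi s R C X} [w|u i v wi s A y z B R C X sA sB hn IH
  |u i v wi s A B R C X sA sB _ IH|u i j v wi s A y z B R C X sA sB _ IH] hr.
- by move=> c; rewrite /ends /= cats0 mem_cat => ->; rewrite orbT.
- have [yz [T1 [T2 [T3 [eQ _ _ _]]]]] := cup_strings hn hr; have {}IH := IH (red_map hr).
  move=> c; rewrite -map_cons -map_flatten => /mapP[a ha ->].
  rewrite ends_map; have : a \in ends ((A ++ y :: z :: B) :: R).
    apply: IH; move: ha; rewrite -[flatten _]/((A ++ B) ++ flatten ((A ++ y :: z :: B) :: R)) mem_cat.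
    by case/orP => //; rewrite /= !(mem_cat, inE) => /orP[]->; rewrite ?orbT.
  have zQ : z \in rev (last (A ++ y :: z :: B) R) ++ A by rewrite eQ mem_cat inE eqxx orbT.
  have zm : z \in map (merge y z) (rev (last (A ++ y :: z :: B) R) ++ A ++ B).
    apply/mapP; exists z; last by rewrite /merge; case: eqP.
    by rewrite catA mem_cat zQ.
  rewrite /ends [last _ _]/= [head _ _]/= => h.
  case: (eqVneq a y) => [->|ny]; first by rewrite /merge eqxx.
  case: (eqVneq a z) => [->|nz]; first by rewrite /merge; case: (z == y).
  apply: map_f; move: h; rewrite !(mem_cat, inE) (negPf ny) (negPf nz) /=.
  by move=> /or3P[]->; rewrite ?orbT.
- have {}IH := IH (red_map hr); rewrite /ends [last _ _]/= last_map -map_rev [head _ _]/= => c.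
  rewrite -[flatten _]/(_ ++ flatten (map (map S) ((A ++ B) :: R))) -map_flatten mem_cat.
  case/orP; first by move=> h; rewrite mem_cat h orbT.
  case/mapP => a /IH; rewrite /ends [last _ _]/= [head _ _]/= => h ->.
  by move: h; rewrite !(mem_cat, inE) /= !(mem_map succn_inj).
move: hr => /red_cross[/IH {}IH _ _] c; rewrite -[flatten _]/(_ ++ flatten ((A ++ y :: z :: B) :: R)).
rewrite mem_cat => /orP[h|/IH]; first by rewrite /ends mem_cat [head _ _]/= h orbT.
rewrite /ends [last _ _]/= [head _ _]/= [last _ _]/= !(mem_cat, inE).
by move=> /or3P[->|->|/or3P[]->]; rewrite ?orbT.
Qed.

Lemma names_closed wi wj s R C X x : names wj wi s R C X -> red C X -> is_point wj s x ->
  exists e, is_point wj s (endpoint s e) /\ same_string wj s x (endpoint s e).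
Proof.
move=> hn hr; rewrite (nm_point _ hn); case hx: (nm R x) => [c|] // _.
have : c \in flatten R.
  apply/flattenP; exists (nth [::] R x.1); last by apply/onthP; exists x.2.
  apply: mem_nth; rewrite ltnNge; apply/negP => h.
  by move: hx; rewrite /nm nth_default // onth0n.
move=> /(names_sub hn hr)/(mem_ends hn)[e he]; exists e.
by rewrite (nm_point _ hn) he; split=> //; apply: (nm_same hn hx he).
Qed.

Lemma matching_canon wi wj s s' R R' C C' X X' :
  names wj wi s R C X -> names wj wi s' R' C' X' ->
  same_matching wj s s' <-> canon (ends R) = canon (ends R').
Proof.
move=> hn hn'.
have geo s1 R1 C1 X1 (h1 : names wj wi s1 R1 C1 X1) : exists T B,
    [/\ ends R1 = rev T ++ B, size T = size wi, size B = size wj,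
        forall p, nm R1 (endpoint s1 (true, p)) = onth T p
      & forall p, nm R1 (endpoint s1 (false, p)) = onth B p].
  have [H [R2 e]] := names_cons h1; subst R1; exists (last H R2), H.
  have hb := names_bottom h1; have ht := names_top h1; split=> // p.
  rewrite /endpoint /nm /=; have [_ _ /(congr1 size)] := names_size h1.
  by rewrite !size_map size_iota => -[<-]; rewrite -[size R2]/(size (H :: R2)).-1 nth_last.
have [T [B [eL sT sB hT hB]]] := geo _ _ _ _ hn.
have [T' [B' [eL' sT' sB' hT' hB']]] := geo _ _ _ _ hn'.
pose pos (e : bool * nat) := if e.1 then (size wi - e.2.+1)%N else (size wi + e.2)%N.
pose ok (e : bool * nat) := (e.2 < size (if e.1 then wi else wj))%N.
have posP T0 B0 e : size T0 = size wi -> size B0 = size wj -> ok e ->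
    Some (nth 0%N (rev T0 ++ B0) (pos e)) = onth (if e.1 then T0 else B0) e.2.
  case: e => [[] p] /= hT0 hB0; rewrite /ok /pos /= => hp; rewrite nth_cat size_rev hT0.
    have -> : (size wi - p.+1 < size wi)%N by lia.
    rewrite nth_rev ?hT0; last by lia.
    have -> : (size wi - (size wi - p.+1).+1 = p)%N by lia.
    by rewrite onthE (nth_map 0%N) ?hT0.
  by rewrite ltnNge leq_addr /= addKn onthE (nth_map 0%N) ?hB0.
have nmP e : ok e -> nm R (endpoint s e) = Some (nth 0%N (ends R) (pos e)) /\
    nm R' (endpoint s' e) = Some (nth 0%N (ends R') (pos e)).
  move=> he; rewrite eL eL' !posP //; by case: e he => [[] p] _; rewrite ?hT ?hT' ?hB ?hB'.
have okP e : is_point wj s (endpoint s e) = ok e.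
  rewrite (nm_point _ hn) /ok; case: e => [[] p]; rewrite ?hT ?hB onthTE ?sT ?sB //.
have posS k : (k < size (ends R))%N -> exists2 e, ok e & pos e = k.
  rewrite eL size_cat size_rev sT sB => hk; have [h|h] := ltnP k (size wi).
    exists (true, (size wi - k.+1)%N); rewrite /ok /pos /=; lia.
  exists (false, (k - size wi)%N); rewrite /ok /pos /=; lia.
have hsz : size (ends R) = size (ends R').
  by rewrite eL eL' !size_cat !size_rev sT sT' sB sB'.
have sameP (w : seq I) s1 R1 C1 X1 a b c d : names wj wi s1 R1 C1 X1 -> nm R1 a = Some c -> nm R1 b = Some d ->
    (same_string wj s1 a b <-> c = d).
  move=> h ha hb; split=> [/(same_nm h)|e]; first by rewrite ha hb => -[].
  by apply: (nm_same h ha); rewrite hb e.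
split=> [hm|hc].
  apply/(canon_pattern hsz) => j k /posS[e he <-] /posS[e' he' <-].
  have [n1 n2] := nmP e he; have [n1' n2'] := nmP e' he'.
  by rewrite -(sameP wi _ _ _ _ _ _ _ _ hn n1 n1') -(sameP wi _ _ _ _ _ _ _ _ hn' n2 n2'); apply: hm; rewrite okP.
move=> e e'; rewrite !okP => he he'.
have [n1 n2] := nmP e he; have [n1' n2'] := nmP e' he'.
rewrite (sameP wi _ _ _ _ _ _ _ _ hn n1 n1') (sameP wi _ _ _ _ _ _ _ _ hn' n2 n2').
have lt e0 : ok e0 -> (pos e0 < size (ends R))%N.
  rewrite eL size_cat size_rev sT sB; case: e0 => [[] p]; rewrite /ok /pos /=; lia.
by apply/(canon_pattern hsz).1; rewrite ?lt.
Qed.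
End Matchings.

Section BasisElements.
Variables (D : satake_data) (hD : satake_axioms D) (P : structure_consts D).
Variables (C : nd_choices D) (hC : choices_axioms C) (l : iw_lattice D).
Variables (wi wj : seq (idx D)) (i0 : idx D).
Notation I := (idx D).
Notation shape := Defs.shape.
Notation V := ([seq tau i | i <- rev wi] ++ wj).
Notation labV := (nth i0 (rev V)).
Notation W := (wick labV (size V) 0 [::]).

Lemma basis_data (s : shape D) : sh C wi wj s -> exists L ds (lab : nat -> I),
  [/\ twice L, vlab lab L = V, perm_eq ds (string_degs lab L),
      size ds = size (marks C wi wj s) /\ (exists R Cc X, names wj wi s R Cc X /\ L = ends R)
    & forall n, size n = size (marks C wi wj s) ->
        hdeg l wj wi (match_deg l lab L - nest_deg l wi + (dot_deg ds n)%:Z)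
          (marked_tm P C wi wj s n)].
Proof.
move=> hs; have [[hrun hcl] hred] := ch_sh_reduced hC hs.
have [H [R [Cc [X [hn _]]]]] := names_ex hrun.
have hr := red_of_reduced hn hred.
have [lab [hv hd]] := names_degree hD P l i0 hn hr.
set m := marks C wi wj s; set nam := fun x => odflt 0%N (nm (H :: R) x).
have um : uniq m := ch_marks_uniq hC hs.
have sm : {subset m <= points (H :: R)}.
  by move=> x hx; rewrite mem_points -(nm_point x hn); apply: (ch_marks_point hC hs hx).
have nmS x : x \in points (H :: R) -> nm (H :: R) x = Some (nam x).
  by rewrite mem_points /nam; case: (nm _ x).
have names_marks : perm_eq (map nam m) (undup (ends (H :: R))).
  apply: uniq_perm; rewrite ?undup_uniq //.
    rewrite map_inj_in_uniq // => x y hx hy e.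
    have [z [_ hz]] := ch_marks hC hs (ch_marks_point hC hs hx).
    rewrite -(hz x); last by split=> //; apply: rst_refl.
    by apply: hz; split=> //; apply: (nm_same hn (nmS _ (sm _ hx))); rewrite (nmS _ (sm _ hy)) e.
  have endS := mem_ends hn.
  move=> c; rewrite mem_undup; apply/mapP/idP => [[x hx ->]|/endS[e he]].
    have hp := ch_marks_point hC hs hx; have [e [_ se]] := hcl x hp.
    by apply/endS; exists e; rewrite -(same_nm hn se) (nmS _ (sm _ hx)).
  have hp : is_point wj s (endpoint s e) by rewrite (nm_point _ hn) he.
  have [x [[hx hxe] _]] := ch_marks hC hs hp; exists x => //.
  by move: (same_nm hn hxe); rewrite he (nmS _ (sm _ hx)) => -[].
exists (ends (H :: R)), [seq dd (lab (nam x)) | x <- m], lab; split=> //.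
- exact: names_twice hn.
- by rewrite /string_degs (map_comp (fun Z => dd (lab Z)) nam); apply: perm_map.
- by rewrite size_map; split=> //; exists (H :: R), Cc, X.
by move=> n hsn; have := hd (fun t p => nth 0%N n (index (t, p) m)); rewrite (ndots_marks lab um sm hsn).
Qed.

Definition rank_fun (d : int) : nat :=
  (\sum_(M <- W) dot_count (string_degs labV M) (d + nest_deg l wi - match_deg l labV M))%N.

Lemma canon_degs lab L : vlab lab L = V -> twice L ->
  [/\ canon L \in W, match_deg l labV (canon L) = match_deg l lab L
    & perm_eq (string_degs labV (canon L)) (string_degs lab L)].
Proof.
move=> hv tw; have hl x : x \in L -> labV (index x (rev L)) = lab x.
  by move=> hx; rewrite -hv (canon_lab i0 lab).
split.
- by have := canon_wick hD i0 lab tw; rewrite hv -(size_vlab lab L) hv.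
- by apply: match_deg_map => //; apply: canon_inj.
rewrite /string_degs; have hu : perm_eq (undup (canon L)) (map (fun x => index x (rev L)) (undup L)).
  apply: uniq_perm; rewrite ?undup_uniq //.
    rewrite map_inj_in_uniq ?undup_uniq // => x y; rewrite !mem_undup; exact: canon_inj.
  by move=> x; rewrite mem_undup; apply/mapP/mapP => -[y hy ->]; exists y; rewrite ?mem_undup // -mem_undup.
apply: perm_trans (perm_map _ hu) _; rewrite -map_comp.
rewrite (_ : map _ _ = [seq dd (lab Z) | Z <- undup L]) //.
by apply/eq_in_map => x; rewrite mem_undup => /hl /= ->.
Qed.

Lemma wick_shape M : M \in W -> exists (s : shape D) (R : seq (seq nat)) (Cc : seq (option nat)) (X : seq (option (nat * nat))),
  [/\ sh C wi wj s, names wj wi s R Cc X & canon (ends R) = M].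
Proof.
move=> hM; have st : wick_state 0 [::] by [].
have tw : twice M by have := wick_twice st hM; rewrite cats0.
have sM := wick_size hM; have hv : vlab labV M = V.
  have := wick_vlab hD st hM; rewrite !cats0 => ->; rewrite -(size_rev V) map_nth_iota0 // take_size.
  exact: revK.
pose T := rev (take (size wi) M); pose B := drop (size wi) M.
have eM : rev T ++ B = M by rewrite revK cat_take_drop.
have sT : size T = size wi.
  by rewrite size_rev size_takel // sM size_cat size_map size_rev leq_addr.
have [s [R [Cc [X [g [hn hr gi hg]]]]]] : realizes wj wi (rev T ++ B).
  by apply: (realizes_all hD (lab := labV)); rewrite ?eM.
rewrite eM in hg; have hc : canon (ends R) = M.
  rewrite -[RHS](canon_named (wick_named st hM)) -hg /canon -map_rev -map_comp.
  apply/eq_in_map => x hx /=; apply: index_ext; rewrite ?size_map // size_rev => k hk.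
  rewrite (nth_map 0%N) ?size_rev //; apply/eqP/eqP => [->//|]; apply: gi => //.
  by rewrite -mem_rev mem_nth ?size_rev.
have hred := reduced_of_red hn hr.
have hcl x := @names_closed D wi wj s R Cc X x hn hr.
have [s' [[hs' hm] _]] := ch_sh_rep hC (conj (conj (names_run hn) hcl) hred).
have [L [ds [lab [twL hvL _ [_ [R' [C' [X' [hn' eL]]]]] _]]]] := basis_data hs'.
exists s', R', C', X'; split=> //.
by rewrite -hc; apply/esym/(matching_canon hn hn').
Qed.
End BasisElements.

Section Rank.
Variables (D : satake_data) (hD : satake_axioms D) (P : structure_consts D).
Variables (C : nd_choices D) (hC : choices_axioms C) (hnd : non_degenerate P C).
Variables (l : iw_lattice D) (wi wj : seq (idx D)) (hw : wti wi = wti wj) (i0 : idx D).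
Notation I := (idx D).
Notation shape := Defs.shape.
Notation V := ([seq tau i | i <- rev wi] ++ wj).
Notation labV := (nth i0 (rev V)).
Notation W := (wick labV (size V) 0 [::]).
Notation K := (nest_deg l wi).
Notation rkf := (rank_fun l wi wj i0).

Lemma rank_fun_odd d : odd (size wi) != odd (size wj) -> rkf d = 0%N.
Proof.
move=> h; rewrite /rank_fun big1_seq // => M /andP[_ hM].
have st : wick_state 0 [::] by [].
have := wick_twice st hM; rewrite cats0 => /twice_even.
rewrite (wick_size hM) size_cat size_map size_rev oddD; move: h.
by case: (odd _); case: (odd _).
Qed.

Lemma graded_rank_hom : graded_rank P l wj wi rkf.
Proof.
case: (boolP (odd (size wi) == odd (size wj))) => [/eqP hodd|hodd]; last first.
  have -> : rkf = (fun=> 0%N) by apply/funext => d; apply: rank_fun_odd.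
  by apply: (graded_rank_odd hD); rewrite eq_sym.
have /choice [f hf] : forall s : shape D, exists y : seq nat * seq nat * (nat -> I),
   sh C wi wj s -> [/\ twice y.1.1, vlab y.2 y.1.1 = V, perm_eq y.1.2 (string_degs y.2 y.1.1),
      size y.1.2 = size (marks C wi wj s) /\
        (exists R Cc X, names wj wi s R Cc X /\ y.1.1 = ends R)
    & forall n, size n = size (marks C wi wj s) ->
        hdeg l wj wi (match_deg l y.2 y.1.1 - K + (dot_deg y.1.2 n)%:Z)
          (marked_tm P C wi wj s n)].
  move=> s; case: (boolP (sh C wi wj s)) => hs; last by exists ([::], [::], fun=> i0).
  by have [L [ds [lab h]]] := basis_data hD P hC l i0 hs; exists (L, ds, lab) => _.
pose md s := match_deg l (f s).2 (f s).1.1 - K.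
have cW s : sh C wi wj s -> [/\ canon (f s).1.1 \in W,
    match_deg l labV (canon (f s).1.1) = match_deg l (f s).2 (f s).1.1
    & perm_eq (string_degs labV (canon (f s).1.1)) (string_degs (f s).2 (f s).1.1)].
  by move=> /hf[tw hv _ _ _]; apply: canon_degs.
have /choice [rep hrep] : forall M : seq nat, exists s : shape D, M \in W ->
    sh C wi wj s /\ canon (f s).1.1 = M.
  move=> M; case: (boolP (M \in W)) => hM; last by exists [::].
  have [s [R [Cc [X [hs hn e]]]]] := wick_shape hD P hC l hM; exists s => _; split=> //.
  have [_ _ _ [_ [R' [C' [X' [hn' ->]]]]] _] := hf s hs.
  by rewrite -e; apply/(matching_canon hn' hn) => e1 e2 _ _.
have dpos s : sh C wi wj s -> all (leq 1) (f s).1.2.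
  by move=> /hf[_ _ hp _ _]; rewrite (perm_all _ hp); apply: string_degs_pos.
have rep_uniq s : sh C wi wj s -> s = rep (canon (f s).1.1).
  move=> hs; have [hM _ _] := cW s hs; have [hs' e] := hrep _ hM.
  have [_ _ _ [_ [R [Cc [X [hn eR]]]]] _] := hf s hs.
  have [_ _ _ [_ [R' [C' [X' [hn' eR']]]]] _] := hf _ hs'.
  have [s0 [_ h0]] := ch_sh_rep hC (ch_sh_reduced hC hs).
  have es : s0 = s by apply: h0; split.
  rewrite -{1}es; apply: h0; split; first exact: hs'.
  by apply: (matching_canon hn hn').2; rewrite -eR -eR' e.
exists (basis_index C wi wj), (@basis_elt D P C l wi wj),
  (fun x => md (val x).1 + (dot_deg (f (val x).1).1.2 (val x).2)%:Z).
have bP (x : basis_index C wi wj) : sh C wi wj (val x).1 /\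
    size (val x).2 = size (marks C wi wj (val x).1).
  by have /andP[h /eqP h'] := valP x.
split.
- exact: (nd_hom hnd l hw hodd).
- by move=> x; have [hs hn] := bP x; apply: homog_cls; have [_ _ _ _] := hf _ hs; apply.
- exists (- \sum_(M <- W) `|match_deg l labV M| - K) => x; have [hs _] := bP x.
  have [hM e _] := cW _ hs; rewrite /md -e.
  rewrite (perm_big _ (perm_to_rem hM)) big_cons /=.
  have : 0 <= \sum_(M <- rem (canon (f (val x).1).1.1) W) `|match_deg l labV M| by rewrite sumr_ge0.
  move: (\sum_(M <- rem _ _) _) (match_deg l labV _) (dot_deg _ _) => a b d; clear; lia.
move=> d; pose E := flatten [seq [seq (rep M, n) | n <- dot_lists (f (rep M)).1.2 (d - md (rep M))] | M <- W].
have mE y : (y \in E) = sh C wi wj y.1 && (size y.2 == size (marks C wi wj y.1)) &&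
    (md y.1 + (dot_deg (f y.1).1.2 y.2)%:Z == d).
  apply/flattenP/idP => [[_ /mapP[M hM ->] /mapP[n hn ->]]|/andP[/andP[hs /eqP hsz] /eqP hd]] /=.
    have [hs _] := hrep M hM; have [_ _ _ [sd _] _] := hf _ hs.
    move: hn; rewrite mem_dot_lists ?dpos // sd hs => /andP[-> /eqP ->] /=.
    by apply/eqP; ring.
  case: y hs hsz hd => s n /= hs hsz hd; have [hM _ _] := cW s hs.
  exists [seq (rep (canon (f s).1.1), n0) | n0 <-
    dot_lists (f (rep (canon (f s).1.1))).1.2 (d - md (rep (canon (f s).1.1)))].
    by apply/mapP; exists (canon (f s).1.1).
  rewrite -(rep_uniq s hs); apply/mapP; exists n => //.
  have [_ _ _ [sd _] _] := hf _ hs; rewrite mem_dot_lists ?dpos // sd hsz eqxx /=.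
  by rewrite -hd; apply/eqP; ring.
have uE : uniq E.
  have uW : uniq W by apply: wick_uniq.
  suff H ss : {subset ss <= W} -> uniq ss -> uniq (flatten
      [seq [seq (rep M, n) | n <- dot_lists (f (rep M)).1.2 (d - md (rep M))] | M <- ss]) by apply: H.
  elim: ss => [//|M ss IH] sub /= /andP[nM us].
  rewrite cat_uniq IH ?andbT //; last by move=> a ha; apply: sub; rewrite inE ha orbT.
  rewrite map_inj_uniq ?dot_lists_uniq /=; last by move=> ? ? [].
  apply/hasPn => y /flattenP[_ /mapP[M' hM' ->] /mapP[n _ ->]]; apply/negP => /mapP[n' _ [e _]].
  have [_ e1] := hrep M' (sub M' (mem_behead (s := M :: ss) hM')).
  have [_ e2] := hrep M (sub M (mem_head _ _)).
  by move: nM; rewrite -e2 -e e1 hM'.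
exists (pmap insub E : seq (basis_index C wi wj)); split.
- exact: pmap_sub_uniq.
- rewrite size_pmap_sub; rewrite (_ : count _ E = size E); last first.
    by apply/eqP; rewrite -all_count; apply/allP => y; rewrite mE => /andP[].
  rewrite size_flatten /seq.shape -map_comp sumnE big_map /rank_fun.
  rewrite big_seq [RHS]big_seq; apply: eq_bigr => M hM; rewrite /= size_map.
  have [hs e] := hrep M hM; have [_ e1 e2] := cW _ hs; have [_ _ hp _ _] := hf _ hs.
  rewrite e in e1 e2; rewrite -/(dot_count _ _) (dot_count_perm _ (dpos _ hs) hp).
  rewrite -(dot_count_perm _ (string_degs_pos hD _ _) e2) /md -e1.
  by congr dot_count; ring.
by move=> x; rewrite mem_pmap_sub mE; have [-> ->] := bP x; rewrite eqxx.
Qed.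

Lemma adj_exp_nest x (w v : seq I) : wti w = wti v -> adj_exp x w v = nest_deg (iw x) w.
Proof.
elim: w v => [//|i w IH] v h /=; have e : wti w = wti (tau i :: v).
  by rewrite wti_cons (iw_tau hD) -h wti_cons addKr.
by rewrite -e (IH _ e).
Qed.

(** In deep enough weights the pairing of two words is the sum of the powers of q
    that count dotted matchings. *)
Lemma form_count (L : wlat D -> hw_data D)
    (hL : forall x : wlat D, dominant x -> is_hw_module x (L x)) (B : int) :
  eventually l (fun x => dominant x -> exists E, hw_form (bword wi *: hw_vec (L x)) (bword wj *: hw_vec (L x)) = qsum E /\
    forall d, d <= B -> count_mem (- d) E = rkf d).
Proof.
have st : wick_state 0 [::] by [].
have h1 := wick_count hD l labV (size V) (B + K) st.
pose n := size V; pose N i := (n%:Z * \sum_(j <- V) `|cartan (tau i) j|)%R.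
have h2 : eventually l (fun x => forall i, i \in V ->
    N i <= ev (scoroot (tau i)) (x - \sum_(j <- [::]) sroot j)).
  by apply: eventually_all => i _; apply: eventually_large.
apply: eventually_imp (eventually_and h1 h2) => x hx [{}h1 {}h2] dx.
have hLx := hL x dx; exists [seq K + e | e <- wexps x (rev V) [::]]; split.
  rewrite (form_words hD hLx) qsum_shift (adj_exp_nest x hw) hx; congr (_ * _).
  have := @wexpsP D hD (L x) x hLx V n _ (rev V) [::]; rewrite revK fv_nil catrevE => <- //.
  - by rewrite map_rev.
  - move=> i w hi sw hwn; rewrite (evBr hD) subr_ge0.
    have := h2 i hi; rewrite big_nil subr0; apply: le_trans; rewrite /N.
    have bnd (u : seq I) : {subset u <= V} ->
        ev (scoroot (tau i)) (\sum_(j <- u) sroot j) <= (size u)%:Z * \sum_(j <- V) `|cartan (tau i) j|.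
      elim: u => [|a u IH] su; first by rewrite big_nil (ev0r hD) mul0r.
      rewrite big_cons (sat_evDr hD) (sat_ev hD) /= -add1n PoszD mulrDl mul1r; apply: lerD.
        apply: le_trans (ler_norm _) _; have ha : a \in V by apply: su; rewrite inE eqxx.
        by rewrite (perm_big _ (perm_to_rem ha)) big_cons lerDl sumr_ge0.
      by apply: IH => b hb; apply: su; rewrite inE hb orbT.
    apply: le_trans (bnd w sw) _; apply: ler_wpM2r; first by rewrite sumr_ge0.
    by rewrite lez_nat.
  - by move=> i; rewrite mem_rev.
  by rewrite size_rev addn0.
move=> d hd; rewrite count_map (eq_count (a2 := pred1 (- (d + K)))); last first.
  by move=> e /=; apply/eqP/eqP; lia.
have := h1 (d + K); rewrite lerD2r => /(_ hd).
rewrite -(size_rev V) map_nth_iota0 // take_size size_rev => ->.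
by rewrite /rank_fun; apply: eq_bigr => M _; rewrite cats0.
Qed.
End Rank.

Lemma ract_one (D : satake_data) (P : structure_consts D) l (z : hom2 P l [::] [::]) :
  ract (end_id P l) z = z.
Proof.
elim/cls_ind: z => a ta; rewrite /end_id -clsE ract_cls //; last exact: typed_id.
apply: cls_rel => //; last exact: rel_tens1l.
by apply: ract_typed => //; exact: typed_id.
Qed.

Lemma graded_rank_nil (D : satake_data) (P : structure_consts D) (l : iw_lattice D) :
  graded_rank P l [::] [::] (fun d => d == 0).
Proof.
exists unit, (fun=> end_id P l), (fun=> 0); split.
- split=> [s c us|v]; last first.
    by exists [:: Datatypes.tt], (fun=> v); rewrite big_seq1 ract_one.
  by case: s us => [//|[] [|[] s]] //= _; rewrite big_seq1 ract_one => h [] _.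
- by move=> _; apply: homog_id.
- by exists 0.
move=> d; case: (boolP (d == 0)) => [/eqP e|nd].
  by exists [:: Datatypes.tt]; split=> // -[]; rewrite e.
by exists [::]; split=> // -[]; rewrite eq_sym (negPf nd).
Qed.

Theorem theorem5p17
  (D : satake_data) (hD : satake_axioms D)
  (P : structure_consts D) (hP : const_axioms P)
  (C : nd_choices D) (hC : choices_axioms C)
  (hnd : non_degenerate P C)
  (L : wlat D -> hw_data D)
  (hL : forall x : wlat D, dominant x -> is_hw_module x (L x))
  (psi : matrix_U D -> matrix_U D) (hpsi : bar_involution psi)
  (iform : matrix_U D -> matrix_U D -> laurent) (hform : iform_axioms L iform)
  (l : iw_lattice D) (wi wj : seq (idx D)) (hw : wti wi = wti wj) :
  (exists m : int -> nat, graded_rank P l wj wi m) /\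
  (forall m : int -> nat, graded_rank P l wj wi m ->
     forall n : int,
       iform (psi (m_right (bword wi) l)) (m_right (bword wj) l) n
         = (m (- n))%:R).
Proof.
have [m0 [hm0 hE]] : exists m0, graded_rank P l wj wi m0 /\ forall B : int,
    eventually l (fun x => dominant x -> exists E,
      hw_form (bword wi *: hw_vec (L x)) (bword wj *: hw_vec (L x)) = qsum E /\
      forall d : int, d <= B -> count_mem (- d) E = m0 d).
  have gen (i0 : idx D) : exists m0, graded_rank P l wj wi m0 /\ forall B : int,
      eventually l (fun x => dominant x -> exists E,
        hw_form (bword wi *: hw_vec (L x)) (bword wj *: hw_vec (L x)) = qsum E /\
        forall d : int, d <= B -> count_mem (- d) E = m0 d).
    exists (rank_fun l wi wj i0); split; first exact: (graded_rank_hom hD hC hnd).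
    move=> B; have [F [m h]] := form_count hD l hw i0 hL B; exists F, m => x dx1 dx2.
    by have [E [h1 h2]] := h x dx1 dx2; exists E; split=> // d hd; exact: h2.
  case: (wi) (wj) gen => [|i wi'] [|j wj'] gen; [|exact: gen j|exact: gen i|exact: gen i].
  exists (fun d => d == 0); split; first exact: graded_rank_nil.
  move=> B; exists [::], 0 => x _ dx; exists [:: 0]; have hx := hL x dx.
  rewrite /bword !big_nil !scale1r (hw_one hx) /qsum big_seq1 expr0z; split=> // d _.
  by rewrite /= addn0 eq_sym oppr_eq0.
split; first by exists m0.
move=> m hm n; rewrite (bar_bword hD hpsi) (graded_rank_uniq hD hP hnd hm hm0).
have [_ ex lim] := if_lim hform l (in_Ui_bword wi) (in_Ui_bword wj).
have [F [M hF]] := lim n; have [F' [M' hF']] := hE (- n).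
have [x [hx dx hd]] := ex (F ++ F') (Num.max M M').
have dx1 : deep l F M x.
  by split=> // i hi; apply: le_trans (hd i _); rewrite ?le_max ?lexx ?mem_cat ?hi.
have dx2 : deep l F' M' x.
  by split=> // i hi; apply: le_trans (hd i _); rewrite ?le_max ?lexx ?mem_cat ?hi ?orbT.
have [t [ht <- //]] := hF x dx1; have [E [hEq hcount]] := hF' x dx2 dx.
by rewrite hEq in ht; rewrite (expands_qsum n ht) -(hcount (- n)) // opprK.
Qed.
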